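(* Let $\theta>1$ and let $V$ be twice continuously differentiable on $[0,+\infty)$ with $\lim_{x\to+\infty}V(x)/\log x=+\infty$. Suppose a probability measure $\mu$ is supported on one interval $[a,b]$ with $a>0$, has a continuous density $\psi$ on $(a,b)$, and satisfies, for some $\ell\in\mathbb R$, $$\int\log|x-y|d\mu(y)+\int\log|x^\theta-y^\theta|d\mu(y)-V(x)=\ell\quad\text{for }x\in\operatorname{supp}\mu,$$ $$\int\log|x-y|d\mu(y)+\int\log|x^\theta-y^\theta|d\mu(y)-V(x)\le\ell\quad\text{for }x\in[0,+\infty).$$ Then there are constants $c_0>c_1>0$ solving the system $$\frac{1}{2\pi i}\oint_{\widetilde\gamma}\frac{V'(\widetilde J_{c_0,c_1}(t))\widetilde J_{c_0,c_1}(t)}{t}dt=1+\theta,\qquad \frac{1}{2\pi i}\oint_{\widetilde\gamma}\frac{V'(\widetilde J_{c_0,c_1}(t))\widetilde J_{c_0,c_1}(t)}{t+1}dt=1,$$ such that $a=\widetilde J_{c_0,c_1}(s_a)$, $b=\widetilde J_{c_0,c_1}(s_b)$, and for $x\in(a,b)$, $$\psi(x)=\frac{1}{2\pi^2x}\int_a^b\big(V''(y)y+V'(y)\big)\log\left|\frac{\widetilde I_+(y)-\widetilde I_-(x)}{\widetilde I_+(y)-\widetilde I_+(x)}\right|dy.$$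
   Context: For $c_0>c_1>0$, $\widetilde J_{c_0,c_1}(s)=(c_1s+c_0)\left(\frac{s+1}{s}\right)^{1/\theta}$ with branch cut on $[-1,0]$ and $\widetilde J_{c_0,c_1}(s)\sim c_1s$ as $s\to\infty$. Its two real critical points are $$s_a=-\frac{\theta-1}{2\theta}-\frac{1}{2\theta c_1}\sqrt{4c_0c_1\theta+c_1^2(\theta-1)^2},\qquad s_b=-\frac{\theta-1}{2\theta}+\frac{1}{2\theta c_1}\sqrt{4c_0c_1\theta+c_1^2(\theta-1)^2},$$ with $s_a<-1$, $s_b>0$, $0<\widetilde J(s_a)<\widetilde J(s_b)$. There are two complex conjugate curves $\widetilde\gamma_1$ (upper half-plane) and $\widetilde\gamma_2$ (lower half-plane) from $s_a$ to $s_b$, each mapped bijectively by $\widetilde J_{c_0,c_1}$ onto $[\widetilde J(s_a),\widetilde J(s_b)]$; $\widetilde\gamma=\widetilde\gamma_1\cup\widetilde\gamma_2$ is oriented counterclockwise. $\widetilde I_+(x)\in\widetilde\gamma_1$ and $\widetilde I_-(x)\in\widetilde\gamma_2$ denote the preimages of $x$ under $\widetilde J_{c_0,c_1}$. *)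

(* Defs.v *)
From HB Require Import structures.
From mathcomp Require Import all_boot all_order all_algebra.
From mathcomp Require Import all_classical all_reals all_analysis.
From mathcomp Require Import complex.

Set Implicit Arguments.
Unset Strict Implicit.
Unset Printing Implicit Defensive.

Import Order.TTheory GRing.Theory Num.Theory.
Import numFieldNormedType.Exports.

Local Open Scope classical_set_scope.
Local Open Scope ring_scope.
Local Open Scope complex_scope.
Local Open Scope ring_scope.

Section Defs.
Variable R : realType.

Definition cmod (z : R[i]) : R := Num.sqrt (complex.Re z ^+ 2 + complex.Im z ^+ 2).

Definition cconj (z : R[i]) : R[i] := Complex (complex.Re z) (- complex.Im z).

(* principal argument, with values in (-pi, pi] (atan2) *)
Definition carg (z : R[i]) : R :=
  if 0 < complex.Re z then atan (complex.Im z / complex.Re z)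
  else if complex.Re z < 0 then
    (if 0 <= complex.Im z then atan (complex.Im z / complex.Re z) + pi else atan (complex.Im z / complex.Re z) - pi)
  else if 0 < complex.Im z then pi / 2
  else if complex.Im z < 0 then - (pi / 2)
  else 0.

(* principal branch of w^p = exp (p Log w), Log with arg in (-pi,pi];
   its branch cut is the negative real axis *)
Definition cpow (w : R[i]) (p : R) : R[i] :=
  if w == 0 then 0
  else (((cmod w) `^ p)%:C * Complex (cos (p * carg w)) (sin (p * carg w)))%C.

(* \tilde J_{c0,c1}(s) = (c1 s + c0) ((s+1)/s)^{1/theta}; with the principal
   branch of the power, the cut in the s-plane is exactly [-1,0] and
   \tilde J(s) ~ c1 s at infinity *)
Definition Jt (theta c0 c1 : R) (s : R[i]) : R[i] :=
  ((c1%:C * s + c0%:C) * cpow ((s + 1) / s) theta^-1)%C.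

(* the two real critical points *)
Definition s_a (theta c0 c1 : R) : R :=
  - ((theta - 1) / (2 * theta))
  - (2 * theta * c1)^-1 * Num.sqrt (4 * c0 * c1 * theta + c1 ^+ 2 * (theta - 1) ^+ 2).
Definition s_b (theta c0 c1 : R) : R :=
  - ((theta - 1) / (2 * theta))
  + (2 * theta * c1)^-1 * Num.sqrt (4 * c0 * c1 * theta + c1 ^+ 2 * (theta - 1) ^+ 2).

Definition JA (theta c0 c1 : R) : R := complex.Re (Jt theta c0 c1 (s_a theta c0 c1)%:C).
Definition JB (theta c0 c1 : R) : R := complex.Re (Jt theta c0 c1 (s_b theta c0 c1)%:C).

Definition cderive (g : R -> R[i]) (x : R) : R[i] :=
  Complex (derive1 (fun u => complex.Re (g u)) x) (derive1 (fun u => complex.Im (g u)) x).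

(* [Ip] is the map x |-> \tilde I_+(x) : [J(s_a), J(s_b)] -> \tilde\gamma_1,
   i.e. a continuous (and on the open interval differentiable) parametrization
   of the upper curve \tilde\gamma_1 from s_a to s_b, inverse to \tilde J.
   The lower curve \tilde\gamma_2 is its complex conjugate, parametrized by
   \tilde I_- = cconj \o Ip. *)
Definition upper_curve (theta c0 c1 : R) (Ip : R -> R[i]) : Prop :=
  let A := JA theta c0 c1 in let B := JB theta c0 c1 in
  [/\ Ip A = (s_a theta c0 c1)%:C, Ip B = (s_b theta c0 c1)%:C,
      {within `[A, B], continuous (fun x => complex.Re (Ip x))},
      {within `[A, B], continuous (fun x => complex.Im (Ip x))} &
      [/\ (forall x, x \in `]A, B[ -> 0 < complex.Im (Ip x)),
        (forall x, x \in `[A, B] -> Jt theta c0 c1 (Ip x) = x%:C) &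
        (forall x, x \in `]A, B[ ->
          derivable (fun u => complex.Re (Ip u)) x 1 /\
          derivable (fun u => complex.Im (Ip u)) x 1)]].

(* [contour_int theta c0 c1 Ip f z] : the contour integral of f over
   \tilde\gamma = \tilde\gamma_1 \cup \tilde\gamma_2, oriented counterclockwise,
   equals z.  Counterclockwise: \tilde\gamma_2 (lower) from s_a to s_b,
   i.e. t = cconj (Ip x), x from A to B, then \tilde\gamma_1 (upper) from s_b
   back to s_a, i.e. t = Ip x, x from B to A.  Real and imaginary parts are
   (possibly improper at the endpoints) Lebesgue integrals over ]A,B[. *)
Definition contour_int (theta c0 c1 : R) (Ip : R -> R[i]) (f : R[i] -> R[i])
    (z : R[i]) : Prop :=
  let A := JA theta c0 c1 in let B := JB theta c0 c1 in
  let h := fun x => (f (cconj (Ip x)) * cconj (cderive Ip x)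
                      - f (Ip x) * cderive Ip x)%C in
  (\int[lebesgue_measure]_(x in `]A, B[) (complex.Re (h x))%:E = (complex.Re z)%:E)%E /\
  (\int[lebesgue_measure]_(x in `]A, B[) (complex.Im (h x))%:E = (complex.Im z)%:E)%E.

Definition lnE (r : R) : \bar R := if r == 0 then -oo%E else (ln r)%:E.

Definition msupport (mu : set R -> \bar R) : set R :=
  [set x : R | forall e : R, 0 < e -> let I := `]x - e, x + e[%classic in (0 < mu I)%E].

Definition Upot (theta : R) (mu : {measure set R -> \bar R}) (V : R -> R)
    (x : R) : \bar R :=
  (\int[mu]_y lnE (`|x - y|)%R + \int[mu]_y lnE (`|x `^ theta - y `^ theta|)%R
   - (V x)%:E)%E.

End Defs.

(* Main.v *)
(** Put [ell s = log J(s)] on the upper half-plane. The upper curve is the level set [Im ell = 0]: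
    every ray from the origin meets it once, transversally. Outside the curve [J], and inside it
    [J ^ theta], is a conformal coordinate which takes the curve to the real interval [(a, b)],
    resp. [(a^theta, b^theta)]. Given a point [s] outside the curve and [A : C], let
    [p (y) = Im (A / (I(y) - s) + conj A / (I(y) - conj s))], which vanishes at [a] and [b]. A maximum
    principle shows that the Cauchy transforms of [p] in both coordinates are explicit rational
    functions of the curve variable, so [int p'(y) (log |t - y| + log |t^theta - y^theta|) dy] is an
    explicit function of [t]. Integrating it against [mu] and using the Euler-Lagrange equality gives
    [int p V'] in terms of the Stieltjes transform of [mu] at [J(s)]. Let [s] tend to a critical
    point: the variational inequality bounds the transform there, and the limits are two equations
    equivalent to the contour conditions. Let [s] tend to [I(x)]: the transform recovers the density
    by the Poisson kernel, and an integration by parts gives the logarithmic formula. The constants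
    exist because the ratio of the critical values takes every value above [1]. *)

Require Import Defs.
From HB Require Import structures.
From mathcomp Require Import all_boot all_order all_algebra.
From mathcomp Require Import all_classical all_reals all_analysis.
From mathcomp Require Import measurable_realfun complex ring lra zify.
Import Order.TTheory GRing.Theory Num.Theory.
Import numFieldNormedType.Exports.
Local Open Scope classical_set_scope.
Local Open Scope complex_scope.
Local Open Scope ring_scope.

Set Implicit Arguments.
Unset Strict Implicit.
Unset Printing Implicit Defensive.

(** A Cauchy transform is identified through boundary values: the difference with its candidate has
    imaginary part tending to zero at every boundary point, hence is constant along each ray, and
    the constant is read off at infinity or at the origin. The weight [p] comes from a function real
    on the real axis, so it vanishes at both ends; this removes the boundary terms when the Cauchy
    kernel is turned into a logarithm, and [p'] is integrable because the curve leaves the critical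
    points like a square root. The exterior transform contributes [- pi * pf (I t)], the interior
    one [+ pi * pf (I t)]; in the sum of the two logarithms they cancel, and only the pole at [s]
    and the value at the origin remain. The obstacle is that the behaviour of [mu] near [a] and [b]
    is unknown. So [s] approaches a critical point in a direction off the curve along which the
    modulus of [J] lies outside [[a, b]]: there the Stieltjes transform stays bounded while [ell']
    tends to zero, and the measure drops out of the limit. The two contour conditions and the
    density formula are then partial fractions of [1 / ell']. *)

Local Notation Re := complex.Re.
Local Notation Im := complex.Im.

(** * Complex numbers in real coordinates *)

Section ComplexBasics.
Variable R : realType.
Local Notation C := R[i].
Implicit Types (z w : C) (x y r : R).

Lemma complexE_RI z : z = Complex (Re z) (Im z).
Proof. by case: z. Qed.

Lemma complex_ext z w : Re z = Re w -> Im z = Im w -> z = w.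
Proof. by case: z => ? ?; case: w => ? ? /= -> ->. Qed.

Lemma ReD z w : Re (z + w) = Re z + Re w. Proof. by case: z; case: w. Qed.
Lemma ImD z w : Im (z + w) = Im z + Im w. Proof. by case: z; case: w. Qed.
Lemma ReN z : Re (- z) = - Re z. Proof. by case: z. Qed.
Lemma ImN z : Im (- z) = - Im z. Proof. by case: z. Qed.
Lemma ReM z w : Re (z * w) = Re z * Re w - Im z * Im w.
Proof. by case: z; case: w. Qed.
Lemma ImM z w : Im (z * w) = Re z * Im w + Im z * Re w.
Proof. by case: z; case: w. Qed.
Lemma ReV z : Re z^-1 = Re z / (Re z ^+ 2 + Im z ^+ 2).
Proof. by case: z. Qed.
Lemma ImV z : Im z^-1 = - Im z / (Re z ^+ 2 + Im z ^+ 2).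
Proof. by case: z => a b; rewrite mulNr. Qed.
Lemma ReC x : Re x%:C = x. Proof. by []. Qed.
Lemma ImC x : Im x%:C = 0. Proof. by []. Qed.
Lemma Re1 : Re (1 : C) = 1. Proof. by []. Qed.
Lemma Im1 : Im (1 : C) = 0. Proof. by []. Qed.
Lemma Re0 : Re (0 : C) = 0. Proof. by []. Qed.
Lemma Im0 : Im (0 : C) = 0. Proof. by []. Qed.
Lemma Re_conj z : Re (cconj z) = Re z. Proof. by []. Qed.
Lemma Im_conj z : Im (cconj z) = - Im z. Proof. by []. Qed.

Definition ReIm := (ReD, ImD, ReN, ImN, ReM, ImM, ReC, ImC, Re1, Im1, Re0, Im0,
  Re_conj, Im_conj).

Lemma cmodC z : (cmod z)%:C = `|z|.
Proof. by case: z. Qed.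

Lemma cmod_ge0 z : 0 <= cmod z. Proof. exact: sqrtr_ge0. Qed.

Lemma cmodM z w : cmod (z * w) = cmod z * cmod w.
Proof. by apply: (@complexI R); rewrite rmorphM /= !cmodC normrM. Qed.

Lemma cmodV z : cmod z^-1 = (cmod z)^-1.
Proof. by apply: (@complexI R); rewrite fmorphV /= !cmodC normfV. Qed.

Lemma cmodD z w : cmod (z + w) <= cmod z + cmod w.
Proof. by rewrite -(@lecR R) rmorphD /= !cmodC; exact: ler_normD. Qed.

Lemma cmodN z : cmod (- z) = cmod z.
Proof. by apply: (@complexI R); rewrite !cmodC normrN. Qed.

Lemma cmodB z w : cmod (z - w) = cmod (w - z).
Proof. by rewrite -cmodN opprB. Qed.

Lemma cmod_conj z : cmod (cconj z) = cmod z.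
Proof. by rewrite /cmod /= sqrrN. Qed.

Lemma cmod_real x : cmod x%:C = `|x|.
Proof. by rewrite /cmod /= expr0n /= addr0 sqrtr_sqr. Qed.

Lemma cmod0 : cmod (0 : C) = 0.
Proof. by rewrite (cmod_real 0) normr0. Qed.

Lemma cmod1 : cmod (1 : C) = 1.
Proof. by rewrite (cmod_real 1) normr1. Qed.

Lemma cmod_eq0 z : (cmod z == 0) = (z == 0).
Proof. by rewrite -(inj_eq (@complexI R)) cmodC normr_eq0. Qed.

Lemma cmod_gt0 z : (0 < cmod z) = (z != 0).
Proof. by rewrite lt0r cmod_ge0 cmod_eq0 andbT. Qed.

Lemma cmod_sqr z : cmod z ^+ 2 = Re z ^+ 2 + Im z ^+ 2.
Proof. by rewrite sqr_sqrtr // addr_ge0 ?sqr_ge0. Qed.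

Lemma Re_le_cmod z : `|Re z| <= cmod z.
Proof. by rewrite -sqrtr_sqr ler_wsqrtr // lerDl sqr_ge0. Qed.

Lemma Im_le_cmod z : `|Im z| <= cmod z.
Proof. by rewrite -sqrtr_sqr ler_wsqrtr // lerDr sqr_ge0. Qed.

Lemma cmod_le_RI z : cmod z <= `|Re z| + `|Im z|.
Proof.
have -> : z = (Re z)%:C + Complex 0 (Im z).
  by apply: complex_ext; rewrite !ReIm ?addr0 ?add0r.
apply: le_trans (cmodD _ _) _; rewrite cmod_real ReD ImD /= addr0 add0r lerD2l.
by rewrite /cmod /= expr0n /= add0r sqrtr_sqr.
Qed.

Lemma cmod_ler_dist z w : cmod z - cmod w <= cmod (z - w).
Proof. by rewrite lerBlDr (le_trans _ (cmodD _ _)) // subrK. Qed.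

Lemma cmodBD z w v : cmod (z - v) <= cmod (z - w) + cmod (w - v).
Proof. by apply: le_trans (cmodD _ _); rewrite addrA subrK. Qed.

Lemma cconjD z w : cconj (z + w) = cconj z + cconj w.
Proof. by apply: complex_ext; rewrite !ReIm // opprD. Qed.
Lemma cconjN z : cconj (- z) = - cconj z.
Proof. by apply: complex_ext; rewrite !ReIm. Qed.
Lemma cconjM z w : cconj (z * w) = cconj z * cconj w.
Proof. by apply: complex_ext; rewrite !ReIm; ring. Qed.
Lemma cconjV z : cconj z^-1 = (cconj z)^-1.
Proof. by case: z => x y; apply: complex_ext; rewrite /= sqrrN ?mulNr. Qed.
Lemma cconjC x : cconj x%:C = x%:C.
Proof. by apply: complex_ext; rewrite !ReIm ?oppr0. Qed.
Lemma cconj1 : cconj 1 = 1 :> C. Proof. exact: (cconjC 1). Qed.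

Lemma Im_neq0 z : Im z != 0 -> z != 0.
Proof. by apply: contra => /eqP ->. Qed.

Lemma Im_gt0_neq z x : 0 < Im z -> z - x%:C != 0.
Proof. by move=> h; apply: Im_neq0; rewrite !ReIm subr0 gt_eqF. Qed.

End ComplexBasics.

(** * Real derivatives in remainder form *)

Section RealDerive.
Variable R : realType.
Implicit Types (f : R -> R) (x d : R).

(** In remainder form, the derivatives of a real and an imaginary part combine into one estimate on
    a modulus, and conversely. *)
Lemma is_derive1_eps f x d :
  (forall e, 0 < e -> exists2 del, 0 < del &
     forall h, `|h| < del -> `|f (x + h) - f x - d * h| <= e * `|h|) ->
  is_derive x 1 f d.
Proof.
move=> H.
have L : (fun h => h^-1 *: (f (h *: (1 : R) + x) - f x)) h @[h --> (0:R)^'] --> d.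
  apply/cvgrPdist_le => e e0; have [del del0 Hd] := H _ e0.
  near=> h.
  have h0 : h != 0 by near: h; exact: nbhs_dnbhs_neq.
  have hd : `|h| < del.
    by near: h; exact: dnbhs0_lt.
  have := Hd _ hd; rewrite /GRing.scale /= mulr1 (addrC h x) => Hh.
  have -> : d - h^-1 * (f (x + h) - f x) = - (h^-1 * (f (x + h) - f x - d * h)).
    by field.
  by rewrite normrN normrM normfV mulrC ler_pdivrMr ?normr_gt0.
have E := cvg_lim (@Rhausdorff _) L.
by apply: DeriveDef; [apply/cvg_ex; exists d | rewrite /derive E].
Unshelve. all: by end_near. Qed.

Lemma is_derive1_epsE f x d : is_derive x 1 f d ->
  forall e, 0 < e -> exists2 del, 0 < del &
     forall h, `|h| < del -> `|f (x + h) - f x - d * h| <= e * `|h|.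
Proof.
move=> [df Ed] e e0.
have : (fun h => h^-1 *: (f (h *: (1 : R) + x) - f x)) h @[h --> (0:R)^'] --> d.
  by rewrite -Ed; exact: df.
move=> /cvgrPdist_le /(_ _ e0) [del /= del0 Hd].
exists del => // h hd.
have [->|h0] := eqVneq h 0; first by rewrite addr0 subrr mulr0 subr0 normr0 mulr0.
have := Hd h; rewrite /= sub0r normrN => /(_ hd h0).
rewrite /GRing.scale /= mulr1 (addrC h x).
have -> : d - h^-1 * (f (x + h) - f x) = - (h^-1 * (f (x + h) - f x - d * h)).
  by field.
by rewrite normrN normrM normfV mulrC ler_pdivrMr ?normr_gt0.
Qed.

Lemma is_derive1_cont f x d : is_derive x 1 f d -> {for x, continuous f}.
Proof.
by move=> [df _]; apply: differentiable_continuous; apply/derivable1_diffP.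
Qed.

Lemma is_derive1_uniq f x d d' : is_derive x 1 f d -> is_derive x 1 f d' -> d = d'.
Proof. by move=> [_ <-] [_ <-]. Qed.

Lemma MVT_cc (f df : R -> R) (a b : R) : a <= b ->
  (forall x, a <= x <= b -> is_derive x 1 f (df x)) ->
  exists2 c, a <= c <= b & f b - f a = df c * (b - a).
Proof.
move=> ab fd.
have [||c cI E] := @MVT_segment R f df a b ab; last by exists c.
- by move=> x; rewrite in_itv /= => /andP[x0 x1]; apply: fd; rewrite !ltW.
- apply: derivable_within_continuous => x; rewrite in_itv /= => hx.
  by have [] := fd _ hx.
Qed.

Lemma derD (f g : R -> R) (x df dg : R) : is_derive x 1 f df -> is_derive x 1 g dg ->
  is_derive x 1 (fun u => f u + g u) (df + dg).
Proof. by move=> h1 h2; exact: is_deriveD. Qed.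

Lemma derN (f : R -> R) (x df : R) : is_derive x 1 f df ->
  is_derive x 1 (fun u => - f u) (- df).
Proof. by move=> h1; exact: is_deriveN. Qed.

Lemma derM (f g : R -> R) (x df dg : R) : is_derive x 1 f df -> is_derive x 1 g dg ->
  is_derive x 1 (fun u => f u * g u) (df * g x + f x * dg).
Proof.
move=> h1 h2; have := is_deriveM h1 h2.
by move=> /is_derive_eq; apply; rewrite /GRing.scale /=; ring.
Qed.

Lemma derC (c x : R) : is_derive x 1 (fun _ : R => c) 0.
Proof. exact: is_derive_cst. Qed.

Lemma derI (x : R) : is_derive x 1 (fun u : R => u) 1.
Proof. exact: is_derive_id. Qed.

Lemma derZ (c : R) (g : R -> R) (x dg : R) : is_derive x 1 g dg ->
  is_derive x 1 (fun u => c * g u) (c * dg).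
Proof. by move=> h; have := derM (derC c x) h; rewrite mul0r add0r. Qed.

Lemma derComp (f g : R -> R) (x df dg : R) : is_derive (g x) 1 f df ->
  is_derive x 1 g dg -> is_derive x 1 (fun u => f (g u)) (df * dg).
Proof. by move=> h1 h2; exact: is_derive1_comp. Qed.

Lemma derV (g : R -> R) (x dg : R) : g x != 0 -> is_derive x 1 g dg ->
  is_derive x 1 (fun u => (g u)^-1) (- (g x) ^- 2 * dg).
Proof. by move=> g0 h; exact: is_deriveV. Qed.

Lemma der_sqr (g : R -> R) (x dg : R) : is_derive x 1 g dg ->
  is_derive x 1 (fun u => g u ^+ 2) (2 * g x * dg).
Proof.
move=> h; have := derM h h => /is_derive_eq; apply.
by ring.
Qed.

Lemma der_ext (f g : R -> R) (x d r : R) : 0 < r ->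
  (forall u, `|u - x| < r -> f u = g u) -> is_derive x 1 f d -> is_derive x 1 g d.
Proof.
move=> r0 E fd; apply: is_derive1_eps => eps /(is_derive1_epsE fd)[del del0 H].
exists (Num.min r del); first by rewrite lt_min r0.
move=> h; rewrite lt_min => /andP[hr hd]; rewrite -!E ?subrr ?normr0 //; first exact: H.
by rewrite addrC addKr.
Qed.

End RealDerive.

(** * Derivatives along paths and complex differentiability *)

Section PathCalculus.
Variable R : realType.
Local Notation C := R[i].

(** Componentwise, so that the real chain rule and mean value theorem apply to each part; [cder_eps]
    and [cder_epsE] translate to bounds on the modulus. *)
Definition cder (g : R -> C) (x : R) (e : C) : Prop :=
  is_derive x 1 (fun u => Re (g u)) (Re e) /\
  is_derive x 1 (fun u => Im (g u)) (Im e).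

(* Complex differentiability with a quadratic remainder, the form in which
   analyticity is used throughout. *)
Definition qd (f : C -> C) (s d : C) : Prop :=
  exists M r, [/\ 0 < M, 0 < r &
    forall w, cmod (w - s) < r ->
      cmod (f w - f s - d * (w - s)) <= M * cmod (w - s) ^+ 2].

Lemma cder_eps (g : R -> C) x e :
  (forall eps, 0 < eps -> exists2 del, 0 < del &
     forall h, `|h| < del -> cmod (g (x + h) - g x - e * h%:C) <= eps * `|h|) ->
  cder g x e.
Proof.
move=> H; split; apply: is_derive1_eps => eps /H[del del0 Hd]; exists del => // h hd.
  apply: le_trans (Hd _ hd); apply: le_trans (Re_le_cmod _).
  by rewrite !ReIm mulr0 subr0.
apply: le_trans (Hd _ hd); apply: le_trans (Im_le_cmod _).
by rewrite !ReIm mulr0 add0r.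
Qed.

Lemma cder_epsE (g : R -> C) x e : cder g x e ->
  (forall eps, 0 < eps -> exists2 del, 0 < del &
     forall h, `|h| < del -> cmod (g (x + h) - g x - e * h%:C) <= eps * `|h|).
Proof.
move=> [H1 H2] eps e0; have e2 : 0 < eps / 2 by rewrite divr_gt0.
have [d1 d10 h1] := is_derive1_epsE H1 e2.
have [d2 d20 h2] := is_derive1_epsE H2 e2.
exists (Num.min d1 d2); first by rewrite lt_min d10.
move=> h; rewrite lt_min => /andP[hd1 hd2].
apply: le_trans (cmod_le_RI _) _.
rewrite !ReIm mulr0 subr0 mulr0 add0r.
by have := lerD (h1 _ hd1) (h2 _ hd2); rewrite -mulrDl -splitr.
Qed.

Lemma cder_uniq (g : R -> C) x e e' : cder g x e -> cder g x e' -> e = e'.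
Proof.
by move=> [a b] [a' b']; apply: complex_ext; [exact: is_derive1_uniq a a'|exact: is_derive1_uniq b b'].
Qed.

Lemma cder_bound (g : R -> C) x e : cder g x e ->
  exists2 del, 0 < del & forall h, `|h| < del -> cmod (g (x + h) - g x) <= (cmod e + 1) * `|h|.
Proof.
move=> /cder_epsE/(_ 1 ltr01)[del del0 H]; exists del => // h /H hh.
have -> : g (x + h) - g x = (g (x + h) - g x - e * h%:C) + e * h%:C by ring.
by apply: le_trans (cmodD _ _) _; rewrite cmodM cmod_real mulrDl addrC lerD2l.
Qed.

(** The bridge from complex to real differentiation: derivatives in the curve parameter and along
    rays are taken through it. *)
Lemma qd_path (f : C -> C) (g : R -> C) x d e :
  qd f (g x) d -> cder g x e -> cder (fun u => f (g u)) x (d * e).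
Proof.
move=> [M [r [M0 r0 Hf]]] gd; apply: cder_eps => eps eps0.
have [d1 d10 h1] := cder_bound gd.
have K0 : 0 < cmod e + 1 by rewrite ltr_wpDl ?cmod_ge0.
have dd0 : 0 < cmod d + 1 by rewrite ltr_wpDl ?cmod_ge0.
have [d2 d20 h2] := cder_epsE gd (divr_gt0 (divr_gt0 eps0 (ltr0Sn R 1)) dd0).
set K := cmod e + 1 in K0 h1.
pose d3 := r / K; have d30 : 0 < d3 by rewrite divr_gt0.
pose d4 := (eps / 2) / (M * K ^+ 2).
have d40 : 0 < d4 by rewrite !divr_gt0 // mulr_gt0 // exprn_gt0.
exists (Num.min (Num.min d1 d2) (Num.min d3 d4)).
  by rewrite !lt_min d10 d20 d30.
move=> h; rewrite !lt_min => /andP[/andP[hd1 hd2] /andP[hd3 hd4]].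
have h1h := h1 _ hd1; have h2h := h2 _ hd2.
have gr : cmod (g (x + h) - g x) < r.
  by apply: le_lt_trans h1h _; rewrite mulrC -ltr_pdivlMr.
have hf := Hf _ gr.
have -> : f (g (x + h)) - f (g x) - d * e * h%:C =
  (f (g (x + h)) - f (g x) - d * (g (x + h) - g x)) +
  d * (g (x + h) - g x - e * h%:C) by ring.
apply: le_trans (cmodD _ _) _; rewrite cmodM (splitr eps) mulrDl.
apply: lerD.
  apply: le_trans hf _.
  have : cmod (g (x + h) - g x) ^+ 2 <= (K * `|h|) ^+ 2.
    by rewrite lerXn2r // ?nnegrE ?cmod_ge0 // mulr_ge0 // ltW.
  move=> /(ler_wpM2l (ltW M0)) /le_trans; apply.
  have -> : M * (K * `|h|) ^+ 2 = (`|h| * (M * K ^+ 2)) * `|h| by ring.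
  by rewrite ler_wpM2r // ltW // -ltr_pdivlMr // mulr_gt0 // exprn_gt0.
apply: le_trans (ler_wpM2l (cmod_ge0 _) h2h) _.
rewrite mulrA ler_wpM2r // mulrCA ler_piMr ?divr_ge0 ?ltW //.
by rewrite ltr_pdivrMr // mul1r ltrDl.
Qed.

Lemma qdI (f : C -> C) (s d : C) (M r : R) : 0 < r ->
  (forall w, cmod (w - s) < r ->
      cmod (f w - f s - d * (w - s)) <= M * cmod (w - s) ^+ 2) -> qd f s d.
Proof.
move=> r0 H; exists (`|M| + 1), r; split => //.
move=> w /H /le_trans; apply; rewrite ler_wpM2r ?sqr_ge0 //.
by rewrite (le_trans (ler_norm M)) // lerDl.
Qed.

Lemma qdE (f : C -> C) s d : qd f s d ->
  exists M r, [/\ 0 < M, 0 < r, r <= 1, forall w, cmod (w - s) < r ->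
      cmod (f w - f s - d * (w - s)) <= M * cmod (w - s) ^+ 2 &
      forall w, cmod (w - s) < r -> cmod (f w - f s) <= M * cmod (w - s)].
Proof.
move=> [M [r [M0 r0 H]]].
have M1 : 0 < M + cmod d by rewrite ltr_wpDr ?cmod_ge0.
exists (M + cmod d), (Num.min r 1); split => //.
- by rewrite lt_min r0 /=.
- by rewrite ge_min lexx orbT.
- move=> w; rewrite lt_min => /andP[/H wr _]; apply: le_trans wr _.
  by rewrite ler_wpM2r ?sqr_ge0 // lerDl cmod_ge0.
move=> w; rewrite lt_min => /andP[/H wr w1].
have -> : f w - f s = (f w - f s - d * (w - s)) + d * (w - s) by ring.
apply: le_trans (cmodD _ _) _; rewrite cmodM mulrDl lerD2r.
apply: le_trans wr _; rewrite (ler_wpM2l (ltW M0)) // expr2.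
by rewrite ler_piMr ?cmod_ge0 // ltW.
Qed.

Lemma qd_cvg (f : C -> C) s d : qd f s d -> forall eps, 0 < eps ->
  exists2 del, 0 < del & forall w, cmod (w - s) < del -> cmod (f w - f s) < eps.
Proof.
move=> /qdE[M [r [M0 r0 _ _ H]]] eps e0.
exists (Num.min r (eps / M)); first by rewrite lt_min r0 divr_gt0.
move=> w; rewrite lt_min => /andP[/H wr]; rewrite ltr_pdivlMr // mulrC.
exact: le_lt_trans.
Qed.

Lemma qd_cst (c s : C) : qd (fun _ => c) s 0.
Proof.
by apply: (@qdI _ _ _ 0 1) => // w _; rewrite subrr mul0r subr0 cmod0 mul0r.
Qed.

Lemma qd_id (s : C) : qd id s 1.
Proof.
by apply: (@qdI _ _ _ 0 1) => // w _; rewrite mul1r subrr cmod0 mul0r.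
Qed.

Lemma qd_ext (f g : C -> C) s d r : 0 < r ->
  (forall w, cmod (w - s) < r -> f w = g w) -> qd f s d -> qd g s d.
Proof.
move=> r0 E [M [r' [M0 r'0 H]]]; apply: (@qdI _ _ _ M (Num.min r r')).
  by rewrite lt_min r0.
move=> w; rewrite lt_min => /andP[wr wr']; rewrite -!E ?subrr ?cmod0 //.
exact: H.
Qed.

Lemma qdD (f g : C -> C) s d e :
  qd f s d -> qd g s e -> qd (fun w => f w + g w) s (d + e).
Proof.
move=> [M [r [M0 r0 H]]] [M' [r' [M'0 r'0 H']]].
apply: (@qdI _ _ _ (M + M') (Num.min r r')); first by rewrite lt_min r0.
move=> w; rewrite lt_min => /andP[/H h /H' h'].
have -> : f w + g w - (f s + g s) - (d + e) * (w - s) =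
  (f w - f s - d * (w - s)) + (g w - g s - e * (w - s)) by ring.
by apply: le_trans (cmodD _ _) _; rewrite mulrDl lerD.
Qed.

Lemma qdM (f g : C -> C) s d e :
  qd f s d -> qd g s e -> qd (fun w => f w * g w) s (d * g s + f s * e).
Proof.
move=> /qdE[M [r [M0 r0 r1 H _]]] /qdE[M' [r' [M'0 r'0 r'1 H' L']]].
apply: (@qdI _ _ _ (M * (cmod (g s) + M') + cmod (f s) * M' + cmod d * M')
  (Num.min r r')); first by rewrite lt_min r0.
move=> w; rewrite lt_min => /andP[wr wr'].
have h := H _ wr; have h' := H' _ wr'; have l' := L' _ wr'.
have -> : f w * g w - f s * g s - (d * g s + f s * e) * (w - s) =
  (f w - f s - d * (w - s)) * g w + f s * (g w - g s - e * (w - s)) +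
  d * (w - s) * (g w - g s) by ring.
apply: le_trans (cmodD _ _) _; rewrite [leRHS]mulrDl; apply: lerD.
  apply: le_trans (cmodD _ _) _; rewrite [leRHS]mulrDl; apply: lerD.
    rewrite cmodM mulrAC; apply: ler_pM; rewrite ?cmod_ge0 //.
    have -> : g w = g s + (g w - g s) by ring.
    apply: le_trans (cmodD _ _) _; rewrite lerD2l; apply: le_trans l' _.
    by rewrite ler_piMr // ltW // (lt_le_trans wr').
  by rewrite cmodM -mulrA ler_wpM2l ?cmod_ge0.
rewrite !cmodM -!mulrA ler_wpM2l ?cmod_ge0 //.
by rewrite expr2 mulrCA ler_wpM2l ?cmod_ge0.
Qed.

Lemma qdZ (c : C) (g : C -> C) s e : qd g s e -> qd (fun w => c * g w) s (c * e).
Proof.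
by move=> h; have := qdM (qd_cst c s) h; rewrite mul0r add0r.
Qed.

Lemma qdN (g : C -> C) s e : qd g s e -> qd (fun w => - g w) s (- e).
Proof.
move=> h; have := qdZ (-1) h; rewrite mulN1r.
by apply: (@qd_ext _ _ _ _ 1) => // w _; rewrite mulN1r.
Qed.

Lemma qdV (s : C) : s != 0 -> qd (fun w => w^-1) s (- s ^- 2).
Proof.
move=> s0; have cs : 0 < cmod s by rewrite cmod_gt0.
apply: (@qdI _ _ _ (2 / cmod s ^+ 3) (cmod s / 2)); first by rewrite divr_gt0.
move=> w wr.
have ws : cmod s / 2 < cmod w.
  have := cmod_ler_dist s w; rewrite cmodB => h.
  rewrite {1}(splitr (cmod s)) in h; lra.
have w0 : w != 0 by rewrite -cmod_gt0 (lt_trans _ ws) // divr_gt0.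
have -> : w^-1 - s^-1 - - s ^- 2 * (w - s) = (w - s) ^+ 2 * (w * s ^+ 2)^-1.
  by field; rewrite s0 w0.
rewrite cmodM !expr2 !cmodM cmodV !cmodM mulrC ler_wpM2r ?mulr_ge0 ?cmod_ge0 //.
rewrite ler_pdivlMr ?exprn_gt0 // mulrC ler_pdivrMr ?mulr_gt0 ?(lt_trans _ ws) ?divr_gt0 //.
rewrite mulrA -subr_ge0.
have -> : 2 * (cmod w * cmod s * cmod s) - cmod s ^+ 3 =
  2 * (cmod w - cmod s / 2) * (cmod s * cmod s) by field.
by rewrite !mulr_ge0 ?cmod_ge0 // subr_ge0 ltW.
Qed.

Lemma qd_comp (f g : C -> C) s d e :
  qd f (g s) d -> qd g s e -> qd (fun w => f (g w)) s (d * e).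
Proof.
move=> [M [r [M0 r0 H]]] /qdE[M' [r' [M'0 r'0 r'1 H' L']]].
apply: (@qdI _ _ _ (M * M' ^+ 2 + cmod d * M') (Num.min r' (r / M'))).
  by rewrite lt_min r'0 divr_gt0.
move=> w; rewrite lt_min => /andP[wr' wr].
have h' := H' _ wr'; have l' := L' _ wr'.
have gr : cmod (g w - g s) < r.
  by apply: le_lt_trans l' _; rewrite mulrC -ltr_pdivlMr.
have h := H _ gr.
have -> : f (g w) - f (g s) - d * e * (w - s) =
  (f (g w) - f (g s) - d * (g w - g s)) + d * (g w - g s - e * (w - s)) by ring.
apply: le_trans (cmodD _ _) _; rewrite mulrDl; apply: lerD.
  apply: le_trans h _; rewrite -mulrA (ler_wpM2l (ltW M0)) //.
  by rewrite -exprMn lerXn2r // nnegrE ?cmod_ge0 // (mulr_ge0 (ltW M'0)) ?cmod_ge0.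
by rewrite cmodM -mulrA ler_wpM2l ?cmod_ge0.
Qed.

Lemma qdV_comp (g : C -> C) s e : g s != 0 -> qd g s e ->
  qd (fun w => (g w)^-1) s (- (g s) ^- 2 * e).
Proof. by move=> g0 gd; apply: qd_comp gd; exact: qdV. Qed.

Lemma qd_inv_sub (A p s : C) : s != p -> qd (fun w => A / (w - p)) s (- A / (s - p) ^+ 2).
Proof.
move=> sp; have sp0 : s - p != 0 by rewrite subr_eq0.
have h : qd (fun w => w - p) s 1.
  by have := qdD (qd_id s) (qd_cst (- p) s); rewrite addr0.
by have := qdZ A (@qdV_comp (fun w => w - p) s 1 sp0 h); rewrite mulr1 mulrN mulNr.
Qed.

Lemma cder_line (z e : C) x : cder (fun u => z + u%:C * e) x e.
Proof.
apply: cder_eps => eps eps0; exists 1 => // h _.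
have -> : z + (x + h)%:C * e - (z + x%:C * e) - e * h%:C = 0.
  by rewrite rmorphD /=; ring.
by rewrite cmod0 mulr_ge0 // ltW.
Qed.

Lemma cder_ext (f g : R -> C) x e r : 0 < r ->
  (forall u, `|u - x| < r -> f u = g u) -> cder f x e -> cder g x e.
Proof.
move=> r0 E fd; apply: cder_eps => eps /(cder_epsE fd)[del del0 H].
exists (Num.min r del); first by rewrite lt_min r0.
move=> h; rewrite lt_min => /andP[hr hd]; rewrite -!E ?subrr ?normr0 //; first exact: H.
by rewrite addrC addKr.
Qed.

(* Twice the sharp mean value bound, which is all that is needed. *)
Lemma cder_mean (g g' : R -> C) M :
  (forall u, 0 <= u <= 1 -> cder g u (g' u)) ->
  (forall u, 0 <= u <= 1 -> cmod (g' u) <= M) -> cmod (g 1 - g 0) <= 2 * M.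
Proof.
move=> gd gM.
have key (F : C -> R) : (F = @complex.Re R \/ F = @complex.Im R) -> `|F (g 1) - F (g 0)| <= M.
  move=> HF.
  have Fd (u : R) : 0 <= u <= 1 -> is_derive u 1 (fun t => F (g t)) (F (g' u)).
    by move=> /gd[? ?]; case: HF => ->.
  have [c cI ->] := MVT_cc ler01 Fd.
  rewrite subr0 mulr1; move: cI => /gM /(le_trans _); apply.
  by case: HF => ->; [exact: Re_le_cmod|exact: Im_le_cmod].
apply: le_trans (cmod_le_RI _) _; rewrite !ReIm mulrDl mul1r.
by apply: lerD; apply: key; [left|right].
Qed.

Lemma cderD (f g : R -> C) x d e :
  cder f x d -> cder g x e -> cder (fun u => f u + g u) x (d + e).
Proof.
move=> [a1 b1] [a2 b2]; split; [have := is_deriveD a1 a2|have := is_deriveD b1 b2].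
  rewrite -ReD; suff -> : (fun u => Re (f u + g u)) = (fun u => Re (f u)) + (fun u => Re (g u)) by [].
  by apply/funext => u; rewrite ReD.
rewrite -ImD; suff -> : (fun u => Im (f u + g u)) = (fun u => Im (f u)) + (fun u => Im (g u)) by [].
by apply/funext => u; rewrite ImD.
Qed.

Lemma cmod_seg (s w : C) u : 0 <= u <= 1 -> cmod (u%:C * (w - s)) <= cmod (w - s).
Proof.
move=> /andP[u0 u1]; rewrite cmodM cmod_real ger0_norm //.
by rewrite ler_piMl ?cmod_ge0.
Qed.

(** A derivative known along paths near [s] and Lipschitz at [s] upgrades to a quadratic remainder:
    subtract the linear part [f1 s * w] and apply the mean value bound on the segment from [s] to
    [w]. *)
Lemma qd_of_path (f f1 : C -> C) s M r : 0 < r ->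
  (forall w g x e, cmod (w - s) < r -> g x = w -> cder g x e ->
     cder (fun u => f (g u)) x (f1 w * e)) ->
  (forall w, cmod (w - s) < r -> cmod (f1 w - f1 s) <= M * cmod (w - s)) ->
  qd f s (f1 s).
Proof.
move=> r0 fd f1L.
have M0 : 0 <= M.
  have h : cmod (s + (r / 2)%:C - s) = r / 2.
    by rewrite addrAC subrr add0r cmod_real ger0_norm // divr_ge0 // ltW.
  have := f1L (s + (r / 2)%:C); rewrite h => /(_ _).
  have -> : r / 2 < r by rewrite ltr_pdivrMr // ltr_pMr // ltr1n.
  move=> /(_ isT) /(le_trans (cmod_ge0 _)); rewrite pmulr_lge0 //.
  by rewrite divr_gt0.
apply: (@qdI _ _ _ (2 * M) r) => // w wr.
pose g (u : R) := f (s + u%:C * (w - s)) - f1 s * (s + u%:C * (w - s)).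
pose g' (u : R) := (f1 (s + u%:C * (w - s)) - f1 s) * (w - s).
have sr u : 0 <= u <= 1 -> cmod (s + u%:C * (w - s) - s) < r.
  move=> hu; rewrite addrAC subrr add0r; apply: le_lt_trans wr.
  exact: cmod_seg.
have := @cder_mean g g' (M * cmod (w - s) * cmod (w - s)).
have -> : g 1 - g 0 = f w - f s - f1 s * (w - s).
  rewrite /g /= mul1r mul0r addr0.
  have -> : s + (w - s) = w by ring.
  by ring.
have -> : 2 * (M * cmod (w - s) * cmod (w - s)) = 2 * M * cmod (w - s) ^+ 2 by ring.
apply.
- move=> u hu; have hl := cder_line s (w - s) u.
  have h1 := fd _ _ _ _ (sr _ hu) erefl hl.
  have h2 : qd (fun z => - (f1 s * z)) (s + u%:C * (w - s)) (- f1 s).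
    have := qdN (qdZ (f1 s) (qd_id (s + u%:C * (w - s)))).
    by rewrite mulr1.
  have h3 := qd_path h2 hl.
  have := cderD h1 h3; rewrite /g /g' mulrBl mulNr; exact.
move=> u hu; rewrite /g' cmodM ler_wpM2r ?cmod_ge0 //.
apply: le_trans (f1L _ (sr _ hu)) _; rewrite ler_wpM2l //.
by rewrite addrAC subrr add0r; exact: cmod_seg.
Qed.

End PathCalculus.

(** * Exponential, and logarithm on the upper half-plane *)

Section ExpLog.
Variable R : realType.
Local Notation C := R[i].
Implicit Types (z w s : C) (x y : R).

Fact expC_key : unit. Proof. exact: tt. Qed.

(* Locked, so that rewriting with the laws of Re and Im does not unfold it. *)
Definition expC z : C := locked_with expC_key
  (Complex (expR (Re z) * cos (Im z)) (expR (Re z) * sin (Im z))).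

Lemma Re_expC z : Re (expC z) = expR (Re z) * cos (Im z). Proof. by rewrite /expC unlock. Qed.
Lemma Im_expC z : Im (expC z) = expR (Re z) * sin (Im z). Proof. by rewrite /expC unlock. Qed.

Lemma expCD z w : expC (z + w) = expC z * expC w.
Proof.
apply: complex_ext; rewrite !ReIm !Re_expC !Im_expC !ReIm expRD.
  by rewrite cosD; ring.
by rewrite sinD; ring.
Qed.

Lemma cmod_expC z : cmod (expC z) = expR (Re z).
Proof.
rewrite /cmod Re_expC Im_expC !exprMn -mulrDr cos2Dsin2 mulr1 sqrtr_sqr.
by rewrite ger0_norm // expR_ge0.
Qed.

Lemma expC_neq0 z : expC z != 0.
Proof. by rewrite -cmod_gt0 cmod_expC expR_gt0. Qed.

Lemma expC0 : expC 0 = 1.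
Proof. by apply: complex_ext; rewrite ?Re_expC ?Im_expC ?ReIm expR0 ?cos0 ?sin0 ?mulr1 ?mulr0. Qed.

Lemma expCN z : expC (- z) = (expC z)^-1.
Proof.
by apply: (mulfI (expC_neq0 z)); rewrite -expCD subrr expC0 divff // expC_neq0.
Qed.

Lemma expC_real x : expC x%:C = (expR x)%:C.
Proof. by apply: complex_ext; rewrite ?Re_expC ?Im_expC ?ReIm ?cos0 ?sin0 ?mulr1 ?mulr0. Qed.

Lemma expC_conj z : expC (cconj z) = cconj (expC z).
Proof. by apply: complex_ext; rewrite !(Re_expC, Im_expC, ReIm) ?cosN ?sinN // mulrN. Qed.

Lemma expC_path (g : R -> C) x (e : C) :
  cder g x e -> cder (fun u => expC (g u)) x (expC (g x) * e).
Proof.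
move=> [a b].
have e1 := derComp (is_derive_expR (Re (g x))) a.
have c1 := derComp (is_derive_cos (Im (g x))) b.
have s1 := derComp (is_derive_sin (Im (g x))) b.
split; under eq_fun do rewrite ?Re_expC ?Im_expC.
  by have := derM e1 c1 => /is_derive_eq; apply; rewrite !ReIm Re_expC Im_expC; ring.
by have := derM e1 s1 => /is_derive_eq; apply; rewrite !ReIm Re_expC Im_expC; ring.
Qed.

Lemma qd_expC s : qd expC s (expC s).
Proof.
apply: (@qd_of_path R expC expC s (2 * expR (Re s + 1)) 1) => //.
  by move=> w g x e _ <- h; exact: expC_path.
move=> w wr.
have h := @cder_mean R (fun u => expC (s + u%:C * (w - s)))
  (fun u => expC (s + u%:C * (w - s)) * (w - s)) (expR (Re s + 1) * cmod (w - s)).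
have E1 : s + 1%:C * (w - s) = w by rewrite mul1r addrC subrK.
have E0 : s + 0%:C * (w - s) = s by rewrite mul0r addr0.
move: h; rewrite E1 E0 mulrA; apply.
  by move=> u _; apply: expC_path; exact: cder_line.
move=> u hu; rewrite cmodM cmod_expC ler_wpM2r ?cmod_ge0 // ler_expR ReD lerD2l.
apply: le_trans (ler_norm _) _; apply: le_trans (Re_le_cmod _) _.
exact: le_trans (cmod_seg _ _ hu) (ltW wr).
Qed.

(** The argument as an arc cotangent: one smooth formula on the whole open upper half-plane, with
    values in [(0, pi)]. *)
Definition Arg s : R := pi / 2 - atan (Re s / Im s).

Definition Lg s : C := locked_with expC_key
  (Complex (2^-1 * ln (Re s ^+ 2 + Im s ^+ 2)) (Arg s)).

Lemma Re_LgE s : Re (Lg s) = 2^-1 * ln (Re s ^+ 2 + Im s ^+ 2).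
Proof. by rewrite /Lg unlock. Qed.
Lemma Im_Lg s : Im (Lg s) = Arg s. Proof. by rewrite /Lg unlock. Qed.

Lemma Arg_itv s : 0 < Arg s < pi.
Proof.
have := atan_ltpi2 (Re s / Im s); have := atan_gtNpi2 (Re s / Im s).
rewrite /Arg; set t := atan _; lra.
Qed.

Lemma Re_Lg s : 0 < Im s -> Re (Lg s) = ln (cmod s).
Proof.
move=> s0; have c0 : 0 < cmod s by rewrite cmod_gt0 Im_neq0 // gt_eqF.
by rewrite Re_LgE -cmod_sqr lnXn // mulr2n; field.
Qed.

Lemma LgK s : 0 < Im s -> expC (Lg s) = s.
Proof.
move=> s0; have c0 : 0 < cmod s by rewrite cmod_gt0 Im_neq0 // gt_eqF.
have E : Num.sqrt (1 + (Re s / Im s) ^+ 2) = cmod s / Im s.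
  have -> : 1 + (Re s / Im s) ^+ 2 = (cmod s / Im s) ^+ 2.
    rewrite !expr_div_n cmod_sqr; field.
    by rewrite gt_eqF.
  by rewrite sqrtr_sqr ger0_norm // divr_ge0 ?ltW.
have Ec : cos (atan (Re s / Im s)) = Im s / cmod s by rewrite cos_atan E invf_div.
have Es : sin (atan (Re s / Im s)) = Re s / cmod s.
  have c1 : Im s / cmod s != 0 by rewrite gt_eqF // divr_gt0.
  have := atanK (Re s / Im s); rewrite /tan Ec => /(canRL (mulfVK c1)) ->.
  by field; rewrite !gt_eqF.
apply: complex_ext; rewrite ?Re_expC ?Im_expC Re_Lg // lnK ?posrE // Im_Lg /Arg.
  by rewrite cosB cos_pihalf sin_pihalf mul0r add0r mul1r Es mulrC divfK // gt_eqF.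
by rewrite sinB cos_pihalf sin_pihalf mul0r subr0 mul1r Ec mulrC divfK // gt_eqF.
Qed.

Lemma Lg_path (g : R -> C) x (e : C) : 0 < Im (g x) ->
  cder g x e -> cder (fun u => Lg (g u)) x ((g x)^-1 * e).
Proof.
move=> g0 [a b].
have n0 : Re (g x) ^+ 2 + Im (g x) ^+ 2 != 0.
  by rewrite gt_eqF // ltr_wpDl ?sqr_ge0 // exprn_gt0.
have h0 : 0 < Re (g x) ^+ 2 + Im (g x) ^+ 2 by rewrite lt0r n0 addr_ge0 ?sqr_ge0.
split; under eq_fun do rewrite ?Re_LgE ?Im_Lg.
  have := derZ 2^-1 (@derComp R (@ln R) (fun u => Re (g u) ^+ 2 + Im (g u) ^+ 2) x _ _ (is_derive1_ln h0) (derD (der_sqr a) (der_sqr b))).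
  move=> /is_derive_eq; apply; rewrite !ReIm ReV ImV; field.
  by rewrite n0.
have V := derV (lt0r_neq0 g0) b.
have := derD (derC (pi / 2) x) (derN (@derComp R (@atan R) (fun u => Re (g u) / Im (g u)) x _ _ (is_derive1_atan _) (derM a V))).
move=> /is_derive_eq; apply; rewrite !ReIm ReV ImV; field.
by rewrite n0 gt_eqF.
Qed.

Lemma Im_ball s w : cmod (w - s) < Im s -> 0 < Im w.
Proof.
move=> h; have := le_lt_trans (Im_le_cmod (w - s)) h.
rewrite !ReIm => /ltr_normlP[h1 h2]; lra.
Qed.

Lemma qd_Lg s : 0 < Im s -> qd Lg s s^-1.
Proof.
move=> s0; have sn : s != 0 by rewrite Im_neq0 // gt_eqF.
have [M [r [M0 r0 _ _ L]]] := qdE (qdV sn).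
apply: (@qd_of_path R Lg (fun w => w^-1) s M (Num.min r (Im s))).
- by rewrite lt_min r0.
- move=> w g x e; rewrite lt_min => /andP[_ wr] E h; rewrite -E.
  by apply: Lg_path h; rewrite E (Im_ball wr).
by move=> w; rewrite lt_min => /andP[wr _]; exact: L.
Qed.

(** Links the case-defined argument of the statement to [expC]. The cases follow the position of
    [Im z] relative to [- (pi / 2)] and [pi / 2], where the cosine changes sign and the arctangent
    must be shifted by [pi]. *)
Lemma carg_expC z : - pi < Im z < pi -> carg (expC z) = Im z.
Proof.
move=> /andP[z1 z2]; rewrite /carg Re_expC Im_expC; set t := Im z in z1 z2 *.
have e0 := expR_gt0 (Re z).
rewrite !pmulr_rgt0 // !pmulr_rlt0 // pmulr_rge0 //.
have tE : cos t != 0 -> expR (Re z) * sin t / (expR (Re z) * cos t) = tan t.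
  by move=> c0; rewrite /tan; field; rewrite c0 gt_eqF.
have p0 := @pi_gt0 R.
case: (ltgtP t (pi / 2)) => h1.
- case: (ltgtP t (- (pi / 2))) => h2.
  + have c0 : cos t < 0.
      rewrite -(opprK (cos t)) -cosDpi oppr_lt0 cos_gt0_pihalf //; lra.
    have s0 : sin t < 0.
      rewrite -(opprK (sin t)) -sinN oppr_lt0 sin_gt0_pi //; lra.
    rewrite (ltNge 0 (cos t)) (ltW c0) /= c0 (leNgt 0 (sin t)) s0 /= tE ?lt_eqF //.
    rewrite -tanDpi tanK ?addrK // in_itv /=; lra.
  + have c0 : 0 < cos t by rewrite cos_gt0_pihalf //; lra.
    by rewrite c0 tE ?gt_eqF // tanK // in_itv /= h1 h2.
  + have c0 : cos t = 0 by rewrite h2 cosN cos_pihalf.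
    have s0 : sin t = - 1 by rewrite h2 sinN sin_pihalf.
    by rewrite c0 s0 ltxx oppr_gt0 ltr10 /= oppr_lt0 ltr01 h2.
- have c0 : cos t < 0.
    have -> : t = (t - pi) + pi by rewrite subrK.
    rewrite cosDpi oppr_lt0 cos_gt0_pihalf //; lra.
  have s0 : 0 < sin t by rewrite sin_gt0_pi //; lra.
  rewrite (ltNge 0 (cos t)) (ltW c0) /= c0 (ltW s0) tE ?lt_eqF //.
  have -> : tan t = tan (t - pi) by rewrite -[in RHS]tanDpi subrK.
  rewrite tanK ?subrK // in_itv /=; lra.
- have c0 : cos t = 0 by rewrite h1 cos_pihalf.
  have s0 : sin t = 1 by rewrite h1 sin_pihalf.
  by rewrite c0 s0 ltxx ltr01 h1.
Qed.

Lemma cpow_expC z p : - pi < Im z < pi -> cpow (expC z) p = expC (p%:C * z).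
Proof.
move=> h; rewrite /cpow (negbTE (expC_neq0 z)) carg_expC // cmod_expC.
have -> : expR (Re z) `^ p = expR (p * Re z) by rewrite -expRM mulrC.
by apply: complex_ext; rewrite !(Re_expC, Im_expC, ReIm) !mul0r ?subr0 ?addr0.
Qed.

Lemma cpow_pos x p : 0 < x -> cpow x%:C p = (x `^ p)%:C.
Proof.
move=> x0; have -> : x%:C = expC (ln x)%:C by rewrite expC_real lnK.
rewrite cpow_expC /=; last by rewrite oppr_lt0 pi_gt0.
by rewrite -rmorphM /= expC_real /powR gt_eqF.
Qed.

Lemma expC_inj z w : - pi < Im z < pi -> - pi < Im w < pi -> expC z = expC w -> z = w.
Proof.
move=> hz hw E; apply: complex_ext; last by rewrite -carg_expC // E carg_expC.
by apply: expR_inj; rewrite -!cmod_expC E.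
Qed.

End ExpLog.

(** * The maximum principle for harmonic functions *)

Section MaximumPrinciple.
Variable R : realType.
Local Notation C := R[i].
Implicit Types (O : C -> Prop) (u v : C -> R).

Lemma MVT_oo (f df : R -> R) (a b : R) : a < b ->
  (forall x, a <= x <= b -> is_derive x 1 f (df x)) ->
  exists2 c, a < c < b & f b - f a = df c * (b - a).
Proof.
move=> ab fd.
have [||c cI E] := @MVT R f df a b ab; last by exists c.
- by move=> x; rewrite in_itv /= => /andP[x0 x1]; apply: fd; rewrite !ltW.
- apply: derivable_within_continuous => x; rewrite in_itv /= => hx.
  by have [] := fd _ hx.
Qed.

(** If [f2] were positive, [f1] would be positive just right of [0] when [f1 0 >= 0] and negative
    just left of it otherwise; the mean value theorem then gives a value above [f 0]. *)
Lemma second_derivative_test (f f1 : R -> R) (f2 r : R) : 0 < r ->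
  (forall t : R, `|t| < r -> is_derive t 1 f (f1 t)) -> is_derive (0 : R) 1 f1 f2 ->
  (forall t : R, `|t| < r -> f t <= f 0) -> f2 <= 0.
Proof.
move=> r0 fd f1d fmax; rewrite leNgt; apply/negP => f20.
have [del del0 H] := is_derive1_epsE f1d (divr_gt0 f20 (ltr0Sn R 1)).
pose k := Num.min r del / 2.
have m0 : 0 < Num.min r del by rewrite lt_min r0.
have k0 : 0 < k by rewrite divr_gt0.
have km : k < Num.min r del by rewrite ltr_pdivrMr // ltr_pMr // ltr1n.
have [kr kd] : k < r /\ k < del by move: km; rewrite lt_min => /andP.
have [h0|h0] := leP 0 (f1 0).
  have [|c /andP[c0 ck] E] := @MVT_oo f f1 0 k k0.
    move=> x /andP[x0 xk]; apply: fd; rewrite ger0_norm //; exact: le_lt_trans kr.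
  have := fmax k; rewrite ger0_norm ?(ltW k0) // => /(_ kr).
  rewrite -subr_le0 E subr0 pmulr_lle0 //; apply/negP; rewrite -ltNge.
  have := H c; rewrite ger0_norm ?(ltW c0) // => /(_ (lt_trans ck kd)).
  rewrite add0r => /ler_normlP[h _]; nra.
have nk : - k < 0 by rewrite oppr_lt0.
have [|c /andP[c0 ck] E] := @MVT_oo f f1 (- k) 0 nk.
  move=> x /andP[x0 xk]; apply: fd; rewrite ler0_norm //.
  by rewrite ltrNl (lt_le_trans _ x0) // ltrN2.
have := fmax (- k); rewrite normrN ger0_norm ?(ltW k0) // => /(_ kr).
rewrite -subr_ge0 E sub0r opprK pmulr_lge0 //; apply/negP; rewrite -ltNge.
have := H c; rewrite ler0_norm ?(ltW ck) // ltrNl => /(_ _).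
have cd : - del < c by rewrite (lt_trans _ c0) // ltrN2.
move=> /(_ cd); rewrite add0r => /ler_normlP[_ h]; nra.
Qed.

Definition copen O := forall s, O s -> exists2 r : R, 0 < r & forall w : C, cmod (w - s) < r -> O w.

(* [D s] plays the role of the complex derivative of a function with imaginary
   part [u]; no single-valued conjugate of [u] is required. *)
Definition har O u := exists D D1 : C -> C, forall s, O s ->
  [/\ forall (g : R -> C) (x : R) (e : C), g x = s -> cder g x e ->
        is_derive x 1 (fun t => u (g t)) (Im (D s * e)),
      qd D s (D1 s) &
      forall eps : R, 0 < eps -> exists2 del : R, 0 < del &
        forall w : C, cmod (w - s) < del -> `|u w - u s| < eps].

Lemma har_sub O O' u : (forall s, O' s -> O s) -> har O u -> har O' u.
Proof. by move=> sub [D [D1 H]]; exists D, D1 => s /sub /H. Qed.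

Lemma har_Im O (E E1 E2 : C -> C) : (forall s, O s -> qd E s (E1 s) /\ qd E1 s (E2 s)) ->
  har O (fun s => Im (E s)).
Proof.
move=> H; exists E1, E2 => s /H[h1 h2]; split => //.
  move=> g x e Es gd; rewrite -Es in h1 *; by have [] := qd_path h1 gd.
move=> eps e0; have [del d0 h] := qd_cvg h1 e0; exists del => // w /h.
by apply: le_lt_trans; rewrite -ImN -ImD; exact: Im_le_cmod.
Qed.

Lemma harD O u v : har O u -> har O v -> har O (fun s => u s + v s).
Proof.
move=> [D [D1 H]] [E [E1 H']]; exists (fun s => D s + E s), (fun s => D1 s + E1 s) => s Os.
have [a b c] := H _ Os; have [a' b' c'] := H' _ Os; split.
- move=> g x e Es gd; have := derD (a _ _ _ Es gd) (a' _ _ _ Es gd).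
  by rewrite mulrDl ImD.
- exact: qdD.
move=> eps e0; have e2 : 0 < eps / 2 by rewrite divr_gt0.
have [d1 d10 h1] := c _ e2; have [d2 d20 h2] := c' _ e2.
exists (Num.min d1 d2); first by rewrite lt_min d10.
move=> w; rewrite lt_min => /andP[/h1 w1 /h2 w2].
have -> : u w + v w - (u s + v s) = (u w - u s) + (v w - v s) by ring.
by apply: le_lt_trans (ler_normD _ _) _; rewrite (splitr eps) ltrD.
Qed.

Lemma harZ O u (c : R) : har O u -> har O (fun s => c * u s).
Proof.
move=> [D [D1 H]]; exists (fun s => c%:C * D s), (fun s => c%:C * D1 s) => s Os.
have [a b cu] := H _ Os; split.
- move=> g x e Es gd; have := derZ c (a _ _ _ Es gd).
  by rewrite -mulrA [Im (c%:C * _)]ImM !ReIm mul0r addr0.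
- exact: qdZ.
move=> eps e0; have c0 : 0 < `|c| + 1 by [].
have [d1 d10 h1] := cu _ (divr_gt0 e0 c0); exists d1 => // w /h1.
rewrite ltr_pdivlMr // -mulrBr normrM; apply: le_lt_trans.
by rewrite mulrC ler_wpM2l // lerDl.
Qed.

Definition ic : C := locked_with expC_key (Complex 0 1).
Lemma icE : ic = Complex 0 1. Proof. by rewrite /ic unlock. Qed.
Lemma Re_i : Re ic = 0. Proof. by rewrite icE. Qed.
Lemma Im_i : Im ic = 1. Proof. by rewrite icE. Qed.
Lemma ic2 : ic * ic = - 1.
Proof. by apply: complex_ext; rewrite !ReIm Re_i Im_i; ring. Qed.

Lemma Im_iM (z : C) : Im (ic * z) = Re z.
Proof. by rewrite ImM Re_i Im_i mul0r add0r mul1r. Qed.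

(** [log |s - p|] is the imaginary part of the multivalued [i * log (s - p)], whose derivative
    [i / (s - p)] is single valued around [p]. *)
Lemma har_log (p : C) : har (fun s => s <> p)
  (fun s => 2^-1 * ln (Re (s - p) ^+ 2 + Im (s - p) ^+ 2)).
Proof.
exists (fun s => ic / (s - p)), (fun s => - ic / (s - p) ^+ 2) => s sp.
have n0 : 0 < Re (s - p) ^+ 2 + Im (s - p) ^+ 2.
  by rewrite -cmod_sqr exprn_gt0 // cmod_gt0 subr_eq0; apply/eqP.
split; last 1 first.
- move=> eps e0.
  have /continuous_ln/cvgrPdist_lt/(_ (2 * eps)) := n0.
  have e2 : 0 < 2 * eps by rewrite mulr_gt0.
  move=> /(_ e2)[/= del d0 Hd].
  pose K := 2 * cmod (s - p) + 1.
  have K0 : 0 < K by rewrite /K ltr_wpDl // mulr_ge0 ?cmod_ge0.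
  exists (Num.min 1 (del / K)); first by rewrite lt_min ltr01 divr_gt0.
  move=> w; rewrite lt_min => /andP[w1 wd].
  have : `|Re (s - p) ^+ 2 + Im (s - p) ^+ 2 - (Re (w - p) ^+ 2 + Im (w - p) ^+ 2)| < del.
    rewrite -!cmod_sqr subr_sqr normrM.
    have a1 : `|cmod (s - p) - cmod (w - p)| <= cmod (w - s).
      apply/ler_normlP; split; rewrite ?opprB.
        by apply: le_trans (cmod_ler_dist _ _) _; rewrite opprB addrA subrK.
      by apply: le_trans (cmod_ler_dist _ _) _; rewrite opprB addrA subrK cmodB.
    have a2 : `|cmod (s - p) + cmod (w - p)| <= K.
      rewrite ger0_norm ?addr_ge0 ?cmod_ge0 // /K.
      have := cmodBD w s p; have := ltW w1; lra.
    apply: le_lt_trans (ler_pM _ _ a1 a2) _ => //.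
    by rewrite -ltr_pdivlMr.
  move=> /Hd /=; rewrite -mulrBr normrM distrC ger0_norm ?invr_ge0 //.
  by move=> h; rewrite mulrC ltr_pdivrMr // mulrC.
- move=> g x e Es [a b].
  have a' := derD a (derC (- Re p) x); have b' := derD b (derC (- Im p) x).
  rewrite -Es in n0.
  have n1 : 0 < (Re (g x) - Re p) ^+ 2 + (Im (g x) - Im p) ^+ 2.
    by move: n0; rewrite !ReIm.
  have := derZ 2^-1 (@derComp R (@ln R) (fun t => (Re (g t) - Re p) ^+ 2 + (Im (g t) - Im p) ^+ 2)
    x _ _ (is_derive1_ln n1) (derD (der_sqr a') (der_sqr b'))).
  under eq_fun do rewrite -!ReN -!ImN -!ReD -!ImD.
  move=> /is_derive_eq; apply; rewrite -Es.
  rewrite [RHS](_ : _ = Re ((g x - p)^-1 * e)); last by rewrite -mulrA Im_iM.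
  rewrite ReM ReV ImV !ReIm; field.
  by rewrite gt_eqF.
- by apply: qd_inv_sub; apply/eqP.
Qed.

Definition mkC (p : R * R) : C := Complex p.1 p.2.

Lemma cmod_mkC (p q : R * R) r : `|p.1 - q.1| < r / 2 -> `|p.2 - q.2| < r / 2 ->
  cmod (mkC q - mkC p) < r.
Proof.
move=> h1 h2; rewrite cmodB; apply: le_lt_trans (cmod_le_RI _) _; rewrite !ReIm /=.
by rewrite (splitr r) ltrD.
Qed.

Lemma mkC_nbhs (p : R * R) (P : C -> Prop) r : 0 < r ->
  (forall w, cmod (w - mkC p) < r -> P w) -> \forall q \near p, P (mkC q).
Proof.
move=> r0 H; apply/nbhs_ballP; exists (r / 2) => /=; first by rewrite divr_gt0.
by move=> q [/= h1 h2]; apply: H; exact: cmod_mkC.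
Qed.

(** If [u s0 > 0], the two limit conditions make the set of points of [O] with [u >= u s0 / 2]
    compact. A small multiple of the squared modulus is added to [u]; at an interior maximum the
    second derivatives in the directions [1] and [i] are both nonpositive, while their sum is
    strictly positive. *)
Lemma maximum_principle O u : copen O -> har O u ->
  (forall s, ~ O s -> forall del : R, 0 < del ->
     exists2 r : R, 0 < r & forall w, O w -> cmod (w - s) < r -> u w < del) ->
  (forall del : R, 0 < del -> exists K : R, forall w, O w -> K < cmod w -> u w < del) ->
  forall s, O s -> u s <= 0.
Proof.
move=> Oo [D [D1 hu]] bnd inf s0 Os0; rewrite leNgt; apply/negP => us0.
pose del := u s0 / 2; have del0 : 0 < del by rewrite divr_gt0.
have uc s eps : O s -> 0 < eps -> exists2 r, 0 < r &
    forall w, cmod (w - s) < r -> `|u w - u s| < eps.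
  by move=> /hu[_ _ h] /h.
pose S : set (R * R) := [set p | O (mkC p) /\ del <= u (mkC p)].
have [K0 HK0] := inf _ del0; pose K := `|K0| + 1.
have K1 : 0 < K by rewrite /K ltr_wpDl.
have HK w : O w -> del <= u w -> cmod w <= K.
  move=> Ow h; rewrite leNgt; apply/negP => kw.
  have k0 : K0 < cmod w.
    by apply: le_lt_trans kw; rewrite (le_trans (ler_norm _)) // lerDl.
  by have := HK0 w Ow k0; rewrite ltNge h.
have Sc : compact S.
  apply: (@subclosed_compact _ S (`[- K, K]%classic `*` `[- K, K]%classic)).
  - rewrite -openC; move=> p Sp; have [Op|nO] := pselect (O (mkC p)).
      have up : u (mkC p) < del.
        by rewrite ltNge; apply/negP => h; apply: Sp.
      have e0 : 0 < del - u (mkC p) by rewrite subr_gt0.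
      have [r r0 Hr] := uc _ _ Op e0.
      apply: (@mkC_nbhs p (fun w => ~ (O w /\ del <= u w)) r r0) => w /Hr h [_ h'].
      have := le_lt_trans (ler_norm _) h; rewrite ltrD2r ltNge h'; exact/negP.
    have [r r0 Hr] := bnd _ nO _ del0.
    apply: (@mkC_nbhs p (fun w => ~ (O w /\ del <= u w)) r r0) => w wr [Ow h'].
    by have := Hr _ Ow wr; rewrite ltNge h'.
  - by apply: compact_setX; exact: segment_compact.
  - move=> p [Op h]; have hp := HK _ Op h.
    split; rewrite /= in_itv /= -ler_norml; apply: le_trans hp.
      exact: (Re_le_cmod (mkC p)).
    exact: (Im_le_cmod (mkC p)).
(* With this constant the added term is at most [del / 2] on [S]. As [u s0 = 2 * del], the maximum
   of [v] still has [u > del], so it is not attained on the level set [u = del] and a whole disc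
   around it lies in [S]. *)
pose kap := del / (2 * K ^+ 2).
have kap0 : 0 < kap by rewrite divr_gt0 // mulr_gt0 // exprn_gt0.
pose v (p : R * R) := u (mkC p) + kap * (p.1 ^+ 2 + p.2 ^+ 2).
have vc : {within S, continuous v}.
  apply: continuous_in_subspaceT => p /set_mem[Op _].
  apply: cvgD.
    apply/cvgrPdist_lt => eps e0; have [r r0 Hr] := uc _ _ Op e0.
    apply: (@mkC_nbhs p (fun w => `|u (mkC p) - u w| < eps) r r0) => w /Hr.
    by rewrite distrC.
  apply: cvgM; first exact: cvg_cst.
  by apply: cvgD; apply: cvgM; (exact: cvg_fst || exact: cvg_snd).
have S0 : S !=set0.
  exists (Re s0, Im s0); rewrite /S /= /mkC /= -complexE_RI; split => //.
  by rewrite ler_pdivrMr // ler_pMr // ler1n.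
have [c /set_mem[Oc uc1] cmax] := compact_EVT_max S0 Sc vc.
have key (p : R * R) : S p -> kap * (p.1 ^+ 2 + p.2 ^+ 2) <= del / 2.
  move=> [Op h]; have hp := HK _ Op h.
  have : p.1 ^+ 2 + p.2 ^+ 2 <= K ^+ 2.
    have <- : cmod (mkC p) ^+ 2 = p.1 ^+ 2 + p.2 ^+ 2 by rewrite cmod_sqr.
    by rewrite lerXn2r // nnegrE ?cmod_ge0 // ltW.
  move=> /(ler_wpM2l (ltW kap0)) /le_trans; apply; rewrite /kap.
  have -> : del / (2 * K ^+ 2) * K ^+ 2 = del / 2; last exact: lexx.
  by field; rewrite gt_eqF.
have uc2 : del < u (mkC c).
  have := cmax (Re s0, Im s0); rewrite mem_set => [/(_ isT)|]; last first.
    rewrite /S /= /mkC /= -complexE_RI; split => //.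
    by rewrite ler_pdivrMr // ler_pMr // ler1n.
  rewrite /v /mkC /= -complexE_RI => h.
  have h1 : kap * (c.1 ^+ 2 + c.2 ^+ 2) <= del / 2 by apply: key.
  have h2 : 0 <= kap * (Re s0 ^+ 2 + Im s0 ^+ 2).
    by rewrite mulr_ge0 ?addr_ge0 ?sqr_ge0 // ltW.
  move: h h1 h2.
  have -> : u s0 = 2 * del by rewrite /del; field.
  move: del0; lra.
have e0 : 0 < u (mkC c) - del by rewrite subr_gt0.
have [r1 r10 Hr1] := uc _ _ Oc e0; have [r2 r20 Hr2] := Oo _ Oc.
pose r := Num.min r1 r2; have r0 : 0 < r by rewrite lt_min r10.
have loc w : cmod (w - mkC c) < r ->
    O w /\ u w + kap * (Re w ^+ 2 + Im w ^+ 2) <= u (mkC c) + kap * (c.1 ^+ 2 + c.2 ^+ 2).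
  rewrite lt_min => /andP[/Hr1 h1 /Hr2 Ow]; split => //.
  have := cmax (Re w, Im w); rewrite /v /mkC /= -complexE_RI; apply.
  rewrite mem_set // /S /= /mkC /= -complexE_RI; split => //.
  by have := ler_ltB (lexx (u (mkC c))) h1; have /ler_normlP[] := ltW h1; move: h1; lra.
(* The harmonic part contributes [Im (D1 * e ^ 2)], which changes sign between [e = 1] and [e = i];
   adding the two inequalities leaves only the positive multiple of [kap]. *)
have main (e : C) : cmod e = 1 ->
    Im (D1 (mkC c) * e * e) + 2 * kap * (Re e ^+ 2 + Im e ^+ 2) <= 0.
  move=> e1.
  pose g (t : R) : C := mkC c + t%:C * e.
  have gr t : `|t| < r -> cmod (g t - mkC c) < r.
    by rewrite /g addrAC subrr add0r cmodM cmod_real e1 mulr1.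
  have g0 : g 0 = mkC c by rewrite /g mul0r addr0.
  pose f t := u (g t) + kap * (Re (g t) ^+ 2 + Im (g t) ^+ 2).
  pose f1 t := Im (D (g t) * e) + kap * (2 * Re (g t) * Re e + 2 * Im (g t) * Im e).
  apply: (@second_derivative_test f f1 _ r r0).
  - move=> t /gr /loc[Og _]; have [a _ _] := hu _ Og.
    have [l1 l2] := cder_line (mkC c) e t.
    apply: derD; first by apply: a => //; exact: cder_line.
    exact: derZ (derD (der_sqr l1) (der_sqr l2)).
  - have [l1 l2] := cder_line (mkC c) e 0.
    have [_ b _] := hu _ Oc; rewrite -g0 in b.
    have b' : qd (fun w => D w * e) (g 0) (D1 (g 0) * e).
      have := qdZ e b; rewrite mulrC.
      by apply: (@qd_ext R _ _ _ _ 1) => // w _; rewrite mulrC.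
    have [_ h] := qd_path b' (cder_line (mkC c) e 0).
    have := derD h (derZ kap (derD (derM (derZ 2 l1) (derC (Re e) 0)) (derM (derZ 2 l2) (derC (Im e) 0)))).
    move=> /is_derive_eq; apply; rewrite g0; ring.
  move=> t /gr /loc[_]; rewrite /f g0; exact.
have h1 := main 1 (cmod1 R).
have i1 : cmod ic = 1 by rewrite /cmod Re_i Im_i expr0n expr1n add0r sqrtr1.
have := main ic i1; move: h1.
have -> : D1 (mkC c) * ic * ic = - D1 (mkC c) by rewrite -mulrA ic2 mulrN1.
rewrite !mulr1 Re_i Im_i !ReIm; move: kap0; lra.
Qed.

End MaximumPrinciple.

(** * Continuation of the logarithm across the real axis *)

Section LogExtension.
Variable R : realType.
Local Notation C := R[i].
Implicit Types (z w s : C) (x y : R).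

(** The logarithm on the right half-plane. It continues [Lg] across the positive half-axis, and
    [LgP (- s) + pi * i] continues it across the negative one. *)
Definition LgP s : C := locked_with expC_key
  (Complex (2^-1 * ln (Re s ^+ 2 + Im s ^+ 2)) (atan (Im s / Re s))).

Lemma Re_LgP s : Re (LgP s) = 2^-1 * ln (Re s ^+ 2 + Im s ^+ 2).
Proof. by rewrite /LgP unlock. Qed.
Lemma Im_LgP s : Im (LgP s) = atan (Im s / Re s).
Proof. by rewrite /LgP unlock. Qed.

Lemma LgP_path (g : R -> C) x (e : C) : 0 < Re (g x) ->
  cder g x e -> cder (fun u => LgP (g u)) x ((g x)^-1 * e).
Proof.
move=> g0 [a b].
have n0 : Re (g x) ^+ 2 + Im (g x) ^+ 2 != 0.
  by rewrite gt_eqF // ltr_wpDr ?sqr_ge0 // exprn_gt0.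
have h0 : 0 < Re (g x) ^+ 2 + Im (g x) ^+ 2 by rewrite lt0r n0 addr_ge0 ?sqr_ge0.
split; under eq_fun do rewrite ?Re_LgP ?Im_LgP.
  have := derZ 2^-1 (@derComp R (@ln R) (fun u => Re (g u) ^+ 2 + Im (g u) ^+ 2) x _ _
    (is_derive1_ln h0) (derD (der_sqr a) (der_sqr b))).
  move=> /is_derive_eq; apply; rewrite !ReIm ReV ImV; field.
  by rewrite n0.
have V := derV (lt0r_neq0 g0) a.
have := @derComp R (@atan R) (fun u => Im (g u) / Re (g u)) x _ _ (is_derive1_atan _) (derM b V).
move=> /is_derive_eq; apply; rewrite !ReIm ReV ImV; field.
by rewrite n0 gt_eqF // addrC.
Qed.

Lemma Re_ball s w : cmod (w - s) < Re s -> 0 < Re w.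
Proof.
move=> h; have := le_lt_trans (Re_le_cmod (w - s)) h.
rewrite !ReIm => /ltr_normlP[h1 h2]; lra.
Qed.

Lemma qd_LgP s : 0 < Re s -> qd LgP s s^-1.
Proof.
move=> s0; have sn : s != 0 by apply: contraTneq s0 => ->; rewrite Re0 ltxx.
have [M [r [M0 r0 _ _ L]]] := qdE (qdV sn).
apply: (@qd_of_path R LgP (fun w => w^-1) s M (Num.min r (Re s))).
- by rewrite lt_min r0.
- move=> w g x e; rewrite lt_min => /andP[_ wr] E h; rewrite -E.
  by apply: LgP_path h; rewrite E (Re_ball wr).
by move=> w; rewrite lt_min => /andP[wr _]; exact: L.
Qed.

Lemma atan_inv x : 0 < x -> atan x^-1 = pi / 2 - atan x.
Proof.
move=> x0; have h : - (pi / 2) < pi / 2 - atan x < pi / 2.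
  have := atan_ltpi2 x; have : 0 < atan x by rewrite -atan0 lt_atan.
  have := @pi_gt0 R; lra.
rewrite -[RHS]tanK ?in_itv //; congr atan.
have c0 : cos (atan x) != 0 by rewrite cos_atan invr_eq0 sqrtr_eq0 -ltNge ltr_pwDl ?sqr_ge0.
have := atanK x; rewrite /tan sinB cosB sin_pihalf cos_pihalf !mul0r !mul1r subr0 add0r => E.
by rewrite -[in LHS]E invf_div.
Qed.

Lemma LgP_Lg s : 0 < Re s -> 0 < Im s -> LgP s = Lg s.
Proof.
move=> h1 h2; apply: complex_ext; rewrite ?Re_LgP ?Re_LgE // Im_LgP Im_Lg /Arg.
by rewrite -atan_inv ?divr_gt0 // invf_div.
Qed.

Lemma LgPN_Lg s : Re s < 0 -> 0 < Im s -> LgP (- s) + pi%:C * ic R = Lg s.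
Proof.
move=> h1 h2; apply: complex_ext; rewrite !(ReIm, Re_LgP, Im_LgP, Re_LgE, Im_Lg, Re_i, Im_i).
  by rewrite !sqrrN mulr0 mul0r subrr addr0.
rewrite mulr1 mul0r addr0 invrN mulrNN /Arg.
have -> : Re s / Im s = - (- Re s / Im s) by rewrite mulNr opprK.
have -> : Im s / Re s = - (- Re s / Im s)^-1 by rewrite invf_div invrN mulrN opprK.
rewrite !atanN atan_inv; last by rewrite divr_gt0 // oppr_gt0.
by field.
Qed.

(* Analytic continuation of the logarithm from the upper half-plane across the
   nonzero real point [x]. *)
Definition LgX x s : C := if 0 < x then LgP s else LgP (- s) + pi%:C * ic R.

Lemma qd_LgX x s : cmod (s - x%:C) < `|x| -> qd (LgX x) s s^-1.
Proof.
move=> h; rewrite /LgX; case: (ltP 0 x) => x0.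
  rewrite ger0_norm ?(ltW x0) // in h; apply: qd_LgP.
  by apply: (@Re_ball x%:C).
rewrite ler0_norm // in h.
have h' : 0 < Re (- s).
  by apply: (@Re_ball (- x)%:C); rewrite rmorphN /= -opprD cmodN.
have sn : s != 0 by apply: contraTneq h' => ->; rewrite oppr0 Re0 ltxx.
have h1 : qd (fun w => - w) s (- 1) by exact: qdN (qd_id s).
have h2 := @qd_comp R LgP (fun w => - w) s _ _ (qd_LgP h') h1.
have := qdD h2 (qd_cst (pi%:C * ic R) s).
by rewrite addr0 invrN mulrNN mulr1.
Qed.

Lemma LgX_Lg x s : cmod (s - x%:C) < `|x| -> 0 < Im s -> LgX x s = Lg s.
Proof.
move=> h s0; rewrite /LgX; case: (ltP 0 x) => x0.
  rewrite ger0_norm ?(ltW x0) // in h; apply: LgP_Lg => //.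
  by apply: (@Re_ball x%:C).
rewrite ler0_norm // in h; apply: LgPN_Lg => //.
rewrite -oppr_gt0 -ReN.
by apply: (@Re_ball (- x)%:C); rewrite rmorphN /= -opprD cmodN.
Qed.

Lemma Re_LgX x : Re (LgX x x%:C) = 2^-1 * ln (x ^+ 2).
Proof.
rewrite /LgX; case: (ltP 0 x) => _; rewrite !(ReIm, Re_LgP, Re_i, Im_i).
  by rewrite expr0n /= addr0.
by rewrite sqrrN oppr0 expr0n /= mulr0 mul0r subrr !addr0.
Qed.

Lemma Im_LgX x : Im (LgX x x%:C) = if 0 < x then 0 else pi.
Proof.
rewrite /LgX; case: (ltP 0 x) => _; rewrite !(ReIm, Im_LgP, Re_i, Im_i).
  by rewrite mul0r atan0.
by rewrite oppr0 !mul0r atan0 mulr1 addr0 add0r.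
Qed.

End LogExtension.

(** * The logarithm of the map on the upper half-plane *)

Section Ell.
Variable R : realType.
Local Notation C := R[i].
Variables theta c1 d : R.
Hypothesis theta_gt1 : 1 < theta.
Hypothesis c1_gt0 : 0 < c1.
Hypothesis d_gt1 : 1 < d.
Implicit Types (z w s : C) (x y : R).

Let kap := theta^-1.

Lemma kap_gt0 : 0 < kap.
Proof. by rewrite invr_gt0 (lt_trans _ theta_gt1). Qed.
Lemma kap_lt1 : kap < 1.
Proof. by rewrite invf_lt1 // (lt_trans _ theta_gt1). Qed.

(** The parameter is [d = c0 / c1], so that [c1 * s + c0 = c1 * (s + d)]; [kap] is the exponent
    [1 / theta]. *)
Definition ell s : C := (ln c1)%:C + Lg (s + d%:C) + kap%:C * (Lg (s + 1) - Lg s).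
Definition ell1 s : C := (s + d%:C)^-1 + kap%:C * ((s + 1)^-1 - s^-1).
Definition ell2 s : C :=
  - (s + d%:C) ^- 2 + kap%:C * (- (s + 1) ^- 2 + s ^- 2).

Lemma qd_shift (f : C -> C) (c s e : C) : qd f (s + c) e -> qd (fun w => f (w + c)) s e.
Proof.
move=> h; have := @qd_comp R f (fun w => w + c) s e 1 h.
rewrite mulr1; apply.
by have := qdD (qd_id s) (qd_cst c s); rewrite addr0.
Qed.

Lemma Im_shift s x : Im (s + x%:C) = Im s. Proof. by rewrite !ReIm addr0. Qed.
Lemma Im_shift1 s : Im (s + 1) = Im s. Proof. exact: (Im_shift s 1). Qed.

Lemma H_neq0 s : 0 < Im s -> s != 0.
Proof. by move=> h; rewrite Im_neq0 // gt_eqF. Qed.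

Lemma qd_ell s : 0 < Im s -> qd ell s (ell1 s).
Proof.
move=> s0.
have h1 : qd (fun w => Lg (w + d%:C)) s (s + d%:C)^-1.
  by apply: qd_shift; apply: qd_Lg; rewrite Im_shift.
have h2 : qd (fun w => Lg (w + 1)) s (s + 1)^-1.
  by apply: qd_shift; apply: qd_Lg; rewrite Im_shift1.
have := qdD (qdD (qd_cst (ln c1)%:C s) h1) (qdZ kap%:C (qdD h2 (qdN (qd_Lg s0)))).
by rewrite add0r.
Qed.

Lemma qd_ell1 s : s != 0 -> s + 1 != 0 -> s + d%:C != 0 -> qd ell1 s (ell2 s).
Proof.
move=> s0 s1 sd.
have h1 : qd (fun w => (w + d%:C)^-1) s (- (s + d%:C) ^- 2).
  by apply: (@qd_shift (fun w => w^-1)); exact: qdV.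
have h2 : qd (fun w => (w + 1)^-1) s (- (s + 1) ^- 2).
  by apply: (@qd_shift (fun w => w^-1)); exact: qdV.
have := qdD h1 (qdZ kap%:C (qdD h2 (qdN (qdV s0)))).
by rewrite opprK.
Qed.

Lemma qd_ell1H s : 0 < Im s -> qd ell1 s (ell2 s).
Proof. by move=> h; apply: qd_ell1; rewrite H_neq0 // ?Im_shift ?Im_shift1. Qed.

Lemma Im_ell s : Im (ell s) = Arg (s + d%:C) + kap * (Arg (s + 1) - Arg s).
Proof. by rewrite /ell !(ReIm, Im_Lg) mul0r addr0 add0r. Qed.

Lemma Arg_shift s x : 0 < Im s -> 0 < x -> Arg (s + x%:C) < Arg s.
Proof.
move=> s0 x0; rewrite /Arg ltrD2l ltrN2 lt_atan // !ReIm addr0.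
by rewrite ltr_pM2r ?invr_gt0 // ltrDl.
Qed.

(** These bounds decide the powers: [Im (ell s)] lies in [(0, pi)] outside the curve, and
    [theta * Im (ell s)] lies in [(- pi, 0)] inside, so [J] outside and [J ^ theta] inside each stay
    in one open half-plane. *)
Lemma Im_ell_itv s : 0 < Im s -> - (kap * pi) < Im (ell s) < pi.
Proof.
move=> s0; rewrite Im_ell.
have /andP[a1 a2] := Arg_itv (s + d%:C); have /andP[b1 b2] := Arg_itv (s + 1).
have /andP[e1 e2] := Arg_itv s; have h : Arg (s + 1) < Arg s := Arg_shift s0 (@ltr01 R).
have k0 := kap_gt0; apply/andP; split; nra.
Qed.

Lemma Im_ell_pi s : 0 < Im s -> - pi < Im (ell s) < pi.
Proof.
move=> /Im_ell_itv/andP[h1 h2]; rewrite h2 andbT (le_lt_trans _ h1) // lerN2.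
by rewrite ler_piMl ?pi_ge0 // ltW // kap_lt1.
Qed.

(** [s * ell1 s] is the derivative of [ell] in the coordinate [log s]. Up to a real constant it is a
    positive combination of functions [s / (s + x)] with [x > 0], which preserve the upper
    half-plane. Injectivity of [ell], transversality of the rays and nonvanishing of [ell1] all rest
    on this sign. *)
Lemma ImQ_gt0 s : 0 < Im s -> 0 < Im (s * ell1 s).
Proof.
move=> s0.
have key x : 0 < x -> 0 < Im (s / (s + x%:C)).
  move=> x0; rewrite !(ReIm, ReV, ImV) addr0.
  have n0 : 0 < (Re s + x) ^+ 2 + Im s ^+ 2 by rewrite ltr_wpDl ?sqr_ge0 // exprn_gt0.
  have -> : Re s * (- Im s / ((Re s + x) ^+ 2 + Im s ^+ 2)) +
    Im s * ((Re s + x) / ((Re s + x) ^+ 2 + Im s ^+ 2)) =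
    Im s * x / ((Re s + x) ^+ 2 + Im s ^+ 2) by field; rewrite gt_eqF.
  by rewrite divr_gt0 // mulr_gt0.
have sn := H_neq0 s0.
have -> : s * ell1 s = s / (s + d%:C) + kap%:C * (s / (s + 1%:C)) - kap%:C.
  rewrite /ell1; field; rewrite sn !H_neq0 ?Im_shift ?Im_shift1 //.
have k1 := key _ (@ltr01 R); have kd := key _ (lt_trans ltr01 d_gt1).
have -> : Im (s / (s + d%:C) + kap%:C * (s / (s + 1%:C)) - kap%:C) =
    Im (s / (s + d%:C)) + kap * Im (s / (s + 1%:C)).
  by rewrite ImD ImN ImC subr0 ImD [in LHS](ImM kap%:C) ReC ImC mul0r addr0.
by rewrite addr_gt0 // mulr_gt0 // kap_gt0.
Qed.

Lemma ell1_neq0 s : 0 < Im s -> ell1 s != 0.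
Proof.
by move=> /ImQ_gt0; apply: contraTneq => ->; rewrite mulr0 Im0 ltxx.
Qed.

Lemma expC_H z : 0 < Im z < pi -> 0 < Im (expC z).
Proof. by move=> h; rewrite Im_expC mulr_gt0 ?expR_gt0 // sin_gt0_pi. Qed.

(* In the coordinate log s the half-plane is a convex strip on which the
   derivative of [ell] has positive imaginary part. *)
Lemma ell_inj s w : 0 < Im s -> 0 < Im w -> ell s = ell w -> s = w.
Proof.
move=> s0 w0 E.
pose D := Lg w - Lg s.
have [D0|D0] := eqVneq D 0.
  by rewrite -(LgK s0) -(LgK w0); congr expC; apply/esym/eqP; rewrite -subr_eq0 -/D D0.
pose g u : C := Lg s + u%:C * D.
have gI (u : R) : 0 <= u <= 1 -> 0 < Im (expC (g u)).
  move=> /andP[u0 u1]; apply: expC_H; rewrite /g /D !(ReIm, Im_Lg) mul0r addr0.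
  have /andP[a1 a2] := Arg_itv s; have /andP[b1 b2] := Arg_itv w.
  have -> : Arg s + u * (Arg w - Arg s) = (1 - u) * Arg s + u * Arg w by ring.
  have [->|un] := eqVneq u 0; first by rewrite subr0 mul1r mul0r addr0 a1.
  have up : 0 < u by rewrite lt0r un.
  have := mulr_gt0 up b1; have : 0 <= (1 - u) * Arg s by apply: mulr_ge0; [rewrite subr_ge0|exact: ltW].
  have : u * Arg w < u * pi by rewrite ltr_pM2l.
  have : (1 - u) * Arg s <= (1 - u) * pi by rewrite ler_wpM2l ?subr_ge0 // ltW.
  lra.
pose f u := D^-1 * ell (expC (g u)).
have fd (u : R) : 0 <= u <= 1 -> cder f u (expC (g u) * ell1 (expC (g u))).
  move=> hu; have h := expC_path (cder_line (Lg s) D u).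
  have := qd_path (qdZ D^-1 (qd_ell (gI _ hu))) h.
  by congr cder; field.
have fI (u : R) : 0 <= u <= 1 -> is_derive u 1 (fun t => Im (f t)) (Im (expC (g u) * ell1 (expC (g u)))).
  by move=> /fd[].
have [c hc] := MVT_cc (@ler01 R) fI.
have -> : f 1 = f 0.
  rewrite /f; congr (_ * _).
  have -> : expC (g 1) = w by rewrite /g mul1r addrC subrK LgK.
  by have -> : expC (g 0) = s by rewrite /g mul0r addr0 LgK.
rewrite subrr subr0 mulr1 => E0.
by have := ImQ_gt0 (gI _ hc); rewrite -E0 ltxx.
Qed.

Lemma Im_ell_ray s x y : 0 < Im s -> 0 < x -> x < y ->
  Im (ell (x%:C * s)) < Im (ell (y%:C * s)).
Proof.
move=> s0 x0 xy.
have I (u : R) : 0 < u -> 0 < Im (u%:C * s) by move=> u0; rewrite !ReIm mul0r addr0 mulr_gt0.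
have fd (u : R) : x <= u <= y ->
    is_derive u 1 (fun t => Im (ell (t%:C * s))) (Im (u%:C * s * ell1 (u%:C * s)) / u).
  move=> /andP[xu _]; have u0 : 0 < u by exact: lt_le_trans xu.
  have l : cder (fun t => t%:C * s) u s.
    by apply: (@cder_ext R (fun t => 0 + t%:C * s) _ _ _ 1) (cder_line 0 s u) => // t _; rewrite add0r.
  have [_] := qd_path (qd_ell (I _ u0)) l.
  congr is_derive.
  have -> : u%:C * s * ell1 (u%:C * s) = u%:C * (ell1 (u%:C * s) * s) by ring.
  by rewrite [Im (u%:C * _)]ImM ReC ImC mul0r addr0 mulrAC divff ?mul1r // gt_eqF.
have [c /andP[c1' c2] E] := MVT_cc (ltW xy) fd.
have c0 : 0 < c by exact: lt_le_trans c1'.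
by rewrite -subr_gt0 E mulr_gt0 ?subr_gt0 // divr_gt0 // ImQ_gt0 // I.
Qed.

Lemma Jt_ell s : 0 < Im s -> Jt theta (c1 * d) c1 s = expC (ell s).
Proof.
move=> s0; have sd0 : 0 < Im (s + d%:C) by rewrite Im_shift.
have s10 : 0 < Im (s + 1) by rewrite Im_shift1.
have E : (s + 1) / s = expC (Lg (s + 1) - Lg s) by rewrite expCD expCN !LgK.
have h : - pi < Im (Lg (s + 1) - Lg s) < pi.
  rewrite !(ReIm, Im_Lg); have /andP[b1 b2] := Arg_itv (s + 1).
  have /andP[e1 e2] := Arg_itv s; lra.
rewrite /Jt E cpow_expC // /ell !expCD LgK // expC_real lnK ?posrE //.
by rewrite rmorphM /=; ring.
Qed.

Lemma Jt_conj s : 0 < Im s -> Jt theta (c1 * d) c1 (cconj s) = cconj (Jt theta (c1 * d) c1 s).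
Proof.
move=> s0; have sd0 : 0 < Im (s + d%:C) by rewrite Im_shift.
have s10 : 0 < Im (s + 1) by rewrite Im_shift1.
have E : (s + 1) / s = expC (Lg (s + 1) - Lg s) by rewrite expCD expCN !LgK.
have h : - pi < Im (Lg (s + 1) - Lg s) < pi.
  rewrite !(ReIm, Im_Lg); have /andP[b1 b2] := Arg_itv (s + 1).
  have /andP[e1 e2] := Arg_itv s; lra.
have E1 : cconj s + 1 = cconj (s + 1) by rewrite cconjD cconj1.
rewrite /Jt E1 -cconjV -cconjM E -expC_conj !cpow_expC //; last first.
  by rewrite Im_conj; move: h; lra.
transitivity (cconj (c1%:C * s + (c1 * d)%:C) * cconj (expC ((theta^-1)%:C * (Lg (s + 1) - Lg s)))).
  by rewrite -expC_conj !cconjD !cconjM !cconjC !cconjD.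
by rewrite -cconjM.
Qed.

(** The continuation of [ell] to a disc about a real point [x] other than [0], [-1], [- d]; [radX x]
    is the distance from [x] to these singularities. *)
Definition ellX x s : C :=
  (ln c1)%:C + LgX (x + d) (s + d%:C) + kap%:C * (LgX (x + 1) (s + 1) - LgX x s).

Definition radX x : R := Num.min `|x| (Num.min `|x + 1| `|x + d|).

Lemma radX_gt0 x : x != 0 -> x + 1 != 0 -> x + d != 0 -> 0 < radX x.
Proof. by move=> h1 h2 h3; rewrite !lt_min !normr_gt0 h1 h2. Qed.

Lemma radXE x s : cmod (s - x%:C) < radX x ->
  [/\ cmod (s - x%:C) < `|x|, cmod (s + 1 - (x + 1)%:C) < `|x + 1| &
      cmod (s + d%:C - (x + d)%:C) < `|x + d|].
Proof.
rewrite !lt_min => /and3P[h1 h2 h3]; split => //.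
  by rewrite rmorphD /= opprD addrACA subrr addr0.
by rewrite rmorphD /= opprD addrACA subrr addr0.
Qed.

Lemma radX_neq0 x s : cmod (s - x%:C) < radX x -> [/\ s != 0, s + 1 != 0 & s + d%:C != 0].
Proof.
move=> /radXE[h1 h2 h3]; split.
- by apply: contraTneq h1 => ->; rewrite sub0r cmodN cmod_real ltxx.
- by apply: contraTneq h2 => ->; rewrite sub0r cmodN cmod_real ltxx.
- by apply: contraTneq h3 => ->; rewrite sub0r cmodN cmod_real ltxx.
Qed.

Lemma qd_ellX x s : cmod (s - x%:C) < radX x -> qd (ellX x) s (ell1 s).
Proof.
move=> /radXE[r1 r2 r3].
have h1 : qd (fun w => LgX (x + d) (w + d%:C)) s (s + d%:C)^-1.
  by apply: qd_shift; exact: qd_LgX.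
have h2 : qd (fun w => LgX (x + 1) (w + 1)) s (s + 1)^-1.
  by apply: qd_shift; exact: qd_LgX.
have := qdD (qdD (qd_cst (ln c1)%:C s) h1) (qdZ kap%:C (qdD h2 (qdN (qd_LgX r1)))).
by rewrite add0r.
Qed.

Lemma ellX_ell x s : cmod (s - x%:C) < radX x -> 0 < Im s -> ellX x s = ell s.
Proof.
move=> /radXE[r1 r2 r3] s0; rewrite /ellX /ell !LgX_Lg ?Im_shift ?Im_shift1 //.
Qed.

Definition lr x : R := ln c1 + 2^-1 * ln ((x + d) ^+ 2) +
  kap * (2^-1 * ln ((x + 1) ^+ 2) - 2^-1 * ln (x ^+ 2)).

Lemma Re_ellX x : Re (ellX x x%:C) = lr x.
Proof.
rewrite /ellX /lr !ReIm mul0r subr0.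
have -> : x%:C + d%:C = (x + d)%:C by rewrite rmorphD.
have -> : x%:C + 1 = (x + 1)%:C by rewrite rmorphD.
by rewrite !Re_LgX.
Qed.

Lemma Im_ellX x : Im (ellX x x%:C) = (if 0 < x + d then 0 else pi) +
  kap * ((if 0 < x + 1 then 0 else pi) - (if 0 < x then 0 else pi)).
Proof.
rewrite /ellX !ReIm mul0r addr0 add0r.
have -> : x%:C + d%:C = (x + d)%:C by rewrite rmorphD.
have -> : x%:C + 1 = (x + 1)%:C by rewrite rmorphD.
by rewrite !Im_LgX.
Qed.

Lemma Jt_real x : 0 < (x + 1) / x -> 0 < x + d ->
  Jt theta (c1 * d) c1 x%:C = (expR (lr x))%:C.
Proof.
move=> h hd; have x0 : x != 0 by apply: contraTneq h => ->; rewrite invr0 mulr0 ltxx.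
have x1 : x + 1 != 0 by apply: contraTneq h => ->; rewrite mul0r ltxx.
rewrite /Jt; have -> : (x%:C + 1) / x%:C = ((x + 1) / x)%:C.
  by rewrite rmorphM fmorphV /= rmorphD.
rewrite cpow_pos // -!rmorphM /= -rmorphD -rmorphM /=; congr (_%:C).
have -> : lr x = ln c1 + ln (x + d) + kap * ln ((x + 1) / x).
  have half y : y != 0 -> 2^-1 * ln (y ^+ 2) = ln `|y|.
    by move=> y0; rewrite -real_normK ?num_real // lnXn ?normr_gt0 // mulr2n; field.
  have xd : x + d != 0 by rewrite gt_eqF.
  rewrite /lr !half // (gtr0_norm hd); congr (_ + _ * _).
  by rewrite -ln_div ?posrE ?normr_gt0 // -normf_div gtr0_norm.
rewrite !expRD !lnK ?posrE // /powR gt_eqF //.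
by ring.
Qed.

(** The hypotheses are the relations between roots and coefficients for
    [s * (s + 1) - kap * (s + d)], the numerator of [ell1]: its zeros are the critical points. *)
Variables ea eb : R.
Hypothesis e_sum : ea + eb = - (1 - kap).
Hypothesis e_prod : ea * eb = - (kap * d).
Hypothesis ea_ltN1 : ea < -1.
Hypothesis eb_gt0 : 0 < eb.

(** At [- d] the quadratic with roots [ea], [eb] takes the value [d * (d - 1) > 0], so [- d] is not
    between the roots, and it is below [eb]. *)
Lemma ea_gtNd : - d < ea.
Proof.
have : 0 < (- d - ea) * (- d - eb).
  have -> : (- d - ea) * (- d - eb) = d ^+ 2 + d * (ea + eb) + ea * eb by ring.
  rewrite e_sum e_prod; have -> : d ^+ 2 + d * - (1 - kap) + - (kap * d) = d * (d - 1) by ring.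
  by rewrite mulr_gt0 ?subr_gt0 // (lt_trans _ d_gt1).
have : - d - eb < 0 by move: d_gt1 eb_gt0; lra.
move=> h; rewrite nmulr_lgt0 // subr_lt0; exact.
Qed.

Lemma ell1_factor s : s != 0 -> s + 1 != 0 -> s + d%:C != 0 ->
  ell1 s = (s - ea%:C) * (s - eb%:C) / (s * (s + 1) * (s + d%:C)).
Proof.
move=> s0 s1 sd; rewrite /ell1.
have -> : (s - ea%:C) * (s - eb%:C) = s * (s + 1) - kap%:C * (s + d%:C).
  have -> : (s - ea%:C) * (s - eb%:C) = s ^+ 2 - s * (ea + eb)%:C + (ea * eb)%:C.
    by rewrite rmorphD rmorphM /=; ring.
  by rewrite e_sum e_prod !(rmorphN, rmorphB, rmorphM, rmorph1) /=; ring.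
by field; rewrite s0 s1 sd.
Qed.

Lemma lr_derive x : x != 0 -> x + 1 != 0 -> x + d != 0 ->
  is_derive x 1 lr ((x - ea) * (x - eb) / (x * (x + 1) * (x + d))).
Proof.
move=> x0 x1 xd.
have h (c : R) : x + c != 0 -> is_derive x 1 (fun t => 2^-1 * ln ((t + c) ^+ 2)) (x + c)^-1.
  move=> xc; have n0 : 0 < (x + c) ^+ 2 by rewrite exprn_even_gt0.
  have := derZ 2^-1 (@derComp R (@ln R) (fun t => (t + c) ^+ 2) x _ _ (is_derive1_ln n0)
    (der_sqr (derD (derI x) (derC c x)))).
  by move=> /is_derive_eq; apply; field.
have h0 : is_derive x 1 (fun t => 2^-1 * ln (t ^+ 2)) x^-1.
  have := h 0; rewrite addr0 => /(_ x0).
  by under eq_fun do rewrite addr0.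
have := derD (derD (derC (ln c1) x) (h _ xd)) (derZ kap (derD (h _ x1) (derN h0))).
move=> /is_derive_eq; apply.
have -> : (x - ea) * (x - eb) = x * (x + 1) - kap * (x + d).
  have -> : (x - ea) * (x - eb) = x ^+ 2 - x * (ea + eb) + ea * eb by ring.
  by rewrite e_sum e_prod; ring.
by field; rewrite x0 x1 xd.
Qed.

(** The derivative of [lr] is [ell1] at real points, whose only positive zero is [eb]. Together with
    [lr_max] this keeps the positive boundary values of the map on the real axis off the open
    interval between the critical values. *)
Lemma lr_min x : 0 < x -> lr eb <= lr x.
Proof.
move=> x0.
have key (u v : R) : 0 < u -> u <= v -> exists2 c, u <= c <= v &
    lr v - lr u = (c - ea) * (c - eb) / (c * (c + 1) * (c + d)) * (v - u).
  move=> u0 uv; apply: MVT_cc uv _ => c /andP[uc _].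
  have c0 : 0 < c by exact: lt_le_trans uc.
  by apply: lr_derive; rewrite gt_eqF // ?addr_gt0 // (lt_trans _ d_gt1).
have pos (c : R) : 0 < c -> 0 < (c - ea) / (c * (c + 1) * (c + d)).
  move=> c0; rewrite divr_gt0 ?mulr_gt0 ?addr_gt0 // ?(lt_trans _ d_gt1) //.
  by move: ea_ltN1; lra.
have [h|h] := leP x eb.
  have [c /andP[h1 h2] E] := key _ _ x0 h.
  have := pos c (lt_le_trans x0 h1); move: E.
  rewrite (mulrAC (c - ea)); set X := (c - ea) / _; clearbody X => E X0.
  rewrite -subr_le0 E -mulrA pmulr_rle0 // mulr_le0_ge0 // ?subr_le0 ?subr_ge0 //.
have [c /andP[h1 h2] E] := key _ _ eb_gt0 (ltW h).
have := pos c (lt_le_trans eb_gt0 h1); move: E.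
rewrite (mulrAC (c - ea)); set X := (c - ea) / _; clearbody X => E X0.
by rewrite -subr_ge0 E !mulr_ge0 ?subr_ge0 ?(ltW X0) ?(ltW h).
Qed.

Lemma lr_max x : - d < x -> x < -1 -> lr x <= lr ea.
Proof.
move=> xd x1.
have key (u v : R) : - d < u -> v < -1 -> u <= v -> exists2 c, u <= c <= v &
    lr v - lr u = (c - ea) * (c - eb) / (c * (c + 1) * (c + d)) * (v - u).
  move=> u0 v0 uv; apply: MVT_cc uv _ => c /andP[uc cv].
  have h1 : - d < c by exact: lt_le_trans uc.
  have h2 : c < -1 by exact: le_lt_trans v0.
  apply: lr_derive; [rewrite lt_eqF // (lt_trans h2) // ltrN10|rewrite lt_eqF //|rewrite gt_eqF //]; lra.
have pos (c : R) : - d < c -> c < -1 -> (c - eb) / (c * (c + 1) * (c + d)) < 0.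
  move=> h1 h2; rewrite pmulr_llt0.
    by move: eb_gt0; lra.
  rewrite invr_gt0 mulr_gt0 //; last by move: h1; lra.
  by rewrite nmulr_rgt0; move: h2; lra.
have [h|h] := leP x ea.
  have [c /andP[h1 h2] E] := key _ _ xd ea_ltN1 h.
  have := pos c (lt_le_trans xd h1) (le_lt_trans h2 ea_ltN1); move: E.
  rewrite -(mulrA (c - ea)); set X := (c - eb) / _; clearbody X => E X0.
  rewrite -subr_ge0 E mulr_ge0 ?subr_ge0 // mulr_le0 ?subr_le0 // ltW //.
have [c /andP[h1 h2] E] := key _ _ ea_gtNd x1 (ltW h).
have := pos c (lt_le_trans ea_gtNd h1) (le_lt_trans h2 x1); move: E.
rewrite -(mulrA (c - ea)); set X := (c - eb) / _; clearbody X => E X0.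
rewrite -subr_le0 E mulr_le0_ge0 ?subr_ge0 ?(ltW h) // mulr_ge0_le0 ?subr_ge0 // ltW //.
Qed.

End Ell.

(** * The upper curve as a polar graph *)

Section Within.
Variable R : realType.
Implicit Types (A : set R) (f : R -> R).

Lemma within_eps A f :
  (forall x : R, A x -> forall eps : R, 0 < eps -> exists2 del : R, 0 < del &
     forall y : R, A y -> `|y - x| < del -> `|f y - f x| < eps) ->
  {within A, continuous f}.
Proof.
move=> H; apply/subspace_continuousP => x Ax; apply/cvgrPdist_lt => eps e0.
have [del d0 Hd] := H _ Ax _ e0.
apply/nbhs_ballP; exists del => //= y yx Ay /=.
by rewrite distrC; apply: Hd => //; rewrite distrC.
Qed.

Lemma within_epsE A f : {within A, continuous f} ->
  forall x : R, A x -> forall eps : R, 0 < eps -> exists2 del : R, 0 < del &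
     forall y : R, A y -> `|y - x| < del -> `|f y - f x| < eps.
Proof.
move=> /subspace_continuousP H x Ax eps e0.
have /cvgrPdist_lt/(_ _ e0)/nbhs_ballP[del d0 Hd] := H _ Ax.
exists del => // y Ay yx; rewrite distrC; apply: Hd => //=.
by rewrite /ball /= distrC.
Qed.

Lemma for_epsE f (x : R) : {for x, continuous f} ->
  forall eps : R, 0 < eps -> exists2 del : R, 0 < del &
     forall y : R, `|y - x| < del -> `|f y - f x| < eps.
Proof.
move=> /cvgrPdist_lt H eps e0; have /nbhs_ballP[del d0 Hd] := H _ e0.
exists del => // y yx; rewrite distrC; apply: Hd => //=.
by rewrite /ball /= distrC.
Qed.

End Within.

Section Curve.
Variable R : realType.
Local Notation C := R[i].
Variables theta c1 d : R.
Hypothesis theta_gt1 : 1 < theta.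
Hypothesis c1_gt0 : 0 < c1.
Hypothesis d_gt1 : 1 < d.
Let kap := theta^-1.
Variables ea eb : R.
Hypothesis e_sum : ea + eb = - (1 - kap).
Hypothesis e_prod : ea * eb = - (kap * d).
Hypothesis ea_ltN1 : ea < -1.
Hypothesis eb_gt0 : 0 < eb.
Hypothesis lr_ab : lr theta c1 d ea < lr theta c1 d eb.
Implicit Types (z w s : C) (x y : R).

Local Notation ell := (ell theta c1 d).
Local Notation ell1 := (ell1 theta d).
Local Notation ellX := (ellX theta c1 d).
Local Notation lr := (lr theta c1 d).
Local Notation radX := (radX d).

Let kap0 : 0 < kap. Proof. exact: kap_gt0. Qed.
Let d_gt0 : 0 < d. Proof. exact: lt_trans d_gt1. Qed.
Let ead : - d < ea. Proof. exact: (ea_gtNd d_gt1 e_sum e_prod). Qed.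

Lemma Arg_scale s x y : 0 < x -> Arg (x%:C * s + y%:C) = Arg (s + (y / x)%:C).
Proof.
move=> x0; rewrite /Arg; congr (_ - atan _); rewrite !ReIm !mul0r subr0 !addr0.
have [->|h] := eqVneq (Im s) 0; first by rewrite mulr0 invr0 !mulr0.
by field; rewrite h gt_eqF.
Qed.

Lemma Im_ell_scale s x : 0 < x ->
  Im (ell (x%:C * s)) = Arg (s + (d / x)%:C) + kap * (Arg (s + (x^-1)%:C) - Arg s).
Proof.
move=> x0; rewrite Im_ell Arg_scale // (Arg_scale s 1 x0) div1r.
have := Arg_scale s 0 x0; rewrite mul0r !addr0 => ->.
by [].
Qed.

(** In the inverse scale [t = 1 / x] the value of [Im ell] on the ray is [Arg (s + d t) + kap * (Arg
    (s + t) - Arg s)]. It equals [Arg s > 0] at [t = 0] and is negative for large [t], where the two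
    moving arguments tend to zero. *)
Lemma ray_zero s : 0 < Im s -> exists2 x, 0 < x & Im (ell (x%:C * s)) = 0.
Proof.
move=> s0.
pose A x := Arg (s + x%:C).
have Ac (k : R) : continuous (fun t : R => A (k * t)).
  move=> t; apply: (@is_derive1_cont R _ t (- ((1 + ((Re s + k * t) / Im s) ^+ 2)^-1 * (k / Im s)))).
  have h : is_derive t 1 (fun t => (Re s + k * t) / Im s) (k / Im s).
    have := derM (derD (derC (Re s) t) (derZ k (derI t))) (derC (Im s)^-1 t).
    by move=> /is_derive_eq; apply; rewrite mulr0 addr0 add0r mulr1.
  have := derD (derC (pi / 2) t) (derN (@derComp R (@atan R) _ t _ _ (is_derive1_atan _) h)).
  rewrite add0r.
  suff -> : (fun t0 : R => A (k * t0)) = (fun u : R => pi / 2 - atan ((Re s + k * u) / Im s)) by [].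
  by apply/funext => u; rewrite /A /Arg !ReIm addr0.
pose M t := A (d * t) + kap * (A (1 * t) - Arg s).
have Mc : continuous M.
  move=> t; apply: cvgD; first exact: Ac.
  by apply: cvgM; [exact: cvg_cst|apply: cvgB; [exact: Ac|exact: cvg_cst]].
have /andP[s1 s2] := Arg_itv s.
(* The threshold for negativity: [A (d * T) < A T < e] gives
   [M T < (1 + kap) * e - kap * Arg s = 0]. It lies below [pi / 2], so the tangent can be inverted
   to find [T]. *)
pose e := kap * Arg s / (1 + kap).
have k1 : 0 < 1 + kap by rewrite addr_gt0.
have e0 : 0 < e by rewrite divr_gt0 ?mulr_gt0.
have e1 : e < pi / 2.
  rewrite /e ltr_pdivrMr //; have := kap_lt1 theta_gt1; rewrite -/kap => kl.
  have : kap * Arg s < kap * pi by rewrite ltr_pM2l.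
  have : 0 < (1 - kap) * pi by rewrite mulr_gt0 ?subr_gt0 ?pi_gt0.
  lra.
pose T := Im s * (`|tan (pi / 2 - e)| + 1) + `|Re s|.
have T0 : 0 < T by rewrite /T ltr_wpDr // mulr_gt0 // ltr_wpDl.
have AT : A T < e.
  rewrite /A /Arg ltrBlDl -ltrBlDr.
  have hI : pi / 2 - e \in `](- (pi / 2)), (pi / 2)[.
    rewrite in_itv /=; have := @pi_gt0 R; move: e0 e1; lra.
  rewrite -[ltLHS](tanK hI); apply: lt_atan.
  rewrite !ReIm addr0 ltr_pdivlMr // /T.
  have h1 := ler_norm (tan (pi / 2 - e)); have h2 := ler_norm (- Re s).
  rewrite normrN in h2.
  have : tan (pi / 2 - e) * Im s <= `|tan (pi / 2 - e)| * Im s by rewrite ler_wpM2r // ltW.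
  move: s0; lra.
have MT : M T < 0.
  rewrite /M mul1r.
  have : A (d * T) < A T.
    have -> : A (d * T) = Arg (s + T%:C + ((d - 1) * T)%:C).
      by rewrite /A -addrA -rmorphD /=; congr (Arg (_ + _%:C)); ring.
    by apply: Arg_shift; rewrite ?Im_shift // mulr_gt0 ?subr_gt0.
  have : (1 + kap) * A T < kap * Arg s.
    by move: AT; rewrite /e ltr_pdivlMr // mulrC.
  lra.
have M0 : 0 < M 0 by rewrite /M !mulr0 /A addr0 subrr mulr0 addr0.
have [||t] := @IVT R M 0 T 0 (ltW T0).
- exact: continuous_subspaceT.
- by rewrite ge_min (ltW MT) orbT /= le_max (ltW M0).
rewrite in_itv /= => /andP[t0 tT] Mt.
have tn : 0 < t.
  by rewrite lt_neqAle t0 andbT; apply: contraTneq M0 => {2}->; rewrite Mt ltxx.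
exists t^-1; first by rewrite invr_gt0.
by rewrite Im_ell_scale ?invr_gt0 // invrK -Mt /M /A mul1r.
Qed.

Definition ep x : C := locked_with expC_key (expC (x%:C * ic R)).
Lemma epE x : ep x = expC (x%:C * ic R). Proof. by rewrite /ep unlock. Qed.

Lemma Re_ep x : Re (ep x) = cos x.
Proof. by rewrite epE Re_expC !ReIm Re_i Im_i !(mulr0, mul0r, subr0, expR0, mul1r, addr0, mulr1). Qed.
Lemma Im_ep x : Im (ep x) = sin x.
Proof. by rewrite epE Im_expC !ReIm Re_i Im_i !(mulr0, mul0r, subr0, expR0, mul1r, addr0, mulr1). Qed.

Lemma ep0 : ep 0 = 1.
Proof. by apply: complex_ext; rewrite ?Re_ep ?Im_ep ?cos0 ?sin0. Qed.

Lemma eppi : ep pi = - 1.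
Proof. by apply: complex_ext; rewrite ?Re_ep ?Im_ep ?cospi ?sinpi !ReIm ?oppr0. Qed.

Lemma ep_H x : 0 < x < pi -> 0 < Im (ep x).
Proof. by rewrite Im_ep => /sin_gt0_pi. Qed.

Lemma ep_der x : cder ep x (ic R * ep x).
Proof.
have h : cder (fun t => t%:C * ic R) x (ic R).
  by apply: (@cder_ext R (fun t => 0 + t%:C * ic R) _ _ _ 1) (cder_line 0 (ic R) x) => // t _; rewrite add0r.
by have := expC_path h; rewrite mulrC -epE; under eq_fun do rewrite -epE.
Qed.

Lemma cmod_ep x : cmod (ep x) = 1.
Proof. by rewrite epE cmod_expC !ReIm Re_i Im_i mulr0 mul0r subr0 expR0. Qed.

Lemma ep_cvg x (eps : R) : 0 < eps -> exists2 del : R, 0 < del &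
  forall y, `|y - x| < del -> cmod (ep y - ep x) < eps.
Proof.
move=> e0; have [del d0 H] := cder_bound (ep_der x).
pose K := cmod (ic R * ep x) + 1; have K0 : 0 < K by rewrite /K ltr_wpDl ?cmod_ge0.
exists (Num.min del (eps / K)); first by rewrite lt_min d0 divr_gt0.
move=> y; rewrite lt_min => /andP[h1 h2]; have := H _ h1; rewrite (addrC x) subrK.
by move=> /le_lt_trans; apply; rewrite -/K mulrC -ltr_pdivlMr.
Qed.

Lemma H_polar s : 0 < Im s -> s = (cmod s)%:C * ep (Arg s).
Proof.
move=> s0; rewrite -{1}(LgK s0); apply: complex_ext.
  rewrite Re_expC Re_Lg // lnK ?posrE ?cmod_gt0 ?(H_neq0 s0) // Im_Lg.
  by rewrite !ReIm Re_ep mul0r subr0.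
rewrite Im_expC Re_Lg // lnK ?posrE ?cmod_gt0 ?(H_neq0 s0) // Im_Lg.
by rewrite !ReIm Im_ep mul0r addr0.
Qed.

Lemma scale_H x y : 0 < x -> 0 < y < pi -> 0 < Im (x%:C * ep y).
Proof. by move=> x0 /ep_H h; rewrite !ReIm mul0r addr0 mulr_gt0. Qed.

Lemma Arg_polar x y : 0 < x -> 0 < y < pi -> Arg (x%:C * ep y) = y.
Proof.
move=> x0 hy; have h := scale_H x0 hy.
have /andP[y0 y1] := hy.
have E : expC (Lg (x%:C * ep y)) = expC (Complex (ln x) y).
  rewrite LgK //; apply: complex_ext; rewrite !(Re_expC, Im_expC, ReIm) /= lnK ?posrE //.
    by rewrite Re_ep mul0r subr0.
  by rewrite Im_ep mul0r addr0.
have := expC_inj _ _ E; rewrite Im_Lg /=.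
have /andP[a1 a2] := Arg_itv (x%:C * ep y).
have -> : - pi < Arg (x%:C * ep y) < pi by have := @pi_gt0 R; move: a1 a2; lra.
have -> : - pi < y < pi by have := @pi_gt0 R; move: y0 y1; lra.
by move=> /(_ isT isT) /(congr1 (@complex.Im R)); rewrite Im_Lg.
Qed.

(* The polar radius of the curve at angle x, with the two real endpoints. *)
Definition rho x : R :=
  if pselect (0 < x < pi) is left h then s2val (cid2 (ray_zero (ep_H h)))
  else if x <= 0 then eb else - ea.

Lemma rhoP x : 0 < x < pi -> 0 < rho x /\ Im (ell ((rho x)%:C * ep x)) = 0.
Proof.
rewrite /rho => h; case: pselect => // h'; split.
  exact: s2valP (cid2 (ray_zero (ep_H h'))).
exact: s2valP' (cid2 (ray_zero (ep_H h'))).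
Qed.

Lemma rho0 : rho 0 = eb.
Proof. by rewrite /rho; case: pselect => [h|_]; [have := h; rewrite ltxx|rewrite lexx]. Qed.

Lemma rhopi : rho pi = - ea.
Proof.
rewrite /rho; case: pselect => [h|_]; first by have := h; rewrite ltxx andbF.
by rewrite leNgt pi_gt0.
Qed.

Lemma rho_gt0 x : 0 < rho x.
Proof.
have [h|h] := pselect (0 < x < pi); first by have [] := rhoP h.
rewrite /rho; case: pselect => // _; case: ifP => // _.
by move: ea_ltN1; lra.
Qed.

Lemma rho_lt x y : 0 < x < pi -> 0 < y -> (y < rho x) = (Im (ell (y%:C * ep x)) < 0).
Proof.
move=> hx y0; have [r0 E] := rhoP hx.
case: (ltgtP y (rho x)) => h.
- by rewrite -E; apply/esym; apply: Im_ell_ray => //; exact: ep_H.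
- have := @Im_ell_ray R theta c1 d theta_gt1 d_gt1 _ _ _ (ep_H hx) r0 h; rewrite E => h'.
  by apply/esym/negbTE; rewrite -leNgt ltW.
- by rewrite h E ltxx.
Qed.

Lemma rho_gt x y : 0 < x < pi -> 0 < y -> (rho x < y) = (0 < Im (ell (y%:C * ep x))).
Proof.
move=> hx y0; have [r0 E] := rhoP hx.
case: (ltgtP (rho x) y) => h.
- by rewrite -E; apply/esym; apply: Im_ell_ray => //; exact: ep_H.
- have := @Im_ell_ray R theta c1 d theta_gt1 d_gt1 _ _ _ (ep_H hx) y0 h; rewrite E => h'.
  by apply/esym/negbTE; rewrite -leNgt ltW.
- by rewrite -h E ltxx.
Qed.

(* Sign of [Im ell] next to a real point, read off the angular derivative. *)
Lemma Im_ell_near_real x x0 y (D : R) : y != 0 -> y + 1 != 0 -> y + d != 0 ->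
  D = y * ((y - ea) * (y - eb) / (y * (y + 1) * (y + d))) -> D != 0 ->
  Im (ellX y y%:C) = 0 -> 0 < x -> x%:C * ep x0 = y%:C ->
  exists2 del : R, 0 < del & forall t, `|t - x0| < del -> 0 < t < pi -> t != x0 ->
    0 < Im (ell (x%:C * ep t)) * ((t - x0) * D).
Proof.
move=> y0 y1 yd DE Dn E0 xp Exy.
have r0 : 0 < radX y by exact: radX_gt0.
pose g t : C := x%:C * ep t.
have gd : cder g x0 (ic R * y%:C).
  have := qd_path (qdZ x%:C (qd_id (ep x0))) (ep_der x0).
  by rewrite mulr1 mulrCA Exy.
have q : qd (ellX y) (g x0) (ell1 y%:C).
  by rewrite /g Exy; apply: qd_ellX; rewrite subrr cmod0.
have [_ h] := qd_path q gd.
have Eh : Im (ell1 y%:C * (ic R * y%:C)) = D.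
  have n0 : y%:C != 0 by rewrite (inj_eq (@complexI R)).
  have n1 : y%:C + 1 != 0 by rewrite -(rmorphD (real_complex R) y 1) (inj_eq (@complexI R)).
  have nd : y%:C + d%:C != 0 by rewrite -rmorphD (inj_eq (@complexI R)).
  rewrite (ell1_factor e_sum e_prod) //.
  have -> : (y%:C - ea%:C) * (y%:C - eb%:C) / (y%:C * (y%:C + 1) * (y%:C + d%:C)) *
    (ic R * y%:C) = ic R * D%:C.
    rewrite DE !(rmorphM, fmorphV, rmorphB, rmorphD, rmorph1) /=; ring.
  by rewrite Im_iM.
rewrite Eh in h.
have D2 : 0 < `|D| / 2 by rewrite divr_gt0 // normr_gt0.
have [d1 d10 H1] := is_derive1_epsE h D2.
have [d2 d20 H2] := ep_cvg x0 (divr_gt0 r0 xp).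
exists (Num.min d1 d2); first by rewrite lt_min d10.
move=> t; rewrite lt_min => /andP[t1 t2] tpi tx.
have E : ell (g t) = ellX y (g t).
  rewrite ellX_ell // /g; last exact: scale_H.
  rewrite -Exy -mulrBr cmodM cmod_real gtr0_norm // mulrC -ltr_pdivlMr //.
  exact: H2.
have := H1 _ t1; rewrite (addrC x0) subrK /g -/(g t) -E Exy E0 subr0.
set u := Im _; set tau := t - x0 => hh.
have tn : tau != 0 by rewrite subr_eq0.
have p : 0 < (D * tau) ^+ 2 by rewrite exprn_even_gt0 //= mulf_neq0.
have : `|u - D * tau| * `|D * tau| <= (D * tau) ^+ 2 / 2.
  rewrite -[(D * tau) ^+ 2]real_normK ?num_real // expr2.
  have := ler_wpM2r (normr_ge0 (D * tau)) hh; rewrite [`|D * tau|]normrM; lra.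
rewrite -normrM => /ler_normlP[_ _]; have := ler_norm (- ((u - D * tau) * (D * tau))).
rewrite normrN normrM => h1.
have h2 : `|u - D * tau| * `|D * tau| <= (D * tau) ^+ 2 / 2.
  rewrite -[(D * tau) ^+ 2]real_normK ?num_real // expr2.
  have := ler_wpM2r (normr_ge0 (D * tau)) hh; rewrite [`|D * tau|]normrM; lra.
move: h1 h2 p; set v := `|_| * `|_|.
have -> : u * (tau * D) = (D * tau) ^+ 2 + (u - D * tau) * (D * tau) by ring.
lra.
Qed.

Lemma rho_cvg_itv x (eps : R) : 0 <= x <= pi -> 0 < eps -> exists2 del : R, 0 < del &
  forall t, 0 < t < pi -> `|t - x| < del -> t != x -> `|rho t - rho x| < eps.
Proof.
move=> /andP[x0 xpi] e0.
have p0 := @pi_gt0 R.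
have [xI|xI] := pselect (0 < x < pi).
  have r0 := rho_gt0 x.
  pose e := Num.min eps (rho x / 2).
  have e1 : 0 < e by rewrite lt_min e0 divr_gt0.
  have e2 : e <= eps by rewrite ge_min lexx.
  have e3 : e < rho x.
    have : e <= rho x / 2 by rewrite ge_min lexx orbT.
    by move: r0; lra.
  have key y : 0 < y -> y != rho x -> exists2 del : R, 0 < del & forall t, `|t - x| < del ->
      `|Im (ell (y%:C * ep t)) - Im (ell (y%:C * ep x))| < `|Im (ell (y%:C * ep x))|.
    move=> y0 yn.
    have I0 : Im (ell (y%:C * ep x)) != 0.
      by case: (ltgtP y (rho x)) yn => // h _; [rewrite lt_eqF // -rho_lt|rewrite gt_eqF // -rho_gt].
    have In : 0 < `|Im (ell (y%:C * ep x))| by rewrite normr_gt0.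
    have [d1 d10 H1] := qd_cvg (qd_ell theta c1 d (scale_H y0 xI)) In.
    have [d2 d20 H2] := ep_cvg x (divr_gt0 d10 y0).
    exists d2 => // t /H2 h; rewrite -ImN -ImD; apply: le_lt_trans (Im_le_cmod _) _.
    apply: H1; rewrite -mulrBr cmodM cmod_real gtr0_norm // mulrC -ltr_pdivlMr //.
  have yp : 0 < rho x + e by rewrite addr_gt0.
  have ym : 0 < rho x - e by rewrite subr_gt0.
  have np : rho x + e != rho x by rewrite gt_eqF // ltrDl.
  have nm : rho x - e != rho x by rewrite lt_eqF // ltrBlDr ltrDl.
  have [d1 d10 H1] := key _ yp np.
  have [d2 d20 H2] := key _ ym nm.
  have s1 : 0 < Im (ell ((rho x + e)%:C * ep x)) by rewrite -rho_gt // ltrDl.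
  have s2 : Im (ell ((rho x - e)%:C * ep x)) < 0 by rewrite -rho_lt // ltrBlDr ltrDl.
  exists (Num.min d1 d2); first by rewrite lt_min d10.
  move=> t tI; rewrite lt_min => /andP[/H1 h1 /H2 h2] _.
  apply: lt_le_trans e2; apply/ltr_normlP; split.
    rewrite opprB ltrBlDr -ltrBlDl rho_lt //.
    move: h2; rewrite (ltr0_norm s2) => /ltr_normlP[_]; move: s2; lra.
  rewrite ltrBlDl rho_gt //.
  move: h1; rewrite (gtr0_norm s1) => /ltr_normlP[]; move: s1; lra.
have [x00|xn0] := eqVneq x 0.
  subst x; rewrite rho0.
  pose e := Num.min eps (eb / 2).
  have e1 : 0 < e by rewrite lt_min e0 divr_gt0.
  have e2 : e <= eps by rewrite ge_min lexx.
  have e3 : e < eb.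
    have : e <= eb / 2 by rewrite ge_min lexx orbT.
    by move: eb_gt0; lra.
  have key y : 0 < y -> y != eb -> exists2 del : R, 0 < del & forall t, `|t| < del -> 0 < t < pi ->
      0 < Im (ell (y%:C * ep t)) * (y - eb).
    move=> y0 yn.
    pose D := y * ((y - ea) * (y - eb) / (y * (y + 1) * (y + d))).
    pose K := (y - ea) / ((y + 1) * (y + d)).
    have K0 : 0 < K by rewrite divr_gt0 ?mulr_gt0 ?addr_gt0 //; move: ea_ltN1; lra.
    have DK : D = (y - eb) * K.
      by rewrite /D /K; field; rewrite !gt_eqF // addr_gt0.
    have Dn : D != 0 by rewrite DK mulf_neq0 ?subr_eq0 // gt_eqF.
    have [||||||del del0 H] := @Im_ell_near_real y 0 y D _ _ _ erefl Dn.
    - by rewrite gt_eqF.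
    - by rewrite gt_eqF // addr_gt0.
    - by rewrite gt_eqF // addr_gt0.
    - by rewrite Im_ellX !addr_gt0 // y0 subrr mulr0 addr0.
    - by [].
    - by rewrite ep0 mulr1.
    exists del => // t td tI; have /andP[t0 _] := tI.
    have := H t; rewrite subr0 => /(_ td tI (lt0r_neq0 t0)).
    have -> : Im (ell (y%:C * ep t)) * (t * D) =
      (Im (ell (y%:C * ep t)) * (y - eb)) * (t * K) by rewrite DK; ring.
    by rewrite pmulr_lgt0 // mulr_gt0.
  have yp : 0 < eb + e by rewrite addr_gt0.
  have ym : 0 < eb - e by rewrite subr_gt0.
  have np : eb + e != eb by rewrite gt_eqF // ltrDl.
  have nm : eb - e != eb by rewrite lt_eqF // ltrBlDr ltrDl.
  have [d1 d10 H1] := key _ yp np.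
  have [d2 d20 H2] := key _ ym nm.
  exists (Num.min d1 d2); first by rewrite lt_min d10.
  move=> t tI; rewrite subr0 lt_min => /andP[td1 td2] _.
  have h1 : rho t < eb + e.
    have := H1 _ td1 tI; rewrite [eb + e - eb](_ : _ = e); last by ring.
    by rewrite pmulr_lgt0 // -rho_gt.
  have h2 : eb - e < rho t.
    have := H2 _ td2 tI; rewrite [eb - e - eb](_ : _ = - e); last by ring.
    by rewrite nmulr_lgt0 ?oppr_lt0 // -rho_lt.
  by apply: lt_le_trans e2; apply/ltr_normlP; move: h1 h2; split; lra.
have x11 : x = pi.
  apply: contra_notP xI => /eqP xp; rewrite !lt_neqAle x0 xpi xp eq_sym xn0 //.
subst x; rewrite rhopi.
(* Keeps [ea - e] and [ea + e] inside [(- d, -1)], where [Im (ellX y y)] vanishes and the factor [K]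
   below is positive. *)
pose m := Num.min (d + ea) (- 1 - ea).
have m0 : 0 < m by rewrite lt_min; move: ead ea_ltN1; lra.
pose e := Num.min eps (m / 2).
have e1 : 0 < e by rewrite lt_min e0 divr_gt0.
have e2 : e <= eps by rewrite ge_min lexx.
have e3 : e < m.
  have : e <= m / 2 by rewrite ge_min lexx orbT.
  by move: m0; lra.
have [e4 e5] : e < d + ea /\ e < - 1 - ea by move: e3; rewrite lt_min => /andP.
have key y : - d < y -> y < - 1 -> y != ea -> exists2 del : R, 0 < del &
    forall t, `|t - pi| < del -> 0 < t < pi ->
    0 < Im (ell ((- y)%:C * ep t)) * (ea - y).
  move=> yd y1 yn.
  pose D := y * ((y - ea) * (y - eb) / (y * (y + 1) * (y + d))).
  pose K := (y - eb) / ((y + 1) * (y + d)).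
  have h1 : y + 1 < 0 by lra.
  have h2 : 0 < y + d by lra.
  have h3 : y < 0 by lra.
  have K0 : 0 < K.
    rewrite nmulr_lgt0; first by move: eb_gt0; lra.
    by rewrite invr_lt0 pmulr_llt0.
  have DK : D = (y - ea) * K.
    by rewrite /D /K; field; rewrite gt_eqF // !lt_eqF.
  have Dn : D != 0 by rewrite DK mulf_neq0 ?subr_eq0 // gt_eqF.
  have [||||||del del0 H] := @Im_ell_near_real (- y) pi y D _ _ _ erefl Dn.
  - by rewrite lt_eqF.
  - by rewrite lt_eqF.
  - by rewrite gt_eqF.
  - by rewrite Im_ellX h2 (ltNge 0 (y + 1)) (ltW h1) (ltNge 0 y) (ltW h3) /= subrr mulr0 addr0.
  - by rewrite oppr_gt0.
  - by rewrite eppi mulrN1 rmorphN /= opprK.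
  exists del => // t td tI; have /andP[_ t0] := tI.
  have := H t td tI; rewrite lt_eqF // => /(_ isT).
  have -> : Im (ell ((- y)%:C * ep t)) * ((t - pi) * D) =
    (Im (ell ((- y)%:C * ep t)) * (ea - y)) * ((pi - t) * K) by rewrite DK; ring.
  by rewrite pmulr_lgt0 // mulr_gt0 // subr_gt0.
have m1 : - d < ea - e by move: e4; lra.
have m2 : ea - e < -1 by move: ea_ltN1 e1; lra.
have m3 : ea - e != ea by rewrite lt_eqF // ltrBlDr ltrDl.
have p1 : - d < ea + e by move: ead e1; lra.
have p2 : ea + e < -1 by move: e5; lra.
have p3 : ea + e != ea by rewrite gt_eqF // ltrDl.
have [d1 d10 H1] := key _ m1 m2 m3.
have [d2 d20 H2] := key _ p1 p2 p3.
exists (Num.min d1 d2); first by rewrite lt_min d10.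
move=> t tI; rewrite lt_min => /andP[td1 td2] _.
have pm : 0 < - (ea - e) by move: m2; lra.
have pp : 0 < - (ea + e) by move: p2; lra.
have h1 : rho t < - (ea - e).
  have := H1 _ td1 tI; rewrite [ea - (ea - e)](_ : _ = e); last by ring.
  by rewrite pmulr_lgt0 // -rho_gt.
have h2 : - (ea + e) < rho t.
  have := H2 _ td2 tI; rewrite [ea - (ea + e)](_ : _ = - e); last by ring.
  by rewrite nmulr_lgt0 ?oppr_lt0 // -rho_lt.
by apply: lt_le_trans e2; apply/ltr_normlP; move: h1 h2; split; lra.
Qed.

Definition cS x : C := (rho x)%:C * ep x.

Lemma cS0 : cS 0 = eb%:C. Proof. by rewrite /cS rho0 ep0 mulr1. Qed.
Lemma cSpi : cS pi = ea%:C.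
Proof. by rewrite /cS rhopi eppi mulrN1 rmorphN /= opprK. Qed.

Lemma cS_H x : 0 < x < pi -> 0 < Im (cS x).
Proof. by move=> h; apply: scale_H => //; exact: rho_gt0. Qed.

Lemma itv0pi x : 0 <= x <= pi -> [\/ 0 < x < pi, x = 0 | x = pi].
Proof.
move=> /andP[x0 x1]; have [->|n0] := eqVneq x 0; first by apply: Or32.
have [->|n1] := eqVneq x pi; first by apply: Or33.
by apply: Or31; rewrite !lt_neqAle x0 x1 eq_sym n0 n1.
Qed.

Lemma cS_cvg x (eps : R) : 0 <= x <= pi -> 0 < eps -> exists2 del : R, 0 < del &
  forall t, 0 <= t <= pi -> `|t - x| < del -> cmod (cS t - cS x) < eps.
Proof.
move=> xI e0.
have e1 : 0 < eps / 2 by rewrite divr_gt0.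
have r0 := rho_gt0 x.
have e2 : 0 < eps / 2 / rho x by rewrite divr_gt0.
have [d1 d10 H1] := rho_cvg_itv xI e1.
have [d2 d20 H2] := ep_cvg x e2.
have p0 := @pi_gt0 R.
(* Excludes the endpoints of [[0, pi]] other than [x] itself, because [rho_cvg_itv] only speaks of
   open angles [t]. *)
pose d3 := if pselect (0 < x < pi) is left _ then Num.min x (pi - x) else pi.
have d30 : 0 < d3.
  by rewrite /d3; case: pselect => // h; rewrite lt_min subr_gt0.
exists (Num.min (Num.min d1 d2) d3); first by rewrite !lt_min d10 d20.
move=> t tI; rewrite !lt_min => /andP[/andP[t1 t2] t3].
have h1 : `|rho t - rho x| < eps / 2.
  have [->|tx] := eqVneq t x; first by rewrite subrr normr0.
  apply: H1 => //.
  case: (itv0pi tI) => [//|tE|tE]; move: t3; rewrite /d3; case: pselect => xJ; rewrite tE.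
  - have /andP[x0 _] := xJ.
    by rewrite sub0r normrN gtr0_norm // lt_min => /andP[]; rewrite ltxx.
  - case: (itv0pi xI) => // xE; first by move: tx; rewrite tE xE eqxx.
    by rewrite xE sub0r normrN gtr0_norm // ltxx.
  - have /andP[_ x0] := xJ.
    by move=> h; exfalso; move: h; rewrite gtr0_norm ?subr_gt0 // lt_min => /andP[_]; rewrite ltxx.
  - case: (itv0pi xI) => // xE; last by move: tx; rewrite tE xE eqxx.
    by move=> h; exfalso; move: h; rewrite xE subr0 gtr0_norm // ltxx.
have -> : cS t - cS x = (rho t - rho x)%:C * ep t + (rho x)%:C * (ep t - ep x).
  by rewrite /cS rmorphB /=; ring.
apply: le_lt_trans (cmodD _ _) _; rewrite !cmodM !cmod_real cmod_ep mulr1 (gtr0_norm r0).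
rewrite (splitr eps) ltrD // mulrC -ltr_pdivlMr //; exact: H2.
Qed.

(** The logarithm of the map along the curve as a function of the polar angle. The end values are
    prescribed, because the formula for [ell] is meaningful only above the real axis. *)
Definition Yl x : R := if 0 < x < pi then Re (ell (cS x)) else if x <= 0 then lr eb else lr ea.

Lemma Yl0 : Yl 0 = lr eb. Proof. by rewrite /Yl ltxx lexx. Qed.
Lemma Ylpi : Yl pi = lr ea. Proof. by rewrite /Yl ltxx andbF leNgt pi_gt0. Qed.

Lemma ell_cS x : 0 < x < pi -> ell (cS x) = (Yl x)%:C.
Proof.
move=> h; apply: complex_ext; first by rewrite ReC /Yl h.
by rewrite ImC; have [] := rhoP h.
Qed.

Lemma edge_rad e : e = ea \/ e = eb ->
  [/\ 0 < radX e, ellX e e%:C = (lr e)%:C & Jt theta (c1 * d) c1 e%:C = (expR (lr e))%:C].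
Proof.
have q : [\/ 0 < e | (e < -1 /\ - d < e)] -> [/\ 0 < radX e, ellX e e%:C = (lr e)%:C &
    Jt theta (c1 * d) c1 e%:C = (expR (lr e))%:C].
  move=> H.
  have [n0 n1 nd sg] : [/\ e != 0, e + 1 != 0, e + d != 0 & 0 < e + d /\ ((0 < e + 1) = (0 < e))].
    case: H => [h|[h1 h2]].
      by rewrite !gt_eqF ?addr_gt0 // h; split.
    have k1 : e + 1 < 0 by move: h1; lra.
    have k2 : 0 < e + d by move: h2; lra.
    have k3 : e < 0 by move: h1; lra.
    split; [by rewrite lt_eqF|by rewrite lt_eqF|by rewrite gt_eqF|].
    by rewrite k2 !ltNge (ltW k1) (ltW k3).
  split; first exact: radX_gt0.
    apply: complex_ext; first by rewrite ReC Re_ellX.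
    rewrite ImC Im_ellX.
    by case: sg => -> ->; rewrite subrr mulr0 addr0.
  case: sg => s1 s2; apply: Jt_real => //.
  case: H => [h|[h1 h2]]; first by rewrite divr_gt0 // addr_gt0.
  by rewrite nmulr_rgt0 ?invr_lt0; move: h1; lra.
by move=> H; apply: q; case: H => ->; [right|left].
Qed.

Lemma Yl_cvg x (eps : R) : 0 <= x <= pi -> 0 < eps -> exists2 del : R, 0 < del &
  forall t, 0 <= t <= pi -> `|t - x| < del -> `|Yl t - Yl x| < eps.
Proof.
move=> xI e0; case: (itv0pi xI) => [xJ|xE|xE].
- have [d1 d10 H1] := qd_cvg (qd_ell theta c1 d (cS_H xJ)) e0.
  have [d2 d20 H2] := cS_cvg xI d10.
  have /andP[x0 x1] := xJ.
  exists (Num.min d2 (Num.min x (pi - x))); first by rewrite !lt_min d20 subr_gt0 x0.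
  move=> t tI; rewrite !lt_min => /and3P[t1 t2 t3].
  have tJ : 0 < t < pi.
    by move: t2 t3 => /ltr_normlP[h1 h2] /ltr_normlP[h3 h4]; move: h1 h2 h3 h4; lra.
  rewrite -(cmod_real (Yl t - Yl x)) rmorphB /= -!ell_cS //.
  by apply: H1; exact: H2.
- have [r0 E _] := edge_rad (or_intror erefl).
  have z0 : cmod (eb%:C - eb%:C) < radX eb by rewrite subrr cmod0.
  have [d1 d10 H1] := qd_cvg (qd_ellX theta c1 z0) e0.
  have m0 : 0 < Num.min d1 (radX eb) by rewrite lt_min d10.
  have [d2 d20 H2] := cS_cvg xI m0; have p0 := @pi_gt0 R.
  exists (Num.min d2 pi); first by rewrite lt_min d20.
  move=> t tI; rewrite lt_min => /andP[t1 t2].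
  case: (itv0pi tI) => [tJ|->|tE]; last 2 first.
  + by rewrite xE subrr normr0.
  + by move: t2; rewrite tE xE subr0 gtr0_norm // ltxx.
  have := H2 _ tI t1; rewrite xE cS0 lt_min => /andP[h1 h2].
  have := H1 _ h1; rewrite E ellX_ell ?cS_H // ell_cS // -rmorphB /= cmod_real.
  by rewrite Yl0.
- have [r0 E _] := edge_rad (or_introl erefl).
  have z0 : cmod (ea%:C - ea%:C) < radX ea by rewrite subrr cmod0.
  have [d1 d10 H1] := qd_cvg (qd_ellX theta c1 z0) e0.
  have m0 : 0 < Num.min d1 (radX ea) by rewrite lt_min d10.
  have [d2 d20 H2] := cS_cvg xI m0; have p0 := @pi_gt0 R.
  exists (Num.min d2 pi); first by rewrite lt_min d20.
  move=> t tI; rewrite lt_min => /andP[t1 t2].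
  case: (itv0pi tI) => [tJ|tE|->]; last 2 first.
  + by move: t2; rewrite tE xE sub0r normrN gtr0_norm // ltxx.
  + by rewrite xE subrr normr0.
  have := H2 _ tI t1; rewrite xE cSpi lt_min => /andP[h1 h2].
  have := H1 _ h1; rewrite E ellX_ell ?cS_H // ell_cS // -rmorphB /= cmod_real.
  by rewrite Ylpi.
Qed.

Lemma Yl_cont : {within `[0, pi], continuous Yl}.
Proof.
apply: within_eps => x; rewrite /= in_itv /= => xI eps e0.
have [del d0 H] := Yl_cvg xI e0; exists del => // y; rewrite in_itv /=; exact: H.
Qed.

Lemma Yl_inj x y : 0 < x < pi -> 0 < y < pi -> Yl x = Yl y -> x = y.
Proof.
move=> hx hy E.
have : cS x = cS y.
  by apply: (@ell_inj R theta c1 d theta_gt1 d_gt1 _ _ (cS_H hx) (cS_H hy)); rewrite !ell_cS // E.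
by move=> /(congr1 (@Arg R)); rewrite /cS !Arg_polar // ?rho_gt0.
Qed.

(** Injectivity of [ell] and continuity force strict monotonicity. If [Yl] increased, the limits at
    the two ends would give [lr eb <= Yl x < Yl y <= lr ea], against the order of the critical
    values. *)
Lemma Yl_dec_open x y : 0 < x -> x < y -> y < pi -> Yl y < Yl x.
Proof.
move=> x0 xy y1; have p0 := @pi_gt0 R.
have cont : {within [set` `]0, (pi : R)[], continuous Yl}.
  by apply: continuous_subspaceW Yl_cont => t /=; rewrite !in_itv /= => /andP[/ltW -> /ltW ->].
have inj : {in `]0, (pi : R)[ &, injective Yl}.
  by move=> u v; rewrite !in_itv /=; exact: Yl_inj.
have xI : x \in `]0, (pi : R)[ by rewrite in_itv /= x0 (lt_trans xy).
have yI : y \in `]0, (pi : R)[ by rewrite in_itv /= y1 (lt_trans x0).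
have [E|NE] := pselect (exists u v : R, [/\ u \in `]0, (pi : R)[, v \in `]0, (pi : R)[, u < v & Yl v <= Yl u]).
  have H := itv_continuous_inj_ge E cont inj.
  by rewrite ltNge H // -ltNge.
have inc u v : 0 < u -> u < v -> v < pi -> Yl u < Yl v.
  move=> u0 uv v1; rewrite ltNge; apply/negP => h; apply: NE; exists u, v.
  by rewrite !in_itv /= u0 (lt_trans uv v1) (lt_trans u0 uv) v1 uv h.
have [m1 m2] : lr eb <= Yl x /\ Yl y <= lr ea.
  split; rewrite leNgt; apply/negP => h.
    have e0 : 0 < lr eb - Yl x by rewrite subr_gt0.
    have I0 : 0 <= (0 : R) <= pi by rewrite lexx ltW.
    have [del d0 H] := Yl_cvg I0 e0.
    pose t := Num.min del x / 2.
    have m0 : 0 < Num.min del x by rewrite lt_min d0.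
    have t0 : 0 < t by rewrite divr_gt0.
    have : t < Num.min del x by rewrite ltr_pdivrMr // ltr_pMr // ltr1n.
    rewrite lt_min => /andP[td tx].
    have tI : 0 <= t <= pi by rewrite ltW //= ltW // (lt_trans tx) // (lt_trans xy).
    have := H _ tI; rewrite subr0 gtr0_norm // => /(_ td) /ltr_normlP[].
    rewrite Yl0; have := inc _ _ t0 tx (lt_trans xy y1); lra.
  have e0 : 0 < Yl y - lr ea by rewrite subr_gt0.
  have I0 : 0 <= (pi : R) <= pi by rewrite pi_ge0 lexx.
  have [del d0 H] := Yl_cvg I0 e0.
  pose t := Num.min del (pi - y) / 2.
  have m0 : 0 < Num.min del (pi - y) by rewrite lt_min d0 subr_gt0.
  have t0 : 0 < t by rewrite divr_gt0.
  have : t < Num.min del (pi - y) by rewrite ltr_pdivrMr // ltr_pMr // ltr1n.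
  rewrite lt_min => /andP[td tx].
  have tI : 0 <= pi - t <= pi.
    by have := lt_trans x0 xy; move: t0 tx; lra.
  have := H _ tI; rewrite addrAC subrr sub0r normrN gtr0_norm // => /(_ td) /ltr_normlP[].
  have k1 : y < pi - t by move: tx; lra.
  have k2 : pi - t < pi by move: t0; lra.
  rewrite Ylpi; have := inc _ _ (lt_trans x0 xy) k1 k2; lra.
by have := inc _ _ x0 xy y1; move: lr_ab m1 m2; lra.
Qed.

Lemma Yl_dec x y : 0 <= x -> x < y -> y <= pi -> Yl y < Yl x.
Proof.
have p0 := @pi_gt0 R.
have D0 t : 0 < t < pi -> Yl t < lr eb.
  move=> /andP[t0 t1].
  have h : Yl t < Yl (t / 2).
    apply: Yl_dec_open => //; [by rewrite divr_gt0|].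
    by rewrite ltr_pdivrMr // ltr_pMr // ltr1n.
  apply: lt_le_trans h _; rewrite leNgt; apply/negP => h.
  have e0 : 0 < Yl (t / 2) - lr eb by rewrite subr_gt0.
  have I0 : 0 <= (0 : R) <= pi by rewrite lexx ltW.
  have [del d0 H] := Yl_cvg I0 e0.
  pose u := Num.min del (t / 2) / 2.
  have m0 : 0 < Num.min del (t / 2) by rewrite lt_min d0 divr_gt0.
  have u0 : 0 < u by rewrite divr_gt0.
  have : u < Num.min del (t / 2) by rewrite ltr_pdivrMr // ltr_pMr // ltr1n.
  rewrite lt_min => /andP[ud ut].
  have ut2 : t / 2 < pi by move: t0 t1; lra.
  have uI : 0 <= u <= pi by rewrite ltW //= ltW // (lt_trans ut).
  have := H _ uI; rewrite subr0 gtr0_norm // => /(_ ud) /ltr_normlP[].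
  rewrite Yl0; have := Yl_dec_open u0 ut ut2; lra.
have D1 t : 0 < t < pi -> lr ea < Yl t.
  move=> /andP[t0 t1]; pose m := (t + pi) / 2.
  have tm : t < m by rewrite /m; move: t1; lra.
  have mp : m < pi by rewrite /m; move: t1; lra.
  have h := Yl_dec_open t0 tm mp.
  apply: le_lt_trans h; rewrite leNgt; apply/negP => h.
  have e0 : 0 < lr ea - Yl m by rewrite subr_gt0.
  have I0 : 0 <= (pi : R) <= pi by rewrite pi_ge0 lexx.
  have [del d0 H] := Yl_cvg I0 e0.
  pose u := Num.min del (pi - m) / 2.
  have m0 : 0 < Num.min del (pi - m) by rewrite lt_min d0 subr_gt0.
  have u0 : 0 < u by rewrite divr_gt0.
  have : u < Num.min del (pi - m) by rewrite ltr_pdivrMr // ltr_pMr // ltr1n.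
  rewrite lt_min => /andP[ud ut].
  have k1 : m < pi - u by move: ut; lra.
  have k2 : pi - u < pi by move: u0; lra.
  have mm : 0 < m by exact: lt_trans tm.
  have uI : 0 <= pi - u <= pi by rewrite (ltW k2) andbT ltW // (lt_trans mm).
  have := H _ uI; rewrite addrAC subrr sub0r normrN gtr0_norm // => /(_ ud) /ltr_normlP[].
  rewrite Ylpi; have := Yl_dec_open mm k1 k2; lra.
move=> x0 xy y1; have [x00|xn] := eqVneq x 0.
  subst x; rewrite Yl0; have [->|yn] := eqVneq y pi; first by rewrite Ylpi.
  by apply: D0; rewrite xy lt_neqAle yn y1.
have xp : 0 < x by rewrite lt_neqAle eq_sym xn x0.
have [->|yn] := eqVneq y pi.
  by rewrite Ylpi; apply: D1; rewrite xp (lt_le_trans xy).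
by apply: Yl_dec_open => //; rewrite lt_neqAle yn y1.
Qed.

(** Each ray carries a single zero of [Im ell], so the point is on the polar graph at an angle
    strictly between [0] and [pi], and [Yl] decreases between its end values. *)
Lemma curve_range s : 0 < Im s -> Im (ell s) = 0 -> lr ea < Re (ell s) < lr eb.
Proof.
move=> s0 E; have xI := Arg_itv s; have /andP[x0 x1] := xI; have p0 := @pi_gt0 R.
have Es : s = cS (Arg s).
  rewrite {1}(H_polar s0) /cS; congr (_%:C * _).
  have c0 : 0 < cmod s by rewrite cmod_gt0 H_neq0.
  case: (ltgtP (cmod s) (rho (Arg s))) => //.
    by rewrite rho_lt // -H_polar // E ltxx.
  by rewrite rho_gt // -H_polar // E ltxx.
rewrite Es ell_cS // ReC -Yl0 -Ylpi.
by rewrite !Yl_dec // ltW.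
Qed.

Lemma Yl_surj y : lr ea <= y <= lr eb -> exists2 x, 0 <= x <= pi & Yl x = y.
Proof.
move=> /andP[y0 y1]; have [|x] := @IVT R Yl 0 pi y (@pi_ge0 R) Yl_cont.
  by rewrite Yl0 Ylpi ge_min y0 orbT le_max y1.
by rewrite in_itv /= => h E; exists x.
Qed.

Definition Phi y : R :=
  if pselect (lr ea <= y <= lr eb) is left h then s2val (cid2 (Yl_surj h)) else 0.

Lemma PhiP y : lr ea <= y <= lr eb -> 0 <= Phi y <= pi /\ Yl (Phi y) = y.
Proof.
rewrite /Phi => h; case: pselect => // h'; split.
  exact: s2valP (cid2 (Yl_surj h')).
exact: s2valP' (cid2 (Yl_surj h')).
Qed.

Lemma Phi_cvg y (eps : R) : lr ea <= y <= lr eb -> 0 < eps -> exists2 del : R, 0 < del &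
  forall t, lr ea <= t <= lr eb -> `|t - y| < del -> `|Phi t - Phi y| < eps.
Proof.
move=> yI e0; have [/andP[f0 f1] fE] := PhiP yI.
have [d1 d10 H1] : exists2 d1 : R, 0 < d1 & forall t, lr ea <= t <= lr eb -> `|t - y| < d1 ->
    Phi t < Phi y + eps.
  have [h|h] := leP (Phi y + eps) pi; last first.
    by exists 1 => // t /PhiP[/andP[_ h1] _] _; exact: le_lt_trans h.
  have k : Yl (Phi y + eps) < y by rewrite -{2}fE; apply: Yl_dec => //; rewrite ltrDl.
  exists (y - Yl (Phi y + eps)); first by rewrite subr_gt0.
  move=> t /PhiP[/andP[g0 g1] gE] /ltr_normlP[h1 h2]; rewrite ltNge; apply/negP => h3.
  have : Yl (Phi t) <= Yl (Phi y + eps).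
    move: h3; rewrite le_eqVlt => /orP[/eqP ->//|h3]; apply/ltW/Yl_dec => //.
    by rewrite addr_ge0 // ltW.
  by rewrite gE; move: h1; lra.
have [d2 d20 H2] : exists2 d2 : R, 0 < d2 & forall t, lr ea <= t <= lr eb -> `|t - y| < d2 ->
    Phi y - eps < Phi t.
  have [h|h] := leP 0 (Phi y - eps); last first.
    by exists 1 => // t /PhiP[/andP[h1 _] _] _; exact: lt_le_trans h1.
  have k : y < Yl (Phi y - eps).
    by rewrite -{1}fE; apply: Yl_dec => //; rewrite ltrBlDr ltrDl.
  exists (Yl (Phi y - eps) - y); first by rewrite subr_gt0.
  move=> t /PhiP[/andP[g0 g1] gE] /ltr_normlP[h1 h2]; rewrite ltNge; apply/negP => h3.
  have : Yl (Phi y - eps) <= Yl (Phi t).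
    move: h3; rewrite le_eqVlt => /orP[/eqP ->//|h3]; apply/ltW/Yl_dec => //.
    by apply: le_trans f1; rewrite lerBlDr lerDl ltW.
  by rewrite gE; move: h2; lra.
exists (Num.min d1 d2); first by rewrite lt_min d10.
move=> t tI; rewrite lt_min => /andP[/(H1 _ tI) h1 /(H2 _ tI) h2].
by apply/ltr_normlP; move: h1 h2; split; lra.
Qed.

Hypothesis s_aE : s_a theta (c1 * d) c1 = ea.
Hypothesis s_bE : s_b theta (c1 * d) c1 = eb.

Lemma JAE : JA theta (c1 * d) c1 = expR (lr ea).
Proof. by rewrite /JA s_aE; have [_ _ ->] := edge_rad (or_introl erefl). Qed.
Lemma JBE : JB theta (c1 * d) c1 = expR (lr eb).
Proof. by rewrite /JB s_bE; have [_ _ ->] := edge_rad (or_intror erefl). Qed.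

Lemma ln_range y : expR (lr ea) <= y <= expR (lr eb) -> lr ea <= ln y <= lr eb.
Proof.
move=> /andP[y0 y1]; have yp : 0 < y by apply: lt_le_trans y0; exact: expR_gt0.
by rewrite -ler_expR -[in X in _ && X]ler_expR lnK // y0 y1.
Qed.

Lemma ln_range_open y : expR (lr ea) < y < expR (lr eb) -> lr ea < ln y < lr eb.
Proof.
move=> /andP[y0 y1]; have yp : 0 < y by apply: lt_trans y0; exact: expR_gt0.
by rewrite -ltr_expR -[in X in _ && X]ltr_expR lnK // y0 y1.
Qed.

(** The candidate is the polar graph reparametrised by [y = expR (Yl x)]. Its differentiability is
    that of a continuous local inverse of [expC (ell w)], whose derivative does not vanish on the
    curve. *)
Lemma upper_curve_exists : exists Ip, upper_curve theta (c1 * d) c1 Ip.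
Proof.
have p0 := @pi_gt0 R.
have lab := ltW lr_ab.
pose Ip y := cS (Phi (ln y)).
have cvg y (eps : R) : expR (lr ea) <= y <= expR (lr eb) -> 0 < eps -> exists2 del : R, 0 < del &
    forall t, expR (lr ea) <= t <= expR (lr eb) -> `|t - y| < del -> cmod (Ip t - Ip y) < eps.
  move=> yI e0; have lI := ln_range yI; have [fI _] := PhiP lI.
  have yp : 0 < y by have /andP[h _] := yI; apply: lt_le_trans h; exact: expR_gt0.
  have [d1 d10 H1] := cS_cvg fI e0; have [d2 d20 H2] := Phi_cvg lI d10.
  have [d3 d30 H3] := for_epsE (continuous_ln yp) d20.
  exists d3 => // t tI /H3 h; have tl := ln_range tI.
  by apply: H1; [have [] := PhiP tl|exact: H2].
have open y : expR (lr ea) < y < expR (lr eb) -> 0 < Im (Ip y) /\ ell (Ip y) = (ln y)%:C.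
  move=> /ln_range_open /andP[h1 h2].
  have [|fI fE] := @PhiP (ln y); first by rewrite !ltW.
  have fJ : 0 < Phi (ln y) < pi.
    case: (itv0pi fI) => // E; move: fE; rewrite E ?Yl0 ?Ylpi => E'.
      by move: h2; rewrite E' ltxx.
    by move: h1; rewrite E' ltxx.
  by split; [exact: cS_H|rewrite ell_cS // fE].
have EA : Ip (expR (lr ea)) = ea%:C.
  have [|fI fE] := @PhiP (lr ea); first by rewrite lexx.
  rewrite /Ip expRK -cSpi; congr cS.
  have /andP[f0 f1] := fI; apply/eqP; rewrite eq_le f1 leNgt /=; apply/negP => h.
  by have := Yl_dec f0 h (lexx _); rewrite fE Ylpi ltxx.
have EB : Ip (expR (lr eb)) = eb%:C.
  have [|fI fE] := @PhiP (lr eb); first by rewrite lexx lab.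
  rewrite /Ip expRK -cS0; congr cS.
  have /andP[f0 f1] := fI; apply/eqP; rewrite eq_le f0 leNgt andbT; apply/negP => h.
  by have := Yl_dec (lexx _) h f1; rewrite fE Yl0 ltxx.
exists Ip; rewrite /upper_curve JAE JBE s_aE s_bE; split => //.
- apply: within_eps => y; rewrite /= in_itv /= => yI eps e0.
  have [del d0 H] := cvg _ _ yI e0; exists del => // t; rewrite in_itv /= => tI /(H _ tI).
  by apply: le_lt_trans; rewrite -ReN -ReD; exact: Re_le_cmod.
- apply: within_eps => y; rewrite /= in_itv /= => yI eps e0.
  have [del d0 H] := cvg _ _ yI e0; exists del => // t; rewrite in_itv /= => tI /(H _ tI).
  by apply: le_lt_trans; rewrite -ImN -ImD; exact: Im_le_cmod.
split.
- by move=> y; rewrite in_itv /= => /open[].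
- move=> y; rewrite in_itv /= => yI.
  have [yJ|yJ] := pselect (expR (lr ea) < y < expR (lr eb)).
    have [h1 h2] := open _ yJ; rewrite Jt_ell // h2 expC_real lnK //.
    by have /andP[h _] := yJ; rewrite posrE (lt_trans _ h) // expR_gt0.
  have /andP[y0 y1] := yI.
  have [->|n0] := eqVneq y (expR (lr ea)).
    by rewrite EA; have [_ _ ->] := edge_rad (or_introl erefl).
  have [->|n1] := eqVneq y (expR (lr eb)).
    by rewrite EB; have [_ _ ->] := edge_rad (or_intror erefl).
  by exfalso; apply: yJ; rewrite !lt_neqAle y0 y1 eq_sym n0 n1.
move=> y; rewrite in_itv /= => yJ.
have [s0 Es] := open _ yJ; have /andP[y0 y1] := yJ.
have yp : 0 < y by apply: lt_trans y0; exact: expR_gt0.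
set s := Ip y in s0 Es.
have qJ : qd (fun w => expC (ell w)) s (expC (ell s) * ell1 s).
  by apply: qd_comp; [exact: qd_expC|exact: qd_ell].
pose D := expC (ell s) * ell1 s.
have Dn : D != 0 by rewrite mulf_neq0 ?expC_neq0 // ell1_neq0.
have cD : 0 < cmod D by rewrite cmod_gt0.
have [M [r [M0 r0 H]]] := qJ.
suff : cder Ip y D^-1 by move=> [[h1 _] [h2 _]].
apply: cder_eps => eps e0.
have K0 : 0 < eps * cmod D ^+ 2 / (2 * M).
  by rewrite divr_gt0 ?mulr_gt0 ?exprn_gt0.
have m0 : 0 < Num.min r (Num.min (cmod D / (2 * M)) (eps * cmod D ^+ 2 / (2 * M))).
  by rewrite !lt_min r0 K0 divr_gt0 ?mulr_gt0.
have yI : expR (lr ea) <= y <= expR (lr eb) by rewrite !ltW.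
have [d1 d10 H1] := cvg _ _ yI m0.
exists (Num.min d1 (Num.min (y - expR (lr ea)) (expR (lr eb) - y))).
  by rewrite !lt_min d10 !subr_gt0 y0.
move=> h; rewrite !lt_min => /and3P[h1 /ltr_normlP[h2 h2'] /ltr_normlP[h3 h3']].
have yhJ : expR (lr ea) < y + h < expR (lr eb) by move: h2 h2' h3 h3'; lra.
have yhI : expR (lr ea) <= y + h <= expR (lr eb) by have /andP[? ?] := yhJ; rewrite !ltW.
have yhp : 0 < y + h by have /andP[k _] := yhJ; apply: lt_trans k; exact: expR_gt0.
have [w0 Ew] := open _ yhJ.
have := H1 _ yhI; rewrite addrC addKr => /(_ h1); rewrite -/s !lt_min => /and3P[k1 k2 k3].
have := H _ k1; rewrite Ew Es !expC_real !lnK ?posrE // -rmorphB /= [y + h - y](_ : _ = h); last by ring.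
rewrite -/s; set De := Ip (y + h) - s.
have -> : y%:C * ell1 s = D by rewrite /D Es expC_real lnK.
(* The quadratic remainder is first absorbed into half of the linear term, which bounds the
   increment [De] by a multiple of [h]; put back into the remainder, this bound makes it small
   compared with [h]. *)
move=> hh; have N : cmod (h%:C - D * De) <= cmod D / 2 * cmod De.
  apply: le_trans hh _; rewrite expr2 mulrA ler_wpM2r ?cmod_ge0 //.
  by move: k2; rewrite ltr_pdivlMr ?mulr_gt0 // => /ltW; rewrite mulrCA; move: M0; lra.
have N2 : cmod De <= 2 / cmod D * `|h|.
  have : cmod D * cmod De <= cmod D / 2 * cmod De + `|h|.
    rewrite -cmodM -(cmod_real h); apply: le_trans _ (lerD N (lexx _)).
    by rewrite cmodB; apply: le_trans (cmodD _ _); rewrite subrK.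
  move=> h'; rewrite mulrAC ler_pdivlMr // mulrC; move: h'; lra.
have -> : De - D^-1 * h%:C = - (D^-1 * (h%:C - D * De)) by field.
rewrite cmodN cmodM cmodV ler_pdivrMl //; apply: le_trans hh _.
apply: (@le_trans _ _ (M * (eps * cmod D ^+ 2 / (2 * M) * (2 / cmod D * `|h|)))).
  rewrite ler_wpM2l ?(ltW M0) // expr2; apply: ler_pM; rewrite ?cmod_ge0 //.
  exact: ltW.
rewrite le_eqVlt; apply/orP; left; apply/eqP; field.
by rewrite !gt_eqF.
Qed.

End Curve.

(** * Integration on open intervals with endpoint singularities *)

Section Integration.
Variable R : realType.
Section AnyMeasure.
Variables (d : measure_display) (T : measurableType d) (m : {measure set T -> \bar R}) (D : set T).
Implicit Types (f g : T -> R) (x : T).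
Hypothesis mD : measurable D.

Lemma Rintegral_dominated (f_ : nat -> T -> R) f g :
  (forall n, measurable_fun D (f_ n)) -> measurable_fun D f ->
  (forall x, D x -> f_ n x @[n --> \oo] --> f x) ->
  m.-integrable D (EFin \o g) ->
  (forall n x, D x -> `|f_ n x| <= g x) ->
  m.-integrable D (EFin \o f) /\
  (\int[m]_(x in D) f_ n x)%R @[n --> \oo] --> (\int[m]_(x in D) f x)%R.
Proof.
move=> mf_ mf fc ig fg.
have [|||||i1 _ i3] := @dominated_convergence _ _ _ m D mD (fun n => EFin \o f_ n) (EFin \o f) (EFin \o g).
- by move=> n; exact/measurable_EFinP.
- exact/measurable_EFinP.
- by apply: aeW => x Dx; apply: cvg_EFin; [exact: nearW|exact: fc].
- exact: ig.
- by apply: aeW => x n Dx /=; rewrite lee_fin; exact: fg.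
split => //; apply: fine_cvg.
rewrite fineK; last exact: integrable_fin_num.
exact: i3.
Qed.

Lemma integrable_le f g : measurable_fun D f -> m.-integrable D (EFin \o g) ->
  (forall x, D x -> `|f x| <= g x) -> m.-integrable D (EFin \o f).
Proof.
move=> mf ig fg; apply: le_integrable ig => //; first exact/measurable_EFinP.
by move=> x Dx /=; rewrite lee_fin (le_trans (fg _ Dx)) // ler_norm.
Qed.

Lemma le_Rintegral_norm f g : m.-integrable D (EFin \o f) -> m.-integrable D (EFin \o g) ->
  (forall x, D x -> `|f x| <= g x) -> `|\int[m]_(x in D) f x| <= \int[m]_(x in D) g x.
Proof.
move=> i1 i2 fg; apply: le_trans (le_normr_Rintegral mD i1) _.
apply: le_Rintegral => //.
have := integrable_abse i1.
by apply: eq_integrable => // x _ /=; rewrite abse_EFin.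
Qed.

Lemma integrableDr f g : m.-integrable D (EFin \o f) -> m.-integrable D (EFin \o g) ->
  m.-integrable D (EFin \o (fun x => f x + g x)).
Proof.
move=> i1 i2; have := integrableD mD i1 i2.
by apply: eq_integrable => // x _ /=; rewrite EFinD.
Qed.

Lemma integrableZr (c : R) f : m.-integrable D (EFin \o f) ->
  m.-integrable D (EFin \o (fun x => c * f x)).
Proof.
move=> i1; have := integrableZl mD c i1.
by apply: eq_integrable => // x _ /=; rewrite EFinM.
Qed.

Lemma integrableNr f : m.-integrable D (EFin \o f) ->
  m.-integrable D (EFin \o (fun x => - f x)).
Proof.
move=> i1; have := integrableN i1.
by apply: eq_integrable => // x _ /=; rewrite EFinN.
Qed.

Lemma integrable_normr f : m.-integrable D (EFin \o f) ->
  m.-integrable D (EFin \o (fun x => `|f x|)).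
Proof.
move=> i1; have := integrable_abse i1.
by apply: eq_integrable => // x _ /=; rewrite abse_EFin.
Qed.

Lemma integrable_measurable f : m.-integrable D (EFin \o f) -> measurable_fun D f.
Proof. by move=> /measurable_int/measurable_EFinP. Qed.

End AnyMeasure.

Implicit Types (f g F : R -> R) (a b x : R).

Local Notation leb := (@lebesgue_measure R).

Lemma oo_measurable a b : measurable (`]a, b[%classic : set R). Proof. exact: measurable_itv. Qed.

Lemma within_measurable a b f : {within `]a, b[, continuous f} -> measurable_fun `]a, b[ f.
Proof. by move=> h; apply: subspace_continuous_measurable_fun. Qed.

Lemma integrable_cst_oo a b (c : R) : leb.-integrable `]a, b[ (EFin \o cst c).
Proof.
have h : leb.-integrable `[a, b] (EFin \o cst c).
  by apply: continuous_compact_integrable; [exact: segment_compact|by apply: continuous_subspaceT => x; exact: cvg_cst].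
apply: integrableS h => //.
by move=> x /=; rewrite !in_itv /= => /andP[/ltW -> /ltW ->].
Qed.

Lemma integrable_cc_oo a b f : {within `[a, b], continuous f} -> leb.-integrable `]a, b[ (EFin \o f).
Proof.
move=> cf; have h : leb.-integrable `[a, b] (EFin \o f).
  by apply: continuous_compact_integrable; [exact: segment_compact|].
apply: integrableS h => //.
by move=> x /=; rewrite !in_itv /= => /andP[/ltW -> /ltW ->].
Qed.

Lemma FTC_seg (u v : R) f F : u < v -> {within `[u, v], continuous f} ->
  (forall x, u <= x <= v -> is_derive x 1 F (f x)) ->
  (\int[leb]_(x in `[u, v]) (f x)%:E = (F v - F u)%:E)%E.
Proof.
move=> uv cf Fd; rewrite (continuous_FTC2 uv cf (F := F)) //.
  split.
  - move=> x; rewrite in_itv /= => /andP[x1 x2].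
    by have [] := Fd x; rewrite ?(ltW x1) ?(ltW x2).
  - by apply: cvg_at_right_filter; apply: is_derive1_cont (Fd u _); rewrite lexx ltW.
  - by apply: cvg_at_left_filter; apply: is_derive1_cont (Fd v _); rewrite lexx ltW.
move=> x; rewrite in_itv /= => /andP[x1 x2]; rewrite derive1E.
by have [|_ ->] := Fd x; rewrite ?(ltW x1) ?(ltW x2).
Qed.

Section OpenInterval.
Variables (a b : R).
Hypothesis ab : a < b.
Variables (f F : R -> R).
Hypothesis cf : {within `]a, b[, continuous f}.
Hypothesis cF : {within `[a, b], continuous F}.
Hypothesis Fd : forall x, a < x < b -> is_derive x 1 F (f x).

(** The shift by three makes the step smaller than half the length, so every [[u n, v n]] is a
    nondegenerate interval inside []a, b[]. *)
Let u n : R := a + (b - a) / n.+3%:R.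
Let v n : R := b - (b - a) / n.+3%:R.
Let D n : set R := `[u n, v n]%classic.

Let sm n : 0 < (b - a) / n.+3%:R < (b - a) / 2.
Proof.
have h : 0 < b - a by rewrite subr_gt0.
by rewrite divr_gt0 ?ltr0n //= ltr_pM2l // ltf_pV2 ?posrE ?ltr0n // ltr_nat.
Qed.

Let uv n : u n < v n.
Proof. by move: (sm n); rewrite /u /v; set q := _ / n.+3%:R; lra. Qed.

Let au n : a < u n. Proof. by move: (sm n); rewrite /u; set q := _ / n.+3%:R; lra. Qed.
Let vb n : v n < b. Proof. by move: (sm n); rewrite /v; set q := _ / n.+3%:R; lra. Qed.

Let DS n : D n `<=` `]a, b[.
Proof.
move=> x; rewrite /D /= !in_itv /= => /andP[h1 h2].
by rewrite (lt_le_trans (au n) h1) (le_lt_trans h2 (vb n)).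
Qed.

Let small0 : (b - a) / n.+3%:R @[n --> \oo] --> 0.
Proof.
rewrite -[0](mulr0 (b - a)); apply: cvgM; first exact: cvg_cst.
have h : n.+1%:R^-1 @[n --> \oo] --> (0 : R) by exact: cvg_harmonic.
apply/cvgrPdist_lt => eps e0; have /cvgrPdist_lt/(_ _ e0) := h.
apply: filterS => n; rewrite !sub0r !normrN; apply: le_lt_trans.
by rewrite !ger0_norm ?invr_ge0 ?ler0n // lef_pV2 ?posrE ?ltr0n // ler_nat; lia.
Qed.

Let Fuv : F (v n) - F (u n) @[n --> \oo] --> F b - F a.
Proof.
have [ca cb] : (F (u n) @[n --> \oo] --> F a) /\ (F (v n) @[n --> \oo] --> F b).
  split; apply/cvgrPdist_lt => eps e0.
    have aI : `[a, b]%classic a by rewrite /= in_itv /= lexx ltW.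
    have [del d0 H] := within_epsE cF aI e0.
    have /cvgrPdist_lt/(_ _ d0) := small0; apply: filterS => n; rewrite sub0r normrN => hn.
    rewrite distrC; apply: H; last by rewrite /u addrAC subrr add0r.
    by rewrite /= in_itv /= (ltW (au n)) ltW // (lt_trans (uv n)).
  have bI : `[a, b]%classic b by rewrite /= in_itv /= lexx ltW.
  have [del d0 H] := within_epsE cF bI e0.
  have /cvgrPdist_lt/(_ _ d0) := small0; apply: filterS => n; rewrite sub0r normrN => hn.
  rewrite distrC; apply: H; last by rewrite /v addrAC subrr add0r normrN.
  by rewrite /= in_itv /= (ltW (vb n)) andbT ltW // (lt_trans (au n)).
exact: cvgB.
Qed.

Let DI n : (\int[leb]_(x in D n) (f x)%:E = (F (v n) - F (u n))%:E)%E.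
Proof.
apply: FTC_seg => //; first by apply: continuous_subspaceW cf; exact: DS.
move=> x /andP[h1 h2]; apply: Fd.
by rewrite (lt_le_trans (au n) h1) (le_lt_trans h2 (vb n)).
Qed.

Let Dev x : a < x < b -> \forall n \near \oo, D n x.
Proof.
move=> /andP[x1 x2].
have m0 : 0 < Num.min (x - a) (b - x) by rewrite lt_min !subr_gt0 x1.
have /cvgrPdist_lt/(_ _ m0) := small0; apply: filterS => n; rewrite sub0r normrN.
rewrite lt_min => /andP[/ltr_normlP[_ h1] /ltr_normlP[_ h2]].
by rewrite /D /= in_itv /= /u /v; move: h1 h2; set q := _ / n.+3%:R; lra.
Qed.

Let mDf n : measurable_fun `]a, b[ (f \_ (D n)).
Proof.
apply/(measurable_restrict _ _ _) => //; first exact: measurable_itv.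
by apply: measurable_funS (within_measurable cf) => //; exact: subIsetl.
Qed.

Let Dfc x : a < x < b -> (f \_ (D n)) x @[n --> \oo] --> f x.
Proof.
move=> /Dev h; apply: cvg_near_cst; apply: filterS h => n Dn.
by rewrite patchE mem_set.
Qed.

Let IDf n : (\int[leb]_(x in `]a, b[) ((f \_ (D n)) x)%:E = (F (v n) - F (u n))%:E)%E.
Proof.
rewrite -DI [in RHS](_ : D n = `]a, b[ `&` D n); last by rewrite setIidr.
rewrite integral_mkcondr; apply: eq_integral => x _.
by rewrite !patchE; case: ifP.
Qed.

(** Monotone convergence along the exhausting segments: integrability follows from the finite value.
    This serves the inverse square roots. *)
Lemma ge0_FTC_open : (forall x, a < x < b -> 0 <= f x) ->
  (\int[leb]_(x in `]a, b[) (f x)%:E = (F b - F a)%:E)%E.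
Proof.
move=> f0.
have h := @cvg_monotone_convergence _ _ _ leb `]a, b[%classic (oo_measurable a b)
  (fun n => EFin \o (f \_ (D n))).
have L : (\int[leb]_(x in `]a, b[) (EFin \o f \_ (D n)) x)%E @[n --> \oo] -->
    (\int[leb]_(x in `]a, b[) (f x)%:E)%E.
  rewrite [X in _ --> X](_ : _ = (\int[leb]_(x in `]a, b[) limn (fun n => (EFin \o f \_ (D n)) x))%E); last first.
    apply: eq_integral => x /set_mem; rewrite /= in_itv /= => xI; apply/esym/cvg_lim => //.
    by apply: cvg_EFin; [exact: nearW|exact: Dfc].
  apply: h.
  - by move=> n; apply/measurable_EFinP; exact: mDf.
  - move=> n x; rewrite /= in_itv /= => xI; rewrite lee_fin patchE; case: ifP => // _; exact: f0.
  - move=> x; rewrite /= in_itv /= => xI n k nk; rewrite lee_fin !patchE.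
    case: ifP => [/set_mem Dn|_]; last by case: ifP => // _; exact: f0.
    rewrite mem_set //; move: Dn; rewrite /D /= !in_itv /= => /andP[h1 h2].
    have : (b - a) / k.+3%:R <= (b - a) / n.+3%:R.
      by rewrite ler_wpM2l ?subr_ge0 ?(ltW ab) // lef_pV2 ?posrE ?ltr0n // ler_nat.
    move: h1 h2; rewrite /u /v; set q := _ / n.+3%:R; set q' := _ / k.+3%:R; lra.
have L2 : (\int[leb]_(x in `]a, b[) (EFin \o f \_ (D n)) x)%E @[n --> \oo] --> ((F b - F a)%:E)%E.
  under eq_cvg do rewrite IDf.
  by apply: cvg_EFin; [exact: nearW|exact: Fuv].
exact: cvg_unique L L2.
Qed.

Lemma ge0_integrable_open : (forall x, a < x < b -> 0 <= f x) -> leb.-integrable `]a, b[ (EFin \o f).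
Proof.
move=> f0; apply/integrableP; split; first by apply/measurable_EFinP; exact: within_measurable.
suff -> : (\int[leb]_(x in `]a, b[) `|(EFin \o f) x| = \int[leb]_(x in `]a, b[) (f x)%:E)%E.
  by rewrite ge0_FTC_open // ltry.
by apply: eq_integral => x /set_mem; rewrite /= in_itv /= => xI; rewrite ger0_norm // f0.
Qed.

(** The integrand may be unbounded at both ends; continuity of [F] on the closed interval supplies
    the two limits, and [|f|] dominates the truncations. *)
Lemma FTC_open : leb.-integrable `]a, b[ (EFin \o f) ->
  \int[leb]_(x in `]a, b[) f x = F b - F a.
Proof.
move=> fi.
have [|||_ L] := @Rintegral_dominated _ _ leb `]a, b[%classic (oo_measurable a b) (fun n => f \_ (D n)) f
  (fun x => `|f x|) mDf (within_measurable cf).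
- by move=> x; rewrite /= in_itv /=; exact: Dfc.
- exact: integrable_normr.
- by move=> n x _; rewrite patchE; case: ifP; rewrite ?normr0.
have L2 : (\int[leb]_(x in `]a, b[) (f \_ (D n)) x)%R @[n --> \oo] --> F b - F a.
  rewrite (_ : (fun n => _) = (fun n => F (v n) - F (u n))); first exact: Fuv.
  by apply/funext => n; rewrite /Rintegral IDf.
exact: cvg_unique L L2.
Qed.

End OpenInterval.

Lemma sqrt_der x : 0 < x -> is_derive x 1 (@Num.sqrt R) (2 * Num.sqrt x)^-1.
Proof.
move=> x0; have := @is_derive1_powR R 2^-1 x x0.
have h : 0 < Num.sqrt x by rewrite sqrtr_gt0.
move=> /(der_ext (g := @Num.sqrt R) x0) H; apply: is_derive_eq; first apply: H.
  move=> u /ltr_normlP[h1 h2]; apply: powR12_sqrt; move: h1; lra.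
rewrite powRB ?(gt_eqF x0) ?implybT // powR12_sqrt ?(ltW x0) // powRr1 ?(ltW x0) //.
rewrite -{2}(sqr_sqrtr (ltW x0)); field.
by rewrite gt_eqF.
Qed.

Lemma invsqrt_right a b : a < b ->
  leb.-integrable `]a, b[ (EFin \o (fun x => (Num.sqrt (b - x))^-1)).
Proof.
move=> ab.
have Fd x : a < x < b -> is_derive x 1 (fun x => - 2 * Num.sqrt (b - x)) (Num.sqrt (b - x))^-1.
  move=> /andP[_ xb]; have h : 0 < b - x by rewrite subr_gt0.
  have := derZ (- 2) (@derComp R (@Num.sqrt R) (fun x => b - x) x _ _ (sqrt_der h) (derD (derC b x) (derN (derI x)))).
  move=> /is_derive_eq; apply; field.
  by rewrite gt_eqF // sqrtr_gt0.
apply: (@ge0_integrable_open a b ab _ (fun x => - 2 * Num.sqrt (b - x))).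
- apply: continuous_in_subspaceT => x /set_mem; rewrite /= in_itv /= => /andP[_ xb].
  have h : 0 < Num.sqrt (b - x) by rewrite sqrtr_gt0 subr_gt0.
  apply: cvgV; first by rewrite gt_eqF.
  apply: (@continuous_comp _ _ _ (fun x => b - x) (@Num.sqrt R)); last exact: sqrt_continuous.
  by apply: cvgB; [exact: cvg_cst|exact: cvg_id].
- apply: continuous_subspaceT => x; apply: cvgM; first exact: cvg_cst.
  apply: (@continuous_comp _ _ _ (fun x => b - x) (@Num.sqrt R)); last exact: sqrt_continuous.
  by apply: cvgB; [exact: cvg_cst|exact: cvg_id].
- by move=> x _; rewrite invr_ge0 sqrtr_ge0.
Qed.

Lemma invsqrt_left a b : a < b ->
  leb.-integrable `]a, b[ (EFin \o (fun x => (Num.sqrt (x - a))^-1)).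
Proof.
move=> ab.
have Fd x : a < x < b -> is_derive x 1 (fun x => 2 * Num.sqrt (x - a)) (Num.sqrt (x - a))^-1.
  move=> /andP[xa _]; have h : 0 < x - a by rewrite subr_gt0.
  have := derZ 2 (@derComp R (@Num.sqrt R) (fun x => x - a) x _ _ (sqrt_der h) (derD (derI x) (derC (- a) x))).
  move=> /is_derive_eq; apply; field.
  by rewrite gt_eqF // sqrtr_gt0.
apply: (@ge0_integrable_open a b ab _ (fun x => 2 * Num.sqrt (x - a))).
- apply: continuous_in_subspaceT => x /set_mem; rewrite /= in_itv /= => /andP[xb _].
  have h : 0 < Num.sqrt (x - a) by rewrite sqrtr_gt0 subr_gt0.
  apply: cvgV; first by rewrite gt_eqF.
  apply: (@continuous_comp _ _ _ (fun x => x - a) (@Num.sqrt R)); last exact: sqrt_continuous.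
  by apply: cvgB; [exact: cvg_id|exact: cvg_cst].
- apply: continuous_subspaceT => x; apply: cvgM; first exact: cvg_cst.
  apply: (@continuous_comp _ _ _ (fun x => x - a) (@Num.sqrt R)); last exact: sqrt_continuous.
  by apply: cvgB; [exact: cvg_id|exact: cvg_cst].
- by move=> x _; rewrite invr_ge0 sqrtr_ge0.
Qed.

(** Writing [ln u = 2 * ln (sqrt u)] and using that the logarithm is below the identity bounds the
    negative part by an inverse square root, which is integrable. *)
Lemma norm_ln_le (u K : R) : 0 < u -> u <= K -> 1 <= K -> `|ln u| <= 2 * (Num.sqrt u)^-1 + ln K.
Proof.
move=> u0 uK K1; have s0 : 0 < Num.sqrt u by rewrite sqrtr_gt0.
have lK : 0 <= ln K by exact: ln_ge0.
have E : ln u = 2 * ln (Num.sqrt u).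
  by rewrite -{1}(sqr_sqrtr (ltW u0)) lnXn // mulr2n; ring.
apply/ler_normlP; split.
  rewrite E -mulrN -lnV ?posrE // ler_wpDr // ler_wpM2l //.
  by apply: ltW; apply: ln_sublinear; rewrite invr_gt0.
have : ln u <= ln K by rewrite ler_ln ?posrE // (lt_le_trans ltr01 K1).
by move/le_trans; apply; rewrite lerDr mulr_ge0 // invr_ge0 sqrtr_ge0.
Qed.

Lemma integrable_ln_dist a b x : a < x < b ->
  leb.-integrable `]a, b[ (EFin \o (fun y => ln `|y - x|)).
Proof.
move=> /andP[ax xb]; pose K := (b - a) + 1.
have K1 : 1 <= K by rewrite /K lerDr subr_ge0 ltW // (lt_trans ax).
have mf (D : set R) : measurable D -> measurable_fun D (fun y : R => ln `|y - x|).
  move=> mD; apply: measurable_funS (_ : measurable_fun setT _) => //.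
  apply: measurableT_comp; first exact: measurable_ln.
  apply: measurableT_comp; first exact: normr_measurable.
  by apply: measurable_funB; [exact: measurable_id|exact: measurable_cst].
(* [Num.sqrt] vanishes on negative reals and [0^-1 = 0], so the formula is its own extension by zero
   from one side of [x] to the whole interval. *)
have i1 : leb.-integrable `]a, b[ (EFin \o (fun y => (Num.sqrt (x - y))^-1)).
  have := invsqrt_right ax.
  have -> : `]a, x[%classic = `]a, b[ `&` `]a, x[ :> set R.
    rewrite setIidr // => y; rewrite /= !in_itv /= => /andP[-> h].
    by rewrite (lt_trans h).
  move=> /integrable_restrict -/(_ (oo_measurable a x) (oo_measurable a b)).
  apply: eq_integrable => // y /set_mem; rewrite /= in_itv /= => /andP[ya _]; rewrite patchE.
  case: ifP => // /negbT; rewrite notin_setE /= in_itv /= ya /= => /negP; rewrite -leNgt => xy.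
  by rewrite ler0_sqrtr ?subr_le0 // invr0.
have i2 : leb.-integrable `]a, b[ (EFin \o (fun y => (Num.sqrt (y - x))^-1)).
  have := invsqrt_left xb.
  have -> : `]x, b[%classic = `]a, b[ `&` `]x, b[ :> set R.
    rewrite setIidr // => y; rewrite /= !in_itv /= => /andP[h ->].
    by rewrite (lt_trans ax).
  move=> /integrable_restrict -/(_ (oo_measurable x b) (oo_measurable a b)).
  apply: eq_integrable => // y /set_mem; rewrite /= in_itv /= => /andP[_ yb]; rewrite patchE.
  case: ifP => // /negbT; rewrite notin_setE /= in_itv /= yb andbT => /negP; rewrite -leNgt => xy.
  by rewrite ler0_sqrtr ?subr_le0 // invr0.
apply: (@integrable_le _ _ leb _ (oo_measurable a b) _
  (fun y => 2 * (Num.sqrt (x - y))^-1 + (2 * (Num.sqrt (y - x))^-1 + ln K))).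
- exact: mf.
- apply: integrableDr => //; first exact: integrableZr.
  by apply: integrableDr => //; [exact: integrableZr|exact: integrable_cst_oo].
move=> y; rewrite /= in_itv /= => /andP[h1 h2].
have lK : 0 <= ln K by exact: ln_ge0.
case: (ltgtP y x) => h.
- rewrite distrC [X in ln X]gtr0_norm ?subr_gt0 //.
  have := @norm_ln_le (x - y) K; rewrite subr_gt0 => /(_ h) H.
  rewrite (_ : 2 * (Num.sqrt (y - x))^-1 = 0) ?add0r; last first.
    by rewrite ler0_sqrtr ?subr_le0 ?(ltW h) // invr0 mulr0.
  by apply: H => //; rewrite /K; move: h1 xb; lra.
- rewrite [X in ln X]gtr0_norm ?subr_gt0 //.
  have := @norm_ln_le (y - x) K; rewrite subr_gt0 => /(_ h) H.
  rewrite (_ : 2 * (Num.sqrt (x - y))^-1 = 0) ?add0r; last first.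
    by rewrite ler0_sqrtr ?subr_le0 ?(ltW h) // invr0 mulr0.
  by apply: H => //; rewrite /K; move: h2 ax; lra.
- by rewrite h subrr normr0 ln0 // normr0 sqrtr0 invr0 mulr0 !add0r.
Qed.

End Integration.

(** * Integrals of complex functions *)

Section ComplexIntegral.
Variable R : realType.
Local Notation C := R[i].
Variables (d : measure_display) (T : measurableType d) (m : {measure set T -> \bar R}) (D : set T).
Hypothesis mD : measurable D.
Implicit Types (f g : T -> C).

Definition cint f := m.-integrable D (EFin \o (fun x => Re (f x))) /\
  m.-integrable D (EFin \o (fun x => Im (f x))).

Definition cI f : C := locked_with expC_key
  (Complex (\int[m]_(x in D) Re (f x)) (\int[m]_(x in D) Im (f x))).

Lemma Re_cI f : Re (cI f) = \int[m]_(x in D) Re (f x).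
Proof. by rewrite /cI unlock. Qed.
Lemma Im_cI f : Im (cI f) = \int[m]_(x in D) Im (f x).
Proof. by rewrite /cI unlock. Qed.

Lemma cintD f g : cint f -> cint g -> cint (fun x => f x + g x).
Proof.
move=> [h1 h2] [h3 h4]; split.
  have := integrableDr mD h1 h3; apply: eq_integrable => // x _ /=; by rewrite ReD.
have := integrableDr mD h2 h4; apply: eq_integrable => // x _ /=; by rewrite ImD.
Qed.

Lemma cintZ (c : C) f : cint f -> cint (fun x => c * f x).
Proof.
move=> [h1 h2]; split.
  have := integrableDr mD (integrableZr mD (Re c) h1) (integrableZr mD (- Im c) h2).
  by apply: eq_integrable => // x _ /=; rewrite ReM mulNr.
have := integrableDr mD (integrableZr mD (Re c) h2) (integrableZr mD (Im c) h1).
by apply: eq_integrable => // x _ /=; rewrite ImM.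
Qed.

Lemma cID f g : cint f -> cint g -> cI (fun x => f x + g x) = cI f + cI g.
Proof.
move=> [h1 h2] [h3 h4]; apply: complex_ext; rewrite !(ReD, ImD, Re_cI, Im_cI).
  rewrite -(RintegralD mD h1 h3); apply: eq_Rintegral => x _; by rewrite ReD.
rewrite -(RintegralD mD h2 h4); apply: eq_Rintegral => x _; by rewrite ImD.
Qed.

Lemma cIZ (c : C) f : cint f -> cI (fun x => c * f x) = c * cI f.
Proof.
move=> [h1 h2]; apply: complex_ext; rewrite !(ReM, ImM, Re_cI, Im_cI).
  rewrite -(RintegralZl (Re c) mD h1) -(RintegralZl (Im c) mD h2).
  rewrite -(RintegralB mD (integrableZr mD _ h1) (integrableZr mD _ h2)).
  by apply: eq_Rintegral => x _; rewrite ReM.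
rewrite -(RintegralZl (Re c) mD h2) -(RintegralZl (Im c) mD h1).
rewrite -(RintegralD mD (integrableZr mD _ h2) (integrableZr mD _ h1)).
by apply: eq_Rintegral => x _; rewrite ImM.
Qed.

(** The factor [2] comes from estimating the real and imaginary parts separately. *)
Lemma cI_le f (g : T -> R) : cint f -> m.-integrable D (EFin \o g) ->
  (forall x, D x -> cmod (f x) <= g x) -> cmod (cI f) <= 2 * \int[m]_(x in D) g x.
Proof.
move=> [h1 h2] h3 fg; apply: le_trans (cmod_le_RI _) _; rewrite Re_cI Im_cI mulr2n mulrDl mul1r.
apply: lerD; apply: le_Rintegral_norm => // x Dx; apply: le_trans (fg _ Dx).
  exact: Re_le_cmod.
exact: Im_le_cmod.
Qed.

(** Differentiation under the integral sign: a quadratic remainder with an integrable constant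
    passes to the integral directly. *)
Lemma qd_cI (k k1 : C -> T -> C) (z : C) (M r : R) (g : T -> R) : 0 < r ->
  (forall w, cmod (w - z) < r -> cint (k w)) -> cint (k1 z) ->
  m.-integrable D (EFin \o g) ->
  (forall w x, D x -> cmod (w - z) < r ->
     cmod (k w x - k z x - k1 z x * (w - z)) <= M * cmod (w - z) ^+ 2 * g x) ->
  qd (fun w => cI (k w)) z (cI (k1 z)).
Proof.
move=> r0 ik ik1 ig H.
apply: (@qdI R _ _ _ (2 * (M * \int[m]_(x in D) g x)) r) => // w wr.
have iz : cint (k z) by apply: ik; rewrite subrr cmod0.
have i1 := cintZ (-1) iz; have i2 := cintZ (- (w - z)) ik1.
have -> : cI (k w) - cI (k z) - cI (k1 z) * (w - z) =
    cI (fun x => k w x + (-1) * k z x + (- (w - z)) * k1 z x).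
  rewrite (cID (cintD (ik _ wr) i1) i2) (cID (ik _ wr) i1) !cIZ //; ring.
have := @cI_le (fun x => k w x + (-1) * k z x + (- (w - z)) * k1 z x)
  (fun x => (M * cmod (w - z) ^+ 2) * g x) (cintD (cintD (ik _ wr) i1) i2) (integrableZr mD _ ig).
rewrite RintegralZl //.
have -> : 2 * (M * \int[m]_(x in D) g x) * cmod (w - z) ^+ 2 =
  2 * (M * cmod (w - z) ^+ 2 * \int[m]_(x in D) g x) by ring.
apply=> x Dx; have := H _ _ Dx wr; congr (cmod _ <= _); ring.
Qed.

End ComplexIntegral.

(** * Cauchy transforms and Poisson integrals in a real coordinate *)

Section CauchyTransform.
Variable R : realType.
Local Notation C := R[i].
Local Notation leb := (@lebesgue_measure R).
Variables (a b : R) (p Y Y1 : R -> R).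
Hypothesis ab : a < b.
Hypothesis cp : {within `[a, b], continuous p}.
Hypothesis Yd : forall y, a <= y <= b -> is_derive y 1 Y (Y1 y).
Hypothesis cY1 : {within `[a, b], continuous Y1}.
Hypothesis Y1_gt0 : forall y, a <= y <= b -> 0 < Y1 y.
Implicit Types (z w : C) (t y : R).

Let cY : {within `[a, b], continuous Y}.
Proof.
by apply: derivable_within_continuous => x; rewrite in_itv /= => /Yd[].
Qed.

Let oo_cc y : `]a, b[%classic y -> a <= y <= b.
Proof. by rewrite /= in_itv /= => /andP[/ltW -> /ltW ->]. Qed.

Let q y := p y * Y1 y.

Let cq : {within `[a, b], continuous q}.
Proof. by move=> x; apply: cvgM; [exact: cp|exact: cY1]. Qed.

Let bounded_cc (f : R -> R) : {within `[a, b], continuous f} ->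
  exists2 B, 0 < B & forall y, a <= y <= b -> `|f y| <= B.
Proof.
move=> cf.
have [c1 _ H1] := EVT_max (ltW ab) cf; have [c2 _ H2] := EVT_min (ltW ab) cf.
exists (`|f c1| + `|f c2| + 1); first by rewrite ltr_wpDl // addr_ge0.
move=> y yI; have h1 : f y <= f c1 by apply: H1; rewrite in_itv.
have h2 : f c2 <= f y by apply: H2; rewrite in_itv.
have := ler_norm (f c1); have := ler_norm (- f c2); rewrite normrN.
have := normr_ge0 (f c1); have := normr_ge0 (f c2).
by move=> *; apply/ler_normlP; split; lra.
Qed.

(** [CT] is the Cauchy transform of the density [p] with respect to [dY]; the Jacobian [Y1] is
    absorbed in [q]. *)
Definition CK z y : C := (q y)%:C / (z - (Y y)%:C).
Definition CK1 z y : C := - (q y)%:C / (z - (Y y)%:C) ^+ 2.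
Definition CK2 z y : C := 2 * (q y)%:C / (z - (Y y)%:C) ^+ 3.
Definition CT z : C := cI leb `]a, b[ (CK z).
Definition CT1 z : C := cI leb `]a, b[ (CK1 z).
Definition CT2 z : C := cI leb `]a, b[ (CK2 z).

Lemma Im_sub_le z y : `|Im z| <= cmod (z - y%:C).
Proof. by apply: le_trans (Im_le_cmod _); rewrite !ReIm subr0. Qed.

Lemma Im_sub_neq0 z y : Im z != 0 -> z - y%:C != 0.
Proof. by move=> h; rewrite Im_neq0 // !ReIm subr0. Qed.

Definition ccont (f : R -> C) := {within `[a, b], continuous (fun y => Re (f y))} /\
  {within `[a, b], continuous (fun y => Im (f y))}.

Lemma ccont_real (f : R -> R) : {within `[a, b], continuous f} -> ccont (fun y => (f y)%:C).
Proof. by move=> h; split => // x; exact: cvg_cst. Qed.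

Lemma ccont_cst (c : C) : ccont (fun=> c).
Proof. by split => x; exact: cvg_cst. Qed.

Lemma ccontD (f g : R -> C) : ccont f -> ccont g -> ccont (fun y => f y + g y).
Proof.
move=> [h1 h2] [h3 h4]; split.
  rewrite (_ : (fun y => Re (f y + g y)) = (fun y => Re (f y) + Re (g y))); last by apply/funext => y; rewrite ReD.
  by move=> x; apply: cvgD; [exact: h1|exact: h3].
rewrite (_ : (fun y => Im (f y + g y)) = (fun y => Im (f y) + Im (g y))); last by apply/funext => y; rewrite ImD.
by move=> x; apply: cvgD; [exact: h2|exact: h4].
Qed.

Lemma ccontM (f g : R -> C) : ccont f -> ccont g -> ccont (fun y => f y * g y).
Proof.
move=> [h1 h2] [h3 h4]; split.
  rewrite (_ : (fun y => Re (f y * g y)) = (fun y => Re (f y) * Re (g y) - Im (f y) * Im (g y))); last by apply/funext => y; rewrite ReM.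
  move=> x.
  by apply: cvgB; apply: cvgM; [exact: h1|exact: h3|exact: h2|exact: h4].
rewrite (_ : (fun y => Im (f y * g y)) = (fun y => Re (f y) * Im (g y) + Im (f y) * Re (g y))); last by apply/funext => y; rewrite ImM.
move=> x.
by apply: cvgD; apply: cvgM; [exact: h1|exact: h4|exact: h2|exact: h3].
Qed.

Lemma ccontV (f : R -> C) : (forall y, a <= y <= b -> f y != 0) -> ccont f -> ccont (fun y => (f y)^-1).
Proof.
move=> f0 [h1 h2].
have n0 x : a <= x <= b -> Re (f x) ^+ 2 + Im (f x) ^+ 2 != 0.
  by move=> /f0; rewrite -cmod_sqr expf_eq0 /= cmod_eq0.
have hs : {within `[a, b], continuous (fun y => (Re (f y) ^+ 2 + Im (f y) ^+ 2)^-1)}.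
  apply/subspace_continuousP => x xI.
  have /subspace_continuousP/(_ _ xI) g1 := h1; have /subspace_continuousP/(_ _ xI) g2 := h2.
  apply: cvgV; first by apply: n0; move: xI; rewrite /= in_itv.
  by apply: cvgD; apply: cvgM.
split.
  rewrite (_ : (fun y => Re (f y)^-1) = (fun y => Re (f y) * (Re (f y) ^+ 2 + Im (f y) ^+ 2)^-1)); last by apply/funext => y; rewrite ReV.
  move=> x.
  by apply: cvgM; [exact: h1|exact: hs].
rewrite (_ : (fun y => Im (f y)^-1) = (fun y => - Im (f y) * (Re (f y) ^+ 2 + Im (f y) ^+ 2)^-1)); last by apply/funext => y; rewrite ImV.
move=> x.
by apply: cvgM; [apply: cvgN; exact: h2|exact: hs].
Qed.

Lemma ccont_cint (f : R -> C) : ccont f -> cint leb `]a, b[ f.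
Proof. by move=> [h1 h2]; split; exact: integrable_cc_oo. Qed.

Lemma ccont_zY z : ccont (fun y => z - (Y y)%:C).
Proof.
apply: ccontD; first exact: ccont_cst.
have -> : (fun y => - (Y y)%:C) = (fun y => (- Y y)%:C :> C) by apply/funext => y; rewrite rmorphN.
by apply: ccont_real => x; apply: cvgN; exact: cY.
Qed.

Lemma ccont_zYV z : Im z != 0 -> ccont (fun y => (z - (Y y)%:C)^-1).
Proof. by move=> z0; apply: ccontV; [move=> y _; exact: Im_sub_neq0|exact: ccont_zY]. Qed.

Lemma CK_cint z : Im z != 0 -> cint leb `]a, b[ (CK z).
Proof.
by move=> z0; apply: ccont_cint; apply: ccontM; [exact: ccont_real|exact: ccont_zYV].
Qed.

Lemma CK1_cint z : Im z != 0 -> cint leb `]a, b[ (CK1 z).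
Proof.
move=> z0; apply: ccont_cint.
have -> : CK1 z = (fun y => (-1) * (q y)%:C * ((z - (Y y)%:C)^-1 * (z - (Y y)%:C)^-1)).
  by apply/funext => y; rewrite /CK1 expr2 invfM mulN1r.
by apply: ccontM; [apply: ccontM; [exact: ccont_cst|exact: ccont_real]|apply: ccontM; exact: ccont_zYV].
Qed.

Lemma CK2_cint z : Im z != 0 -> cint leb `]a, b[ (CK2 z).
Proof.
move=> z0; apply: ccont_cint.
have -> : CK2 z = (fun y => 2 * (q y)%:C * ((z - (Y y)%:C)^-1 * ((z - (Y y)%:C)^-1 * (z - (Y y)%:C)^-1))).
  by apply/funext => y; rewrite /CK2 !exprS expr0 mulr1 !invfM.
by apply: ccontM; [apply: ccontM; [exact: ccont_cst|exact: ccont_real]|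
  do 2 (apply: ccontM; first exact: ccont_zYV); exact: ccont_zYV].
Qed.

Let near_Im z w : cmod (w - z) < `|Im z| / 2 -> `|Im z| / 2 < `|Im w|.
Proof.
move=> h; have := le_lt_trans (Im_le_cmod (w - z)) h; rewrite !ReIm => h1.
have := ler_distD (Im w) (Im z) 0; rewrite !subr0 distrC; move: h1; lra.
Qed.

Let near_neq0 z w : cmod (w - z) < `|Im z| / 2 -> Im w != 0.
Proof. by move=> /near_Im h; rewrite -normr_gt0 (le_lt_trans _ h) // divr_ge0. Qed.

Let inv_le z (e : R) y : 0 < e -> e <= `|Im z| -> cmod (z - (Y y)%:C)^-1 <= e^-1.
Proof.
move=> e0 h; rewrite cmodV lef_pV2 ?posrE //; first by apply: le_trans h _; exact: Im_sub_le.
by apply: lt_le_trans e0 _; apply: le_trans h _; exact: Im_sub_le.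
Qed.

Lemma qd_CT z : Im z != 0 -> qd CT z (CT1 z).
Proof.
move=> z0; have e0 : 0 < `|Im z| by rewrite normr_gt0.
have [B B0 HB] := bounded_cc cq.
pose e := `|Im z| / 2; have e1 : 0 < e by rewrite divr_gt0.
apply: (@qd_cI R _ _ leb _ (oo_measurable a b) CK CK1 z (e^-1 ^+ 3) e (cst B)) => //.
- by move=> w /near_neq0; exact: CK_cint.
- exact: CK1_cint.
- exact: integrable_cst_oo.
move=> w y yI wr.
have ez : e <= `|Im z| by rewrite /e ler_pdivrMr // ler_pMr // ler1n.
have ew : e <= `|Im w| by apply/ltW/near_Im.
have iz := inv_le y e1 ez; have iw := inv_le y e1 ew.
have nz := Im_sub_neq0 (Y y) z0; have nw := Im_sub_neq0 (Y y) (near_neq0 wr).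
have -> : CK w y - CK z y - CK1 z y * (w - z) =
  (q y)%:C * (w - z) ^+ 2 * ((w - (Y y)%:C)^-1 * ((z - (Y y)%:C)^-1 * (z - (Y y)%:C)^-1)).
  by rewrite /CK /CK1; field; rewrite nz nw.
rewrite !cmodM cmod_real.
have hq := HB _ (oo_cc yI).
have -> : e^-1 ^+ 3 * cmod (w - z) ^+ 2 * cst B y =
  (B * (cmod (w - z) * cmod (w - z))) * (e^-1 * (e^-1 * e^-1)) by rewrite /cst; ring.
by apply: ler_pM; rewrite ?mulr_ge0 ?cmod_ge0 //; [rewrite ler_wpM2r ?mulr_ge0 ?cmod_ge0|
  apply: ler_pM; rewrite ?mulr_ge0 ?cmod_ge0 //; apply: ler_pM; rewrite ?cmod_ge0].
Qed.

Lemma qd_CT1 z : Im z != 0 -> qd CT1 z (CT2 z).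
Proof.
move=> z0; have e0 : 0 < `|Im z| by rewrite normr_gt0.
have [B B0 HB] := bounded_cc cq.
pose e := `|Im z| / 2; have e1 : 0 < e by rewrite divr_gt0.
apply: (@qd_cI R _ _ leb _ (oo_measurable a b) CK1 CK2 z (3 * e^-1 ^+ 4) e (cst B)) => //.
- by move=> w /near_neq0; exact: CK1_cint.
- exact: CK2_cint.
- exact: integrable_cst_oo.
move=> w y yI wr.
have ez : e <= `|Im z| by rewrite /e ler_pdivrMr // ler_pMr // ler1n.
have ew : e <= `|Im w| by apply/ltW/near_Im.
have iz := inv_le y e1 ez; have iw := inv_le y e1 ew.
have nz := Im_sub_neq0 (Y y) z0; have nw := Im_sub_neq0 (Y y) (near_neq0 wr).
set A := (w - (Y y)%:C)^-1 in iw; set Z := (z - (Y y)%:C)^-1 in iz.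
have -> : CK1 w y - CK1 z y - CK2 z y * (w - z) =
  - ((q y)%:C * (w - z) ^+ 2 * (A * (Z * (Z * Z)) + A * (Z * (Z * Z)) + A * (A * (Z * Z)))).
  by rewrite /CK1 /CK2 /A /Z; field; rewrite nz nw.
rewrite cmodN [X in X <= _]cmodM cmodM cmod_real [cmod ((w - z) ^+ 2)]cmodM.
have hq := HB _ (oo_cc yI).
have -> : 3 * e^-1 ^+ 4 * cmod (w - z) ^+ 2 * cst B y =
  (B * (cmod (w - z) * cmod (w - z))) * (3 * e^-1 ^+ 4) by rewrite /cst; ring.
have h1 : cmod (A * (Z * (Z * Z))) <= e^-1 ^+ 4.
  rewrite !cmodM !exprS expr0 mulr1.
  by do 3 (apply: ler_pM; rewrite ?mulr_ge0 ?cmod_ge0 //).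
have h2 : cmod (A * (A * (Z * Z))) <= e^-1 ^+ 4.
  rewrite !cmodM !exprS expr0 mulr1.
  by do 3 (apply: ler_pM; rewrite ?mulr_ge0 ?cmod_ge0 //).
apply: ler_pM; rewrite ?mulr_ge0 ?cmod_ge0 //; first by rewrite ler_wpM2r ?mulr_ge0 ?cmod_ge0.
apply: le_trans (cmodD _ _) _; have := cmodD (A * (Z * (Z * Z))) (A * (Z * (Z * Z))).
by move: h1 h2; lra.
Qed.

Lemma CT_infty (eps : R) : 0 < eps -> exists K : R, forall z, Im z != 0 -> K < cmod z -> cmod (CT z) < eps.
Proof.
move=> e0; have [B B0 HB] := bounded_cc cq; have [B' B'0 HB'] := bounded_cc cY.
pose L := fine (leb `]a, b[%classic).
have EL : \int[leb]_(x in `]a, b[) cst B x = B * L by rewrite Rintegral_cst.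
exists (2 * B' + (4 * `|B * L| + 1) / eps) => z z0 zK.
have k0 : 0 < (4 * `|B * L| + 1) / eps by rewrite divr_gt0 // ltr_wpDl // mulr_ge0.
have cz : 0 < cmod z by move: zK k0 B'0; lra.
have h y : `]a, b[%classic y -> cmod (CK z y) <= 2 / cmod z * B.
  move=> yI; have hY := HB' _ (oo_cc yI); have hq := HB _ (oo_cc yI).
  have zl : cmod z / 2 <= cmod (z - (Y y)%:C).
    have := cmod_ler_dist z (Y y)%:C; rewrite cmod_real; move: zK k0 hY; lra.
  rewrite cmodM cmod_real cmodV mulrC; apply: ler_pM; rewrite ?invr_ge0 ?cmod_ge0 //.
  rewrite -[2 / _]invf_div lef_pV2 ?posrE ?divr_gt0 //.
  by apply: lt_le_trans zl; rewrite divr_gt0.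
have i0 : leb.-integrable `]a, b[ (EFin \o (fun y => 2 / cmod z * cst B y)).
  by apply: integrableZr; [exact: oo_measurable|exact: integrable_cst_oo].
have := @cI_le R _ _ leb _ (oo_measurable a b) (CK z) (fun y => 2 / cmod z * cst B y) (CK_cint z0) i0 h.
rewrite RintegralZl //; last exact: integrable_cst_oo.
rewrite EL => /le_lt_trans; apply.
have -> : 2 * (2 / cmod z * (B * L)) = 4 * (B * L) / cmod z by field; rewrite gt_eqF.
rewrite ltr_pdivrMr //.
have : (4 * `|B * L| + 1) / eps < cmod z by move: zK B'0; lra.
rewrite ltr_pdivrMr // mulrC; have := ler_norm (B * L); lra.
Qed.

(** This is [pi] times the Poisson kernel of the half-plane containing [z], at the boundary point
    [Y y]. *)
Definition PK z y : R := `|Im z| / ((Re z - Y y) ^+ 2 + Im z ^+ 2).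

Lemma PK_ge0 z y : 0 <= PK z y.
Proof. by rewrite divr_ge0 // addr_ge0 // sqr_ge0. Qed.

Lemma PK_den z y : Im z != 0 -> 0 < (Re z - Y y) ^+ 2 + Im z ^+ 2.
Proof. by move=> h; rewrite ltr_wpDl ?sqr_ge0 // exprn_even_gt0. Qed.

Lemma PK_cont z : Im z != 0 -> {within `[a, b], continuous (PK z)}.
Proof.
move=> z0; apply/subspace_continuousP => x xI.
have /subspace_continuousP/(_ _ xI) g := cY.
apply: cvgM; first exact: cvg_cst.
apply: cvgV; first by rewrite gt_eqF // PK_den.
apply: cvgD; last exact: cvg_cst.
by apply: cvgM; (apply: cvgB; [exact: cvg_cst|exact: g]).
Qed.

Lemma Im_CT z : Im z != 0 -> Im (CT z) = - (Num.sg (Im z) * \int[leb]_(y in `]a, b[) (PK z y * q y)).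
Proof.
move=> z0; rewrite Im_cI.
have i : leb.-integrable `]a, b[ (EFin \o (fun y => PK z y * q y)).
  by apply: integrable_cc_oo => x; apply: cvgM; [exact: PK_cont|exact: cq].
rewrite -mulNr -RintegralZl //; apply: eq_Rintegral => y _.
rewrite /CK !(ReIm, ReV, ImV) subr0 mul0r addr0 /PK.
have -> : `|Im z| = Num.sg (Im z) * Im z by rewrite normrEsg.
have s2 : Num.sg (Im z) * Num.sg (Im z) = 1 by rewrite -expr2 sqr_sg z0.
have -> : - Num.sg (Im z) * (Num.sg (Im z) * Im z / ((Re z - Y y) ^+ 2 + Im z ^+ 2) * q y) =
  - ((Num.sg (Im z) * Num.sg (Im z)) * Im z / ((Re z - Y y) ^+ 2 + Im z ^+ 2) * q y) by ring.
by rewrite s2 mul1r; ring.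
Qed.

Lemma PK_mass z : Im z != 0 -> \int[leb]_(y in `]a, b[) (PK z y * Y1 y) =
  atan ((Y b - Re z) / `|Im z|) - atan ((Y a - Re z) / `|Im z|).
Proof.
move=> z0; have n0 : 0 < `|Im z| by rewrite normr_gt0.
apply: (@FTC_open R a b ab _ (fun y => atan ((Y y - Re z) / `|Im z|))).
- apply: (@continuous_subspaceW _ _ `]a, b[ `[a, b]); first by move=> y /oo_cc; rewrite /= in_itv.
  by move=> x; apply: cvgM; [exact: PK_cont|exact: cY1].
- apply: within_eps => x xI eps e0.
  have := @continuous_atan R ((Y x - Re z) / `|Im z|) => /for_epsE/(_ _ e0)[d1 d10 H1].
  have d2 : 0 < d1 * `|Im z| by rewrite mulr_gt0.
  have [d3 d30 H3] := within_epsE cY xI d2.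
  exists d3 => // y yI yx; apply: H1; rewrite -mulrBl normrM normfV normr_id.
  rewrite ltr_pdivrMr // (_ : Y y - Re z - (Y x - Re z) = Y y - Y x); first exact: H3.
  by ring.
- move=> y /andP[y1 y2]; have yI : a <= y <= b by rewrite !ltW.
  have := derM (derD (Yd yI) (derC (- Re z) y)) (derC (`|Im z|^-1) y).
  move=> /(@derComp R (@atan R) (fun y => (Y y - Re z) / `|Im z|) y _ _ (is_derive1_atan _)).
  move=> /is_derive_eq; apply; rewrite /PK -(real_normK (num_real (Im z))).
  have : (Re z - Y y) ^+ 2 + `|Im z| ^+ 2 != 0 by rewrite real_normK ?num_real // gt_eqF // PK_den.
  move=> nn; field; rewrite ?nn (gt_eqF n0) /=.
  have nn' : (Y y - Re z) ^+ 2 + `|Im z| ^+ 2 != 0 by move: nn; congr (_ != 0); ring.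
  by move: nn nn'; rewrite ?andbT /= => nn nn'; try done; rewrite -?[_ == 0]/(_ == 0); move: nn'; congr (_ != 0); ring.
- by apply: integrable_cc_oo => x; apply: cvgM; [exact: PK_cont|exact: cY1].
Qed.

Lemma PK_mass_le z : Im z != 0 -> 0 <= \int[leb]_(y in `]a, b[) (PK z y * Y1 y) <= pi.
Proof.
move=> z0; apply/andP; split.
  by apply: Rintegral_ge0 => y /oo_cc yI; rewrite mulr_ge0 ?PK_ge0 // ltW // Y1_gt0.
rewrite PK_mass //.
have := atan_ltpi2 ((Y b - Re z) / `|Im z|); have := atan_gtNpi2 ((Y a - Re z) / `|Im z|).
set u := atan _; set v := atan _; lra.
Qed.

Lemma Y_mono x y : a <= x -> x < y -> y <= b -> Y x < Y y.
Proof.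
move=> ax xy yb; have [|c /andP[c1 c2] E] := MVT_cc (ltW xy) (_ : forall t, x <= t <= y -> is_derive t 1 Y (Y1 t)).
  by move=> t /andP[h1 h2]; apply: Yd; rewrite (le_trans ax h1) (le_trans h2 yb).
rewrite -subr_gt0 E mulr_gt0 ?subr_gt0 // Y1_gt0 //.
by rewrite (le_trans ax c1) (le_trans c2 yb).
Qed.

Lemma Y_sep t (eta : R) : a <= t <= b -> 0 < eta -> exists2 c, 0 < c &
  forall y, a <= y <= b -> eta <= `|y - t| -> c <= `|Y y - Y t|.
Proof.
move=> /andP[ta tb] e0.
have [m m0 Hm] : exists2 m, 0 < m & forall y, a <= y <= b -> m <= Y1 y.
  have [c cI H] := EVT_min (ltW ab) cY1; exists (Y1 c).
    by apply: Y1_gt0; move: cI; rewrite in_itv.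
  by move=> y yI; apply: H; rewrite in_itv.
have key x y : a <= x -> x <= y -> y <= b -> m * (y - x) <= Y y - Y x.
  move=> ax xy yb; have [|c /andP[c1 c2] ->] := MVT_cc xy (_ : forall t, x <= t <= y -> is_derive t 1 Y (Y1 t)).
    by move=> u /andP[h1 h2]; apply: Yd; rewrite (le_trans ax h1) (le_trans h2 yb).
  by rewrite ler_wpM2r ?subr_ge0 // Hm // (le_trans ax c1) (le_trans c2 yb).
exists (m * eta); first by rewrite mulr_gt0.
move=> y /andP[ya yb] h; have [yt|ty] := leP y t.
  rewrite distrC ger0_norm; last by apply: le_trans (key _ _ ya yt tb); rewrite mulr_ge0 ?subr_ge0 // ltW.
  apply: le_trans (key _ _ ya yt tb); rewrite ler_wpM2l ?(ltW m0) //.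
  by move: h; rewrite distrC ger0_norm // subr_ge0.
rewrite ger0_norm; last by apply: le_trans (key _ _ ta (ltW ty) yb); rewrite mulr_ge0 ?subr_ge0 ?(ltW ty) // ltW.
apply: le_trans (key _ _ ta (ltW ty) yb); rewrite ler_wpM2l ?(ltW m0) //.
by move: h; rewrite ger0_norm // subr_ge0 ltW.
Qed.

Lemma atan_large (eps : R) : 0 < eps -> exists2 K : R, 0 < K & forall u : R, K < u -> pi / 2 - eps < atan u.
Proof.
move=> e0; have [h|h] := leP eps (pi / 2); last first.
  exists 1 => // u u1; have : 0 < atan u by rewrite -atan0 lt_atan // (lt_trans ltr01).
  by move: h; lra.
have hI : pi / 2 - eps \in `](- (pi / 2)), (pi / 2)[.
  by rewrite in_itv /=; have := @pi_gt0 R; move: e0 h; lra.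
exists (`|tan (pi / 2 - eps)| + 1); first by rewrite ltr_wpDl.
move=> u hu; rewrite -[ltLHS](tanK hI); apply: lt_atan; apply: le_lt_trans hu.
by rewrite (le_trans (ler_norm _)) // lerDl.
Qed.

(** Near [t] the oscillation of [p] is small and the kernel has mass at most [pi]; away from [t] the
    kernel is of order [|Im z|]. The mass tends to [pi] only at interior points, which is why an
    endpoint is allowed only where [p] vanishes. *)
Lemma Poisson_limit t (eps : R) : a <= t <= b -> a < t < b \/ p t = 0 -> 0 < eps -> exists2 del : R, 0 < del &
  forall z, Im z != 0 -> cmod (z - (Y t)%:C) < del ->
    `|\int[leb]_(y in `]a, b[) (PK z y * q y) - pi * p t| < eps.
Proof.
move=> tI tI' e0; have p0 := @pi_gt0 R.
have tS : `[a, b]%classic t by rewrite /= in_itv.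
pose e1 := eps / 3 / pi; have e10 : 0 < e1 by rewrite !divr_gt0.
have [eta eta0 Heta] := within_epsE cp tS e10.
have [c c0 Hc] := Y_sep tI eta0.
have [B B0 HB] := bounded_cc cp.
pose L := \int[leb]_(y in `]a, b[) Y1 y.
have L0 : 0 <= L by apply: Rintegral_ge0 => y /oo_cc yI; rewrite ltW // Y1_gt0.
pose K := 8 * B / c ^+ 2 * L.
have K0 : 0 <= K by rewrite !mulr_ge0 ?invr_ge0 ?sqr_ge0 // ltW.
have [d2 d20 H2] : exists2 d2 : R, 0 < d2 & forall z, Im z != 0 -> cmod (z - (Y t)%:C) < d2 ->
    `|p t| * `|\int[leb]_(y in `]a, b[) (PK z y * Y1 y) - pi| < eps / 3.
  have [pt0|pt0] := eqVneq (p t) 0.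
    by exists 1 => // z _ _; rewrite pt0 normr0 mul0r !divr_gt0.
  have /andP[ta tb] := tI.
  have /andP[ta' tb'] : a < t < b by case: tI' => // E; rewrite E eqxx in pt0.
  have n0 : 0 < `|p t| by rewrite normr_gt0.
  have e20 : 0 < eps / 3 / `|p t| / 2 by rewrite !divr_gt0.
  have [M M0 HM] := atan_large e20.
  have g1 : 0 < Y t - Y a by rewrite subr_gt0 Y_mono.
  have g2 : 0 < Y b - Y t by rewrite subr_gt0 Y_mono.
  pose g := Num.min (Y t - Y a) (Y b - Y t).
  have g0 : 0 < g by rewrite lt_min g1.
  exists (Num.min (g / 2) (g / 2 / M)); first by rewrite lt_min !divr_gt0.
  move=> z z0; rewrite lt_min => /andP[z1 z2].
  have i0 : 0 < `|Im z| by rewrite normr_gt0.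
  have r1 : `|Re z - Y t| < g / 2.
    by apply: le_lt_trans z1; apply: le_trans (Re_le_cmod _); rewrite !ReIm.
  have i1 : `|Im z| < g / 2 / M by apply: le_lt_trans z2; exact: Im_sub_le.
  have [gg1 gg2] : g <= Y t - Y a /\ g <= Y b - Y t by split; rewrite ge_min lexx ?orbT.
  have key v : g / 2 < v -> pi / 2 - eps / 3 / `|p t| / 2 < atan (v / `|Im z|).
    move=> hv; apply: HM; rewrite ltr_pdivlMr //; apply: lt_trans hv.
    by rewrite mulrC -ltr_pdivlMr.
  have k1 := key (Y b - Re z); have k2 := key (Re z - Y a).
  rewrite mulrC -ltr_pdivlMr // PK_mass //.
  move: r1 => /ltr_normlP[r1 r2].
  have {}k1 : pi / 2 - eps / 3 / `|p t| / 2 < atan ((Y b - Re z) / `|Im z|) by apply: k1; move: r2 gg2; lra.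
  have {}k2 : pi / 2 - eps / 3 / `|p t| / 2 < - atan ((Y a - Re z) / `|Im z|).
    have -> : - atan ((Y a - Re z) / `|Im z|) = atan ((Re z - Y a) / `|Im z|) by rewrite -atanN; congr atan; ring.
    by apply: k2; move: r1 gg1; lra.
  have h1 := atan_ltpi2 ((Y b - Re z) / `|Im z|); have h2 := atan_gtNpi2 ((Y a - Re z) / `|Im z|).
  by apply/ltr_normlP; move: h1 h2 k1 k2; split; lra.
exists (Num.min d2 (Num.min (c / 2) (eps / 3 / (K + 1)))).
  by rewrite !lt_min d20 !divr_gt0 //= ltr_wpDl.
move=> z z0; rewrite !lt_min => /and3P[z2 zc zK].
have i0 : 0 < `|Im z| by rewrite normr_gt0.
have iz : `|Im z| < eps / 3 / (K + 1) by apply: le_lt_trans zK; exact: Im_sub_le.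
have I1 : leb.-integrable `]a, b[ (EFin \o (fun y => PK z y * Y1 y)).
  by apply: integrable_cc_oo => x; apply: cvgM; [exact: PK_cont|exact: cY1].
have IY : leb.-integrable `]a, b[ (EFin \o Y1) by exact: integrable_cc_oo.
have I2 : leb.-integrable `]a, b[ (EFin \o (fun y => PK z y * q y)).
  by apply: integrable_cc_oo => x; apply: cvgM; [exact: PK_cont|exact: cq].
have mo := oo_measurable a b.
have -> : \int[leb]_(y in `]a, b[) (PK z y * q y) - pi * p t =
  \int[leb]_(y in `]a, b[) (PK z y * q y - p t * (PK z y * Y1 y)) +
  p t * (\int[leb]_(y in `]a, b[) (PK z y * Y1 y) - pi).
  rewrite RintegralB //; last exact: integrableZr.
  by rewrite RintegralZl //; ring.
apply: le_lt_trans (ler_normD _ _) _; rewrite normrM.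
have h2 := H2 _ z0 z2.
suff : `|\int[leb]_(y in `]a, b[) (PK z y * q y - p t * (PK z y * Y1 y))| <= eps / 3 + eps / 3.
  by move: h2; lra.
have I3 : leb.-integrable `]a, b[ (EFin \o (fun y => PK z y * q y - p t * (PK z y * Y1 y))).
  by apply: integrableDr => //; apply: integrableNr => //; exact: integrableZr.
have I4 : leb.-integrable `]a, b[ (EFin \o (fun y => e1 * (PK z y * Y1 y) + 8 * B / c ^+ 2 * `|Im z| * Y1 y)).
  by apply: integrableDr => //; exact: integrableZr.
apply: le_trans (@le_Rintegral_norm R _ _ leb _ mo (fun y => PK z y * q y - p t * (PK z y * Y1 y))
  (fun y => e1 * (PK z y * Y1 y) + 8 * B / c ^+ 2 * `|Im z| * Y1 y) I3 I4 _) _.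
  move=> y /oo_cc yI; have Yy := Y1_gt0 yI.
  have -> : PK z y * q y - p t * (PK z y * Y1 y) = (PK z y * Y1 y) * (p y - p t) by rewrite /q; ring.
  have P0 : 0 <= PK z y * Y1 y by rewrite mulr_ge0 ?PK_ge0 // ltW.
  rewrite normrM (ger0_norm P0).
  have [hy|hy] := ltP `|y - t| eta.
    have : `|p y - p t| < e1 by apply: Heta => //; rewrite /= in_itv.
    move=> /ltW /(ler_wpM2l P0) /le_trans; apply.
    by rewrite mulrC lerDl !mulr_ge0 ?invr_ge0 ?sqr_ge0 // ltW.
  have hc := Hc _ yI hy.
  have zY : c / 2 <= `|Re z - Y y|.
    have r1 : `|Re z - Y t| < c / 2.
      by apply: le_lt_trans zc; apply: le_trans (Re_le_cmod _); rewrite !ReIm.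
    have := ler_distD (Re z) (Y y) (Y t); rewrite (distrC (Y y) (Re z)); move: r1 hc; lra.
  have PKl : PK z y <= `|Im z| * (4 / c ^+ 2).
    rewrite /PK ler_wpM2l // -[4 / _]invf_div lef_pV2 ?posrE ?divr_gt0 ?exprn_gt0 ?PK_den //.
    have : (c / 2) ^+ 2 <= (Re z - Y y) ^+ 2.
      by rewrite -(real_normK (num_real (Re z - Y y))) lerXn2r // nnegrE // divr_ge0 // ltW.
    have := sqr_ge0 (Im z); rewrite expr_div_n; lra.
  have pp : `|p y - p t| <= 2 * B.
    apply: le_trans (ler_normB _ _) _; have := HB _ yI; have := HB _ tI; lra.
  apply: (@le_trans _ _ (`|Im z| * (4 / c ^+ 2) * Y1 y * (2 * B))).
    apply: ler_pM => //; rewrite ler_wpM2r // ltW //.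
  have -> : `|Im z| * (4 / c ^+ 2) * Y1 y * (2 * B) = 8 * B / c ^+ 2 * `|Im z| * Y1 y by ring.
  by rewrite lerDr mulr_ge0 // ltW.
rewrite RintegralD //; try exact: integrableZr.
rewrite !RintegralZl //.
apply: lerD.
  have /andP[_ hm] := PK_mass_le z0.
  apply: (@le_trans _ _ (e1 * pi)); first by rewrite ler_wpM2l // ltW.
  by rewrite /e1 divfK // gt_eqF.
rewrite -/L (_ : 8 * B / c ^+ 2 * `|Im z| * L = K * `|Im z|); last by rewrite /K; ring.
apply: (@le_trans _ _ ((K + 1) * `|Im z|)); first by rewrite ler_wpM2r // lerDl.
by rewrite mulrC -ler_pdivlMr ?ltr_wpDl // ltW.
Qed.

Lemma Poisson_outside (x eps : R) : x < Y a \/ Y b < x -> 0 < eps -> exists2 del : R, 0 < del &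
  forall z, Im z != 0 -> cmod (z - x%:C) < del ->
    `|\int[leb]_(y in `]a, b[) (PK z y * q y)| < eps.
Proof.
move=> xo e0; have [B B0 HB] := bounded_cc cq.
pose c := if x < Y a then Y a - x else x - Y b.
have c0 : 0 < c.
  rewrite /c; case: ifP => [h|h]; first by rewrite subr_gt0.
  by case: xo => [h'|h']; [rewrite h' in h|rewrite subr_gt0].
have Yin y : a <= y <= b -> Y a <= Y y <= Y b.
  move=> /andP[h1 h2]; apply/andP; split.
    by move: h1; rewrite le_eqVlt => /orP[/eqP ->//|h1]; rewrite ltW // Y_mono.
  by move: h2; rewrite le_eqVlt => /orP[/eqP ->//|h2]; rewrite ltW // Y_mono.
have hc y : a <= y <= b -> c <= `|Y y - x|.
  move=> /Yin/andP[h1 h2]; rewrite /c; case: ifP => h.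
    by rewrite ger0_norm; move: h h1; lra.
  case: xo => h'; first by rewrite h' in h.
  by rewrite ler0_norm; move: h' h2; lra.
pose L := fine (leb `]a, b[%classic).
have L0 : 0 <= L by rewrite fine_ge0.
pose K := 4 * B / c ^+ 2 * L.
have K0 : 0 <= K by rewrite !mulr_ge0 ?invr_ge0 ?sqr_ge0 // ltW.
exists (Num.min (c / 2) (eps / (K + 1))); first by rewrite lt_min !divr_gt0 // ltr_wpDl.
move=> z z0; rewrite lt_min => /andP[zc zK].
have iz : `|Im z| < eps / (K + 1) by apply: le_lt_trans zK; exact: Im_sub_le.
have mo := oo_measurable a b.
have I2 : leb.-integrable `]a, b[ (EFin \o (fun y => PK z y * q y)).
  by apply: integrable_cc_oo => u; apply: cvgM; [exact: PK_cont|exact: cq].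
have I0 := integrable_cst_oo a b (`|Im z| * (4 / c ^+ 2) * B).
apply: (@le_lt_trans _ _ (\int[leb]_(y in `]a, b[) cst (`|Im z| * (4 / c ^+ 2) * B) y)).
  apply: (@le_Rintegral_norm R _ _ leb _ mo _ (cst (`|Im z| * (4 / c ^+ 2) * B)) I2 I0).
  move=> y /oo_cc yI.
  have zY : c / 2 <= `|Re z - Y y|.
    have r1 : `|Re z - x| < c / 2.
      by apply: le_lt_trans zc; apply: le_trans (Re_le_cmod _); rewrite !ReIm.
    have := hc _ yI; have := ler_distD (Re z) (Y y) x; rewrite (distrC (Y y) (Re z)); move: r1; lra.
  rewrite normrM ger0_norm ?PK_ge0 //; apply: ler_pM; rewrite ?PK_ge0 //; last exact: HB.
  rewrite /PK ler_wpM2l // -[4 / _]invf_div lef_pV2 ?posrE ?divr_gt0 ?exprn_gt0 ?PK_den //.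
  have : (c / 2) ^+ 2 <= (Re z - Y y) ^+ 2.
    by rewrite -(real_normK (num_real (Re z - Y y))) lerXn2r // nnegrE // divr_ge0 // ltW.
  have := sqr_ge0 (Im z); rewrite expr_div_n; lra.
rewrite Rintegral_cst // -/L (_ : _ * L = K * `|Im z|); last by rewrite /K; ring.
apply: (@le_lt_trans _ _ ((K + 1) * `|Im z|)); first by rewrite ler_wpM2r // lerDl.
by rewrite mulrC -ltr_pdivlMr ?ltr_wpDl.
Qed.

End CauchyTransform.

(** * Conformal coordinates on the two sides of the curve *)

Section CurveData.
Variable R : realType.
Local Notation C := R[i].

Lemma ReB (z w : C) : Re (z - w) = Re z - Re w. Proof. by rewrite ReD ReN. Qed.
Lemma ImB (z w : C) : Im (z - w) = Im z - Im w. Proof. by rewrite ImD ImN. Qed.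

(* [ea], [eb] are the critical points, [Ip] parametrizes the upper curve by the
   (real) value of the map, here [expC (ell s)] *)
Record curve_data (theta c1 d ea eb : R) (Ip : R -> C) : Prop := CurveData {
  cd_theta : 1 < theta;
  cd_c1 : 0 < c1;
  cd_d : 1 < d;
  cd_sum : ea + eb = - (1 - theta^-1);
  cd_prod : ea * eb = - (theta^-1 * d);
  cd_ea : ea < -1;
  cd_eb : 0 < eb;
  cd_lt : lr theta c1 d ea < lr theta c1 d eb;
  cd_Ia : Ip (expR (lr theta c1 d ea)) = ea%:C;
  cd_Ib : Ip (expR (lr theta c1 d eb)) = eb%:C;
  cd_Re : {within `[expR (lr theta c1 d ea), expR (lr theta c1 d eb)], continuous (fun y => Re (Ip y))};
  cd_Im : {within `[expR (lr theta c1 d ea), expR (lr theta c1 d eb)], continuous (fun y => Im (Ip y))};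
  cd_H : forall y : R, expR (lr theta c1 d ea) < y < expR (lr theta c1 d eb) -> 0 < Im (Ip y);
  cd_ell : forall y : R, expR (lr theta c1 d ea) < y < expR (lr theta c1 d eb) ->
    ell theta c1 d (Ip y) = (ln y)%:C;
  cd_der : forall y : R, expR (lr theta c1 d ea) < y < expR (lr theta c1 d eb) ->
    exists e, cder Ip y e }.

Variables (theta c1 d ea eb : R) (Ip : R -> C).
Hypothesis HD : curve_data theta c1 d ea eb Ip.
Let kap := theta^-1.
Let a := expR (lr theta c1 d ea).
Let b := expR (lr theta c1 d eb).
Local Notation ell := (ell theta c1 d).
Local Notation ell1 := (ell1 theta d).
Local Notation ellX := (ellX theta c1 d).
Local Notation lr := (lr theta c1 d).
Local Notation radX := (radX d).
Let th1 : 1 < theta := cd_theta HD.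
Let c10 : 0 < c1 := cd_c1 HD.
Let d1 : 1 < d := cd_d HD.
Implicit Types (s w z : C) (x y t : R).
Let th0 : 0 < theta. Proof. exact: lt_trans ltr01 th1. Qed.
Let kap0 : 0 < kap. Proof. by rewrite /kap invr_gt0. Qed.

Lemma cd_a0 : 0 < a. Proof. exact: expR_gt0. Qed.
Lemma cd_ab : a < b. Proof. by rewrite ltr_expR (cd_lt HD). Qed.

Lemma curve_pt s : 0 < Im s -> Im (ell s) = 0 ->
  exists2 t, a < t < b & s = Ip t /\ ell s = (ln t)%:C.
Proof.
move=> s0 h; have /andP[h1 h2] := curve_range th1 c10 d1 (cd_sum HD) (cd_prod HD) (cd_ea HD) (cd_eb HD) (cd_lt HD) s0 h.
have tI : a < expR (Re (ell s)) < b by rewrite !ltr_expR h1.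
have E : ell s = (ln (expR (Re (ell s))))%:C by apply: complex_ext; rewrite ?expRK ?ReC ?ImC.
exists (expR (Re (ell s))) => //; split=> //.
apply: (@ell_inj R theta c1 d th1 d1 _ _ s0 (cd_H HD tI)).
by rewrite (cd_ell HD tI) {1}E.
Qed.

Lemma Re_ell s : 0 < Im s ->
  Re (ell s) = ln c1 + ln (cmod (s + d%:C)) + kap * (ln (cmod (s + 1)) - ln (cmod s)).
Proof.
move=> s0; rewrite /ell !ReIm mul0r subr0 !Re_Lg ?Im_shift1 ?Im_shift //.
Qed.

Let cmod_shift s x : 0 < Im s -> 0 < cmod (s + x%:C).
Proof. by move=> s0; rewrite cmod_gt0 H_neq0 // Im_shift. Qed.
Let cmod_shift1 s : 0 < Im s -> 0 < cmod (s + 1).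
Proof. by move=> s0; rewrite cmod_gt0 H_neq0 // Im_shift1. Qed.
Let cmod_H s : 0 < Im s -> 0 < cmod s.
Proof. by move=> s0; rewrite cmod_gt0 H_neq0. Qed.

Let ln_lt (u v : R) : 0 < u -> u < v -> ln u < ln v.
Proof. by move=> u0 uv; rewrite ltr_ln ?posrE // (lt_trans u0). Qed.
Let ln_le (u v : R) : 0 < u -> u <= v -> ln u <= ln v.
Proof. by move=> u0 uv; rewrite ler_ln ?posrE // (lt_le_trans u0). Qed.

Let cmod_lo s x : `|x| - cmod s <= cmod (s + x%:C).
Proof. have := cmod_ler_dist x%:C (- s); rewrite opprK cmodN cmod_real [x%:C + s]addrC; lra. Qed.
Let cmod_lo' s x : cmod s - `|x| <= cmod (s + x%:C).
Proof. have := cmod_ler_dist s (- x%:C); rewrite opprK cmodN cmod_real; lra. Qed.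
Let cmod_hi s x : cmod (s + x%:C) <= cmod s + `|x|.
Proof. by have := cmodD s x%:C; rewrite cmod_real. Qed.

Let one_C : (1 : C) = 1%:C. Proof. by []. Qed.

Lemma ell_inf (K : R) : exists M : R, forall s, 0 < Im s -> M < cmod s -> K < Re (ell s).
Proof.
pose L := K - ln c1 + kap * ln 2.
exists (2 * d + 2 + 2 * expR L) => s s0 hs; rewrite Re_ell //.
have := expR_gt0 L => eL.
have h1 : cmod s / 2 < cmod (s + d%:C).
  have := cmod_lo' s d; rewrite ger0_norm ?(ltW (lt_trans ltr01 d1)) //; move: hs eL; lra.
have h2 : cmod s / 2 < cmod (s + 1).
  have := cmod_lo' s 1; rewrite normr1 -one_C; move: hs eL d1; lra.
have c2 : 0 < cmod s / 2 by rewrite divr_gt0 // cmod_H.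
have k1 := ln_lt c2 h1; have k2 := ln_lt c2 h2.
have k3 : L < ln (cmod s / 2) by rewrite -[L]expRK; apply: ln_lt => //; move: hs d1; lra.
rewrite [ln (_ / _)]ln_div ?posrE ?cmod_H // in k2.
have : kap * (- ln 2) <= kap * (ln (cmod (s + 1)) - ln (cmod s)) by rewrite ler_pM2l //; move: k2; lra.
by move: k1 k3; rewrite /L; lra.
Qed.

Lemma ell_zero (K : R) : exists2 r : R, 0 < r & forall s, 0 < Im s -> cmod s < r -> K < Re (ell s).
Proof.
pose L := (ln c1 - ln 2 - K) / kap - ln 2.
exists (Num.min (2^-1) (expR L)); first by rewrite lt_min expR_gt0 invr_gt0 ltr0n.
move=> s s0; rewrite lt_min => /andP[hs hs2]; rewrite Re_ell //.
have h1 : 2^-1 <= cmod (s + d%:C).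
  have := cmod_lo s d; rewrite ger0_norm ?(ltW (lt_trans ltr01 d1)) //; move: hs d1; lra.
have h2 : 2^-1 <= cmod (s + 1).
  have := cmod_lo s 1; rewrite normr1 -one_C; move: hs; lra.
have i2 : 0 < (2^-1 : R) by rewrite invr_gt0.
have k1 := ln_le i2 h1; have k2 := ln_le i2 h2; rewrite lnV ?posrE // in k1 k2.
have k3 : ln (cmod s) < L by rewrite -[L]expRK; apply: ln_lt => //; exact: cmod_H.
have : kap * (- ln 2 - L) < kap * (ln (cmod (s + 1)) - ln (cmod s)) by rewrite ltr_pM2l //; move: k2 k3; lra.
have -> : kap * (- ln 2 - L) = - (ln c1 - ln 2 - K) by rewrite /L; field; rewrite gt_eqF.
by move: k1; lra.
Qed.

Lemma ell_N1 (K : R) : exists2 r : R, 0 < r & forall s, 0 < Im s -> cmod (s + 1) < r -> Re (ell s) < K.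
Proof.
pose L := (K - ln c1 - ln (d + 1)) / kap - ln 2.
exists (Num.min (2^-1) (expR L)); first by rewrite lt_min expR_gt0 invr_gt0 ltr0n.
move=> s s0; rewrite lt_min => /andP[hs hs2]; rewrite Re_ell //.
have h1 : cmod (s + d%:C) <= d + 1.
  have := cmod_hi (s + 1) (d - 1); rewrite ger0_norm ?subr_ge0 ?(ltW d1) //.
  have -> : s + 1 + (d - 1)%:C = s + d%:C by apply: complex_ext; rewrite !ReIm; ring.
  by move: hs; lra.
have h2 : 2^-1 <= cmod s.
  have := cmod_lo (s + 1) (-1); rewrite normrN1.
  have -> : s + 1 + (-1)%:C = s by apply: complex_ext; rewrite !ReIm; ring.
  by move: hs; lra.
have i2 : 0 < (2^-1 : R) by rewrite invr_gt0.
have k1 := ln_le (cmod_shift d s0) h1; have k2 := ln_le i2 h2; rewrite lnV ?posrE // in k2.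
have k3 : ln (cmod (s + 1)) < L by rewrite -[L]expRK; apply: ln_lt => //; exact: cmod_shift1.
have : kap * (ln (cmod (s + 1)) - ln (cmod s)) < kap * (L + ln 2) by rewrite ltr_pM2l //; move: k2 k3; lra.
have -> : kap * (L + ln 2) = K - ln c1 - ln (d + 1) by rewrite /L; field; rewrite gt_eqF.
by move: k1; lra.
Qed.

Lemma ell_Nd (K : R) : exists2 r : R, 0 < r & forall s, 0 < Im s -> cmod (s + d%:C) < r -> Re (ell s) < K.
Proof.
pose L := K - ln c1 - kap * (ln (d + 1) + ln 2).
exists (Num.min (2^-1) (expR L)); first by rewrite lt_min expR_gt0 invr_gt0 ltr0n.
move=> s s0; rewrite lt_min => /andP[hs hs2]; rewrite Re_ell //.
have h1 : cmod (s + 1) <= d + 1.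
  have := cmod_hi (s + d%:C) (1 - d); rewrite ler0_norm ?subr_le0 ?(ltW d1) //.
  have -> : s + d%:C + (1 - d)%:C = s + 1 by apply: complex_ext; rewrite !ReIm; ring.
  by move: hs; lra.
have h2 : 2^-1 <= cmod s.
  have := cmod_lo (s + d%:C) (- d); rewrite normrN ger0_norm ?(ltW (lt_trans ltr01 d1)) //.
  have -> : s + d%:C + (- d)%:C = s by apply: complex_ext; rewrite !ReIm; ring.
  by move: hs d1; lra.
have i2 : 0 < (2^-1 : R) by rewrite invr_gt0.
have k1 := ln_le (cmod_shift1 s0) h1; have k2 := ln_le i2 h2; rewrite lnV ?posrE // in k2.
have k3 : ln (cmod (s + d%:C)) < L by rewrite -[L]expRK; apply: ln_lt => //; exact: cmod_shift.
have : kap * (ln (cmod (s + 1)) - ln (cmod s)) <= kap * (ln (d + 1) + ln 2) by rewrite ler_pM2l //; move: k1 k2; lra.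
by move: k3; rewrite /L; lra.
Qed.

Section Power.
(* [kk = 1], [sg = 1] is the exterior of the curve, where [J] itself is used as coordinate;
   [kk = theta], [sg = -1] is the interior, with coordinate [J ^ theta]. *)
Variables (kk sg : R).
Hypothesis hk : (kk = 1 /\ sg = 1) \/ (kk = theta /\ sg = -1).

Definition zf s : C := expC (kk%:C * ell s).
Definition Om s := 0 < Im s /\ 0 < sg * Im (ell s).

Lemma kk_gt0 : 0 < kk. Proof. by case: hk => -[-> _]. Qed.
Lemma sg2 : sg * sg = 1. Proof. by case: hk => -[_ ->]; rewrite ?mulrNN mulr1. Qed.

Lemma cmod_zf s : cmod (zf s) = expR (kk * Re (ell s)).
Proof. by rewrite cmod_expC ReM ReC ImC mul0r subr0. Qed.

Lemma zf_Im s : Om s -> 0 < sg * Im (zf s).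
Proof.
move=> [s0 h]; rewrite Im_expC ReM ImM ReC ImC !mul0r addr0 mulrCA mulr_gt0 ?expR_gt0 //.
have /andP[i1 i2] := Im_ell_itv c1 d th1 s0.
case: hk h => -[-> ->]; rewrite ?mul1r ?mulN1r => h.
  by rewrite sin_gt0_pi // h.
rewrite -sinN -mulrN sin_gt0_pi // mulr_gt0 //=.
have : theta * (- Im (ell s)) < theta * (theta^-1 * pi) by rewrite ltr_pM2l //; move: i1; lra.
by rewrite mulrA mulfV ?mul1r ?gt_eqF.
Qed.

Lemma zf_Im0 s : Om s -> Im (zf s) != 0.
Proof. by move=> /zf_Im h; apply/eqP => E; rewrite E mulr0 ltxx in h. Qed.

Lemma zf_sg s : Om s -> Num.sg (Im (zf s)) = sg.
Proof.
move=> /zf_Im; case: hk => -[_ ->]; rewrite ?mul1r ?mulN1r ?oppr_gt0; first exact: gtr0_sg.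
exact: ltr0_sg.
Qed.

Lemma qd_zf s : 0 < Im s -> qd zf s (zf s * (kk%:C * ell1 s)).
Proof. by move=> s0; apply: (qd_comp (qd_expC _)); apply: qdZ; exact: qd_ell. Qed.

Lemma qd_zf1 s : 0 < Im s -> exists e, qd (fun w => zf w * (kk%:C * ell1 w)) s e.
Proof. by move=> s0; eexists; apply: qdM; [exact: qd_zf|apply: qdZ; exact: qd_ell1H]. Qed.

Lemma copen_Om : copen Om.
Proof.
move=> s [s0 h].
have h' : 0 < `|Im (ell s)| by rewrite normr_gt0; apply/eqP => E; rewrite E mulr0 ltxx in h.
have [r r0 H] := qd_cvg (qd_ell theta c1 d s0) h'.
exists (Num.min r (Im s)); first by rewrite lt_min r0.
move=> w; rewrite lt_min => /andP[/H h1 /Im_ball w0]; split=> //.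
have := le_lt_trans (Im_le_cmod _) h1; rewrite ImB => /ltr_normlP[].
case: hk h => -[_ ->]; rewrite ?mul1r ?mulN1r => h.
  rewrite (gtr0_norm h); lra.
by rewrite ltr0_norm -?oppr_gt0 //; lra.
Qed.

Definition Yp (y : R) : R := y `^ kk.
Definition Yp1 (y : R) : R := kk * y `^ (kk - 1).

Lemma Yp_exp y : 0 < y -> Yp y = expR (kk * ln y).
Proof. by move=> y0; rewrite /Yp /powR gt_eqF. Qed.

Lemma Yp_der y : 0 < y -> is_derive y 1 Yp (Yp1 y).
Proof. by move=> y0; exact: is_derive1_powR. Qed.

Lemma Yp1_gt0 y : 0 < y -> 0 < Yp1 y.
Proof. by move=> y0; rewrite mulr_gt0 ?kk_gt0 // powR_gt0. Qed.

Lemma Yp_lr x : Yp (expR (lr x)) = expR (kk * lr x).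
Proof. by rewrite Yp_exp ?expR_gt0 // expRK. Qed.

Lemma zf_Ip t : a < t < b -> zf (Ip t) = (Yp t)%:C.
Proof.
move=> tI; rewrite /zf (cd_ell HD tI) -rmorphM expC_real Yp_exp //.
by have /andP[] := tI => /(lt_trans cd_a0).
Qed.

Let to_zero (P : R -> C -> Prop) :
  (forall K : R, exists2 r : R, 0 < r & forall s, 0 < Im s -> P r s -> Re (ell s) < K) ->
  forall eps : R, 0 < eps -> exists2 r : R, 0 < r & forall w, Om w -> P r w -> cmod (zf w - 0) < eps.
Proof.
move=> H eps e0; have [r r0 Hr] := H (ln eps / kk); exists r => // w [w0 _] /(Hr _ w0).
rewrite subr0 cmod_zf ltr_pdivlMr ?kk_gt0 // mulrC => h.
by rewrite -[ltRHS]lnK ?posrE // ltr_expR.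
Qed.

Lemma zf_large (K : R) : exists L : R, forall s, L < Re (ell s) -> K < cmod (zf s).
Proof.
exists (ln (`|K| + 1) / kk) => s; rewrite ltr_pdivrMr ?kk_gt0 // mulrC cmod_zf => h.
have k0 : 0 < `|K| + 1 by rewrite ltr_wpDl.
apply: (@lt_trans _ _ (`|K| + 1)); first by rewrite (le_lt_trans (ler_norm _)) // ltrDl.
by rewrite -[ltLHS]lnK ?posrE // ltr_expR.
Qed.

(** The three outcomes follow the intervals cut by [- d], [-1], [0]. Right of [0] the coordinate
    tends to a value above the interval. On [(-1, 0)] only the inside is adherent, with negative
    limits; on [(- d, -1)] the limits are positive and below the interval; left of [- d] only the
    outside is adherent, again with negative limits. At [-1] and [- d] the map tends to zero, at [0]
    it blows up. *)
Lemma zf_real_boundary (x : R) :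
  [\/ exists2 r : R, 0 < r & forall w, Om w -> cmod (w - x%:C) < r -> False,
    exists2 xi : R, xi <= Yp a \/ Yp b <= xi & forall eps : R, 0 < eps ->
      exists2 r : R, 0 < r & forall w, Om w -> cmod (w - x%:C) < r -> cmod (zf w - xi%:C) < eps |
    forall K : R, exists2 r : R, 0 < r & forall w, Om w -> cmod (w - x%:C) < r -> K < cmod (zf w)].
Proof.
have Ya0 : 0 < Yp a by rewrite Yp_exp ?expR_gt0.
have [->|x0] := eqVneq x 0.
  apply: Or33 => K; have [L HL] := zf_large K; have [r r0 Hr] := ell_zero L.
  by exists r => // w [w0 _]; rewrite subr0 => /(Hr _ w0); exact: HL.
have [->|x1] := eqVneq x (-1).
  apply: Or32; exists 0; first by left; exact: ltW.
  apply: (@to_zero (fun r w => cmod (w - (-1)%:C) < r)) => K; have [r r0 Hr] := ell_N1 K; exists r => // s s0.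
  by have -> : s - (-1)%:C = s + 1 by [apply: complex_ext; rewrite !ReIm; ring]; exact: Hr.
have [->|xd] := eqVneq x (- d).
  apply: Or32; exists 0; first by left; exact: ltW.
  apply: (@to_zero (fun r w => cmod (w - (-d)%:C) < r)) => K; have [r r0 Hr] := ell_Nd K; exists r => // s s0.
  by have -> : s - (-d)%:C = s + d%:C by [apply: complex_ext; rewrite !ReIm; ring]; exact: Hr.
have r0 : 0 < radX x by apply: radX_gt0 => //; rewrite addr_eq0 // ?(negbTE x1) // (negbTE xd).
have xr : cmod (x%:C - x%:C) < radX x by rewrite subrr cmod0.
have cE := qd_cvg (qd_ellX theta c1 xr).
have none : sg * Im (ellX x x%:C) < 0 ->
    exists2 r : R, 0 < r & forall w, Om w -> cmod (w - x%:C) < r -> False.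
  move=> h; have h' : 0 < `|Im (ellX x x%:C)|.
    by rewrite normr_gt0; apply/eqP => E; rewrite E mulr0 ltxx in h.
  have [r r00 H] := cE _ h'; exists (Num.min r (radX x)); first by rewrite lt_min r00.
  move=> w [w0 hw]; rewrite lt_min => /andP[/H h1 h2].
  have := le_lt_trans (Im_le_cmod _) h1; rewrite (ellX_ell theta c1 h2 w0) ImB => /ltr_normlP[].
  case: hk h hw => -[_ ->]; rewrite ?mul1r ?mulN1r => h hw.
    rewrite (ltr0_norm h); move: h hw; lra.
  by rewrite gtr0_norm -?oppr_lt0 //; move: h hw; lra.
have lim (xi : R) : expC (kk%:C * ellX x x%:C) = xi%:C -> xi <= Yp a \/ Yp b <= xi ->
  exists2 xi : R, xi <= Yp a \/ Yp b <= xi & forall eps : R, 0 < eps ->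
      exists2 r : R, 0 < r & forall w, Om w -> cmod (w - x%:C) < r -> cmod (zf w - xi%:C) < eps.
  move=> E hxi; exists xi => // eps e0.
  have [r r1 H] := qd_cvg (qd_comp (qd_expC _) (qdZ kk%:C (qd_ellX theta c1 xr))) e0.
  exists (Num.min r (radX x)); first by rewrite lt_min r1.
  move=> w [w0 hw]; rewrite lt_min => /andP[h1 h2]; have := H _ h1.
  by rewrite E (ellX_ell theta c1 h2 w0).
have EC : ellX x x%:C = Complex (lr x) (Im (ellX x x%:C)).
  by rewrite -Re_ellX // -complexE_RI.
have real0 : Im (ellX x x%:C) = 0 -> expC (kk%:C * ellX x x%:C) = (expR (kk * lr x))%:C.
  by move=> E; rewrite EC E -[Complex _ 0]/((lr x)%:C) -rmorphM expC_real.
have realpi : kk * Im (ellX x x%:C) = pi \/ kk * Im (ellX x x%:C) = - pi ->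
    expC (kk%:C * ellX x x%:C) = (- expR (kk * lr x))%:C.
  move=> E; apply: complex_ext; rewrite ?Re_expC ?Im_expC ReM ImM !(ReC, ImC) !mul0r subr0 addr0 Re_ellX.
    by case: E => ->; rewrite ?cosN cospi mulrN1.
  by case: E => ->; rewrite ?sinN sinpi ?oppr0 mulr0.
have negl : - expR (kk * lr x) <= Yp a by rewrite (le_trans _ (ltW Ya0)) // oppr_le0 expR_ge0.
have kk0 := kk_gt0; have p0 := @pi_gt0 R; have kp0 : 0 < theta^-1 * pi by rewrite mulr_gt0.
move: (Im_ellX theta c1 d x).
have [xp|xn] := ltP 0 x.
  have -> : 0 < x + d by move: xp d1; lra. have -> : 0 < x + 1 by move: xp; lra.
  rewrite subrr mulr0 addr0 => E; apply: Or32; apply: lim (real0 E) _; right.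
  by rewrite Yp_lr ler_expR ler_pM2l // (lr_min c1 d1 (cd_sum HD) (cd_prod HD) (cd_ea HD) (cd_eb HD)).
have {}xn : x < 0 by rewrite lt_neqAle x0.
have [xp1|xn1] := ltP 0 (x + 1).
  have -> : 0 < x + d by move: xp1 d1; lra.
  rewrite sub0r add0r => E; case: hk => -[kE sE].
    apply: Or31; apply: none; rewrite E sE mul1r mulrN oppr_lt0 //.
  apply: Or32; apply: lim (realpi _) _; last by left.
  by right; rewrite E kE mulrA mulfV ?gt_eqF // mul1r.
have {}xn1 : x < -1 by rewrite lt_neqAle x1; move: xn1; lra.
have [xpd|xnd] := ltP 0 (x + d).
  rewrite subrr mulr0 addr0 => E; apply: Or32; apply: lim (real0 E) _; left.
  rewrite Yp_lr ler_expR ler_pM2l // (lr_max c1 d1 (cd_sum HD) (cd_prod HD) (cd_ea HD) (cd_eb HD)) //.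
  by move: xpd; lra.
rewrite subrr mulr0 addr0 => E; case: hk => -[kE sE].
  by apply: Or32; apply: lim (realpi _) _; left=> //; rewrite E kE mul1r.
by apply: Or31; apply: none; rewrite E sE mulN1r oppr_lt0.
Qed.

End Power.
End CurveData.

(** * Vanishing through boundary values; the pole function *)

Section ZeroPrinciple.
Variable R : realType.
Local Notation C := R[i].
Implicit Types (O : C -> Prop) (u g : C -> R).

(* [g] is a barrier: it may be large where the boundary behaviour of [u] is
   only known up to a bounded error. *)
Lemma zero_principle O u g : copen O -> har O u -> har O g -> (forall s, O s -> 0 <= g s) ->
  (forall s, ~ O s -> forall del eps : R, 0 < del -> 0 < eps ->
     exists2 r : R, 0 < r & forall w, O w -> cmod (w - s) < r -> `|u w| < del + eps * g w) ->
  (forall del : R, 0 < del -> exists K : R, forall w, O w -> K < cmod w -> `|u w| < del) ->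
  forall s, O s -> u s = 0.
Proof.
move=> oO hu hg g0 Hb Hi s Os.
have key (c : R) : c = 1 \/ c = -1 -> c * u s <= 0.
  move=> hc; have nc (x : R) : c * x <= `|x|.
    by case: hc => ->; rewrite ?mul1r ?mulN1r ?ler_norm // -normrN ler_norm.
  rewrite leNgt; apply/negP => cu.
  have [gs|gs] := eqVneq (g s) 0.
    have := @maximum_principle R O (fun w => c * u w + (-1) * g w) oO (harD (harZ c hu) (harZ (-1) hg)).
    have bd (w : C) (del : R) : `|u w| < del + 1 * g w -> c * u w + (-1) * g w < del.
      by move=> h; have := nc (u w); move: h; lra.
    have H1 : forall t, ~ O t -> forall del : R, 0 < del -> exists2 r : R, 0 < r &
        forall w, O w -> cmod (w - t) < r -> c * u w + (-1) * g w < del.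
      by move=> t nt del d0; have [r r0 H] := Hb t nt del 1 d0 ltr01; exists r => // w Ow wt; apply/bd/H.
    have H2 : forall del : R, 0 < del -> exists K : R, forall w, O w -> K < cmod w -> c * u w + (-1) * g w < del.
      move=> del d0; have [K HK] := Hi del d0; exists K => w Ow Kw; apply: bd.
      by rewrite mul1r (lt_le_trans (HK _ Ow Kw)) // lerDl g0.
    by move=> /(_ H1 H2 _ Os); rewrite gs mulr0 addr0 leNgt cu.
  have gp : 0 < g s by rewrite lt_neqAle eq_sym gs g0.
  (* The largest multiple of the barrier that costs only half of the assumed positive value at [s].
     Where the barrier vanishes at [s], the multiple [1] used above costs nothing. *)
  pose e := c * u s / (2 * g s); have e0 : 0 < e by rewrite divr_gt0 // mulr_gt0.
  have := @maximum_principle R O (fun w => c * u w + (- e) * g w) oO (harD (harZ c hu) (harZ (- e) hg)).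
  have bd (w : C) (del : R) : `|u w| < del + e * g w -> c * u w + (- e) * g w < del.
    by move=> h; have := nc (u w); move: h; rewrite mulNr; lra.
  have H1 : forall t, ~ O t -> forall del : R, 0 < del -> exists2 r : R, 0 < r &
      forall w, O w -> cmod (w - t) < r -> c * u w + (- e) * g w < del.
    by move=> t nt del d0; have [r r0 H] := Hb t nt del e d0 e0; exists r => // w Ow wt; apply/bd/H.
  have H2 : forall del : R, 0 < del -> exists K : R, forall w, O w -> K < cmod w -> c * u w + (- e) * g w < del.
    move=> del d0; have [K HK] := Hi del d0; exists K => w Ow Kw; apply: bd.
    by rewrite (lt_le_trans (HK _ Ow Kw)) // lerDl mulr_ge0 ?g0 // ltW.
  move=> /(_ H1 H2 _ Os).
  have -> : c * u s + - e * g s = c * u s / 2 by rewrite /e; field; rewrite gs.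
  by rewrite leNgt divr_gt0.
have := key 1 (or_introl erefl); have := key (-1) (or_intror erefl); rewrite mul1r mulN1r.
by move=> h1 h2; apply/eqP; rewrite eq_le; apply/andP; split; lra.
Qed.

Lemma har_Im_ex O (E E1 : C -> C) : (forall s, O s -> qd E s (E1 s) /\ exists e, qd E1 s e) ->
  har O (fun s => Im (E s)).
Proof.
move=> H.
have /choice[E2 H2] : forall s, exists e, O s -> qd E1 s e.
  by move=> s; have [/H[_ [e he]]|no] := pselect (O s); [exists e|exists 0].
by apply: (@har_Im R O E E1 E2) => s Os; have [] := H s Os; split=> //; exact: H2.
Qed.

(** Differentiating in the directions [1] and [i] shows that the imaginary and the real part of the
    derivative vanish. *)
Lemma qd_Im0 (E : C -> C) (w e : C) (r : R) : 0 < r ->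
  (forall v, cmod (v - w) < r -> Im (E v) = 0) -> qd E w e -> e = 0.
Proof.
move=> r0 H qE.
have key (c : C) : cmod c = 1 -> Im (e * c) = 0.
  move=> c1; have := cder_line w c 0; move: qE.
  rewrite -{1}[w]addr0 -{1}(mul0r c) => qE hl.
  have [_ h2] := @qd_path R E (fun u : R => w + u%:C * c) (0 : R) e c qE hl.
  apply: is_derive1_uniq h2 _.
  apply: (der_ext r0 _ (derC 0 0)) => u; rewrite subr0 => hu; rewrite H //.
  by rewrite addrAC subrr add0r cmodM cmod_real c1 mulr1.
have k1 := key 1 (cmod1 R); rewrite mulr1 in k1.
have ki : cmod (ic R) = 1.
  have /eqP := cmod_sqr (ic R); rewrite Re_i Im_i expr0n /= add0r expr1n sqrf_eq1 => /orP[/eqP //|/eqP E1].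
  by have := cmod_ge0 (ic R); rewrite E1; lra.
have := key _ ki; rewrite mulrC Im_iM => k2.
by apply: complex_ext; rewrite ?Re0 ?Im0.
Qed.

End ZeroPrinciple.

Section PoleFunction.
Variable R : realType.
Local Notation C := R[i].
Variables (A s : C).
Hypothesis s0 : 0 < Im s.

(** A simple pole at [s] with residue [A], reflected so that the function is real on the real axis:
    its imaginary part has zero boundary values there, and [p] is its imaginary part on the
    curve. *)
Definition pf (w : C) : C := A / (w - s) + cconj A / (w - cconj s).
Definition pf1 (w : C) : C := - A / (w - s) ^+ 2 + - cconj A / (w - cconj s) ^+ 2.

Lemma pf_neq (w : C) : 0 <= Im w -> w != cconj s.
Proof. by move=> w0; apply/eqP => E; move: w0; rewrite E Im_conj oppr_ge0 leNgt s0. Qed.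

Lemma qd_pf (w : C) : w != s -> w != cconj s -> qd pf w (pf1 w).
Proof. by move=> h1 h2; apply: qdD; exact: qd_inv_sub. Qed.

Lemma qd_pf1 (w : C) : w != s -> w != cconj s -> exists e, qd pf1 w e.
Proof.
have key (B q : C) : w != q -> exists e, qd (fun v => - B / (v - q) ^+ 2) w e.
  move=> wq; have h1 := qd_inv_sub (- B) wq; have h2 := qd_inv_sub 1 wq.
  eexists; apply: (qd_ext ltr01 _ (qdM h1 h2)) => v _; rewrite div1r expr2 invfM; ring.
by move=> h1 h2; have [e he] := key A s h1; have [e' he'] := key (cconj A) (cconj s) h2;
  exists (e + e'); exact: qdD.
Qed.

Lemma Im_pf_real (x : R) : Im (pf x%:C) = 0.
Proof.
rewrite /pf; have -> : cconj A / (x%:C - cconj s) = cconj (A / (x%:C - s)).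
  by rewrite cconjM cconjV cconjD cconjN cconjC.
by rewrite ImD Im_conj subrr.
Qed.

Lemma pf_real (x : R) : pf x%:C = (2 * Re (A / (x%:C - s)))%:C.
Proof.
apply: complex_ext; last by rewrite Im_pf_real ImC.
rewrite /pf; have -> : cconj A / (x%:C - cconj s) = cconj (A / (x%:C - s)).
  by rewrite cconjM cconjV cconjD cconjN cconjC.
by rewrite ReD Re_conj ReC mulr2n mulrDl mul1r.
Qed.

Lemma real_neq (x : R) : x%:C != s /\ x%:C != cconj s.
Proof.
by split; apply/eqP => E; move: s0; [rewrite -E ImC ltxx|rewrite -[Im s]opprK -Im_conj -E ImC oppr0 ltxx].
Qed.

Lemma pf_real_lim (x eps : R) : 0 < eps -> exists2 r : R, 0 < r &
  forall w, cmod (w - x%:C) < r -> `|Im (pf w)| < eps.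
Proof.
move=> e0; have [n1 n2] := real_neq x.
have [r r0 H] := qd_cvg (qd_pf n1 n2) e0; exists r => // w /H.
by move=> /(le_lt_trans (Im_le_cmod _)); rewrite ImB Im_pf_real subr0.
Qed.

Lemma pf_inf (eps : R) : 0 < eps -> exists K : R, forall w, K < cmod w -> cmod (pf w) < eps.
Proof.
move=> e0; exists (cmod s + (2 * cmod A + 1) / eps) => w hw.
have q0 : 0 < (2 * cmod A + 1) / eps by rewrite divr_gt0 // ltr_wpDl // mulr_ge0 ?cmod_ge0.
have key (B q : C) : cmod B = cmod A -> cmod q = cmod s -> cmod (B / (w - q)) < eps / 2.
  move=> EB Eq; rewrite cmodM cmodV EB.
  have h : (2 * cmod A + 1) / eps < cmod (w - q) by have := cmod_ler_dist w q; rewrite Eq; move: hw; lra.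
  have h0 := lt_trans q0 h.
  rewrite ltr_pdivrMr //; move: h; rewrite ltr_pdivrMr //; lra.
have h1 := key A s erefl erefl; have h2 := key (cconj A) (cconj s) (cmod_conj _) (cmod_conj _).
by apply: le_lt_trans (cmodD _ _) _; move: h1 h2; lra.
Qed.

End PoleFunction.

(** * Cauchy transforms as explicit functions of the curve variable *)

Section Representation.
Variable R : realType.
Local Notation C := R[i].
Variables (theta c1 d ea eb : R) (Ip : R -> C).
Hypothesis HD : curve_data theta c1 d ea eb Ip.
Let a := expR (lr theta c1 d ea).
Let b := expR (lr theta c1 d eb).
Local Notation ell := (ell theta c1 d).
Local Notation ell1 := (ell1 theta d).
Let th1 : 1 < theta := cd_theta HD.
Let d1 : 1 < d := cd_d HD.
Implicit Types (w z : C) (x y t l : R).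

Lemma Ip_ccont : ccont a b Ip.
Proof. by split; [exact: (cd_Re HD)|exact: (cd_Im HD)]. Qed.

Lemma Ip_Im_ge0 y : a <= y <= b -> 0 <= Im (Ip y).
Proof.
move=> /andP[]; rewrite le_eqVlt => /orP[/eqP <- _|ay]; first by rewrite (cd_Ia HD) ImC.
rewrite le_eqVlt => /orP[/eqP ->|yb]; first by rewrite (cd_Ib HD) ImC.
by rewrite ltW // (cd_H HD) // ay.
Qed.

Lemma ab_gt0 y : a <= y <= b -> 0 < y.
Proof. by move=> /andP[h _]; exact: lt_le_trans (cd_a0 _ _ _ _) h. Qed.

Section Test.
Variables (s A : C).
Hypothesis s0 : 0 < Im s.
Hypothesis s_ext : 0 < Im (ell s).

Lemma Ip_neq_s y : a <= y <= b -> Ip y != s /\ Ip y != cconj s.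
Proof.
move=> yI; split; last by apply: pf_neq => //; exact: Ip_Im_ge0.
move: yI => /andP[]; rewrite le_eqVlt => /orP[/eqP <- _|ay].
  by rewrite (cd_Ia HD); have [] := real_neq s0 ea.
rewrite le_eqVlt => /orP[/eqP ->|yb].
  by rewrite (cd_Ib HD); have [] := real_neq s0 eb.
apply/eqP => E; move: s_ext; rewrite -E (cd_ell HD) ?ImC ?ltxx //.
by rewrite -/a -/b ay.
Qed.

Definition pt y : R := Im (pf A s (Ip y)).

Lemma pf_Ip_ccont : ccont a b (fun y => pf A s (Ip y)).
Proof.
have key (q : C) : ccont a b (fun y => Ip y - q).
  by apply: ccontD; [exact: Ip_ccont|exact: ccont_cst].
apply: ccontD.
  apply: ccontM; first exact: ccont_cst.
  by apply: ccontV; [move=> y /Ip_neq_s[h1 _]; rewrite subr_eq0|exact: key].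
apply: ccontM; first exact: ccont_cst.
by apply: ccontV; [move=> y /Ip_neq_s[_ h2]; rewrite subr_eq0|exact: key].
Qed.

Lemma pt_cont : {within `[a, b], continuous pt}.
Proof. by have [] := pf_Ip_ccont. Qed.

Lemma pt_a : pt a = 0. Proof. by rewrite /pt (cd_Ia HD) Im_pf_real. Qed.
Lemma pt_b : pt b = 0. Proof. by rewrite /pt (cd_Ib HD) Im_pf_real. Qed.

Variables (kk sg : R).
Hypothesis hk : (kk = 1 /\ sg = 1) \/ (kk = theta /\ sg = -1).
Local Notation zf := (zf theta c1 d kk).
Local Notation Om := (Om theta c1 d sg).
Local Notation Y := (Yp kk).
Local Notation Y1 := (Yp1 kk).

Lemma Y_der y : a <= y <= b -> is_derive y 1 Y (Y1 y).
Proof. by move=> /ab_gt0; exact: Yp_der. Qed.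

Lemma Y1_pos y : a <= y <= b -> 0 < Y1 y.
Proof. by move=> /ab_gt0; exact: (Yp1_gt0 HD hk). Qed.

Lemma Y1_cont : {within `[a, b], continuous Y1}.
Proof.
apply: continuous_in_subspaceT => y /set_mem; rewrite /= in_itv /= => /ab_gt0 y0.
apply: cvgM; first exact: cvg_cst.
exact: (is_derive1_cont (@is_derive1_powR R (kk - 1) y y0)).
Qed.

Let ab : a < b := cd_ab HD.
Definition CTt : C -> C := CT a b pt Y Y1.
Definition CTt1 : C -> C := CT1 a b pt Y Y1.

Lemma qd_CTt z : Im z != 0 -> qd CTt z (CTt1 z).
Proof. exact: (qd_CT ab pt_cont Y_der Y1_cont). Qed.

Lemma CTt_infty (eps : R) : 0 < eps -> exists K : R, forall z, Im z != 0 -> K < cmod z -> cmod (CTt z) < eps.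
Proof. exact: (CT_infty ab pt_cont Y_der Y1_cont). Qed.

(** By the Poisson limit, [Im CTt] has boundary value [- sg * pi * pt] on the curve. The sign
    appears because the outside is mapped to the upper and the inside to the lower half-plane. *)
Lemma CTt_curve t (eps : R) : a <= t <= b -> a < t < b \/ pt t = 0 -> 0 < eps ->
  exists2 r : R, 0 < r & forall w, Om w -> cmod (zf w - (Y t)%:C) < r ->
    `|Im (CTt (zf w)) + sg * pi * pt t| < eps.
Proof.
move=> tI tI' e0; have [r r0 H] := Poisson_limit ab pt_cont Y_der Y1_cont Y1_pos tI tI' e0.
exists r => // w Ow hw; have z0 := zf_Im0 HD hk Ow.
have := H _ z0 hw; rewrite /CTt (Im_CT pt_cont Y_der Y1_cont z0) (zf_sg HD hk Ow).
set I := \int[_]_(_ in _) _ => h.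
have -> : - (sg * I) + sg * pi * pt t = - sg * (I - pi * pt t) by ring.
rewrite normrM normrN (_ : `|sg| = 1) ?mul1r //.
by case: hk => -[_ ->]; rewrite ?normrN normr1.
Qed.

Lemma CTt_real xi (eps : R) : xi <= Y a \/ Y b <= xi -> 0 < eps ->
  exists2 r : R, 0 < r & forall w, Om w -> cmod (zf w - xi%:C) < r -> `|Im (CTt (zf w))| < eps.
Proof.
move=> hxi e0.
have edge t : a <= t <= b -> pt t = 0 -> xi = Y t ->
    exists2 r : R, 0 < r & forall w, Om w -> cmod (zf w - xi%:C) < r -> `|Im (CTt (zf w))| < eps.
  move=> tI t0 ->; have [r r0 H] := CTt_curve tI (or_intror t0) e0.
  by exists r => // w Ow /(H _ Ow); rewrite t0 mulr0 addr0.
have [Ea|na] := eqVneq xi (Y a); first by apply: (edge a) => //; rewrite ?pt_a // lexx ltW.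
have [Eb|nb] := eqVneq xi (Y b); first by apply: (edge b) => //; rewrite ?pt_b // lexx ltW.
have {}hxi : xi < Y a \/ Y b < xi.
  by case: hxi => h; [left|right]; rewrite lt_neqAle h ?na // eq_sym nb.
have [r r0 H] := Poisson_outside ab pt_cont Y_der Y1_cont Y1_pos hxi e0.
exists r => // w Ow hw; have z0 := zf_Im0 HD hk Ow.
have := H _ z0 hw; rewrite /CTt (Im_CT pt_cont Y_der Y1_cont z0) (zf_sg HD hk Ow).
set I := \int[_]_(_ in _) _ => h.
rewrite normrN normrM (_ : `|sg| = 1) ?mul1r //.
by case: hk => -[_ ->]; rewrite ?normrN normr1.
Qed.

(** [k] is a function of the coordinate that compensates the pole of [pf] at [s] when [s] lies in
    [Om]. [kS] asks only for a bounded discrepancy near [s], which the barrier absorbs. Outside the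
    curve [k] is again a pole function, inside it is [0]. *)
Variables (k k1 : C -> C).
Hypothesis kq : forall w, Om w -> w <> s -> qd k (zf w) (k1 (zf w)) /\ exists e, qd k1 (zf w) e.
Hypothesis kR : forall x (eps : R), 0 < eps -> exists2 r : R, 0 < r &
  forall z, cmod (z - x%:C) < r -> `|Im (k z)| < eps.
Hypothesis kI : forall eps : R, 0 < eps -> exists K : R, forall z, K < cmod z -> cmod (k z) < eps.
Hypothesis kS : Om s -> exists M r : R, 0 < r /\ forall w, Om w -> w <> s -> cmod (w - s) < r ->
  `|Im (pf A s w) - Im (k (zf w))| <= M.

(** Built so that its imaginary part tends to zero at the boundary: on the curve [Im CTt] tends to
    [- sg * pi * pt] and [Im pf] to [pt], while [k] is asymptotically real; on the real axis every
    term is asymptotically real or small. *)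
Definition Ef w : C := CTt (zf w) + (sg * pi)%:C * (pf A s w - k (zf w)).
Definition Ef1 w : C := CTt1 (zf w) * (zf w * (kk%:C * ell1 w)) +
  (sg * pi)%:C * (pf1 A s w - k1 (zf w) * (zf w * (kk%:C * ell1 w))).

Let O w := Om w /\ w <> s.

Let O_neq w : O w -> w != s /\ w != cconj s.
Proof. by move=> [[w0 _] /eqP ws]; split=> //; apply: pf_neq => //; exact: ltW. Qed.

Let qdB (f g : C -> C) z e e' : qd f z e -> qd g z e' -> qd (fun w => f w - g w) z (e - e').
Proof. by move=> h1 h2; apply: qdD => //; exact: qdN. Qed.

Lemma qd_Ef w : O w -> qd Ef w (Ef1 w).
Proof.
move=> Ow; have [n1 n2] := O_neq Ow; case: (Ow) => Omw ws; have [w0 _] := Omw.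
apply: qdD; first by apply: (qd_comp (qd_CTt (zf_Im0 HD hk Omw))); exact: qd_zf.
apply: qdZ; apply: qdB; first exact: qd_pf.
by apply: qd_comp; [have [] := kq Omw ws|exact: qd_zf].
Qed.

Lemma qd_Ef1 w : O w -> exists e, qd Ef1 w e.
Proof.
move=> Ow; have [n1 n2] := O_neq Ow; case: (Ow) => Omw ws; have [w0 _] := Omw.
have [e1 h1] := qd_zf1 theta c1 d kk w0; have [e2 h2] := qd_pf1 A n1 n2.
have [_ [e3 h3]] := kq Omw ws; have hz := qd_zf theta c1 d kk w0.
have h4 := qd_comp (qd_CT1 ab pt_cont Y_der Y1_cont (zf_Im0 HD hk Omw)) hz.
eexists; apply: qdD; first exact: (qdM h4 h1).
by apply: qdZ; apply: qdB; [exact: h2|apply: (qdM (qd_comp h3 hz) h1)].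
Qed.

(** The Green function [log (|w - conj s| / |w - s|)] of the upper half-plane with pole [s]:
    nonnegative, harmonic off [s], and infinite at [s]. *)
Let g w : R := (2^-1 * ln (Re (w - cconj s) ^+ 2 + Im (w - cconj s) ^+ 2)) +
  (-1) * (2^-1 * ln (Re (w - s) ^+ 2 + Im (w - s) ^+ 2)).

Let har_g : har O g.
Proof.
apply: harD; last apply: harZ.
  by apply: har_sub (har_log (cconj s)) => w /O_neq[_ /eqP].
by apply: har_sub (har_log s) => w [].
Qed.

Let den_s w : w != s -> 0 < Re (w - s) ^+ 2 + Im (w - s) ^+ 2.
Proof. by move=> h; rewrite -cmod_sqr exprn_gt0 // cmod_gt0 subr_eq0. Qed.

Let g_ge0 w : O w -> 0 <= g w.
Proof.
move=> Ow; have [n1 n2] := O_neq Ow; case: (Ow) => -[w0 _] _.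
rewrite /g mulN1r subr_ge0 ler_pM2l ?invr_gt0 // ler_ln ?posrE ?den_s //; last first.
  by rewrite -cmod_sqr exprn_gt0 // cmod_gt0 subr_eq0.
rewrite !ReIm opprK lerD2l -subr_ge0.
have -> : (Im w + Im s) ^+ 2 - (Im w - Im s) ^+ 2 = 4 * (Im w * Im s) by ring.
by rewrite !mulr_ge0 // ltW.
Qed.

Let g_large (K : R) : exists2 r : R, 0 < r & forall w, O w -> cmod (w - s) < r -> K < g w.
Proof.
pose L := - K + ln (Im s); exists (expR L); first exact: expR_gt0.
move=> w Ow hw; have [n1 n2] := O_neq Ow; case: (Ow) => -[w0 _] _.
have p1 : 0 < cmod (w - s) by rewrite cmod_gt0 subr_eq0.
have p2 : 0 < cmod (w - cconj s) by rewrite cmod_gt0 subr_eq0.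
have e2 (x : R) : 2^-1 * (x *+ 2) = x by rewrite -mulr_natl; field.
rewrite /g -!cmod_sqr !lnXn // !e2.
have l1 : ln (cmod (w - s)) < L by rewrite -[L]expRK ltr_ln ?posrE ?expR_gt0.
have l2 : ln (Im s) <= ln (cmod (w - cconj s)).
  rewrite ler_ln ?posrE //; apply: le_trans (Im_le_cmod _); rewrite !ReIm opprK ger0_norm; first lra.
  by rewrite addr_ge0 // ltW.
by move: l1 l2; rewrite /L; lra.
Qed.

Let sgpi x : `|sg * pi * x| = pi * `|x|.
Proof.
rewrite !normrM (_ : `|sg| = 1) ?mul1r; last by case: hk => -[_ ->]; rewrite ?normrN normr1.
by rewrite ger0_norm // ltW // pi_gt0.
Qed.

Let Im_Ef w : Im (Ef w) = Im (CTt (zf w)) + sg * pi * (Im (pf A s w) - Im (k (zf w))).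
Proof. by rewrite /Ef ImD ImM ReC ImC mul0r addr0 ImB. Qed.

Let small w x (e : R) : `|Im (CTt (zf w)) + sg * pi * x| < e -> `|Im (k (zf w))| < e ->
  `|Im (pf A s w) - x| < e -> `|Im (Ef w)| < e * (2 * pi + 1).
Proof.
move=> h1 h2 h3; rewrite Im_Ef.
have -> : Im (CTt (zf w)) + sg * pi * (Im (pf A s w) - Im (k (zf w))) =
  (Im (CTt (zf w)) + sg * pi * x) + (sg * pi * (Im (pf A s w) - x) - sg * pi * Im (k (zf w))) by ring.
apply: le_lt_trans (ler_normD _ _) _.
have := ler_normB (sg * pi * (Im (pf A s w) - x)) (sg * pi * Im (k (zf w))); rewrite !sgpi.
have p0 := @pi_gt0 R.
have : pi * `|Im (pf A s w) - x| < pi * e by rewrite ltr_pM2l.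
have : pi * `|Im (k (zf w))| < pi * e by rewrite ltr_pM2l.
by move: h1; lra.
Qed.

Let at_infinity (del : R) : 0 < del -> exists K : R, forall w, O w -> K < cmod w -> `|Im (Ef w)| < del.
Proof.
move=> d0; have p0 := @pi_gt0 R; pose e := del / (2 * pi + 1).
have q0 : 0 < 2 * pi + 1 :> R by move: p0; lra.
have e0 : 0 < e by rewrite divr_gt0.
have [K1 H1] := CTt_infty e0; have [K2 H2] := kI e0; have [K3 H3] := pf_inf A s e0.
have [L1 L1H] := zf_large HD hk K1; have [L2 L2H] := zf_large HD hk K2.
have [M1 M1H] := ell_inf HD L1; have [M2 M2H] := ell_inf HD L2.
exists (Num.max K3 (Num.max M1 M2)) => w [Ow _]; rewrite !gt_max => /and3P[k3 m1 m2].
have [w0 _] := Ow.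
have -> : del = e * (2 * pi + 1) by rewrite divfK // gt_eqF.
apply: (@small w 0).
- rewrite mulr0 addr0; apply: le_lt_trans (Im_le_cmod _) _; apply: H1; first exact: (zf_Im0 HD hk Ow).
  by apply/L1H/M1H.
- by apply: le_lt_trans (Im_le_cmod _) _; apply/H2/L2H/M2H.
- by rewrite subr0; apply: le_lt_trans (Im_le_cmod _) _; exact: H3.
Qed.

(** A boundary point above the axis lies on the curve or has no point of [Om] nearby; on the axis
    [zf_real_boundary] gives the three cases; below it nothing is adherent. Each case is an instance
    of [small]. *)
Let at_boundary w0 : ~ Om w0 -> forall del : R, 0 < del ->
  exists2 r : R, 0 < r & forall w, O w -> cmod (w - w0) < r -> `|Im (Ef w)| < del.
Proof.
move=> nO del d0; have p0 := @pi_gt0 R; pose e := del / (2 * pi + 1).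
have q0 : 0 < 2 * pi + 1 :> R by move: p0; lra.
have e0 : 0 < e by rewrite divr_gt0.
have Ed : del = e * (2 * pi + 1) by rewrite divfK // gt_eqF.
have [i0|i0|i0] := ltgtP (Im w0) 0.
- exists (- Im w0); first by rewrite oppr_gt0.
  move=> w [[h _] _] /(le_lt_trans (Im_le_cmod _)); rewrite ImB => /ltr_normlP[_]; lra.
- have h0 : sg * Im (ell w0) <= 0 by rewrite leNgt; apply/negP => h; apply: nO.
  have [E|ne] := eqVneq (Im (ell w0)) 0.
    have [t tI [Et El]] := curve_pt HD i0 E.
    have tI2 : a <= t <= b by move: tI => /andP[h1 h2]; rewrite !ltW.
    have [r1 r10 H1] := CTt_curve tI2 (or_introl tI) e0.
    have [r2 r20 H2] := kR (Y t) e0.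
    have [n1 n2] := Ip_neq_s tI2; rewrite -Et in n1 n2.
    have [r3 r30 H3] := qd_cvg (qd_pf A n1 n2) e0.
    have [r4 r40 H4] := qd_cvg (qd_zf theta c1 d kk i0) r10.
    have [r5 r50 H5] := qd_cvg (qd_zf theta c1 d kk i0) r20.
    have Ez : zf w0 = (Y t)%:C by rewrite Et; exact: zf_Ip HD kk _ tI.
    rewrite Ez in H4 H5.
    exists (Num.min r3 (Num.min r4 r5)); first by rewrite !lt_min r30 r40.
    move=> w [Ow _]; rewrite !lt_min Ed => /and3P[h3 h4 h5]; apply: (@small w (pt t)).
    + by apply: H1 => //; exact: H4.
    + by apply: H2; exact: H5.
    + by apply: le_lt_trans (H3 _ h3); rewrite /pt -Et -ImB; exact: Im_le_cmod.
  have h' : 0 < `|Im (ell w0)| by rewrite normr_gt0.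
  have [r r0 H] := qd_cvg (qd_ell theta c1 d i0) h'.
  exists r => // w [[_ hw] _] /H /(le_lt_trans (Im_le_cmod _)); rewrite ImB => /ltr_normlP[].
  have {h0} : sg * Im (ell w0) < 0.
    rewrite lt_neqAle h0 andbT mulf_eq0 (negbTE ne) orbF.
    by case: hk => -[_ ->]; rewrite ?oppr_eq0 oner_eq0.
  case: hk hw => -[_ ->]; rewrite ?mul1r ?mulN1r => hw h.
    rewrite (ltr0_norm h); move: h hw; lra.
  by rewrite gtr0_norm -?oppr_lt0 //; move: h hw; lra.
have Ew : w0 = (Re w0)%:C by apply: complex_ext; rewrite ?ReC ?ImC.
have [r1 r10 H1] := pf_real_lim A s0 (Re w0) e0; rewrite -Ew in H1.
have := zf_real_boundary HD hk (Re w0); rewrite -Ew; case.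
- by move=> [r r0 H]; exists r => // w [Ow _] /(H _ Ow).
- move=> [xi hxi H].
  have [r2 r20 H2] := CTt_real hxi e0; have [r3 r30 H3] := kR xi e0.
  have [r4 r40 H4] := H _ r20; have [r5 r50 H5] := H _ r30.
  exists (Num.min r1 (Num.min r4 r5)); first by rewrite !lt_min r10 r40.
  move=> w [Ow _]; rewrite !lt_min Ed => /and3P[h1 h4 h5]; apply: (@small w 0).
  + by rewrite mulr0 addr0; apply: H2 => //; exact: H4.
  + by apply: H3; exact: H5.
  + by rewrite subr0; exact: H1.
move=> H; have [K1 HK1] := CTt_infty e0; have [K2 HK2] := kI e0.
have [r4 r40 H4] := H K1; have [r5 r50 H5] := H K2.
exists (Num.min r1 (Num.min r4 r5)); first by rewrite !lt_min r10 r40.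
move=> w [Ow _]; rewrite !lt_min Ed => /and3P[h1 h4 h5]; apply: (@small w 0).
+ rewrite mulr0 addr0; apply: le_lt_trans (Im_le_cmod _) _; apply: HK1; last exact: H4.
  exact: (zf_Im0 HD hk Ow).
+ by apply: le_lt_trans (Im_le_cmod _) _; apply/HK2/H5.
+ by rewrite subr0; exact: H1.
Qed.

Let copen_O : copen O.
Proof.
move=> w [Ow ws]; have [r r0 H] := copen_Om hk Ow.
have h : 0 < cmod (w - s) by rewrite cmod_gt0 subr_eq0; apply/eqP.
exists (Num.min r (cmod (w - s))); first by rewrite lt_min r0.
move=> v; rewrite lt_min => /andP[/H Ov hv]; split=> // E.
by move: hv; rewrite E cmodB ltxx.
Qed.

Lemma Im_Ef0 w : Om w -> w <> s -> Im (Ef w) = 0.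
Proof.
move=> Ow ws; apply: (@zero_principle R O (fun w => Im (Ef w)) g copen_O _ har_g g_ge0 _ _ w) => //.
- by apply: (@har_Im_ex R O Ef Ef1) => v Ov; split; [exact: qd_Ef|exact: qd_Ef1].
- move=> v nO del eps d0 e0; have [Ov|nOv] := pselect (Om v); last first.
    have [r r0 H] := at_boundary nOv d0; exists r => // u Ou /(H _ Ou) /lt_le_trans; apply.
    by rewrite lerDl mulr_ge0 ?g_ge0 // ltW.
  have Ev : v = s by apply: contrapT => h; apply: nO.
  rewrite Ev in Ov *.
  have [M [r [r0 H]]] := kS Ov.
  have [r1 r10 H1] := qd_cvg (qd_comp (qd_CTt (zf_Im0 HD hk Ov)) (qd_zf theta c1 d kk s0)) ltr01.
  pose B := cmod (CTt (zf s)) + 1 + pi * M.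
  have [r2 r20 H2] := g_large (B / eps).
  exists (Num.min r (Num.min r1 r2)); first by rewrite !lt_min r0 r10.
  move=> u Ou; rewrite !lt_min => /and3P[h h1 h2].
  have := H2 _ Ou h2; rewrite ltr_pdivrMr // mulrC => hB.
  apply: le_lt_trans (lt_trans hB _); last by rewrite ltrDr.
  rewrite Im_Ef; apply: le_trans (ler_normD _ _) _; rewrite sgpi /B; apply: lerD.
    apply: le_trans (Im_le_cmod _) _; have := cmod_ler_dist (CTt (zf u)) (CTt (zf s)).
    by have := H1 _ h1; lra.
  by rewrite ler_pM2l ?pi_gt0 //; case: Ou => Ou us; exact: H.
Qed.

Lemma ray_Om t l : a < t < b -> 0 < l -> 0 < sg * (l - 1) -> Om (l%:C * Ip t).
Proof.
move=> tI l0 hl; have i0 := cd_H HD tI; split.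
  by rewrite ImM ReC ImC mul0r addr0 mulr_gt0.
have E : Im (ell (1%:C * Ip t)) = 0 by rewrite mul1r (cd_ell HD tI) ImC.
case: hk hl => -[_ ->]; rewrite ?mul1r ?mulN1r => hl.
  by rewrite -E; apply: (Im_ell_ray c1 th1 d1 i0 ltr01); move: hl; lra.
rewrite oppr_gt0 -[ltRHS]E; apply: (Im_ell_ray c1 th1 d1 i0 l0); move: hl; lra.
Qed.

(** Where [Im Ef] vanishes on a disc the derivative of [Ef] is zero, and the part of the ray on one
    side of the curve stays in [Om]; hence [Ef] can be evaluated at the far end of the ray. The ray
    must miss the pole [s]. *)
Lemma Ef_ray t l l' : a < t < b -> (forall m : R, 0 < m -> m%:C * Ip t <> s) ->
  0 < l -> 0 < sg * (l - 1) -> 0 < l' -> 0 < sg * (l' - 1) -> Ef (l%:C * Ip t) = Ef (l'%:C * Ip t).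
Proof.
move=> tI ns l0 hl l'0 hl'.
pose gm (u : R) : C := l%:C * Ip t + u%:C * ((l' - l)%:C * Ip t).
have gmE u : gm u = (l + u * (l' - l))%:C * Ip t by rewrite /gm; apply: complex_ext; rewrite !ReIm; ring.
have Ogm u : 0 <= u <= 1 -> O (gm u).
  move=> /andP[u0 u1]; rewrite gmE.
  have m0 : 0 < l + u * (l' - l).
    have -> : l + u * (l' - l) = (1 - u) * l + u * l' by ring.
    move: u0; rewrite le_eqVlt => /orP[/eqP <-|u0]; first by rewrite subr0 mul1r mul0r addr0.
    by rewrite ltr_wpDl ?mulr_gt0 // mulr_ge0 ?subr_ge0 // ltW.
  split; last exact: ns.
  apply: ray_Om => //.
  have -> : sg * (l + u * (l' - l) - 1) = (1 - u) * (sg * (l - 1)) + u * (sg * (l' - 1)) by ring.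
  move: u0; rewrite le_eqVlt => /orP[/eqP <-|u0]; first by rewrite subr0 mul1r mul0r addr0.
  by apply: ltr_wpDl; [apply: mulr_ge0; [rewrite subr_ge0|exact: ltW]|exact: mulr_gt0].
have z1 w : O w -> Ef1 w = 0.
  move=> Ow; have [r r0 H] := copen_O Ow; apply: (qd_Im0 r0 _ (qd_Ef Ow)).
  by move=> v /H[Ov vs]; exact: Im_Ef0.
have := @cder_mean R (fun u => Ef (gm u)) (fun=> 0) 0.
have H1 (u : R) : 0 <= u <= 1 -> cder (fun u => Ef (gm u)) u 0.
  move=> /Ogm Ou; have := qd_path (qd_Ef Ou) (cder_line _ _ u).
  by rewrite (z1 _ Ou) mul0r.
have H2 (u : R) : 0 <= u <= 1 -> cmod (0 : C) <= 0 by rewrite cmod0.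
move=> /(_ H1 H2); rewrite mulr0 => h.
have : cmod (Ef (gm 1) - Ef (gm 0)) = 0 by apply/eqP; rewrite eq_le h cmod_ge0.
move/eqP; rewrite cmod_eq0 subr_eq0 !gmE mul0r addr0 mul1r => /eqP <-.
by rewrite (_ : l + (l' - l) = l') //; ring.
Qed.

Lemma Ef_infinity (eps : R) : 0 < eps -> exists K : R, forall w, Om w -> K < cmod w -> cmod (Ef w) < eps.
Proof.
move=> d0; have p0 := @pi_gt0 R; pose e := eps / (2 * pi + 1).
have q0 : 0 < 2 * pi + 1 :> R by move: p0; lra.
have e0 : 0 < e by rewrite divr_gt0.
have [K1 H1] := CTt_infty e0; have [K2 H2] := kI e0; have [K3 H3] := pf_inf A s e0.
have [L1 L1H] := zf_large HD hk K1; have [L2 L2H] := zf_large HD hk K2.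
have [M1 M1H] := ell_inf HD L1; have [M2 M2H] := ell_inf HD L2.
exists (Num.max K3 (Num.max M1 M2)) => w Ow; rewrite !gt_max => /and3P[k3 m1 m2].
have [w0 _] := Ow.
have -> : eps = e * (2 * pi + 1) by rewrite divfK // gt_eqF.
have h1 : cmod (CTt (zf w)) < e by apply: H1; [exact: (zf_Im0 HD hk Ow)|apply/L1H/M1H].
have h2 : cmod (k (zf w)) < e by apply/H2/L2H/M2H.
have h3 := H3 _ k3; rewrite /Ef.
apply: le_lt_trans (cmodD _ _) _; rewrite cmodM cmod_real -[sg * pi]mulr1 sgpi normr1 mulr1.
have := cmodD (pf A s w) (- k (zf w)); rewrite cmodN => h4.
have : pi * cmod (pf A s w - k (zf w)) <= pi * (2 * e) by rewrite ler_pM2l //; move: h2 h3 h4; lra.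
by move: h1; lra.
Qed.

(** Inside the curve the rays end at the origin, where the coordinate [J ^ theta] is infinite: the
    Cauchy transform disappears and the constant is [- pi * pf 0]. *)
Lemma Ef_zero t (eps : R) : sg = -1 -> (forall z, k z = 0) -> a < t < b -> 0 < eps ->
  exists2 l, 0 < l < 1 & cmod (Ef (l%:C * Ip t) + pi%:C * pf A s 0) < eps.
Proof.
move=> sgE k0 tI d0; have p0 := @pi_gt0 R; pose e := eps / (pi + 1).
have q0 : 0 < pi + 1 :> R by move: p0; lra.
have e0 : 0 < e by rewrite divr_gt0.
have [K1 H1] := CTt_infty e0.
have [L1 L1H] := zf_large HD hk K1; have [r1 r10 R1H] := ell_zero HD L1.
have [n1 n2] := real_neq s0 0.
have [r2 r20 H2] := qd_cvg (qd_pf A n1 n2) e0.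
have i0 := cd_H HD tI; have c0 : 0 < cmod (Ip t) by rewrite cmod_gt0 H_neq0.
pose l := Num.min (2^-1) (Num.min r1 r2 / (2 * cmod (Ip t))).
have l0 : 0 < l by rewrite lt_min invr_gt0 ltr0n /= divr_gt0 ?mulr_gt0 // lt_min r10.
have l1 : l < 1 by rewrite gt_min (_ : 2^-1 < 1 :> R) ?orTb // invf_lt1 // ltr1n.
have hl : cmod (l%:C * Ip t) < Num.min r1 r2.
  rewrite cmodM cmod_real ger0_norm ?(ltW l0) //.
  have m0 : 0 < Num.min r1 r2 by rewrite lt_min r10.
  have : l <= Num.min r1 r2 / (2 * cmod (Ip t)) by rewrite ge_min lexx orbT.
  rewrite ler_pdivlMr ?mulr_gt0 // => h; move: h m0; set q := Num.min _ _; lra.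
have Ol : Om (l%:C * Ip t) by apply: ray_Om => //; rewrite sgE mulN1r; move: l1; lra.
have [w0 _] := Ol.
move: hl; rewrite lt_min => /andP[hl1 hl2].
exists l; first by rewrite l0.
have h1 : cmod (CTt (zf (l%:C * Ip t))) < e by apply: H1; [exact: (zf_Im0 HD hk Ol)|apply/L1H/R1H].
have h2 : cmod (pf A s (l%:C * Ip t) - pf A s 0) < e by apply: H2; rewrite subr0.
have -> : Ef (l%:C * Ip t) + pi%:C * pf A s 0 =
    CTt (zf (l%:C * Ip t)) - pi%:C * (pf A s (l%:C * Ip t) - pf A s 0).
  by rewrite /Ef k0 sgE mulN1r rmorphN /=; ring.
apply: le_lt_trans (cmodD _ _) _; rewrite cmodN cmodM cmod_real ger0_norm ?(ltW p0) //.
have -> : eps = e * (pi + 1) by rewrite divfK // gt_eqF.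
have : pi * cmod (pf A s (l%:C * Ip t) - pf A s 0) < pi * e by rewrite ltr_pM2l.
by move: h1; lra.
Qed.

End Test.

Lemma cmod_eq0_eps (z : C) : (forall eps : R, 0 < eps -> cmod z < eps) -> z = 0.
Proof.
move=> h; apply/eqP; rewrite -cmod_eq0; apply/negPn/negP => n.
have c0 : 0 < cmod z by rewrite lt_neqAle eq_sym n cmod_ge0.
by have := h _ c0; rewrite ltxx.
Qed.

Section ExtInt.
Variables (s A : C).
Hypothesis s0 : 0 < Im s.
Hypothesis s_ext : 0 < Im (ell s).
Let z0 := zf theta c1 d 1 s.
Let D := zf theta c1 d 1 s * (1%:C * ell1 s).
Let hk1 : ((1 : R) = 1 /\ (1 : R) = 1) \/ ((1 : R) = theta /\ (1 : R) = -1) := or_introl (conj erefl erefl).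
Let hkt : (theta = 1 /\ -1 = 1 :> R) \/ (theta = theta /\ (-1 : R) = -1) := or_intror (conj erefl erefl).

Let Om_s : Om theta c1 d 1 s. Proof. by split=> //; rewrite mul1r. Qed.
Let z0_Im : 0 < Im z0. Proof. by have := zf_Im HD hk1 Om_s; rewrite mul1r. Qed.
Let D_neq0 : D != 0.
Proof. by rewrite /D mul1r mulf_neq0 // ?expC_neq0 // ell1_neq0. Qed.

Let zf1_inj w : Om theta c1 d 1 w -> zf theta c1 d 1 w = z0 -> w = s.
Proof.
move=> [w0 _]; rewrite /z0 /zf !mul1r => E; apply: (@ell_inj R theta c1 d) => //.
by apply: expC_inj E; apply: Im_ell_pi.
Qed.

(** [D] is the derivative of the coordinate at [s], so residue [A] at [s] corresponds to residue
    [A * D] at [z0]; with these residues the two poles cancel to first order. *)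
Let k_bounded : exists M r : R, 0 < r /\ forall w, Om theta c1 d 1 w -> w <> s -> cmod (w - s) < r ->
  `|Im (pf A s w) - Im (pf (A * D) z0 (zf theta c1 d 1 w))| <= M.
Proof.
have qz := qd_zf theta c1 d 1 s0; rewrite -/D in qz.
have [M [r [M0 r0 r1 H _]]] := qdE qz.
have n1 : s != cconj s by apply: pf_neq => //; exact: ltW.
have n2 : z0 != cconj z0 by apply: pf_neq => //; exact: ltW.
have [r2 r20 H2] := qd_cvg (qd_inv_sub (cconj A) n1) ltr01.
have [r3 r30 H3] := qd_cvg (qd_comp (qd_inv_sub (cconj (A * D)) n2) qz) ltr01.
have cD : 0 < cmod D by rewrite cmod_gt0.
pose r4 := cmod D / (2 * M); have r40 : 0 < r4 by rewrite divr_gt0 // mulr_gt0.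
pose N := 2 * M * cmod A / cmod D + (cmod (cconj A / (s - cconj s)) + 1) +
  (cmod (cconj (A * D) / (z0 - cconj z0)) + 1).
exists N, (Num.min (Num.min r r2) (Num.min r3 r4)).
split; first by rewrite !lt_min r0 r20 r30.
move=> w Ow ws; rewrite !lt_min => /andP[/andP[h1 h2] /andP[h3 h4]].
have wn : w - s != 0 by rewrite subr_eq0; apply/eqP.
have wp : 0 < cmod (w - s) by rewrite cmod_gt0.
set z := zf theta c1 d 1 w.
have zn : z - z0 != 0 by rewrite subr_eq0; apply/eqP => E; apply: ws; exact: zf1_inj.
have e1 : cmod (z - z0 - D * (w - s)) <= M * cmod (w - s) ^+ 2 by exact: H.
(* Close to [s] the coordinate moves at least half as fast as its linear part, which controls the
   denominator left after the poles are combined. *)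
have lo : cmod D / 2 * cmod (w - s) <= cmod (z - z0).
  have := cmod_ler_dist (D * (w - s)) (- (z - z0 - D * (w - s))).
  rewrite cmodN opprK cmodM (_ : D * (w - s) + (z - z0 - D * (w - s)) = z - z0); last by ring.
  have : M * cmod (w - s) ^+ 2 <= cmod D / 2 * cmod (w - s).
    rewrite expr2 mulrA ler_pM2r //; move: h4; rewrite /r4 ltr_pdivlMr ?mulr_gt0 //; lra.
  by move: e1; lra.
rewrite -ImB; apply: le_trans (Im_le_cmod _) _.
have -> : pf A s w - pf (A * D) z0 z = A * (z - z0 - D * (w - s)) / ((w - s) * (z - z0)) +
    cconj A / (w - cconj s) - cconj (A * D) / (z - cconj z0).
  have gen (p1 p2 q1 q2 X : C) : p1 - q1 = X -> p1 + p2 - (q1 + q2) = X + p2 - q2 by move=> <-; ring.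
  by apply: gen; field; rewrite wn zn.
have b1 : cmod (A * (z - z0 - D * (w - s)) / ((w - s) * (z - z0))) <= 2 * M * cmod A / cmod D.
  rewrite cmodM cmodV (cmodM A) (cmodM (w - s)) ler_pdivrMr; last by rewrite mulr_gt0 // cmod_gt0.
  apply: (@le_trans _ _ (cmod A * (M * cmod (w - s) ^+ 2))); first by rewrite ler_wpM2l ?cmod_ge0.
  have -> : cmod A * (M * cmod (w - s) ^+ 2) =
     2 * M * cmod A / cmod D * (cmod (w - s) * (cmod D / 2 * cmod (w - s))) by field; rewrite gt_eqF.
  rewrite ler_wpM2l ?mulr_ge0 ?invr_ge0 ?cmod_ge0 ?(ltW M0) //.
  by rewrite ler_pM2l.
have b2 : cmod (cconj A / (w - cconj s)) <= cmod (cconj A / (s - cconj s)) + 1.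
  by have := cmod_ler_dist (cconj A / (w - cconj s)) (cconj A / (s - cconj s)); have := H2 _ h2; lra.
have b3 : cmod (cconj (A * D) / (z - cconj z0)) <= cmod (cconj (A * D) / (z0 - cconj z0)) + 1.
  by have := cmod_ler_dist (cconj (A * D) / (z - cconj z0)) (cconj (A * D) / (z0 - cconj z0)); have := H3 _ h3; lra.
apply: le_trans (cmodD _ _) _; rewrite cmodN /N; apply: lerD => //.
by apply: le_trans (cmodD _ _) _; exact: lerD.
Qed.

(** Along the outward ray [Ef] is constant, and at infinity all its terms vanish. The excluded rays
    are those through [s]. *)
Lemma ext_repr t l : a < t < b -> (forall m : R, 0 < m -> m%:C * Ip t <> s) -> 1 < l ->
  CTt s A 1 (zf theta c1 d 1 (l%:C * Ip t)) =
  - pi%:C * (pf A s (l%:C * Ip t) - pf (A * D) z0 (zf theta c1 d 1 (l%:C * Ip t))).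
Proof.
move=> tI ns l1; pose k := pf (A * D) z0; pose k1 := pf1 (A * D) z0.
have kq w : Om theta c1 d 1 w -> w <> s -> qd k (zf theta c1 d 1 w) (k1 (zf theta c1 d 1 w)) /\
    exists e, qd k1 (zf theta c1 d 1 w) e.
  move=> Ow ws; have n1 : zf theta c1 d 1 w != z0 by apply/eqP => E; apply: ws; exact: zf1_inj.
  have n2 : zf theta c1 d 1 w != cconj z0.
    by apply: pf_neq => //; have := zf_Im HD hk1 Ow; rewrite mul1r => /ltW.
  by split; [exact: qd_pf|exact: qd_pf1].
have kR := @pf_real_lim R (A * D) z0 z0_Im.
have kI := @pf_inf R (A * D) z0.
suff : Ef s A 1 1 k (l%:C * Ip t) = 0.
  by rewrite /Ef mul1r => /eqP; rewrite addr_eq0 mulNr => /eqP.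
apply: cmod_eq0_eps => eps e0.
have [K HK] := Ef_infinity A s0 s_ext hk1 kI e0.
have i0 := cd_H HD tI; have c0 : 0 < cmod (Ip t) by rewrite cmod_gt0 H_neq0.
pose l' := Num.max 2 ((`|K| + 1) / cmod (Ip t)).
have l'1 : 1 < l' by rewrite lt_max ltr1n.
have l'K : K < cmod (l'%:C * Ip t).
  rewrite cmodM cmod_real ger0_norm ?(ltW (lt_trans ltr01 l'1)) //.
  have : (`|K| + 1) / cmod (Ip t) <= l' by rewrite le_max lexx orbT.
  by rewrite ler_pdivrMr //; have := ler_norm K; lra.
have h1 : 0 < 1 * (l - 1) by rewrite mul1r subr_gt0.
have h2 : 0 < 1 * (l' - 1) by rewrite mul1r subr_gt0.
have p1 := lt_trans ltr01 l1; have p2 := lt_trans ltr01 l'1.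
rewrite (@Ef_ray s A s0 s_ext 1 1 hk1 k k1 kq kR kI (fun=> k_bounded) t l l') //.
by apply: HK => //; apply: (ray_Om hk1).
Qed.

(** The pole [s] is outside the curve, so no compensation is necessary inside; the constant [pf 0]
    is the limit at the origin and produces the term [A / s] of the kernel identity. *)
Lemma int_repr t l : a < t < b -> (forall m : R, 0 < m -> m%:C * Ip t <> s) -> 0 < l < 1 ->
  CTt s A theta (zf theta c1 d theta (l%:C * Ip t)) =
  pi%:C * (pf A s (l%:C * Ip t) - pf A s 0).
Proof.
move=> tI ns /andP[l0 l1]; pose k (z : C) : C := 0; pose k1 (z : C) : C := 0.
have kq w : Om theta c1 d (-1) w -> w <> s -> qd k (zf theta c1 d theta w) (k1 (zf theta c1 d theta w)) /\
    exists e, qd k1 (zf theta c1 d theta w) e.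
  by move=> _ _; split; [exact: qd_cst|exists 0; exact: qd_cst].
have kR (x eps : R) : 0 < eps -> exists2 r : R, 0 < r & forall z, cmod (z - x%:C) < r -> `|Im (k z)| < eps.
  by move=> e0; exists 1 => // z _; rewrite /k Im0 normr0.
have kI (eps : R) : 0 < eps -> exists K : R, forall z, K < cmod z -> cmod (k z) < eps.
  by move=> e0; exists 0 => z _; rewrite /k cmod0.
have kS : Om theta c1 d (-1) s -> exists M r : R, 0 < r /\ forall w, Om theta c1 d (-1) w -> w <> s ->
    cmod (w - s) < r -> `|Im (pf A s w) - Im (k (zf theta c1 d theta w))| <= M.
  by move=> [_]; rewrite mulN1r oppr_gt0 => /(lt_trans s_ext); rewrite ltxx.
suff : Ef s A theta (-1) k (l%:C * Ip t) + pi%:C * pf A s 0 = 0.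
  move=> /eqP; rewrite addr_eq0 /Ef /k subr0 mulN1r rmorphN => /eqP E.
  by rewrite mulrBr -[in RHS]E /=; ring.
apply: cmod_eq0_eps => eps e0.
have [l' /andP[l'0 l'1] H] := Ef_zero A s0 s_ext hkt (erefl (-1)) (fun=> erefl) tI e0.
have h1 : 0 < -1 * (l - 1) by rewrite mulN1r; move: l1; lra.
have h2 : 0 < -1 * (l' - 1) by rewrite mulN1r; move: l'1; lra.
by rewrite (@Ef_ray s A s0 s_ext theta (-1) hkt k k1 kq kR kI kS t l l').
Qed.

End ExtInt.
End Representation.

Section Punctured.
Variable R : realType.
Local Notation leb := (@lebesgue_measure R).
Variables (a b t : R).
Implicit Types (f g : R -> R).

Let D : set R := `]a, b[ `\ t.
Let mD : measurable D. Proof. by apply: measurableD => //; exact: measurable_itv. Qed.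
Let DS : D `<=` `]a, b[. Proof. by move=> x []. Qed.

Lemma Rintegral_punctured f : measurable_fun `]a, b[ f ->
  \int[leb]_(x in D) f x = \int[leb]_(x in `]a, b[) f x.
Proof.
move=> mf; rewrite /Rintegral; congr fine; apply: integral_setD1 => //.
by apply/measurable_EFinP; apply: measurable_funS mf => //; exact: oo_measurable.
Qed.

Lemma integrable_punctured f : measurable_fun `]a, b[ f ->
  leb.-integrable D (EFin \o f) -> leb.-integrable `]a, b[ (EFin \o f).
Proof.
move=> mf /integrableP[_ h]; apply/integrableP; split; first exact/measurable_EFinP.
rewrite -(@integral_setD1 _ _ t) //; apply: measurableT_comp => //.
by apply/measurable_EFinP; apply: measurable_funS mf => //; exact: oo_measurable.
Qed.

(** Convergence and domination are asked off one point only: the logarithmic integrands below are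
    singular there, and the convention [ln 0 = 0] gives no meaningful value. *)
Lemma dominated_punctured (f_ : nat -> R -> R) f g :
  (forall n, measurable_fun `]a, b[ (f_ n)) -> measurable_fun `]a, b[ f ->
  (forall x, a < x < b -> x <> t -> f_ n x @[n --> \oo] --> f x) ->
  leb.-integrable `]a, b[ (EFin \o g) ->
  (forall n x, a < x < b -> x <> t -> `|f_ n x| <= g x) ->
  leb.-integrable `]a, b[ (EFin \o f) /\
  (\int[leb]_(x in `]a, b[) f_ n x)%R @[n --> \oo] --> (\int[leb]_(x in `]a, b[) f x)%R.
Proof.
move=> mf_ mf fc ig fg.
have ms (h : R -> R) : measurable_fun `]a, b[ h -> measurable_fun D h.
  by move=> mh; apply: measurable_funS mh => //; exact: oo_measurable.
have [|||||i L] := @Rintegral_dominated R _ _ leb D mD f_ f g.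
- by move=> n; apply: ms.
- exact: ms.
- by move=> x [/=]; rewrite in_itv /= => xI xt; exact: fc.
- by apply: integrableS ig => //; exact: oo_measurable.
- by move=> n x [/=]; rewrite in_itv /= => xI xt; exact: fg.
split; first exact: integrable_punctured.
have E : (fun n => \int[leb]_(x in D) f_ n x) = (fun n => \int[leb]_(x in `]a, b[) f_ n x).
  by apply/funext => n; rewrite Rintegral_punctured.
by move: L; rewrite E Rintegral_punctured.
Qed.

End Punctured.

(** * The derivative of the curve and its square-root singularities *)

Section CurveDerivative.
Variable R : realType.
Local Notation C := R[i].
Local Notation leb := (@lebesgue_measure R).
Variables (theta c1 d ea eb : R) (Ip : R -> C).
Hypothesis HD : curve_data theta c1 d ea eb Ip.
Let a := expR (lr theta c1 d ea).
Let b := expR (lr theta c1 d eb).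
Local Notation ell := (ell theta c1 d).
Local Notation ell1 := (ell1 theta d).
Local Notation lr := (lr theta c1 d).
Let th1 : 1 < theta := cd_theta HD.
Let d1 : 1 < d := cd_d HD.
Let ab : a < b := cd_ab HD.
Let a0 : 0 < a := cd_a0 _ _ _ _.
Implicit Types (w z : C) (x y t l : R).

(** Differentiating [ell (Ip y) = ln y] gives [ell1 (Ip y) * Ip' y = 1 / y]. *)
Definition I1 y : C := (y%:C * ell1 (Ip y))^-1.

Lemma oo_gt0 y : a < y < b -> 0 < y.
Proof. by move=> /andP[h _]; exact: lt_trans a0 h. Qed.

Lemma oo_le y : a < y < b -> a <= y <= b.
Proof. by move=> /andP[h1 h2]; rewrite !ltW. Qed.

Lemma Ip_der y : a < y < b -> cder Ip y (I1 y).
Proof.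
move=> yI; have [e he] := cd_der HD yI; have i0 := cd_H HD yI; have y0 := oo_gt0 yI.
suff -> : I1 y = e by [].
have h1 := qd_path (qd_ell theta c1 d i0) he.
have h2 : cder (fun u => (ln u)%:C : C) y (y^-1)%:C.
  by split; rewrite ?ReC ?ImC; [exact: is_derive1_ln|exact: derC].
have r0 : 0 < Num.min (y - a) (b - y) by rewrite lt_min !subr_gt0.
have := cder_uniq (cder_ext r0 _ h1) h2.
have E (u : R) : `|u - y| < Num.min (y - a) (b - y) -> ell (Ip u) = (ln u)%:C.
  move=> /ltr_normlP[]; rewrite !lt_min => /andP[h _] /andP[_ h'].
  by apply: (cd_ell HD); rewrite -/a -/b; apply/andP; split; move: h h'; lra.
move=> /(_ E) E1; rewrite /I1 invfM.
have n1 := ell1_neq0 th1 d1 i0.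
by apply: (mulfI n1); rewrite E1 mulrCA mulfV // mulr1 fmorphV.
Qed.

Lemma cder_within (g : R -> C) : (forall y, a < y < b -> exists e, cder g y e) ->
  {within `]a, b[, continuous (fun y => Re (g y))} /\ {within `]a, b[, continuous (fun y => Im (g y))}.
Proof.
move=> H; split; apply: continuous_in_subspaceT => y /set_mem; rewrite /= in_itv /= => /H[e [h1 h2]].
  exact: is_derive1_cont h1.
exact: is_derive1_cont h2.
Qed.

Lemma qd_ell1V w : 0 < Im w -> exists e, qd (fun v => (ell1 v)^-1) w e.
Proof. by move=> w0; eexists; apply: qdV_comp; [exact: ell1_neq0|exact: qd_ell1H]. Qed.

Lemma cder_real (f : R -> R) x e : is_derive x 1 f e -> cder (fun u => (f u)%:C : C) x e%:C.
Proof. by move=> h; split; rewrite ?ReC ?ImC //; exact: derC. Qed.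

Lemma cderM (f g : R -> C) x e e' : cder f x e -> cder g x e' ->
  cder (fun u => f u * g u) x (e * g x + f x * e').
Proof.
move=> [h1 h2] [h3 h4]; split.
  have -> : (fun u => Re (f u * g u)) = (fun u => Re (f u) * Re (g u) + - (Im (f u) * Im (g u))).
    by apply/funext => u; rewrite ReM.
  apply: is_derive_eq (derD (derM h1 h3) (derN (derM h2 h4))) _.
  by rewrite !(ReD, ReM); ring.
have -> : (fun u => Im (f u * g u)) = (fun u => Re (f u) * Im (g u) + Im (f u) * Re (g u)).
  by apply/funext => u; rewrite ImM.
apply: is_derive_eq (derD (derM h1 h4) (derM h2 h3)) _.
by rewrite !(ImD, ImM); ring.
Qed.

Lemma I1_der y : a < y < b -> exists e, cder I1 y e.
Proof.
move=> yI; have i0 := cd_H HD yI; have y0 := oo_gt0 yI.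
have [e he] := qd_ell1V i0; have h1 := qd_path he (Ip_der yI).
have n0 : y != 0 by rewrite gt_eqF.
have h2 := cder_real (derV n0 (derI y)).
have h3 := cderM h2 h1; eexists.
apply: (cder_ext ltr01 _ h3) => u _; by rewrite /I1 invfM fmorphV.
Qed.

Lemma ell1_edge e : e = ea \/ e = eb -> ell1 e%:C = 0.
Proof.
have ead := ea_gtNd d1 (cd_sum HD) (cd_prod HD) (cd_eb HD).
have e1 := cd_ea HD; have e2 := cd_eb HD.
have n (x : R) : x != 0 -> x + 1 != 0 -> x + d != 0 ->
    [/\ x%:C != 0 :> C, x%:C + 1 != 0 :> C & x%:C + d%:C != 0 :> C].
  by move=> h1 h2 h3; split; rewrite -?rmorphD -?[1]/(1%:C) -?rmorphD fmorph_eq0.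
move=> he; have [|||h1 h2 h3] := n e.
- by case: he => ->; apply/eqP; lra.
- by case: he => ->; apply/eqP; lra.
- by case: he => ->; apply/eqP; lra.
rewrite (ell1_factor (cd_sum HD) (cd_prod HD) h1 h2 h3).
by case: he => ->; rewrite subrr ?mulr0 !mul0r.
Qed.

Lemma ln_lip x y : 0 < x -> 0 < y -> x <= b -> y <= b -> `|y - x| <= b * `|ln y - ln x|.
Proof.
wlog xy : x y / x <= y.
  move=> H x0 y0 xb yb; have [h|h] := leP x y; first exact: H.
  by rewrite distrC [X in _ <= b * X]distrC; apply: H => //; exact: ltW.
move=> x0 y0 xb yb; have b0 : 0 < b by exact: lt_trans a0 ab.
have h : ln (x / y) <= x / y - 1.
  have := @le_ln1Dx R (x / y - 1); rewrite (_ : 1 + (x / y - 1) = x / y); last by ring.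
  by apply; rewrite ltrBrDr addNr divr_gt0.
rewrite ln_div ?posrE // in h.
have h2 : (y - x) / y <= ln y - ln x by rewrite mulrBl divff ?gt_eqF //; move: h; lra.
have p : 0 <= y - x by rewrite subr_ge0.
have p2 : 0 <= ln y - ln x by apply: le_trans h2; rewrite divr_ge0 // ltW.
rewrite !ger0_norm //; move: h2; rewrite ler_pdivrMr // => /le_trans; apply.
by rewrite mulrC ler_wpM2r.
Qed.

(* At a critical point [ell] vanishes to second order, so that the curve
   leaves the real axis like a square root. *)
Lemma edge_sq e : e = ea \/ e = eb -> exists2 c : R, 0 < c &
  forall y, a < y < b -> c * `|y - expR (lr e)| <= cmod (Ip y - e%:C) ^+ 2.
Proof.
move=> he.
have [r0 X0 _] := edge_rad (cd_c1 HD) d1 (cd_sum HD) (cd_prod HD) (cd_ea HD) (cd_eb HD) he.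
have er : cmod (e%:C - e%:C) < radX d e by rewrite subrr cmod0.
have [M [r [M0 r1 _ H _]]] := qdE (qd_ellX theta c1 er).
pose rr := Num.min r (radX d e); have rr0 : 0 < rr by rewrite lt_min r1.
have b0 : 0 < b := lt_trans a0 ab.
have ba : 0 < b - a by rewrite subr_gt0.
have eb' : expR (lr e) <= b /\ a <= expR (lr e) by case: he => ->; rewrite ?lexx; split => //; exact: ltW.
have [eb1 eb2] := eb'.
exists (Num.min (b * M)^-1 (rr ^+ 2 / (b - a))).
  by rewrite lt_min invr_gt0 mulr_gt0 // divr_gt0 // exprn_gt0.
move=> y yI; have [near|far] := ltP (cmod (Ip y - e%:C)) rr; last first.
  apply: (@le_trans _ _ (rr ^+ 2 / (b - a) * (b - a))).
    apply: ler_pM => //; first by rewrite le_min invr_ge0 mulr_ge0 ?(ltW b0) ?(ltW M0) // divr_ge0 ?sqr_ge0 // ltW.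
      by rewrite ge_min lexx orbT.
    by apply/ler_normlP; have /andP[h1 h2] := yI; split; lra.
  rewrite divfK ?gt_eqF // lerXn2r // nnegrE ?cmod_ge0 // ltW //.
move: near; rewrite lt_min => /andP[n1 n2].
have := H _ n1; rewrite (ell1_edge he) mul0r subr0 X0 (ellX_ell theta c1 n2 (cd_H HD yI)) (cd_ell HD yI).
rewrite -rmorphB cmod_real => h.
have y0 := oo_gt0 yI; have /andP[_ yb] := yI.
have := ln_lip (expR_gt0 (lr e)) y0 eb1 (ltW yb); rewrite expRK => h2.
apply: (@le_trans _ _ ((b * M)^-1 * `|y - expR (lr e)|)); first by rewrite ler_wpM2r // ge_min lexx.
rewrite mulrC ler_pdivrMr ?mulr_gt0 // (le_trans h2) //.
by rewrite [leRHS]mulrC -mulrA ler_pM2l.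
Qed.

(** The common integrable majorant: singularities at the two critical values are of inverse square
    root type, by [edge_sq]. *)
Definition Wt y : R := (Num.sqrt (y - a))^-1 + (Num.sqrt (b - y))^-1.

Lemma Wt_int : leb.-integrable `]a, b[ (EFin \o Wt).
Proof. by apply: integrableDr; [exact: oo_measurable|exact: invsqrt_left|exact: invsqrt_right]. Qed.

Lemma Wt_ge0 y : 0 <= Wt y.
Proof. by rewrite addr_ge0 // invr_ge0 sqrtr_ge0. Qed.

Lemma inv_edge e : e = ea \/ e = eb -> exists2 K : R, 0 < K &
  forall y, a < y < b -> cmod (Ip y - e%:C)^-1 <= K * Wt y.
Proof.
move=> he; have [c c0 H] := edge_sq he; exists (Num.sqrt c)^-1; first by rewrite invr_gt0 sqrtr_gt0.
move=> y yI; have i0 := cd_H HD yI; have /andP[y1 y2] := yI.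
have p : 0 < cmod (Ip y - e%:C) by rewrite cmod_gt0 Im_gt0_neq.
have h : Num.sqrt c * Num.sqrt `|y - expR (lr e)| <= cmod (Ip y - e%:C).
  have -> : cmod (Ip y - e%:C) = Num.sqrt (cmod (Ip y - e%:C) ^+ 2) by rewrite sqrtr_sqr ger0_norm ?cmod_ge0.
  by rewrite -sqrtrM ?(ltW c0) // ler_sqrt ?sqr_ge0 //; exact: H.
have w : (Num.sqrt `|y - expR (lr e)|)^-1 <= Wt y.
  rewrite /Wt; case: he => ->.
    by rewrite -/a [X in Num.sqrt X]gtr0_norm ?subr_gt0 // lerDl invr_ge0 sqrtr_ge0.
  by rewrite -/b distrC [X in Num.sqrt X]gtr0_norm ?subr_gt0 // lerDr invr_ge0 sqrtr_ge0.
have n : 0 < `|y - expR (lr e)|.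
  rewrite normr_gt0 subr_eq0; case: he => ->; first by rewrite gt_eqF.
  by rewrite lt_eqF.
rewrite cmodV; apply: (@le_trans _ _ ((Num.sqrt c)^-1 * (Num.sqrt `|y - expR (lr e)|)^-1)).
  by rewrite -invfM lef_pV2 ?posrE // mulr_gt0 // sqrtr_gt0.
by rewrite ler_pM2l // invr_gt0 sqrtr_gt0.
Qed.

Lemma ccont_bounded (f : R -> C) : ccont a b f -> exists2 B : R, 0 < B &
  forall y, a <= y <= b -> cmod (f y) <= B.
Proof.
move=> [h1 h2].
have key (g : R -> R) : {within `[a, b], continuous g} -> exists2 B : R, 0 < B & forall y, a <= y <= b -> `|g y| <= B.
  move=> cg; have [c1' _ H1] := EVT_max (ltW ab) cg; have [c2' _ H2] := EVT_min (ltW ab) cg.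
  exists (`|g c1'| + `|g c2'| + 1); first by rewrite ltr_wpDl // addr_ge0.
  move=> y yI; have k1 : g y <= g c1' by apply: H1; rewrite in_itv.
  have k2 : g c2' <= g y by apply: H2; rewrite in_itv.
  have := ler_norm (g c1'); have := ler_norm (- g c2'); rewrite normrN.
  have := normr_ge0 (g c1'); have := normr_ge0 (g c2').
  by move=> *; apply/ler_normlP; split; lra.
have [B1 B10 H1] := key _ h1; have [B2 B20 H2] := key _ h2.
exists (B1 + B2); first exact: addr_gt0.
by move=> y yI; apply: le_trans (cmod_le_RI _) _; apply: lerD; [exact: H1|exact: H2].
Qed.

Lemma I1_factor y : a < y < b -> I1 y = (y^-1)%:C * (Ip y * (Ip y + 1) * (Ip y + d%:C)) *
  ((Ip y - ea%:C)^-1 * (Ip y - eb%:C)^-1).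
Proof.
move=> yI; have i0 := cd_H HD yI; have y0 := oo_gt0 yI.
have n1 : Ip y != 0 by exact: H_neq0.
have n2 : Ip y + 1 != 0 by rewrite H_neq0 // Im_shift1.
have n3 : Ip y + d%:C != 0 by rewrite H_neq0 // Im_shift.
rewrite /I1 (ell1_factor (cd_sum HD) (cd_prod HD)) // fmorphV.
have m1 := Im_gt0_neq ea i0; have m2 := Im_gt0_neq eb i0.
have m3 : y%:C != 0 :> C by rewrite fmorph_eq0 gt_eqF.
by field; rewrite n1 n2 n3 m1 m2 m3.
Qed.

(** The two poles of [I1] at the critical points are separated by
    [1 / (u v) <= (1 / u + 1 / v) / (eb - ea)] for the moduli [u], [v] of [Ip y - ea] and
    [Ip y - eb], whose sum is at least [eb - ea]. *)
Lemma I1_le : exists2 K : R, 0 < K & forall y, a < y < b -> cmod (I1 y) <= K * Wt y.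
Proof.
have [Ka Ka0 HKa] := inv_edge (or_introl erefl); have [Kb Kb0 HKb] := inv_edge (or_intror erefl).
have [B B0 HB] : exists2 B : R, 0 < B & forall y, a <= y <= b ->
    cmod (Ip y * (Ip y + 1) * (Ip y + d%:C)) <= B.
  apply: ccont_bounded; have cI := Ip_ccont HD.
  have sh (c : C) : ccont a b (fun y => Ip y + c) by apply: ccontD => //; exact: ccont_cst.
  by apply: ccontM; [apply: ccontM|].
have g0 : 0 < eb - ea by have := cd_ea HD; have := cd_eb HD; lra.
exists (a^-1 * B * ((eb - ea)^-1 * (Ka + Kb))).
  by rewrite !mulr_gt0 ?invr_gt0 // addr_gt0.
move=> y yI; have i0 := cd_H HD yI; have y0 := oo_gt0 yI; have /andP[ya _] := yI.
rewrite (I1_factor yI) cmodM -[leRHS]mulrA; apply: ler_pM; rewrite ?cmod_ge0 //.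
  rewrite cmodM cmod_real ger0_norm ?invr_ge0 ?(ltW y0) //; apply: ler_pM; rewrite ?cmod_ge0 ?invr_ge0 ?(ltW y0) //.
    by rewrite lef_pV2 ?posrE // ltW.
  by apply: HB; exact: oo_le.
have m1 := Im_gt0_neq ea i0; have m2 := Im_gt0_neq eb i0.
set u := Ip y - ea%:C in m1 *; set v := Ip y - eb%:C in m2 *.
have uv : eb - ea <= cmod u + cmod v.
  have := cmodD u (- v); rewrite cmodN (_ : u - v = (eb - ea)%:C); last by rewrite /u /v rmorphB /=; ring.
  by rewrite cmod_real ger0_norm ?(ltW g0).
have u0 : 0 < cmod u by rewrite cmod_gt0. have v0 : 0 < cmod v by rewrite cmod_gt0.
apply: (@le_trans _ _ ((eb - ea)^-1 * (cmod u^-1 + cmod v^-1))).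
  rewrite cmodM !cmodV ler_pdivlMl // -ler_pdivlMr ?mulr_gt0 ?invr_gt0 //.
  apply: le_trans uv _; rewrite le_eqVlt; apply/orP; left; apply/eqP; field.
  by rewrite !gt_eqF.
rewrite -mulrA ler_pM2l ?invr_gt0 // mulrDl; apply: lerD; [exact: HKa|exact: HKb].
Qed.

Section Test.
Variables (s A : C).
Hypothesis s0 : 0 < Im s.
Hypothesis s_ext : 0 < Im (ell s).
Local Notation pt := (pt Ip s A).

Definition pt1 y : R := Im (pf1 A s (Ip y) * I1 y).

Lemma pt_der y : a < y < b -> is_derive y 1 pt (pt1 y).
Proof.
move=> yI; have [n1 n2] := Ip_neq_s HD s0 s_ext (oo_le yI).
by have [] := qd_path (qd_pf A n1 n2) (Ip_der yI).
Qed.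

Lemma pt1_cont : {within `]a, b[, continuous pt1}.
Proof.
have [] // := @cder_within (fun y => pf1 A s (Ip y) * I1 y).
move=> y yI; have [n1 n2] := Ip_neq_s HD s0 s_ext (oo_le yI).
have [e he] := qd_pf1 A n1 n2; have [e' he'] := I1_der yI.
by eexists; apply: cderM; [exact: (qd_path he (Ip_der yI))|exact: he'].
Qed.

Lemma pt1_le : exists2 K : R, 0 < K & forall y, a < y < b -> `|pt1 y| <= K * Wt y.
Proof.
have [K K0 HK] := I1_le.
have [B B0 HB] : exists2 B : R, 0 < B & forall y, a <= y <= b -> cmod (pf1 A s (Ip y)) <= B.
  apply: ccont_bounded; have cI := Ip_ccont HD.
  have sh (c : C) : ccont a b (fun y => Ip y - c) by apply: ccontD => //; exact: ccont_cst.
  have sq (B c : C) : (forall y, a <= y <= b -> Ip y != c) -> ccont a b (fun y => B / (Ip y - c) ^+ 2).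
    move=> nz; apply: ccontM; first exact: ccont_cst.
    apply: ccontV; first by move=> y /nz h; rewrite expf_neq0 // subr_eq0.
    by apply: ccontM.
  by apply: ccontD; apply: sq => y yI; have [] := Ip_neq_s HD s0 s_ext yI.
exists (B * K); first exact: mulr_gt0.
move=> y yI; apply: le_trans (Im_le_cmod _) _; rewrite cmodM -mulrA.
by apply: ler_pM; rewrite ?cmod_ge0 //; [apply: HB; exact: oo_le|exact: HK].
Qed.

Lemma pt1_int : leb.-integrable `]a, b[ (EFin \o pt1).
Proof.
have [K K0 HK] := pt1_le.
apply: (@integrable_le R _ _ leb _ (oo_measurable a b) _ (fun y => K * Wt y)).
- exact: within_measurable pt1_cont.
- by apply: integrableZr; [exact: oo_measurable|exact: Wt_int].
- by move=> y; rewrite /= in_itv /=; exact: HK.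
Qed.

End Test.
End CurveDerivative.

(** * From Cauchy transforms to the logarithmic kernel *)

Section LogLimits.
Variable R : realType.
Local Notation C := R[i].
Local Notation leb := (@lebesgue_measure R).
Variables (theta c1 d ea eb : R) (Ip : R -> C).
Hypothesis HD : curve_data theta c1 d ea eb Ip.
Let a := expR (lr theta c1 d ea).
Let b := expR (lr theta c1 d eb).
Local Notation ell := (ell theta c1 d).
Local Notation ell1 := (ell1 theta d).
Let th1 : 1 < theta := cd_theta HD.
Let d1 : 1 < d := cd_d HD.
Let ab : a < b := cd_ab HD.
Let a0 : 0 < a := cd_a0 _ _ _ _.
Local Notation Wt := (Wt theta c1 d ea eb).
Implicit Types (w z : C) (x y t l : R).

Let oo_open y : `]a, b[%classic y -> a < y < b.
Proof. by rewrite /= in_itv. Qed.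

Lemma norm_ln_between (m K u : R) : 0 < m -> m <= u -> u <= K -> `|ln u| <= `|ln m| + `|ln K|.
Proof.
move=> m0 mu uK; have u0 := lt_le_trans m0 mu.
have h1 : ln m <= ln u by rewrite ler_ln ?posrE.
have h2 : ln u <= ln K by rewrite ler_ln ?posrE // (lt_le_trans u0).
have := ler_norm (ln K); have := ler_norm (- ln m); rewrite normrN.
have := normr_ge0 (ln K); have := normr_ge0 (ln m).
by move=> *; apply/ler_normlP; split; lra.
Qed.

(** The singularities of the two factors are at different points: near [t] the weight is bounded,
    and away from [t] the logarithm is. *)
Lemma Wt_ln_int t : a < t < b ->
  leb.-integrable `]a, b[ (EFin \o (fun y => Wt y * `|ln `|y - t| |)).
Proof.
move=> tI; have /andP[ta tb] := tI.
have mo := oo_measurable a b; have iW := Wt_int HD; have il := integrable_ln_dist tI.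
pose del := Num.min (t - a) (b - t) / 2.
have m0 : 0 < Num.min (t - a) (b - t) by rewrite lt_min !subr_gt0 ta.
have d0 : 0 < del by rewrite divr_gt0.
pose L := `|ln del| + `|ln (b - a)|.
apply: (@integrable_le R _ _ leb _ mo _ (fun y => L * Wt y + 2 / Num.sqrt del * `|ln `|y - t| |)).
- apply: measurable_funM; first exact: integrable_measurable iW.
  by apply: measurableT_comp; [exact: normr_measurable|exact: integrable_measurable il].
- by apply: integrableDr => //; apply: integrableZr => //; exact: integrable_normr.
move=> y /oo_open /andP[ya yb]; rewrite normrM normr_id (ger0_norm (Wt_ge0 _ _ _ _ _ _)).
have L0 : 0 <= L by rewrite addr_ge0.
have md : del <= (t - a) / 2 /\ del <= (b - t) / 2.
  by split; rewrite ler_pM2r ?invr_gt0 // ge_min lexx ?orbT.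
have [h|h] := ltP `|y - t| del.
  apply: ler_wpDl; first by rewrite mulr_ge0 // Wt_ge0.
  rewrite ler_wpM2r //; move: h md => /ltr_normlP[h1 h2] [h3 h4].
  have k (u : R) : del <= u -> (Num.sqrt u)^-1 <= (Num.sqrt del)^-1.
    move=> du; have u0 := lt_le_trans d0 du.
    by rewrite lef_pV2 ?posrE ?sqrtr_gt0 // ler_sqrt // ltW.
  have -> : 2 / Num.sqrt del = (Num.sqrt del)^-1 + (Num.sqrt del)^-1 by ring.
  by apply: lerD; apply: k; move: h1 h2 h3 h4; rewrite -/a -/b; lra.
apply: ler_wpDr; first by rewrite mulr_ge0 // divr_ge0 // sqrtr_ge0.
rewrite mulrC ler_wpM2r ?Wt_ge0 //; apply: norm_ln_between => //.
by apply/ler_normlP; move: ya yb ta tb; split; lra.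
Qed.

Section Power.
Variables (kk sg : R).
Hypothesis hk : (kk = 1 /\ sg = 1) \/ (kk = theta /\ sg = -1).
Local Notation zf := (zf theta c1 d kk).
Local Notation Om := (Om theta c1 d sg).
Local Notation Y := (Yp kk).
Local Notation Y1 := (Yp1 kk).
Let kk0 : 0 < kk := kk_gt0 HD hk.
Let Yd y : a <= y <= b -> is_derive y 1 Y (Y1 y).
Proof. exact: Y_der. Qed.
Let Y1p y : a <= y <= b -> 0 < Y1 y := Y1_pos HD hk (y := y).
Let cY1 : {within `[a, b], continuous Y1}. Proof. exact: Y1_cont. Qed.
Let cY : {within `[a, b], continuous Y}.
Proof. by apply: derivable_within_continuous => x; rewrite in_itv /= => /Yd[]. Qed.

Lemma Y_lower : exists2 m : R, 0 < m & forall x y, a <= x <= b -> a <= y <= b -> m * `|y - x| <= `|Y y - Y x|.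
Proof.
have [c cI H] := EVT_min (ltW ab) cY1; rewrite in_itv /= in cI.
exists (Y1 c); first exact: Y1p.
have key x y : a <= x <= b -> a <= y <= b -> x <= y -> Y1 c * `|y - x| <= `|Y y - Y x|.
  move=> /andP[ax _] /andP[_ yb] xy.
  have D (u : R) : x <= u <= y -> is_derive u 1 Y (Y1 u).
    by move=> /andP[h1 h2]; apply: Yd; rewrite (le_trans ax h1) (le_trans h2 yb).
  have [v /andP[v1 v2] ->] := MVT_cc xy D.
  rewrite normrM ler_wpM2r //.
  have vI : a <= v <= b by rewrite (le_trans ax v1) (le_trans v2 yb).
  by rewrite (ger0_norm (ltW (Y1p vI))); apply: H; rewrite in_itv.
move=> x y xI yI; have [h|h] := leP x y; first exact: key.
by rewrite distrC [X in _ <= X]distrC; apply: key => //; exact: ltW.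
Qed.

Lemma ray_der t : a < t < b ->
  cder (fun l => zf (l%:C * Ip t)) 1 (zf (Ip t) * (kk%:C * ell1 (Ip t)) * Ip t).
Proof.
move=> tI; have := cder_line 0 (Ip t) 1.
move=> /(@qd_path R zf (fun u : R => 0 + u%:C * Ip t) 1 (zf (Ip t) * (kk%:C * ell1 (Ip t)))).
rewrite add0r mul1r => /(_ (qd_zf theta c1 d kk (cd_H HD tI))).
by apply: (cder_ext ltr01) => u _; rewrite add0r.
Qed.

(* The ray leaves the curve transversally, and so does its image from the real line. *)
Lemma nontangential t : a < t < b -> exists c r K : R, [/\ 0 < c, 0 < r, 0 < K &
  forall l, `|l - 1| < r -> cmod (zf (l%:C * Ip t) - (Y t)%:C) <= K * `|l - 1| /\
    forall v : R, c * `|Y t - v| <= cmod (zf (l%:C * Ip t) - v%:C)].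
Proof.
move=> tI; have i0 := cd_H HD tI; have zt := zf_Ip HD kk tI; have t0 := oo_gt0 tI.
set D := zf (Ip t) * (kk%:C * ell1 (Ip t)) * Ip t.
have D0 : 0 < Im D.
  have -> : D = (Y t * kk)%:C * (Ip t * ell1 (Ip t)) by rewrite /D zt rmorphM /=; ring.
  by rewrite ImM ReC ImC mul0r addr0 mulr_gt0 ?ImQ_gt0 // mulr_gt0 // powR_gt0.
have e0 : 0 < Im D / 2 by rewrite divr_gt0.
have [r r0 H] := cder_epsE (ray_der tI) e0.
have cD : Im D <= cmod D by apply: le_trans (Im_le_cmod D); exact: ler_norm.
have cD0 : 0 < cmod D := lt_le_trans D0 cD.
have q0 : 0 < 4 * cmod D / Im D + 1 by rewrite ltr_wpDl // divr_ge0 ?mulr_ge0 ?cmod_ge0 // ltW.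
exists (4 * cmod D / Im D + 1)^-1, r, (2 * cmod D); split; rewrite ?invr_gt0 ?mulr_gt0 //.
move=> l hl; have := H (l - 1) hl; rewrite addrCA subrr addr0 [1%:C * _]mul1r -/D zt.
set g := zf (l%:C * Ip t) => h.
have up : cmod (g - (Y t)%:C) <= 2 * cmod D * `|l - 1|.
  have := cmodD (g - (Y t)%:C - D * (l - 1)%:C) (D * (l - 1)%:C); rewrite subrK cmodM cmod_real => k.
  have : Im D / 2 * `|l - 1| <= cmod D * `|l - 1| by rewrite ler_wpM2r //; move: cD D0; lra.
  by move: h k; lra.
have lo : Im D / 2 * `|l - 1| <= `|Im g|.
  have := le_trans (Im_le_cmod _) h; rewrite !ImB ImM !ReC !ImC subr0 mulr0 add0r => k.
  have := ler_normB (Im g) (Im g - Im D * (l - 1)); rewrite (_ : Im g - (Im g - Im D * (l - 1)) = Im D * (l - 1)); last by ring.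
  by rewrite normrM (gtr0_norm D0); move: k; lra.
split=> // v; rewrite mulrC ler_pdivrMr //.
have gv : `|Im g| <= cmod (g - v%:C) by apply: le_trans (Im_le_cmod _); rewrite ImB ImC subr0.
have tri : `|Y t - v| <= cmod (g - (Y t)%:C) + cmod (g - v%:C).
  rewrite -cmod_real rmorphB /= [X in _ <= X + _]cmodB; exact: cmodBD.
apply: le_trans tri _; rewrite mulrDr mulr1 lerD2r (le_trans up) //.
have -> : 2 * cmod D * `|l - 1| = (Im D / 2 * `|l - 1|) * (4 * cmod D / Im D) by field; rewrite gt_eqF.
rewrite ler_wpM2r ?(le_trans lo) //; first by rewrite divr_ge0 ?mulr_ge0 ?cmod_ge0 // ltW.
Qed.

Section Test.
Variables (s A : C).
Hypothesis s0 : 0 < Im s.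
Hypothesis s_ext : 0 < Im (ell s).
Local Notation pt := (pt Ip s A).
Local Notation pt1 := (pt1 theta d Ip s A).
Local Notation CTt := (CTt theta c1 d ea eb Ip s A kk).

Let lnm z y : R := 2^-1 * ln ((Re z - Y y) ^+ 2 + Im z ^+ 2).
Let lnm1 z y : R := 2^-1 * (((Re z - Y y) ^+ 2 + Im z ^+ 2)^-1 * (2 * (Re z - Y y) * (- Y1 y))).

Let den z y : Im z != 0 -> 0 < (Re z - Y y) ^+ 2 + Im z ^+ 2.
Proof. by move=> h; rewrite ltr_wpDl ?sqr_ge0 // exprn_even_gt0. Qed.

Let lnmE z y : Im z != 0 -> ln (cmod (z - (Y y)%:C)) = lnm z y.
Proof.
move=> z0; have p : 0 < cmod (z - (Y y)%:C) by rewrite cmod_gt0 Im_neq0 // ImB ImC subr0.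
have : ln (cmod (z - (Y y)%:C) ^+ 2) = ln (cmod (z - (Y y)%:C)) *+ 2 by rewrite lnXn.
rewrite cmod_sqr ReB ImB ReC ImC subr0 /lnm => ->; rewrite -mulr_natl; by field.
Qed.

Let lnm_der z y : Im z != 0 -> a <= y <= b -> is_derive y 1 (lnm z) (lnm1 z y).
Proof.
move=> z0 yI.
have h := derD (der_sqr (derD (derC (Re z) y) (derN (Yd yI)))) (derC (Im z ^+ 2) y).
have := derZ 2^-1 (@derComp R (@ln R) (fun u => (Re z - Y u) ^+ 2 + Im z ^+ 2) y _ _ (is_derive1_ln (den y z0)) h).
by move=> /is_derive_eq; apply; rewrite /lnm1 addr0 sub0r.
Qed.

Let cond z : Im z != 0 -> {within `[a, b], continuous (lnm z)}.
Proof. by move=> z0; apply: derivable_within_continuous => y; rewrite in_itv /= => /(lnm_der z0)[]. Qed.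

Let cinv z : Im z != 0 -> {within `[a, b], continuous (lnm1 z)}.
Proof.
move=> z0; apply/subspace_continuousP => y yI.
have /subspace_continuousP/(_ _ yI) g := cY; have /subspace_continuousP/(_ _ yI) g1 := cY1.
have hr : (Re z - Y x) @[x --> within `[a, b]%classic (nbhs y)] --> Re z - Y y.
  by apply: cvgB; [exact: cvg_cst|exact: g].
apply: cvgM; first exact: cvg_cst.
apply: cvgM.
  apply: cvgV; first by rewrite gt_eqF // den.
  by apply: cvgD; [apply: cvgM; exact: hr|exact: cvg_cst].
apply: cvgM; last by apply: cvgN; exact: g1.
by apply: cvgM; [exact: cvg_cst|exact: hr].
Qed.

Let cpt := pt_cont HD s0 s_ext (A := A).
Let sub_cc (f : R -> R) : {within `[a, b], continuous f} -> {within `]a, b[, continuous f}.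
Proof.
apply: continuous_subspaceW => y; rewrite /= !in_itv /= => /andP[h1 h2].
by rewrite (ltW h1) ltW.
Qed.

Let ip1 := pt1_int HD A s0 s_ext.

Let bounded_mul (f g : R -> R) : leb.-integrable `]a, b[ (EFin \o f) -> {within `[a, b], continuous g} ->
  leb.-integrable `]a, b[ (EFin \o (fun y => f y * g y)).
Proof.
move=> fi cg; have [B B0 HB] := ccont_bounded HD (ccont_real cg).
apply: (@integrable_le R _ _ leb _ (oo_measurable a b) _ (fun y => B * `|f y|)).
- apply: measurable_funM; first exact: integrable_measurable fi.
  by apply: within_measurable; exact: sub_cc.
- by apply: integrableZr; [exact: oo_measurable|exact: integrable_normr].
move=> y /oo_open yI; rewrite normrM mulrC ler_wpM2r //.
by have := HB _ (oo_le yI); rewrite cmod_real.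
Qed.

(** Integration by parts: [log |z - Y y|] is an antiderivative of minus the real part of the Cauchy
    kernel, and the boundary terms vanish because [pt] is zero at both ends. *)
Lemma Re_CT_parts z : Im z != 0 ->
  Re (CTt z) = \int[leb]_(y in `]a, b[) (pt1 y * ln (cmod (z - (Y y)%:C))).
Proof.
move=> z0; pose f1 y := pt1 y * lnm z y; pose f2 y := pt y * lnm1 z y.
have mo := oo_measurable a b.
have i1 : leb.-integrable `]a, b[ (EFin \o f1) by apply: bounded_mul => //; exact: cond.
have i2 : leb.-integrable `]a, b[ (EFin \o f2).
  by apply: integrable_cc_oo => x; apply: cvgM; [exact: cpt|exact: cinv].
have F : \int[leb]_(y in `]a, b[) (f1 y + f2 y) = 0.
  have E0 : pt b * lnm z b - pt a * lnm z a = 0.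
    have g0 (p q u v : R) : p = 0 -> q = 0 -> p * u - q * v = 0 by move=> -> ->; ring.
    exact: g0 (pt_b HD s A) (pt_a HD s A).
  rewrite -[RHS]E0; apply: (@FTC_open R a b ab (fun y => f1 y + f2 y) (fun y => pt y * lnm z y)).
  - move=> x; apply: cvgD; apply: cvgM.
    + exact: (pt1_cont HD s0 s_ext).
    + exact: (sub_cc (cond z0)).
    + exact: (sub_cc cpt).
    + exact: (sub_cc (cinv z0)).
  - by move=> x; apply: cvgM; [exact: cpt|exact: cond].
  - by move=> y yI; apply: derM; [exact: (pt_der HD)|apply: lnm_der => //; exact: oo_le].
  - exact: integrableDr.
rewrite RintegralD // in F.
have -> : Re (CTt z) = - \int[leb]_(y in `]a, b[) f2 y.
  rewrite Re_cI -mulN1r -RintegralZl //; apply: eq_Rintegral => y _.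
  rewrite /CK /f2 /lnm1 ReM ReV ReB ImB !ReC !ImC subr0 mul0r subr0.
  by have := den y z0; set D := _ + _ => D0; field; rewrite gt_eqF.
have -> : \int[leb]_(y in `]a, b[) (pt1 y * ln (cmod (z - (Y y)%:C))) = \int[leb]_(y in `]a, b[) f1 y.
  by apply: eq_Rintegral => y _; rewrite lnmE.
by move: F; set u := \int[_]_(_ in _) _; set v := \int[_]_(_ in _) _; lra.
Qed.

Lemma log_meas t : measurable_fun `]a, b[ (fun y => ln `|Y t - Y y|).
Proof.
apply: measurable_funS (_ : measurable_fun setT _) => //.
apply: measurableT_comp; first exact: measurable_ln.
apply: measurableT_comp; first exact: normr_measurable.
by apply: measurable_funB; [exact: measurable_cst|exact: measurable_powR].
Qed.

(** Points on the ray approach [Ip t]. The nontangential estimate bounds [|z - Y y|] below by a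
    multiple of [|y - t|], so one majorant, a weight plus a weight times a logarithm, serves for the
    whole sequence. *)
Lemma CT_log_limit t : a < t < b -> exists l_ : nat -> R,
  [/\ forall n, 0 < l_ n /\ 0 < sg * (l_ n - 1), l_ n @[n --> \oo] --> (1 : R),
   leb.-integrable `]a, b[ (EFin \o (fun y => pt1 y * ln `|Y t - Y y|)) &
   Re (CTt (zf ((l_ n)%:C * Ip t))) @[n --> \oo] --> \int[leb]_(y in `]a, b[) (pt1 y * ln `|Y t - Y y|)].
Proof.
move=> tI; have tI2 := oo_le tI.
have [c [r [K [c0 r0 K0 H]]]] := nontangential tI; have [m m0 Hm] := Y_lower.
pose q := Num.min r 1; have q0 : 0 < q by rewrite lt_min r0 /=.
(* The deviation stays at most half of both [r], where the nontangential estimate holds, and [1],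
   which keeps the factor positive; [sg] selects the side of the curve. *)
pose l_ (n : nat) : R := 1 + sg * (q / n.+2%:R).
have sg1 : `|sg| = 1 by case: hk => -[_ ->]; rewrite ?normrN normr1.
have qn (n : nat) : 0 < q / n.+2%:R <= q / 2.
  by rewrite divr_gt0 ?ltr0n //= ler_pM2l // lef_pV2 ?posrE ?ltr0n // ler_nat.
have ln1 n : `|l_ n - 1| = q / n.+2%:R.
  rewrite /l_ addrAC subrr add0r normrM sg1 mul1r ger0_norm //.
  by have /andP[/ltW] := qn n.
have lr n : `|l_ n - 1| < r.
  rewrite ln1; have /andP[_ /le_lt_trans] := qn n; apply.
  have : q <= r by rewrite ge_min lexx.
  by move: q0; lra.
have lpos n : 0 < l_ n /\ 0 < sg * (l_ n - 1).
  split; last by rewrite /l_ addrAC subrr add0r mulrA (sg2 hk) mul1r; have /andP[] := qn n.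
  have := ln1 n; have /andP[_ h] := qn n; have q1 : q <= 1 by rewrite ge_min lexx orbT.
  move=> E; have : `|l_ n - 1| < 1 by rewrite E; move: h q1; set w := _ / n.+2%:R; lra.
  by move=> /ltr_normlP[]; lra.
have lc : l_ n @[n --> \oo] --> (1 : R).
  rewrite -[X in _ --> X]addr0; apply: cvgD; first exact: cvg_cst.
  rewrite -(mulr0 sg); apply: cvgM; first exact: cvg_cst.
  rewrite -(mulr0 q); apply: cvgM; first exact: cvg_cst.
  have h : n.+1%:R^-1 @[n --> \oo] --> (0 : R) by exact: cvg_harmonic.
  apply/cvgrPdist_lt => eps e0; have /cvgrPdist_lt/(_ _ e0) := h.
  apply: filterS => n; rewrite !sub0r !normrN; apply: le_lt_trans.
  by rewrite !ger0_norm ?invr_ge0 ?ler0n // lef_pV2 ?posrE ?ltr0n // ler_nat.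
have zI n : Im (zf ((l_ n)%:C * Ip t)) != 0.
  by have [h1 h2] := lpos n; exact: (zf_Im0 HD hk (ray_Om HD hk tI h1 h2)).
exists l_.
have [B B0 HB] := ccont_bounded HD (ccont_real cY).
have [K1 K10 HK1] := pt1_le HD A s0 s_ext.
pose KK := K * r + 2 * B.
pose C0 := `|ln (c * m)| + `|ln KK|.
have cm0 : 0 < c * m by rewrite mulr_gt0.
have [|||||i L] := @dominated_punctured R a b t
  (fun n y => pt1 y * ln (cmod (zf ((l_ n)%:C * Ip t) - (Y y)%:C)))
  (fun y => pt1 y * ln `|Y t - Y y|)
  (fun y => K1 * (C0 * Wt y + Wt y * `|ln `|y - t| |)).
- move=> n; apply: measurable_funM; first exact: integrable_measurable ip1.
  rewrite (_ : (fun y => _) = lnm (zf ((l_ n)%:C * Ip t))); last by apply/funext => y; rewrite lnmE.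
  by apply: within_measurable; apply: sub_cc; exact: cond.
- by apply: measurable_funM; [exact: integrable_measurable ip1|exact: log_meas].
- move=> y yI yt; apply: cvgM; first exact: cvg_cst.
  have Yn : 0 < `|Y t - Y y|.
    apply: lt_le_trans (Hm _ _ (oo_le yI) tI2); rewrite mulr_gt0 // normr_gt0 subr_eq0.
    by apply/eqP => E; apply: yt.
  have cl : {for `|Y t - Y y|, continuous (@ln R)} by exact: continuous_ln.
  apply: continuous_cvg; first exact: cl.
  apply/cvgrPdist_lt => eps e0.
  have e1 : 0 < eps / K by rewrite divr_gt0.
  have /cvgrPdist_lt/(_ _ e1) := lc; apply: filterS => n; rewrite distrC => hn.
  have [up _] := H _ (lr n).
  rewrite -cmod_real rmorphB /=.
  have k1 := cmod_ler_dist ((Y t)%:C - (Y y)%:C) (zf ((l_ n)%:C * Ip t) - (Y y)%:C).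
  have k2 := cmod_ler_dist (zf ((l_ n)%:C * Ip t) - (Y y)%:C) ((Y t)%:C - (Y y)%:C).
  have E1 : (Y t)%:C - (Y y)%:C - (zf ((l_ n)%:C * Ip t) - (Y y)%:C) = (Y t)%:C - zf ((l_ n)%:C * Ip t) by ring.
  have E2 : zf ((l_ n)%:C * Ip t) - (Y y)%:C - ((Y t)%:C - (Y y)%:C) = zf ((l_ n)%:C * Ip t) - (Y t)%:C by ring.
  rewrite E1 [cmod ((Y t)%:C - zf _)]cmodB in k1; rewrite E2 in k2.
  have hK : K * `|l_ n - 1| < eps by move: hn; rewrite ltr_pdivlMr // mulrC.
  by apply/ltr_normlP; move: up hK k1 k2; split; lra.
- apply: integrableZr; first exact: oo_measurable.
  apply: integrableDr; first exact: oo_measurable.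
    by apply: integrableZr; [exact: oo_measurable|exact: (Wt_int HD)].
  exact: Wt_ln_int.
- move=> n y yI yt; rewrite normrM.
  have [up lo] := H _ (lr n).
  have ty : 0 < `|y - t| by rewrite normr_gt0 subr_eq0; apply/eqP.
  have l1 : c * m * `|y - t| <= cmod (zf ((l_ n)%:C * Ip t) - (Y y)%:C).
    apply: le_trans (lo (Y y)); rewrite -mulrA ler_pM2l //.
    by rewrite distrC; apply: Hm => //; exact: oo_le.
  have l2 : cmod (zf ((l_ n)%:C * Ip t) - (Y y)%:C) <= KK.
    apply: le_trans (cmodBD _ (Y t)%:C _) _; rewrite /KK; apply: lerD.
      by apply: le_trans up _; rewrite ler_pM2l // ltW // lr.
    rewrite -rmorphB cmod_real; apply: le_trans (ler_normB _ _) _.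
    by have := HB _ tI2; have := HB _ (oo_le yI); rewrite !cmod_real; lra.
  have l0 : 0 < c * m * `|y - t| by rewrite mulr_gt0.
  have := norm_ln_between l0 l1 l2; rewrite lnM ?posrE // => hl.
  have W0 := Wt_ge0 theta c1 d ea eb y.
  apply: (@le_trans _ _ (K1 * Wt y * (C0 + `|ln `|y - t| |))).
    apply: ler_pM => //; first exact: HK1.
    apply: le_trans hl _; rewrite /C0; have := ler_normD (ln (c * m)) (ln `|y - t|); lra.
  by rewrite le_eqVlt; apply/orP; left; apply/eqP; ring.
split=> //.
rewrite (_ : (fun n => _) = (fun n => \int[leb]_(y in `]a, b[)
  (pt1 y * ln (cmod (zf ((l_ n)%:C * Ip t) - (Y y)%:C))))) //.
by apply/funext => n; rewrite Re_CT_parts.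
Qed.

End Test.
End Power.

Section Kernel.
Variables (s A : C).
Hypothesis s0 : 0 < Im s.
Hypothesis s_ext : 0 < Im (ell s).
Local Notation pt1 := (pt1 theta d Ip s A).
Let z0 := zf theta c1 d 1 s.
Let D := zf theta c1 d 1 s * (1%:C * ell1 s).
Let hk1 : ((1 : R) = 1 /\ (1 : R) = 1) \/ ((1 : R) = theta /\ (1 : R) = -1) := or_introl (conj erefl erefl).
Let hkt : (theta = 1 /\ -1 = 1 :> R) \/ (theta = theta /\ (-1 : R) = -1) := or_intror (conj erefl erefl).

Let ray_lim (F : C -> C) (e : C) t (l_ : nat -> R) : qd F (Ip t) e -> l_ n @[n --> \oo] --> (1 : R) ->
  Re (F ((l_ n)%:C * Ip t)) @[n --> \oo] --> Re (F (Ip t)).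
Proof.
move=> qF lc; apply/cvgrPdist_lt => eps e0.
have [del d0 H] := qd_cvg qF e0.
have e1 : 0 < del / (cmod (Ip t) + 1) by rewrite divr_gt0 // ltr_wpDl // cmod_ge0.
have /cvgrPdist_lt/(_ _ e1) := lc; apply: filterS => n hn.
rewrite distrC -ReB; apply: le_lt_trans (Re_le_cmod _) _; apply: H.
rewrite (_ : (l_ n)%:C * Ip t - Ip t = (l_ n - 1)%:C * Ip t); last by rewrite rmorphB mulrBl mul1r.
rewrite cmodM cmod_real distrC; move: hn; rewrite ltr_pdivlMr ?ltr_wpDl ?cmod_ge0 //.
by apply: le_lt_trans; rewrite ler_wpM2l // lerDl.
Qed.

Definition Kern t y : R := ln `|t - y| + ln `|t `^ theta - y `^ theta|.

Lemma kernel_identity t : a < t < b -> (forall m : R, 0 < m -> m%:C * Ip t <> s) ->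
  leb.-integrable `]a, b[ (EFin \o (fun y => pt1 y * Kern t y)) /\
  \int[leb]_(y in `]a, b[) (pt1 y * Kern t y) = 2 * pi * Re (A / s + A * D / (t%:C - z0)).
Proof.
move=> tI ns; have t0 := oo_gt0 tI; have i0 := cd_H HD tI.
have [n1 n2] := Ip_neq_s HD s0 s_ext (oo_le tI).
have [l1 [p1 c1' i1 L1]] := CT_log_limit hk1 A s0 s_ext tI.
have [l2 [p2 c2 i2 L2]] := CT_log_limit hkt A s0 s_ext tI.
have Om_s : Om theta c1 d 1 s by split=> //; rewrite mul1r.
have z0_Im : 0 < Im z0 by have := zf_Im HD hk1 Om_s; rewrite mul1r.
have [m1 m2] := real_neq z0_Im t.
have zt : zf theta c1 d 1 (Ip t) = t%:C by rewrite (zf_Ip HD 1 tI) /Yp powRr1 // ltW.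
have E1 : \int[leb]_(y in `]a, b[) (pt1 y * ln `|Yp 1 t - Yp 1 y|) =
    - pi * (Re (pf A s (Ip t)) - 2 * Re (A * D / (t%:C - z0))).
  have q : qd (fun w => - pi%:C * (pf A s w - pf (A * D) z0 (zf theta c1 d 1 w))) (Ip t)
     (- pi%:C * (pf1 A s (Ip t) - pf1 (A * D) z0 t%:C * (zf theta c1 d 1 (Ip t) * (1%:C * ell1 (Ip t))))).
    apply: qdZ; apply: qdD; first exact: qd_pf.
    apply: qdN; apply: qd_comp; last exact: qd_zf.
    by rewrite zt; exact: qd_pf.
  have := ray_lim q c1'.
  have -> : Re (- pi%:C * (pf A s (Ip t) - pf (A * D) z0 (zf theta c1 d 1 (Ip t)))) =
      - pi * (Re (pf A s (Ip t)) - 2 * Re (A * D / (t%:C - z0))).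
    rewrite zt (pf_real (A * D) z0 t) (ReM (- pi%:C)) (ReN pi%:C) (ImN pi%:C) (ReC pi) (ImC pi) oppr0 mul0r subr0 ReB.
    by rewrite (ReC (2 * _)).
  rewrite (_ : (fun n => Re (- pi%:C * _)) = (fun n => Re (CTt theta c1 d ea eb Ip s A 1
      (zf theta c1 d 1 ((l1 n)%:C * Ip t))))); first exact: cvg_unique L1.
  apply/funext => n; congr (Re _); apply/esym; have [k1 k2] := p1 n; rewrite mul1r subr_gt0 in k2.
  exact: (ext_repr HD A s0 s_ext tI ns k2).
have E2 : \int[leb]_(y in `]a, b[) (pt1 y * ln `|Yp theta t - Yp theta y|) =
    pi * (Re (pf A s (Ip t)) - 2 * Re (A / (0%:C - s))).
  have q : qd (fun w => pi%:C * (pf A s w - pf A s 0)) (Ip t) (pi%:C * (pf1 A s (Ip t) - 0)).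
    by apply: qdZ; apply: qdD; [exact: qd_pf|apply: qdN; exact: qd_cst].
  have := ray_lim q c2.
  have -> : Re (pi%:C * (pf A s (Ip t) - pf A s 0)) = pi * (Re (pf A s (Ip t)) - 2 * Re (A / (0%:C - s))).
    rewrite (ReM pi%:C) (ReC pi) (ImC pi) mul0r subr0 ReB -[pf A s 0]/(pf A s 0%:C) (pf_real A s 0).
    by rewrite (ReC (2 * _)).
  rewrite (_ : (fun n => Re (pi%:C * _)) = (fun n => Re (CTt theta c1 d ea eb Ip s A theta
      (zf theta c1 d theta ((l2 n)%:C * Ip t))))); first exact: cvg_unique L2.
  apply/funext => n; congr (Re _); apply/esym; have [k1 k2] := p2 n; rewrite mulN1r oppr_gt0 subr_lt0 in k2.
  by apply: (int_repr HD A s0 s_ext tI ns); rewrite k1.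
have mo := oo_measurable a b.
have EK y : a < y < b -> pt1 y * Kern t y =
    pt1 y * ln `|Yp 1 t - Yp 1 y| + pt1 y * ln `|Yp theta t - Yp theta y|.
  by move=> /oo_gt0 y0; rewrite /Kern /Yp !powRr1 ?(ltW y0) ?(ltW t0) // mulrDr.
split.
  have i3 : leb.-integrable `]a, b[ (EFin \o (fun y => pt1 y * ln `|Yp 1 t - Yp 1 y| +
      pt1 y * ln `|Yp theta t - Yp theta y|)) by exact: integrableDr.
  by apply: eq_integrable i3 => // y /set_mem /oo_open yI /=; rewrite EK.
rewrite (@eq_Rintegral _ _ _ leb _ (fun y => pt1 y * ln `|Yp 1 t - Yp 1 y| + pt1 y * ln `|Yp theta t - Yp theta y|)).
  rewrite RintegralD // E1 E2.
  have -> : A / (0%:C - s) = - (A / s) by rewrite sub0r invrN mulrN.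
  by rewrite ReN ReD; ring.
by move=> y /set_mem /oo_open yI; exact: EK.
Qed.

End Kernel.
End LogLimits.

(** * The equilibrium measure: atoms, integrability, edge bounds, Fubini *)

Section Equilibrium.
Variable R : realType.
Local Notation leb := (@lebesgue_measure R).
Variables (theta a b : R) (V Vd : R -> R) (mu : probability R R) (ell : R).
Hypothesis th1 : 1 < theta.
Hypothesis a0 : 0 < a.
Hypothesis ab : a < b.
Hypothesis supp : msupport mu = `[a, b]%classic.
Hypothesis Vder : forall x : R, 0 < x -> is_derive x 1 V (Vd x).
Hypothesis cVd : {within `[0, +oo[, continuous Vd}.
Hypothesis ELe : forall x : R, a <= x <= b -> Upot theta mu V x = ell%:E.
Hypothesis ELi : forall x : R, 0 <= x -> (Upot theta mu V x <= ell%:E)%E.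
Implicit Types (D N : set R) (x y t : R).

(** A point outside the support has a null neighbourhood, hence lies in a null interval with
    rational ends; these are countably many, enumerated by [unpickle]. *)
Lemma mu_cc : mu (~` `[a, b]%classic) = 0%E.
Proof.
have mc : measurable (~` `[a, b]%classic : set R) by apply: measurableC; exact: measurable_itv.
pose F (k : nat) : set R := if unpickle k is Some (p, q) then
  (if mu `](ratr (p : rat)), (ratr (q : rat))[%classic == 0%E then `](ratr p), (ratr q)[%classic else set0)
  else set0.
have Fn k : mu.-negligible (F k).
  rewrite /F; case: unpickle => [[p q]|]; last exact: negligible_set0.
  case: ifP => [/eqP E|_]; last exact: negligible_set0.
  by apply/negligibleP.
suff sub : ~` `[a, b]%classic `<=` \bigcup_k F k.
  by apply/(negligibleP _ mc); apply: negligibleS sub (negligible_bigcup Fn).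
move=> x nx; have : ~ msupport mu x by rewrite supp.
move=> /existsNP[e /not_implyP[e0 /negP]]; rewrite -leNgt => h.
have [p] : exists p, ratr p \in `](x - e), x[ by apply: rat_in_itvoo; rewrite ltrBlDr ltrDl.
have [q] : exists q, ratr q \in `]x, (x + e)[ by apply: rat_in_itvoo; rewrite ltrDl.
rewrite !in_itv /= => /andP[q1 q2] /andP[p1 p2].
have z : mu `](ratr p), (ratr q)[%classic = 0%E.
  apply/eqP; rewrite -measure_le0; apply: le_trans h; apply: le_measure; rewrite ?inE //.
  move=> y; rewrite /= !in_itv /= => /andP[y1 y2].
  by rewrite (lt_trans p1 y1) (lt_trans y2 q2).
have E : F (pickle (p, q)) = `](ratr p), (ratr q)[%classic by rewrite /F pickleK z eqxx.
exists (pickle (p, q)); first exact: I.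
by rewrite E; apply/andP; split.
Qed.

Lemma lnE_meas (g : R -> R) : measurable_fun setT g -> measurable_fun setT (fun y => lnE (g y)).
Proof.
move=> mg; apply: measurable_fun_ifT.
- by apply: measurable_fun_eqr => //; exact: measurable_cst.
- exact: measurable_cst.
- by apply/measurable_EFinP; apply: measurableT_comp => //; exact: measurable_ln.
Qed.

(** Domains of full measure, over which integrals against [mu] coincide. They allow the endpoints,
    the diagonal point and an exceptional point to be discarded. *)
Definition dom D := measurable D /\ mu (~` D) = 0%E.

Lemma dom_cc : dom `[a, b]%classic.
Proof. by split; [exact: measurable_itv|exact: mu_cc]. Qed.

Lemma dom_int D (F : R -> \bar R) : dom D -> measurable_fun setT F ->
  (\int[mu]_y F y = \int[mu]_(y in D) F y)%E.
Proof.
move=> [mD D0] mF; have mC := measurableC mD.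
have E : setT `\` ~` D = D by rewrite setDE setCK setTI.
rewrite [LHS]integralE [RHS]integralE; congr (_ - _)%E.
  rewrite (ge0_negligible_integral mC measurableT _ _ D0) ?E //.
  exact: measurable_funepos.
rewrite (ge0_negligible_integral mC measurableT _ _ D0) ?E //.
exact: measurable_funeneg.
Qed.

Lemma dom_intg D D' (F : R -> \bar R) : dom D -> dom D' -> measurable_fun setT F ->
  mu.-integrable D F -> mu.-integrable D' F.
Proof.
move=> dD dD' mF /integrableP[_ h]; apply/integrableP; split.
  by apply: measurable_funS mF.
by rewrite -dom_int // ?(dom_int dD) //; exact: measurableT_comp.
Qed.

Lemma dom_Rint D D' (F : R -> R) : dom D -> dom D' -> measurable_fun setT F ->
  \int[mu]_(y in D) F y = \int[mu]_(y in D') F y.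
Proof.
move=> dD dD' /measurable_EFinP mF; rewrite /Rintegral; congr fine.
exact: etrans (esym (dom_int dD mF)) (dom_int dD' mF).
Qed.

Lemma dom_setD1 D x : dom D -> mu [set x] = 0%E -> dom (D `\ x).
Proof.
move=> [mD D0] x0; split; first exact: measurableD.
apply/negligibleP; first by apply: measurableC; exact: measurableD.
apply: (@negligibleS _ _ _ _ (~` D `|` [set x])).
  move=> y /= h; have [Dy|] := pselect (D y); last by left.
  by right; apply: contrapT => yx; apply: h.
by apply: negligibleU; apply/negligibleP => //; exact: measurableC.
Qed.

Let mlin x : measurable_fun setT (fun y => `|x - y|).
Proof.
apply: measurableT_comp; first exact: normr_measurable.
by apply: measurable_funB; [exact: measurable_cst|exact: measurable_id].
Qed.

Let mpow x : measurable_fun setT (fun y => `|x `^ theta - y `^ theta|).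
Proof.
apply: measurableT_comp; first exact: normr_measurable.
by apply: measurable_funB; [exact: measurable_cst|exact: measurable_powR].
Qed.

Let mln (g : R -> R) : measurable_fun setT g -> measurable_fun setT (fun y => ln (g y)).
Proof. by move=> mg; apply: measurableT_comp => //; exact: measurable_ln. Qed.

Lemma Kern_meas x : measurable_fun setT (Kern theta x).
Proof. by apply: measurable_funD; apply: mln. Qed.

Lemma integrable_bound D (f : R -> R) (K : R) : measurable D -> measurable_fun setT f ->
  (forall y, D y -> `|f y| <= K) -> mu.-integrable D (EFin \o f).
Proof.
move=> mD mf H; apply: (@integrable_le R _ _ mu D mD f (cst K)) => //.
  exact: measurable_funS mf.
exact: finite_measure_integrable_cst.
Qed.

(** The positive part is bounded because [g] is, so a finite value of the extended integral forces
    the negative part to be integrable too. *)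
Lemma lnE_intg (g : R -> R) (K : R) : measurable_fun setT g -> (forall y, a <= y <= b -> 0 <= g y <= K) ->
  (\int[mu]_y lnE (g y))%E \is a fin_num -> mu.-integrable `[a, b] (fun y => lnE (g y)).
Proof.
move=> mg gK; have mF := lnE_meas mg; rewrite (dom_int dom_cc mF) integralE.
have [mc _] := dom_cc.
set F := fun y => lnE (g y).
have mFp : measurable_fun `[a, b] (F^\+)%E by apply: measurable_funepos; exact: measurable_funS mF.
have mFn : measurable_fun `[a, b] (F^\-)%E by apply: measurable_funeneg; exact: measurable_funS mF.
have hp : (\int[mu]_(x in `[a, b]) F^\+ x < +oo)%E.
  apply: (@le_lt_trans _ _ (\int[mu]_(x in `[a, b]) cst (`|ln K|)%:E x)%E).
    apply: ge0_le_integral => //.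
    move=> x; rewrite /= in_itv /= => /gK /andP[g0 gk]; rewrite funeposE /F /lnE.
    case: eqVneq => gx; first by rewrite maxNye lee_fin.
    rewrite ge_max !lee_fin normr_ge0 andbT (le_trans _ (ler_norm _)) //.
    have gp : 0 < g x by rewrite lt_neqAle eq_sym gx.
    by rewrite ler_ln ?posrE // (lt_le_trans gp).
  rewrite integral_cst // lte_mul_pinfty ?lee_fin //.
  by rewrite (le_lt_trans (probability_le1 _ mc)) // ltry.
have p0 : (0 <= \int[mu]_(x in `[a, b]) F^\+ x)%E by apply: integral_ge0.
have n0 : (0 <= \int[mu]_(x in `[a, b]) F^\- x)%E by apply: integral_ge0.
move=> hfin.
have hn : (\int[mu]_(x in `[a, b]) F^\- x < +oo)%E.
  rewrite ltey; apply/eqP => E; move: hfin; rewrite E /=.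
  by move: hp p0; case: (integral _ _ _) => [r| |].
apply/integrableP; split; first exact: measurable_funS mF.
have -> : (\int[mu]_(x in `[a, b]) `|F x| = \int[mu]_(x in `[a, b]) (F^\+ x + F^\- x))%E.
  by apply: eq_integral => x _; rewrite -/((abse \o F) x) fune_abse.
rewrite ge0_integralD //.
by rewrite lte_add_pinfty.
Qed.

Let b0 : 0 < b := lt_trans a0 ab.

Let lin_bound x y : a <= x <= b -> a <= y <= b -> 0 <= `|x - y| <= b - a.
Proof.
by move=> /andP[h1 h2] /andP[h3 h4]; rewrite normr_ge0 /=; apply/ler_normlP; split; lra.
Qed.

Let pow_mono x y : 0 < x -> x <= y -> x `^ theta <= y `^ theta.
Proof.
move=> x0 xy; apply: ge0_ler_powR => //; rewrite ?nnegrE ?(ltW x0) ?(ltW (lt_trans ltr01 th1)) //.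
exact: le_trans (ltW x0) xy.
Qed.

Let pow_lt x y : 0 < x -> x < y -> x `^ theta < y `^ theta.
Proof.
move=> x0 xy; apply: gt0_ltr_powR => //; rewrite ?nnegrE ?(ltW x0) //; [exact: lt_trans ltr01 th1|exact: ltW (lt_trans x0 xy)].
Qed.

Let pow_bound x y : a <= x <= b -> a <= y <= b -> 0 <= `|x `^ theta - y `^ theta| <= b `^ theta.
Proof.
move=> /andP[h1 h2] /andP[h3 h4]; rewrite normr_ge0 /=.
have x0 := lt_le_trans a0 h1; have y0 := lt_le_trans a0 h3.
have := pow_mono x0 h2; have := pow_mono y0 h4.
have := powR_ge0 x theta; have := powR_ge0 y theta.
by move=> *; apply/ler_normlP; split; lra.
Qed.

Lemma pot_intg x : a <= x <= b ->
  mu.-integrable `[a, b] (fun y => lnE `|x - y|) /\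
  mu.-integrable `[a, b] (fun y => lnE `|x `^ theta - y `^ theta|).
Proof.
move=> xI; have : Upot theta mu V x \is a fin_num by rewrite ELe.
rewrite /Upot fin_numB fin_numD => /andP[/andP[f1 f2] _]; split.
  by apply: (@lnE_intg _ (b - a)) => // y yI; exact: lin_bound.
by apply: (@lnE_intg _ (b `^ theta)) => // y yI; exact: pow_bound.
Qed.

(** The potential is finite on the support by the Euler-Lagrange equality, so the logarithm is
    finite almost everywhere; at [x] it is [-oo]. *)
Lemma mu_noatom x : a <= x <= b -> mu [set x] = 0%E.
Proof.
move=> xI; have [i _] := pot_intg xI.
have [mc _] := dom_cc.
have := integrable_ae mc i => -[N [mN N0 H]].
apply/negligibleP => //; exists N; split => // y ->.
apply: H => /= /(_ xI); rewrite subrr normr0 /lnE eqxx.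
by [].
Qed.

Lemma dom_oo : dom `]a, b[%classic.
Proof.
have h := dom_setD1 (dom_setD1 dom_cc (mu_noatom (x := a) _)) (mu_noatom (x := b) _).
have -> : `]a, b[%classic = (`[a, b]%classic `\ a) `\ b.
  apply/seteqP; split => y /=; rewrite !in_itv /=.
    move=> /andP[h1 h2]; split; last by move=> E; rewrite E ltxx in h2.
    by split; [rewrite !ltW|move=> E; rewrite E ltxx in h1].
  move=> [[/andP[h1 h2] n1] n2]; rewrite !lt_neqAle h1 h2 !andbT.
  by apply/andP; split; apply/eqP => // E; apply: n1.
by apply: h; rewrite lexx ltW.
Qed.

Lemma pot_real D x : dom D -> D `<=` `]a, b[ -> 0 < x -> (forall y, D y -> y <> x) ->
  mu.-integrable D (EFin \o (fun y => ln `|x - y|)) ->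
  mu.-integrable D (EFin \o (fun y => ln `|x `^ theta - y `^ theta|)) ->
  mu.-integrable D (EFin \o Kern theta x) /\ Upot theta mu V x = (\int[mu]_(y in D) Kern theta x y - V x)%:E.
Proof.
move=> dD Dab x0 nx i1 i2; have [mD _] := dD.
split; first exact: (integrableDr mD i1 i2).
rewrite /Upot (dom_int dD (lnE_meas (mlin x))) (dom_int dD (lnE_meas (mpow x))).
have E1 : (\int[mu]_(y in D) lnE (`|x - y|)%R)%E = (\int[mu]_(y in D) ln `|x - y|)%:E.
  rewrite /Rintegral fineK; last exact: integrable_fin_num.
  apply: eq_integral => y /set_mem Dy; rewrite /lnE ifF //.
  by rewrite normr_eq0 subr_eq0; apply/eqP => E; apply: (nx _ Dy).
have E2 : (\int[mu]_(y in D) lnE (`|x `^ theta - y `^ theta|)%R)%E = (\int[mu]_(y in D) ln `|x `^ theta - y `^ theta|)%:E.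
  rewrite /Rintegral fineK; last exact: integrable_fin_num.
  apply: eq_integral => y /set_mem Dy; rewrite /lnE ifF //.
  have y0 : 0 < y by have := Dab _ Dy; rewrite /= in_itv /= => /andP[/(lt_trans a0)].
  rewrite normr_eq0 subr_eq0; apply/eqP => E; apply: (nx _ Dy).
  have [h|h|//] := ltgtP y x; first by have := pow_lt y0 h; rewrite E ltxx.
  by have := pow_lt x0 h; rewrite E ltxx.
have E3 : \int[mu]_(y in D) Kern theta x y =
    \int[mu]_(y in D) ln `|x - y| + \int[mu]_(y in D) ln `|x `^ theta - y `^ theta|.
  by rewrite -(RintegralD mD i1 i2).
by rewrite E1 E2 E3.
Qed.

(** Once the diagonal point, null by [mu_noatom], is removed, the extended logarithms are real and
    the Euler-Lagrange equality becomes an identity between real integrals. *)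
Lemma Kern_int D x : dom D -> a <= x <= b ->
  mu.-integrable D (EFin \o Kern theta x) /\ \int[mu]_(y in D) Kern theta x y = V x + ell.
Proof.
move=> dD xI; have x0 : 0 < x by have /andP[/(lt_le_trans a0)] := xI.
have mx := mu_noatom xI; have dO := dom_setD1 dom_oo mx; have [mO _] := dO.
have sub : `]a, b[%classic `\ x `<=` `]a, b[ by move=> y [].
have subc : `]a, b[%classic `\ x `<=` `[a, b].
  by move=> y [/=]; rewrite !in_itv /= => /andP[h1 h2] _; rewrite !ltW.
have nx y : (`]a, b[%classic `\ x) y -> y <> x by case.
have [j1 j2] := pot_intg xI; have [mc _] := dom_cc.
have i1 : mu.-integrable (`]a, b[%classic `\ x) (EFin \o (fun y => ln `|x - y|)).
  apply: eq_integrable (integrableS mc mO subc j1) => // y /set_mem [_ yx]; rewrite /lnE ifF //.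
  by rewrite normr_eq0 subr_eq0; apply/eqP => E; apply: yx.
have i2 : mu.-integrable (`]a, b[%classic `\ x) (EFin \o (fun y => ln `|x `^ theta - y `^ theta|)).
  apply: eq_integrable (integrableS mc mO subc j2) => // y /set_mem Dy; rewrite /lnE ifF //.
  have y0 : 0 < y by have := sub _ Dy; rewrite /= in_itv /= => /andP[/(lt_trans a0)].
  rewrite normr_eq0 subr_eq0; apply/eqP => E; apply: (nx _ Dy).
  have [h|h|//] := ltgtP y x; first by have := pow_lt y0 h; rewrite E ltxx.
  by have := pow_lt x0 h; rewrite E ltxx.
have [iK EK] := pot_real dO sub x0 nx i1 i2.
have mK : measurable_fun setT (EFin \o Kern theta x) by apply/measurable_EFinP; exact: Kern_meas.
split; first exact: dom_intg iK.
rewrite (dom_Rint dD dO (Kern_meas x)).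
by have := ELe xI; rewrite EK => -[<-]; rewrite addrCA subrr addr0.
Qed.

Lemma Kern_out x : 0 < x -> x < a \/ b < x ->
  mu.-integrable `]a, b[ (EFin \o Kern theta x) /\ \int[mu]_(y in `]a, b[) Kern theta x y <= V x + ell.
Proof.
move=> x0 xo; have dO := dom_oo; have [mO _] := dO.
have nx y : `]a, b[%classic y -> y <> x.
  by rewrite /= in_itv /= => /andP[h1 h2] E; case: xo; rewrite -E => h3; move: h1 h2 h3; lra.
have i1 : mu.-integrable `]a, b[ (EFin \o (fun y => ln `|x - y|)).
  pose m := if x < a then a - x else x - b.
  have m0 : 0 < m.
    rewrite /m; case: ifP => h; first by rewrite subr_gt0.
    by case: xo => h'; [rewrite h' in h|rewrite subr_gt0].
  apply: (@integrable_bound _ _ (`|ln m| + `|ln (x + b)|)) => //; first exact: mln.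
  move=> y; rewrite /= in_itv /= => /andP[h1 h2]; apply: norm_ln_between => //.
    rewrite /m; case: ifP => h; first by rewrite ler0_norm; move: h h1; lra.
    by case: xo => h'; [rewrite h' in h|rewrite ger0_norm; move: h' h2; lra].
  by apply/ler_normlP; move: a0 x0 h1 h2; split; lra.
have i2 : mu.-integrable `]a, b[ (EFin \o (fun y => ln `|x `^ theta - y `^ theta|)).
  pose m := if x < a then a `^ theta - x `^ theta else x `^ theta - b `^ theta.
  have m0 : 0 < m.
    rewrite /m; case: ifP => h; first by rewrite subr_gt0 pow_lt.
    by case: xo => h'; [rewrite h' in h|rewrite subr_gt0 pow_lt].
  apply: (@integrable_bound _ _ (`|ln m| + `|ln (x `^ theta + b `^ theta)|)) => //; first exact: mln.
  move=> y; rewrite /= in_itv /= => /andP[h1 h2]; have y0 := lt_trans a0 h1.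
  have p1 := pow_lt a0 h1; have p2 := pow_lt y0 h2; have p3 := powR_ge0 x theta; have p4 := powR_ge0 y theta.
  apply: norm_ln_between => //.
    rewrite /m; case: ifP => h.
      by have p5 := pow_lt x0 h; rewrite ler0_norm; move: p5 p1; lra.
    case: xo => h'; first by rewrite h' in h.
    by have p5 := pow_lt b0 h'; rewrite ger0_norm; move: p5 p2; lra.
  by apply/ler_normlP; move: p1 p2 p3 p4; split; lra.
have [iK EK] := pot_real dO (@subset_refl _ _) x0 nx i1 i2.
split=> //; have := ELi (ltW x0); rewrite EK lee_fin; lra.
Qed.

Lemma Vd_bounded (u v : R) : 0 < u -> u < v -> exists2 B : R, 0 < B & forall x, u <= x <= v -> `|Vd x| <= B.
Proof.
move=> u0 uv.
have cV : {within `[u, v], continuous Vd}.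
  by apply: continuous_subspaceW cVd => x; rewrite /= !in_itv /= andbT => /andP[/(lt_le_trans u0)/ltW].
have [c1 _ H1] := EVT_max (ltW uv) cV; have [c2 _ H2] := EVT_min (ltW uv) cV.
exists (`|Vd c1| + `|Vd c2| + 1); first by rewrite ltr_wpDl // addr_ge0.
move=> y yI; have h1 : Vd y <= Vd c1 by apply: H1; rewrite in_itv.
have h2 : Vd c2 <= Vd y by apply: H2; rewrite in_itv.
have := ler_norm (Vd c1); have := ler_norm (- Vd c2); rewrite normrN.
have := normr_ge0 (Vd c1); have := normr_ge0 (Vd c2).
by move=> *; apply/ler_normlP; split; lra.
Qed.

Lemma V_lip (u v : R) : 0 < u -> u < v -> exists2 B : R, 0 < B &
  forall x y, u <= x -> x <= y -> y <= v -> `|V y - V x| <= B * (y - x).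
Proof.
move=> u0 uv; have [B B0 HB] := Vd_bounded u0 uv; exists B => // x y ux xy yv.
have D (t : R) : x <= t <= y -> is_derive t 1 V (Vd t).
  by move=> /andP[h _]; apply: Vder; exact: lt_le_trans u0 (le_trans ux h).
have [c /andP[c1 c2] ->] := MVT_cc xy D.
rewrite normrM (ger0_norm (_ : 0 <= y - x)) ?subr_ge0 //; apply: ler_wpM2r; first by rewrite subr_ge0.
by apply: HB; rewrite (le_trans ux c1) (le_trans c2 yv).
Qed.

(** The kernel is at most [L] on the interval, so its absolute value is at most [2 * L - Kern],
    whose integral is known from the Euler-Lagrange equality; [V] is bounded on [[a, b]]. This
    uniform bound is what Fubini uses. *)
Lemma Kern_abs : exists2 M : R, 0 <= M & forall D x, dom D -> D `<=` `]a, b[ -> a <= x <= b ->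
  \int[mu]_(y in D) `|Kern theta x y| <= M.
Proof.
have [B B0 HB] := V_lip a0 ab.
pose L := `|ln (b - a)| + `|ln (b `^ theta)|.
have L0 : 0 <= L by rewrite addr_ge0.
pose M := 2 * L + `|V a| + B * (b - a) + `|ell|.
have M0 : 0 <= M by rewrite !addr_ge0 // mulr_ge0 // ?(ltW B0) // subr_ge0 ltW.
exists M => // D x dD Dab xI; have [mD _] := dD.
have [iK EK] := Kern_int dD xI.
have lnle (g K : R) : 0 <= g <= K -> ln g <= `|ln K|.
  move=> /andP[g0 gK]; have [->|gn] := eqVneq g 0; first by rewrite ln0.
  have gp : 0 < g by rewrite lt_neqAle eq_sym gn.
  by apply: le_trans (ler_norm _); rewrite ler_ln ?posrE // (lt_le_trans gp).
have ib : mu.-integrable D (EFin \o (fun y => 2 * L - Kern theta x y)).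
  apply: integrableDr => //; last exact: integrableNr.
  by apply: (@integrable_bound _ _ `|2 * L|).
apply: (@le_trans _ _ (\int[mu]_(y in D) (2 * L - Kern theta x y))).
  apply: le_Rintegral => //; first exact: integrable_normr.
  move=> y Dy; have yI : a <= y <= b.
    by have := Dab _ Dy; rewrite /= in_itv /= => /andP[/ltW -> /ltW ->].
  have h : Kern theta x y <= L by apply: lerD; apply: lnle; [exact: lin_bound|exact: pow_bound].
  by apply/ler_normlP; move: h L0; split; lra.
have ic : mu.-integrable D (EFin \o (fun=> 2 * L)) by apply: (@integrable_bound _ _ `|2 * L|).
rewrite RintegralB // EK Rintegral_cst //.
have m1 : 2 * L * fine (mu D) <= 2 * L.
  rewrite ler_piMr ?mulr_ge0 // -lee_fin fineK ?probability_le1 //.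
  by rewrite ge0_fin_numE // (le_lt_trans (probability_le1 _ mD)) // ltry.
have /andP[ax xb] := xI; have := HB a x (lexx _) ax xb.
have : B * (x - a) <= B * (b - a) by rewrite ler_pM2l //; move: xb; lra.
have := ler_norm (- ell); rewrite normrN; have := ler_norm (- V a); rewrite normrN.
by move=> *; rewrite /M; move: (ler_norm (- (V x - V a))); rewrite normrN; lra.
Qed.

(** The reciprocal is written as [g] times the power [-1] of its square, a composition of measurable
    maps. *)
Lemma inv_meas (g : R -> R) : measurable_fun setT g -> measurable_fun setT (fun y => (g y)^-1).
Proof.
move=> mg; rewrite (_ : (fun y => (g y)^-1) = (fun y => g y * (g y * g y) `^ (-1))).
  apply: measurable_funM => //; apply: (measurableT_comp (f := fun y : R => y `^ (-1))); first exact: measurable_powR.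
  exact: measurable_funM.
apply/funext => y; have [->|g0] := eqVneq (g y) 0; first by rewrite invr0 mul0r.
by rewrite powR_inv1 -?expr2 ?sqr_ge0 // expr2 invfM mulrA mulfV // mul1r.
Qed.

Lemma ln_inv_le (u h : R) : 0 < u -> 0 < h -> h / (u + h) <= ln (u + h) - ln u.
Proof.
move=> u0 h0; have uh : 0 < u + h by exact: addr_gt0.
have q : 0 < u / (u + h) by exact: divr_gt0.
have := @le_ln1Dx R (u / (u + h) - 1); rewrite (_ : 1 + (u / (u + h) - 1) = u / (u + h)); last by ring.
rewrite ltrBrDr addNr => /(_ q); rewrite ln_div ?posrE // => k.
have -> : h / (u + h) = 1 - u / (u + h) by field; rewrite gt_eqF.
by move: k; lra.
Qed.

(* Moving the point [x] out of the support by [h] increases both logarithms; by the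
   variational inequality the increase is at most that of [V]. *)
Lemma soft_edge : exists M h0 : R, [/\ 0 < M, 0 < h0, h0 < a &
  forall h, 0 < h < h0 -> \int[mu]_(t in `]a, b[) (b - t + h)^-1 <= M /\
    \int[mu]_(t in `]a, b[) (t - a + h)^-1 <= M].
Proof.
have a2 : 0 < a / 2 by rewrite divr_gt0.
have ub : a / 2 < b + 1 by move: a0 ab; lra.
have [B B0 HB] := V_lip a2 ub.
pose h0 := Num.min 1 (a / 2).
have hp : 0 < h0 by rewrite lt_min ltr01.
have h1 : h0 <= 1 by rewrite ge_min lexx.
have h2 : h0 <= a / 2 by rewrite ge_min lexx orbT.
exists B, h0; split=> //; first by move: h2 a0; lra.
move=> h /andP[hh0 hh1]; have dO := dom_oo; have [mO _] := dO.
(* The kernel at the outer point integrates to at most [V x' + ell] and at the edge to exactly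
   [V x + ell]. Their difference is at most [B * h], and dividing by [h] bounds the integral of
   [1 / (f + h)] independently of [h]. *)
have key (f : R -> R) x x' : 0 < x' -> x' < a \/ b < x' -> a <= x <= b ->
    (forall y, a < y < b -> 0 < f y) -> measurable_fun setT (fun y => (f y + h)^-1) ->
    (forall y, a < y < b -> h / (f y + h) <= Kern theta x' y - Kern theta x y) ->
    `|V x' - V x| <= B * h -> \int[mu]_(t in `]a, b[) (f t + h)^-1 <= B.
  move=> x'0 xo xI fp mf HK HV.
  have [i1 E1] := Kern_int dO xI; have [i2 E2] := Kern_out x'0 xo.
  have i3 : mu.-integrable `]a, b[ (EFin \o (fun y => (f y + h)^-1)).
    apply: (@integrable_bound _ _ h^-1) => // y; rewrite /= in_itv /= => /fp f0.
    rewrite ger0_norm; last by rewrite invr_ge0 addr_ge0 // ltW.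
    by rewrite lef_pV2 ?posrE ?addr_gt0 // lerDr ltW.
  have le : \int[mu]_(y in `]a, b[) (h * (f y + h)^-1) <= \int[mu]_(y in `]a, b[) (Kern theta x' y - Kern theta x y).
    apply: le_Rintegral => //; first exact: integrableZr.
    by apply: integrableDr => //; exact: integrableNr.
  rewrite RintegralZl // RintegralB // E1 in le.
  have := ler_norm (V x' - V x); move=> k.
  rewrite -(ler_pM2l hh0); move: le E2.
  generalize (\int[mu]_(x in `]a, b[) (f x + h)^-1) => J1.
  generalize (\int[mu]_(x in `]a, b[) Kern theta x' x) => J2 le E2.
  by move: le E2 k HV; rewrite [h * B]mulrC; lra.
have minv (c : R) (e : R) : measurable_fun setT (fun y => (e * y + c)^-1).
  apply: inv_meas.
  by apply: measurable_funD; [apply: measurable_funM; [exact: measurable_cst|exact: measurable_id]|exact: measurable_cst].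
split.
  apply: (@key (fun t => b - t) b (b + h)).
  - by rewrite addr_gt0.
  - by right; rewrite ltrDl.
  - by rewrite lexx ltW.
  - by move=> y /andP[_]; rewrite subr_gt0.
  - rewrite (_ : (fun y => _) = (fun y => (-1 * y + (b + h))^-1)) //.
    by apply/funext => y; congr (_^-1); ring.
  - move=> y /andP[ya yb]; have y0 := lt_trans a0 ya; have by0 : 0 < b - y by rewrite subr_gt0.
    have p1 := pow_lt y0 yb; have bh : b < b + h by rewrite ltrDl. have p2 := pow_lt b0 bh.
    have l1 := ln_inv_le by0 hh0.
    have l2 : ln (b `^ theta - y `^ theta) <= ln ((b + h) `^ theta - y `^ theta).
      by rewrite ler_ln ?posrE; move: p1 p2; lra.
    rewrite /Kern !ger0_norm; [|move: p1 p2 by0 hh0; lra..].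
    by rewrite (_ : b + h - y = b - y + h); [move: l1 l2; lra|ring].
  - by have := HB b (b + h); rewrite (_ : b + h - b = h); [apply; move: a0 ab hh0 hh1 h1; lra|ring].
apply: (@key (fun t => t - a) a (a - h)).
- by move: h2 hh1 a0; lra.
- by left; move: hh0; lra.
- by rewrite lexx ltW.
- by move=> y /andP[h' _]; rewrite subr_gt0.
- rewrite (_ : (fun y => _) = (fun y => (1 * y + (h - a))^-1)) //.
  by apply/funext => y; congr (_^-1); ring.
- move=> y /andP[ya yb]; have y0 := lt_trans a0 ya; have by0 : 0 < y - a by rewrite subr_gt0.
  have ah0 : 0 < a - h by move: h2 hh1 a0; lra. have aha : a - h < a by move: hh0; lra.
  have p1 := pow_lt a0 ya; have p2 := pow_lt ah0 aha.
  have l1 := ln_inv_le by0 hh0.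
  have l2 : ln (y `^ theta - a `^ theta) <= ln (y `^ theta - (a - h) `^ theta).
    by rewrite ler_ln ?posrE; move: p1 p2; lra.
  rewrite /Kern !ler0_norm; [|move: p1 p2 by0 hh0; lra..].
  have [e1 e2] : - (a - h - y) = y - a + h /\ - (a - y) = y - a by split; ring.
  rewrite e1 e2 (opprB ((a - h) `^ theta)) (opprB (a `^ theta)); move: l1 l2; lra.
- have := HB (a - h) a; rewrite (_ : a - (a - h) = h); last by ring.
  by rewrite distrC; apply; move: a0 ab hh0 hh1 h2; lra.
Qed.

Section Swap.
Variables (g : R -> R) (D : set R).
Hypothesis gi : leb.-integrable `]a, b[ (EFin \o g).
Hypothesis dD : dom D.
Hypothesis Dab : D `<=` `]a, b[.

Let F (p : R * R) : R := (g \_ `]a, b[) p.1 * (Kern theta p.2 p.1 * (\1_D p.2)).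

Let mF : measurable_fun setT F.
Proof.
have [mD _] := dD.
apply: measurable_funM.
  apply: (measurableT_comp (f := g \_ `]a, b[)); last exact: measurable_fst.
  by apply: (iffLR (measurable_restrictT _ _)); [exact: oo_measurable|exact: integrable_measurable gi].
apply: measurable_funM; last first.
  have mi : measurable_fun setT (\1_D : R -> R) := measurable_indic mD.
  exact: (measurableT_comp mi measurable_snd).
apply: measurable_funD.
  apply: measurableT_comp; first exact: measurable_ln.
  apply: measurableT_comp; first exact: normr_measurable.
  by apply: measurable_funB; [exact: measurable_snd|exact: measurable_fst].
apply: measurableT_comp; first exact: measurable_ln.
apply: measurableT_comp; first exact: normr_measurable.
by apply: measurable_funB; (apply: (measurableT_comp (f := fun y : R => y `^ theta)); [exact: measurable_powR|
  (exact: measurable_snd || exact: measurable_fst)]).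
Qed.

Let inner y : a < y < b -> (\int[mu]_t (F (y, t))%:E = (g y * (V y + ell))%:E)%E /\
  (\int[mu]_t `|(F (y, t))%:E| = (`|g y| * \int[mu]_(t in D) `|Kern theta y t|)%:E)%E.
Proof.
move=> yI; have [mD _] := dD; have yI2 : a <= y <= b by have /andP[h1 h2] := yI; rewrite !ltW.
have [iK EK] := Kern_int dD yI2.
have iKn := integrable_normr mD iK.
have Ks t : Kern theta t y = Kern theta y t by rewrite /Kern distrC [X in _ + ln X]distrC.
have gy : (g \_ `]a, b[) y = g y by rewrite patchE mem_set // /= in_itv.
split.
  transitivity (\int[mu]_(t in D) (g y * Kern theta y t)%:E)%E.
    rewrite [RHS]integral_mkcond; apply: eq_integral => t _.
    rewrite patchE /F /= gy Ks indicE; case: (t \in D); rewrite ?mulr1 ?mulr0 //.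
  rewrite -EK -RintegralZl // /Rintegral fineK //; apply: integrable_fin_num => //.
  exact: integrableZr.
transitivity (\int[mu]_(t in D) (`|g y| * `|Kern theta y t|)%:E)%E.
  rewrite [RHS]integral_mkcond; apply: eq_integral => t _.
  rewrite patchE /F /= gy Ks indicE; case: (t \in D); rewrite ?mulr1 ?mulr0 ?normrM ?normr0 //.
rewrite -RintegralZl // /Rintegral fineK //; apply: integrable_fin_num => //.
exact: integrableZr.
Qed.

Let outer y : ~ (a < y < b) -> forall t, F (y, t) = 0.
Proof.
move=> ny t; rewrite /F /= patchE ifF ?mul0r //; apply/negP => /set_mem.
by rewrite /= in_itv.
Qed.

(** Fubini for [g y * Kern t y]: integrating first in [t] uses the Euler-Lagrange equality,
    integrating first in [y] uses the formula [v], required only on a full-measure set. The absolute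
    integral is dominated by [M * |g|]. *)
Lemma mu_swap (v : R -> R) : (forall t, D t -> leb.-integrable `]a, b[ (EFin \o (fun y => g y * Kern theta t y)) /\
    \int[leb]_(y in `]a, b[) (g y * Kern theta t y) = v t) ->
  (\int[leb]_(y in `]a, b[) (g y * (V y + ell))%:E = \int[mu]_(t in D) (v t)%:E)%E.
Proof.
move=> Hv; have [M M0 HM] := Kern_abs; have [mD _] := dD.
have mEF : measurable_fun setT (EFin \o F) by apply/measurable_EFinP; exact: mF.
have iF : (leb \x mu)%E.-integrable setT (EFin \o F).
  apply: (iffRL (@integrable12ltyP _ _ _ _ R leb mu (EFin \o F) mEF)).
  apply: (@le_lt_trans _ _ (\int[leb]_(y in `]a, b[) (M * `|g y|)%:E)%E).
    rewrite [leRHS]integral_mkcond; apply: ge0_le_integral => //.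
    - by move=> y _; apply: integral_ge0 => t _; rewrite abse_ge0.
    - apply: (measurable_fun_fubini_tonelli_F (abse \o (EFin \o F))) => //.
        exact: measurableT_comp.
      by move=> y; exact: abse_ge0.
    - apply: (iffLR (measurable_restrictT _ _)); first exact: oo_measurable.
      apply/measurable_EFinP.
      apply: measurable_funM; first exact: measurable_cst.
      by apply: measurableT_comp; [exact: normr_measurable|exact: integrable_measurable gi].
    move=> y _; rewrite patchE; case: ifPn => [/set_mem|/negP ny].
      rewrite /= in_itv /= => yI; have [_ ->] := inner yI.
      rewrite lee_fin mulrC ler_wpM2r //; apply: HM => //.
      by have /andP[h1 h2] := yI; rewrite !ltW.
    rewrite integral0_eq // => t _; rewrite /= outer ?normr0 // => yI; apply: ny.
    by rewrite inE /= in_itv.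
  have : leb.-integrable `]a, b[ (EFin \o (fun y => M * `|g y|)).
    by apply: integrableZr; [exact: oo_measurable|apply: integrable_normr; [exact: oo_measurable|]].
  by move=> /integrableP[_]; apply: le_lt_trans; apply: ge0_le_integral => //;
    [move=> y _; rewrite lee_fin mulr_ge0|
     apply/measurable_EFinP; apply: measurable_funM; [exact: measurable_cst|
       apply: measurableT_comp; [exact: normr_measurable|exact: integrable_measurable gi]]|
     apply: measurableT_comp => //; apply/measurable_EFinP; apply: measurable_funM; [exact: measurable_cst|
       apply: measurableT_comp; [exact: normr_measurable|exact: integrable_measurable gi]]|
     move=> y _; rewrite /= lee_fin ler_norm].
have := Fubini iF.
have -> : (\int[leb]_x \int[mu]_y (EFin \o F) (x, y) = \int[leb]_(y in `]a, b[) (g y * (V y + ell))%:E)%E.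
  rewrite [RHS]integral_mkcond; apply: eq_integral => y _; rewrite patchE; case: ifPn => [/set_mem|/negP ny].
    by rewrite /= in_itv /= => yI; have [] := inner yI.
  rewrite integral0_eq // => t _; rewrite /= outer // => yI; apply: ny.
  by rewrite inE /= in_itv.
move=> ->.
rewrite [RHS]integral_mkcond; apply: eq_integral => t _; rewrite patchE; case: ifPn => [/set_mem Dt|/negP nt].
  have [i <-] := Hv _ Dt; rewrite /Rintegral fineK; last first.
    by apply: integrable_fin_num; [exact: oo_measurable|exact: i].
  have tD : t \in D by rewrite inE.
  rewrite [RHS]integral_mkcond; apply: eq_integral => y _; rewrite patchE /F /= patchE indicE tD mulr1.
  by case: ifP => // _; rewrite mul0r.
rewrite integral0_eq // => y _; rewrite /F /= indicE (_ : t \in D = false) ?mulr0 //.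
exact/negbTE/negP.
Qed.

End Swap.
End Equilibrium.

(** * Duality with the Stieltjes transform, and geometry near a critical point *)

Section Duality.
Variable R : realType.
Local Notation C := R[i].
Local Notation leb := (@lebesgue_measure R).

Record equilibrium (theta a b : R) (V Vd : R -> R) (mu : probability R R) (l : R) : Prop := Equilibrium {
  eq_supp : msupport mu = `[a, b]%classic;
  eq_der : forall x : R, 0 < x -> is_derive x 1 V (Vd x);
  eq_cont : {within `[0, +oo[, continuous Vd};
  eq_EL : forall x : R, a <= x <= b -> Upot theta mu V x = l%:E;
  eq_ELi : forall x : R, 0 <= x -> (Upot theta mu V x <= l%:E)%E }.

Variables (theta c1 d ea eb : R) (Ip : R -> C).
Hypothesis HD : curve_data theta c1 d ea eb Ip.
Let a := expR (lr theta c1 d ea).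
Let b := expR (lr theta c1 d eb).
Local Notation ell := (ell theta c1 d).
Local Notation ell1 := (ell1 theta d).
Local Notation lr := (lr theta c1 d).
Variables (V Vd : R -> R) (mu : probability R R) (l : R).
Hypothesis HE : equilibrium theta a b V Vd mu l.
Let th1 : 1 < theta := cd_theta HD.
Let d1 : 1 < d := cd_d HD.
Let ab : a < b := cd_ab HD.
Let a0 : 0 < a := cd_a0 _ _ _ _.
Local Notation Wt := (Wt theta c1 d ea eb).
Implicit Types (w z : C) (x y t : R).

Let dO := dom_oo th1 a0 ab (eq_supp HE) (eq_EL HE).
Let mO := oo_measurable a b.
Let oo_open y : `]a, b[%classic y -> a < y < b.
Proof. by rewrite /= in_itv. Qed.

Definition GG z : C := cI mu `]a, b[ (fun t => (t%:C - z)^-1).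

Lemma GG_cint z : Im z != 0 -> cint mu `]a, b[ (fun t => (t%:C - z)^-1).
Proof.
move=> z0; have n0 : 0 < `|Im z| by rewrite normr_gt0.
have bd t : cmod (t%:C - z)^-1 <= `|Im z|^-1.
  have h : `|Im z| <= cmod (t%:C - z).
    by apply: le_trans (Im_le_cmod _); rewrite ImB ImC sub0r normrN.
  by rewrite cmodV lef_pV2 ?posrE // (lt_le_trans n0).
have mden : measurable_fun setT (fun t : R => ((t - Re z) ^+ 2 + Im z ^+ 2)^-1).
  apply: inv_meas; apply: measurable_funD; last exact: measurable_cst.
  by apply: measurable_funM; (apply: measurable_funB; [exact: measurable_id|exact: measurable_cst]).
split; apply: (@integrable_bound R mu _ _ `|Im z|^-1) => //.
- rewrite (_ : (fun t : R => _) = (fun t : R => (t - Re z) * ((t - Re z) ^+ 2 + Im z ^+ 2)^-1)).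
    by apply: measurable_funM => //; apply: measurable_funB; [exact: measurable_id|exact: measurable_cst].
  by apply/funext => t; rewrite ReV ReB ImB ReC ImC sub0r sqrrN.
- by move=> t _; apply: le_trans (Re_le_cmod _) (bd t).
- rewrite (_ : (fun t : R => _) = (fun t : R => Im z * ((t - Re z) ^+ 2 + Im z ^+ 2)^-1)).
    by apply: measurable_funM => //; exact: measurable_cst.
  by apply/funext => t; rewrite ImV ReB ImB ReC ImC sub0r sqrrN opprK.
- by move=> t _; apply: le_trans (Im_le_cmod _) (bd t).
Qed.

Lemma mu_one : fine (mu `]a, b[%classic) = 1.
Proof.
have [mD D0] := dO; have := probability_setC mu mD; rewrite D0 => E.
have f : mu `]a, b[%classic \is a fin_num.
  by rewrite ge0_fin_numE // (le_lt_trans (probability_le1 _ mD)) // ltry.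
by move: E; rewrite -(fineK f) -EFinB => -[] /esym /eqP; rewrite subr_eq0 => /eqP ->.
Qed.

Section Test.
Variables (s A : C).
Hypothesis s0 : 0 < Im s.
Hypothesis s_ext : 0 < Im (ell s).
Local Notation pt := (pt Ip s A).
Local Notation pt1 := (pt1 theta d Ip s A).
Let z0 := zf theta c1 d 1 s.
Let D := zf theta c1 d 1 s * (1%:C * ell1 s).

Lemma ext_Im : 0 < Im z0.
Proof.
have hk1 : ((1 : R) = 1 /\ (1 : R) = 1) \/ ((1 : R) = theta /\ (1 : R) = -1) by left.
have Os : Om theta c1 d 1 s by split=> //; rewrite mul1r.
by have := zf_Im HD hk1 Os; rewrite mul1r.
Qed.

(* A ray from the origin meets the curve once, hence at most one [t] is excluded. *)
Let exceptional : exists DD : set R, [/\ dom mu DD, DD `<=` `]a, b[ &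
  forall t, DD t -> forall m : R, 0 < m -> m%:C * Ip t <> s].
Proof.
have [[t0 [t0I [m0 [m00 E0]]]]|no] := pselect (exists t0, a < t0 < b /\ exists m, 0 < m /\ m%:C * Ip t0 = s); last first.
  exists `]a, b[%classic; split=> //.
  by move=> t /oo_open tI m mp E; apply: no; exists t; split=> //; exists m.
exists (`]a, b[%classic `\ t0); split.
- apply: dom_setD1; first exact: dO.
  by apply: (mu_noatom th1 a0 (eq_supp HE) (eq_EL HE)); exact: oo_le.
- by move=> t [].
move=> t [/oo_open tI tt0] m mp E; apply: tt0.
have key (t1 t2 m1 m2 : R) : a < t1 < b -> a < t2 < b -> 0 < m1 -> 0 < m2 ->
    m1%:C * Ip t1 = m2%:C * Ip t2 -> ~ (m1 < m2).
  move=> I1 I2 p1 p2 EE lt12.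
  have E2 : Ip t1 = (m2 / m1)%:C * Ip t2.
    have n1 : m1%:C != 0 :> C by rewrite fmorph_eq0 gt_eqF.
    by apply: (mulfI n1); rewrite EE rmorphM /= fmorphV mulrA mulrCA mulfV // mulr1.
  have q1 : 1 < m2 / m1 by rewrite ltr_pdivlMr // mul1r.
  have := Im_ell_ray c1 th1 d1 (cd_H HD I2) ltr01 q1.
  by rewrite -E2 mul1r (cd_ell HD I1) (cd_ell HD I2) !ImC ltxx.
have EE : m%:C * Ip t = m0%:C * Ip t0 by rewrite E E0.
have mm : m = m0.
  have [h|h|//] := ltgtP m m0; first by case: (key _ _ _ _ tI t0I mp m00 EE).
  by case: (key _ _ _ _ t0I tI m00 mp (esym EE)).
have n1 : m%:C != 0 :> C by rewrite fmorph_eq0 gt_eqF.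
have EI : Ip t = Ip t0 by apply: (mulfI n1); rewrite EE mm.
have : ln t = ln t0.
  have := cd_ell HD tI; rewrite EI (cd_ell HD t0I) => E3.
  by have := congr1 (@complex.Re R) E3; rewrite !ReC.
by apply: ln_inj; rewrite posrE; apply: (@oo_gt0 R theta c1 d ea eb).
Qed.

Let V_cont : {within `[a, b], continuous V}.
Proof.
apply: derivable_within_continuous => x; rewrite in_itv /= => /andP[h _].
by have [] := eq_der HE (lt_le_trans a0 h).
Qed.

Lemma Vd_cont : {within `[a, b], continuous Vd}.
Proof.
by apply: continuous_subspaceW (eq_cont HE) => x; rewrite /= !in_itv /= andbT => /andP[/(lt_le_trans a0)/ltW].
Qed.

Lemma oo_cont (f : R -> R) : {within `[a, b], continuous f} -> {within `]a, b[, continuous f}.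
Proof.
apply: continuous_subspaceW => y; rewrite /= !in_itv /= => /andP[h1 h2].
by rewrite (ltW h1) ltW.
Qed.

Lemma integrable_mul_cc (f g : R -> R) : leb.-integrable `]a, b[ (EFin \o f) ->
  {within `[a, b], continuous g} -> leb.-integrable `]a, b[ (EFin \o (fun y => f y * g y)).
Proof.
move=> fi cg; have [B B0 HB] := ccont_bounded HD (ccont_real cg).
apply: (@integrable_le R _ _ leb _ mO _ (fun y => B * `|f y|)).
- apply: measurable_funM; first exact: integrable_measurable fi.
  by apply: within_measurable; exact: oo_cont.
- by apply: integrableZr => //; exact: integrable_normr.
move=> y /oo_open yI; rewrite normrM mulrC ler_wpM2r //.
by have := HB _ (oo_le yI); rewrite cmod_real.
Qed.

(** Integration by parts replaces [pt * V'] by [- pt1 * (V + l)]; the Euler-Lagrange equality writes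
    [V + l] as an integral of [Kern], and after the exchange the inner integral is the kernel
    identity. The function of [t] obtained is integrated against [mu]. *)
Lemma duality : \int[leb]_(y in `]a, b[) (pt y * Vd y) = - (2 * pi * Re (A / s + A * D * GG z0)).
Proof.
have [DD [dDD DDab ns]] := exceptional.
have zI := ext_Im; have z0n : Im z0 != 0 by rewrite gt_eqF.
pose v t := 2 * pi * Re (A / s + A * D / (t%:C - z0)).
have ip1 := pt1_int HD A s0 s_ext.
have := mu_swap th1 a0 ab (eq_supp HE) (eq_der HE) (eq_cont HE) (eq_EL HE) ip1 dDD DDab (v := v).
move=> H; have {}H := H (fun t Dt => kernel_identity HD A s0 s_ext (oo_open (DDab _ Dt)) (ns _ Dt)).
have cVl : {within `[a, b], continuous (fun y => V y + l)}.
  by move=> x; apply: cvgD; [exact: V_cont|exact: cvg_cst].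
have cpt := pt_cont HD s0 s_ext (A := A).
have i1 : leb.-integrable `]a, b[ (EFin \o (fun y => pt1 y * (V y + l))) by exact: integrable_mul_cc.
have i2 : leb.-integrable `]a, b[ (EFin \o (fun y => pt y * Vd y)).
  by apply: integrable_cc_oo => x; apply: cvgM; [exact: cpt|exact: Vd_cont].
have F : \int[leb]_(y in `]a, b[) (pt1 y * (V y + l) + pt y * Vd y) = 0.
  have E0 : pt b * (V b + l) - pt a * (V a + l) = 0.
    have g0 (p q u u' : R) : p = 0 -> q = 0 -> p * u - q * u' = 0 by move=> -> ->; ring.
    exact: g0 (pt_b HD s A) (pt_a HD s A).
  rewrite -[RHS]E0; apply: (@FTC_open R a b ab (fun y => pt1 y * (V y + l) + pt y * Vd y) (fun y => pt y * (V y + l))).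
  - move=> x; apply: cvgD; apply: cvgM.
    + exact: (pt1_cont HD s0 s_ext).
    + exact: (oo_cont cVl).
    + exact: (oo_cont cpt).
    + exact: (oo_cont Vd_cont).
  - by move=> x; apply: cvgM; [exact: cpt|exact: cVl].
  - move=> y yI; apply: derM; first exact: (pt_der HD).
    have := derD (eq_der HE (oo_gt0 yI)) (derC l y); by rewrite addr0.
  - exact: integrableDr.
rewrite RintegralD // in F.
have -> : \int[leb]_(y in `]a, b[) (pt y * Vd y) = - \int[leb]_(y in `]a, b[) (pt1 y * (V y + l)).
  by move: F; set u := \int[_]_(_ in _) _; set u' := \int[_]_(_ in _) _; lra.
congr (- _); rewrite {1}/Rintegral H -/(Rintegral mu DD v).
have cz := GG_cint z0n; have czD := cintZ mO (A * D) cz.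
have [iR _] := czD.
have mv : measurable_fun setT (fun t => Re (A * D * (t%:C - z0)^-1)).
  have mR : measurable_fun setT (fun t : R => Re (t%:C - z0)^-1).
    rewrite (_ : (fun t : R => _) = (fun t : R => (t - Re z0) * ((t - Re z0) ^+ 2 + Im z0 ^+ 2)^-1)); last first.
      by apply/funext => t; rewrite ReV ReB ImB ReC ImC sub0r sqrrN.
    apply: measurable_funM; first by apply: measurable_funB; [exact: measurable_id|exact: measurable_cst].
    apply: inv_meas; apply: measurable_funD; last exact: measurable_cst.
    by apply: measurable_funM; (apply: measurable_funB; [exact: measurable_id|exact: measurable_cst]).
  have mI : measurable_fun setT (fun t : R => Im (t%:C - z0)^-1).
    rewrite (_ : (fun t : R => _) = (fun t : R => Im z0 * ((t - Re z0) ^+ 2 + Im z0 ^+ 2)^-1)); last first.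
      by apply/funext => t; rewrite ImV ReB ImB ReC ImC sub0r sqrrN opprK.
    apply: measurable_funM; first exact: measurable_cst.
    apply: inv_meas; apply: measurable_funD; last exact: measurable_cst.
    by apply: measurable_funM; (apply: measurable_funB; [exact: measurable_id|exact: measurable_cst]).
  rewrite (_ : (fun t : R => _) = (fun t : R => Re (A * D) * Re (t%:C - z0)^-1 - Im (A * D) * Im (t%:C - z0)^-1)); last first.
    by apply/funext => t; rewrite ReM.
  by apply: measurable_funB; apply: measurable_funM => //; exact: measurable_cst.
have Ev : v = (fun t => 2 * pi * (Re (A / s) + Re (A * D * (t%:C - z0)^-1))).
  by apply/funext => t; rewrite /v ReD.
have mv' : measurable_fun setT v.
  rewrite Ev; apply: measurable_funM; first exact: measurable_cst.
  by apply: measurable_funD => //; exact: measurable_cst.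
rewrite (dom_Rint dDD dO mv') Ev.
have ic : mu.-integrable `]a, b[ (EFin \o cst (Re (A / s))) by apply: (@integrable_bound R mu _ _ `|Re (A / s)|).
have is' : mu.-integrable `]a, b[ (EFin \o (fun t => Re (A / s) + Re (A * D * (t%:C - z0)^-1))).
  by apply: integrableDr.
rewrite RintegralZl // RintegralD // Rintegral_cst // mu_one mulr1 ReD.
by rewrite /GG -(cIZ mO _ cz) Re_cI.
Qed.

End Test.

(** For [z] with modulus outside [[a, b]], [|t - z|] is at least the difference between [|z|] and
    [t]. This reduces to the integrals of [soft_edge] with [h] the distance from [|z|] to the nearer
    edge. *)
Lemma GG_le : exists M h0 : R, [/\ 0 < M, 0 < h0 & forall z, Im z != 0 ->
  (b < cmod z < b + h0) || (a - h0 < cmod z < a) -> cmod (GG z) <= M].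
Proof.
have [M [h0 [M0 hp ha H]]] := soft_edge th1 a0 ab (eq_supp HE) (eq_der HE) (eq_cont HE) (eq_EL HE) (eq_ELi HE).
exists (2 * M), h0; split=> //; first by rewrite mulr_gt0.
move=> z z0 hz; have cz := GG_cint z0.
have key (f : R -> R) (h : R) : 0 < h -> (forall t, a < t < b -> 0 < f t) ->
    measurable_fun setT (fun t => (f t + h)^-1) ->
    (forall t, a < t < b -> f t + h <= cmod (t%:C - z)) -> \int[mu]_(t in `]a, b[) (f t + h)^-1 <= M ->
    cmod (GG z) <= 2 * M.
  move=> hh fp mf Hf HM.
  have i3 : mu.-integrable `]a, b[ (EFin \o (fun y => (f y + h)^-1)).
    apply: (@integrable_bound R mu _ _ h^-1) => // y /oo_open /fp f0.
    rewrite ger0_norm; last by rewrite invr_ge0 addr_ge0 // ltW.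
    by rewrite lef_pV2 ?posrE ?addr_gt0 // lerDr ltW.
  apply: (@le_trans _ _ (2 * \int[mu]_(t in `]a, b[) (f t + h)^-1)); last by rewrite ler_pM2l.
  apply: cI_le => // t /oo_open tI; have f0 := fp _ tI.
  rewrite cmodV lef_pV2 ?posrE ?addr_gt0 //; first exact: Hf.
  by apply: lt_le_trans (Hf _ tI); exact: addr_gt0.
have minv (c e : R) : measurable_fun setT (fun y : R => (e * y + c)^-1).
  apply: inv_meas.
  by apply: measurable_funD; [apply: measurable_funM; [exact: measurable_cst|exact: measurable_id]|exact: measurable_cst].
case/orP: hz => /andP[h1 h2].
  have hI : 0 < cmod z - b < h0 by rewrite subr_gt0 h1 ltrBlDl.
  have [hh _] := andP hI; have [HM _] := H _ hI.
  apply: (key (fun t => b - t) (cmod z - b) hh) => //.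
  - by move=> t /andP[_]; rewrite subr_gt0.
  - rewrite (_ : (fun t : R => _) = (fun t => (-1 * t + cmod z)^-1)) //.
    by apply/funext => t; congr (_^-1); ring.
  move=> t /andP[t1 t2]; have := cmod_ler_dist z t%:C; rewrite cmodB cmod_real gtr0_norm ?(lt_trans a0) //; lra.
have hI : 0 < a - cmod z < h0 by rewrite subr_gt0 h2 /=; move: h1; lra.
have [hh _] := andP hI; have [_ HM] := H _ hI.
apply: (key (fun t => t - a) (a - cmod z) hh) => //.
- by move=> t /andP[t1 _]; rewrite subr_gt0.
- rewrite (_ : (fun t : R => _) = (fun t => (1 * t + (- cmod z))^-1)) //.
  by apply/funext => t; congr (_^-1); ring.
move=> t /andP[t1 t2]; have := cmod_ler_dist t%:C z; rewrite cmod_real gtr0_norm ?(lt_trans a0) //; lra.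
Qed.

Section Edge.
Variables (e e' tau : R).
(** [tau] records on which side the interval of critical values is left: below [a] at [ea], above
    [b] at [eb]. *)
Hypothesis he : (e = ea /\ e' = eb /\ tau = -1) \/ (e = eb /\ e' = ea /\ tau = 1).

Let heE : e = ea \/ e = eb. Proof. by case: he => -[-> _]; [left|right]. Qed.
Let e_nz : [/\ e != 0, e + 1 != 0 & e + d != 0].
Proof.
have ead := ea_gtNd d1 (cd_sum HD) (cd_prod HD) (cd_eb HD).
have e1 := cd_ea HD; have e2 := cd_eb HD.
by case: heE => ->; split; apply/eqP; lra.
Qed.

(** The second derivative of [ell] at the critical point [e], read off the factorisation of
    [ell1]. *)
Let g := (e - e') / (e * (e + 1) * (e + d)).

Let g_sign : 0 < tau * g.
Proof.
have ead := ea_gtNd d1 (cd_sum HD) (cd_prod HD) (cd_eb HD).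
have e1 := cd_ea HD; have e2 := cd_eb HD.
case: he => -[E1 [E2 E3]]; rewrite /g E1 E2 E3.
  rewrite mulN1r -mulNr opprB divr_gt0 //; first by move: e1 e2; lra.
  have -> : ea * (ea + 1) * (ea + d) = (- ea) * (- (ea + 1)) * (ea + d) by ring.
  by rewrite !mulr_gt0 //; move: e1 ead; lra.
rewrite mul1r divr_gt0 //; first by move: e1 e2; lra.
by rewrite !mulr_gt0 //; move: e2 d1; lra.
Qed.

Let tau2 : tau * tau = 1. Proof. by case: he => -[_ [_ ->]]; ring. Qed.

(** Near [e] one has [ell1 w = (w - e) * q w] with [q e = g]; integrating along the segment gives
    the quadratic term with a cubic error. *)
Lemma ell_taylor : exists M r : R, [/\ 0 < M, 0 < r, r <= radX d e & forall w, cmod (w - e%:C) < r ->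
  cmod (ellX theta c1 d e w - (lr e)%:C - (g / 2)%:C * (w - e%:C) ^+ 2) <= M * cmod (w - e%:C) ^+ 3].
Proof.
have [n1 n2 n3] := e_nz.
have [r0 X0 _] := edge_rad (cd_c1 HD) d1 (cd_sum HD) (cd_prod HD) (cd_ea HD) (cd_eb HD) heE.
have cn (x : R) : x != 0 -> x%:C != 0 :> C by rewrite fmorph_eq0.
pose q w : C := (w - e'%:C) / (w * (w + 1) * (w + d%:C)).
have ne : e%:C * (e%:C + 1) * (e%:C + d%:C) != 0 :> C.
  by rewrite !mulf_neq0 ?cn // -?[1]/(1%:C) -rmorphD cn.
have [e1' qq] : exists e1', qd q e%:C e1'.
  eexists; apply: qdM; first by apply: qdD; [exact: qd_id|exact: qd_cst].
  apply: qdV_comp => //; apply: qdM; last by apply: qdD; [exact: qd_id|exact: qd_cst].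
  by apply: qdM; [exact: qd_id|apply: qdD; [exact: qd_id|exact: qd_cst]].
have [M [r [M0 rp _ _ H]]] := qdE qq.
have qe : q e%:C = g%:C.
  by rewrite /q /g !(rmorphM, fmorphV, rmorphD, rmorphN, rmorphB) /= invfM.
exists (2 * M), (Num.min r (radX d e)); split; [by rewrite mulr_gt0|by rewrite lt_min rp r0|by rewrite ge_min lexx orbT|].
move=> w; rewrite lt_min => /andP[wr wX].
pose D := w - e%:C.
pose gm (u : R) : C := e%:C + u%:C * D.
have gmD (u : R) : gm u - e%:C = u%:C * D by rewrite /gm addrAC subrr add0r.
have gml (u : R) : 0 <= u <= 1 -> cmod (gm u - e%:C) <= cmod D.
  by move=> uI; rewrite gmD; exact: cmod_seg.
pose F (u : R) : C := ellX theta c1 d e (gm u) + (- (g / 2)%:C) * (gm u - e%:C) ^+ 2.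
have key := @cder_mean R F (fun u => (ell1 (gm u) - g%:C * (gm u - e%:C)) * D) (M * cmod D ^+ 3).
have H1 (u : R) : 0 <= u <= 1 -> cder F u ((ell1 (gm u) - g%:C * (gm u - e%:C)) * D).
  move=> uI; have ug := le_lt_trans (gml _ uI) wX.
  have h : qd (fun v => ellX theta c1 d e v + (- (g / 2)%:C) * (v - e%:C) ^+ 2) (gm u)
      (ell1 (gm u) + (- (g / 2)%:C) * (1 * (gm u - e%:C) + (gm u - e%:C) * 1)).
    apply: qdD; first exact: qd_ellX.
    have q1 : qd (fun v => v - e%:C) (gm u) 1.
      by have := qdD (qd_id (gm u)) (qd_cst (- e%:C) (gm u)); rewrite addr0.
    by apply: qdZ; exact: (qdM q1 q1).
  have := qd_path h (cder_line e%:C D u).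
  have -> : ell1 (gm u) + - (g / 2)%:C * (1 * (gm u - e%:C) + (gm u - e%:C) * 1) = ell1 (gm u) - g%:C * (gm u - e%:C).
    rewrite (_ : g%:C = (g / 2)%:C + (g / 2)%:C); last by rewrite -rmorphD /=; congr (_%:C); field.
    by ring.
  by [].
have H2 (u : R) : 0 <= u <= 1 -> cmod ((ell1 (gm u) - g%:C * (gm u - e%:C)) * D) <= M * cmod D ^+ 3.
  move=> uI; have ug := le_lt_trans (gml _ uI) wX; have ug2 := le_lt_trans (gml _ uI) wr.
  have [m1 m2 m3] := radX_neq0 ug.
  have -> : ell1 (gm u) - g%:C * (gm u - e%:C) = (gm u - e%:C) * (q (gm u) - q e%:C).
    rewrite qe (ell1_factor (cd_sum HD) (cd_prod HD) m1 m2 m3) /q.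
    by case: he => -[-> [-> _]]; ring.
  rewrite !cmodM; have := H _ ug2; rewrite -/(q _) => hq.
  have -> : M * cmod D ^+ 3 = cmod D * (M * cmod D) * cmod D by ring.
  rewrite ler_wpM2r ?cmod_ge0 //; apply: ler_pM; rewrite ?cmod_ge0 ?gml //.
  by apply: le_trans hq _; rewrite ler_pM2l // gml.
have := key H1 H2; rewrite /F !gmD mul1r mul0r expr0n /= mulr0 addr0.
have -> : gm 1 = w by rewrite /gm mul1r /D addrCA subrr addr0.
have -> : gm 0 = e%:C by rewrite /gm mul0r addr0.
rewrite X0 -/D mulrA; congr (cmod _ <= _); ring.
Qed.

(** On the curve [ell] is real and does not pass beyond the critical value [lr e]. With
    [x + i y = Ip - e], the expansion gives [x ^ 2 - y ^ 2 <= (x ^ 2 + y ^ 2) / 4], hence the cone;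
    its constant [2] is not sharp. *)
Lemma edge_cone : exists2 r : R, 0 < r & forall y, a < y < b -> cmod (Ip y - e%:C) < r ->
  `|Re (Ip y) - e| <= 2 * Im (Ip y).
Proof.
have [M [r [M0 rp rX H]]] := ell_taylor.
have tg := g_sign.
exists (Num.min r (tau * g / (8 * M))); first by rewrite lt_min rp divr_gt0 // mulr_gt0.
move=> y yI; rewrite lt_min => /andP[h1 h2]; have i0 := cd_H HD yI.
have := H _ h1; rewrite (ellX_ell theta c1 (lt_le_trans h1 rX) i0) (cd_ell HD yI).
set D := Ip y - e%:C; set L := ln y - lr e.
have lsgn : tau * L <= 0.
  have /andP[ya yb] := yI; have y0 := oo_gt0 yI; rewrite /L.
  case: he => -[-> [_ ->]]; rewrite ?mulN1r ?mul1r.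
    by rewrite oppr_le0 subr_ge0 -[leLHS]expRK ler_ln ?posrE ?expR_gt0 // ltW.
  by rewrite subr_le0 -[leRHS]expRK ler_ln ?posrE ?expR_gt0 // ltW.
move=> hR; have := le_trans (Re_le_cmod _) hR.
rewrite -rmorphB -/L ReB ReC expr2 (ReM (g / 2)%:C) ReC ImC mul0r subr0 (ReM D) => k.
have kt : M * cmod D ^+ 3 <= tau * g / 8 * cmod D ^+ 2.
  rewrite exprSr mulrCA [leRHS]mulrC ler_wpM2l ?sqr_ge0 //.
  by move: h2; rewrite ltr_pdivlMr ?mulr_gt0 //; lra.
have tn : `|tau| = 1 by case: he => -[_ [_ ->]]; rewrite ?normrN normr1.
have k2 : `|tau * L - tau * g / 2 * (Re D * Re D - Im D * Im D)| <= tau * g / 8 * cmod D ^+ 2.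
  apply: le_trans kt; apply: le_trans k.
  by rewrite (_ : tau * L - _ = tau * (L - g / 2 * (Re D * Re D - Im D * Im D))) ?normrM ?tn ?mul1r //; ring.
have k3 : Re D * Re D - Im D * Im D <= 4^-1 * (Re D ^+ 2 + Im D ^+ 2).
  rewrite -(ler_pM2l tg) -cmod_sqr; move: k2 => /ler_normlP[k2 _].
  have gen (T L' X q : R) : - (L' - T / 2 * X) <= T / 8 * q -> L' <= 0 -> T * X <= T * (4^-1 * q) by lra.
  exact: gen k2 lsgn.
have -> : Re (Ip y) - e = Re D by rewrite ReB ReC.
have -> : Im (Ip y) = Im D by rewrite ImB ImC subr0.
have iD : 0 < Im D by rewrite ImB ImC subr0.
rewrite -[leRHS]ger0_norm; last by rewrite mulr_ge0 // ltW.
rewrite -ler_sqr ?nnegrE // !real_normK ?num_real // exprMn.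
by move: k3; rewrite !expr2; have := sqr_ge0 (Im D); rewrite expr2; lra.
Qed.

(** The direction [8 * tau + i] is well outside the cone that contains the curve, and its square is
    [63 + 16 * tau * i]. Since [tau * g > 0], the expansion of [ell] makes both [Im ell] and
    [tau * (Re ell - lr e)] positive along it. *)
Definition sdir (u : R) : C := e%:C + u%:C * Complex (8 * tau) 1.

Lemma Re_sdir u : Re (sdir u) = e + 8 * tau * u.
Proof. by rewrite /sdir ReD ReM ReC ReC ImC /=; ring. Qed.
Lemma Im_sdir u : Im (sdir u) = u.
Proof. by rewrite /sdir ImD ImM ImC ReC ImC /=; ring. Qed.
Lemma cmod_sdir u : 0 <= u -> cmod (sdir u - e%:C) <= 9 * u.
Proof.
move=> u0; apply: le_trans (cmod_le_RI _) _; rewrite ReB ImB Re_sdir Im_sdir ReC ImC subr0.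
rewrite (_ : e + 8 * tau * u - e = 8 * tau * u); last by ring.
have tn : `|tau| = 1 by case: he => -[_ [_ ->]]; rewrite ?normrN normr1.
by rewrite !normrM tn (ger0_norm u0) ger0_norm //; lra.
Qed.

(** Along [sdir] the leading terms are [8 * (tau * g) * u ^ 2] and [63 / 2 * (tau * g) * u ^ 2], and
    [u0] keeps the cubic error below [tau * g * u ^ 2]. So the points are exterior and their image
    has modulus just beyond the critical value, where [GG_le] applies. *)
Lemma sdir_ext (h : R) : 0 < h -> exists2 u0 : R, 0 < u0 & forall u, 0 < u <= u0 ->
  0 < Im (ell (sdir u)) /\ 0 < tau * (Re (ell (sdir u)) - lr e) < h.
Proof.
move=> h0; have [M [r [M0 rp rX H]]] := ell_taylor; have tg := g_sign.
have [ep0 X0 _] := edge_rad (cd_c1 HD) d1 (cd_sum HD) (cd_prod HD) (cd_ea HD) (cd_eb HD) heE.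
have er : cmod (e%:C - e%:C) < radX d e by rewrite subrr cmod0.
have [r2 r2p H2] := qd_cvg (qd_ellX theta c1 er) h0.
pose u0 := Num.min (r / 10) (Num.min (r2 / 10) (tau * g / (M * 9 ^+ 3))).
have u0p : 0 < u0.
  have [p1 p2] : 0 < r / 10 /\ 0 < r2 / 10 by split; exact: divr_gt0.
  have p3 : 0 < tau * g / (M * 9 ^+ 3) by apply: divr_gt0 => //; apply: mulr_gt0 => //; exact: exprn_gt0.
  by rewrite lt_min p1 lt_min p2 p3.
exists u0 => // u /andP[up]; rewrite le_min => /andP[k1]; rewrite le_min => /andP[k2 k3].
have cs := cmod_sdir (ltW up).
have c1' : cmod (sdir u - e%:C) < r by move: cs k1 up; lra.
have c2' : cmod (sdir u - e%:C) < r2 by move: cs k2 up; lra.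
have i0 : 0 < Im (sdir u) by rewrite Im_sdir.
have := H _ c1'; rewrite (ellX_ell theta c1 (lt_le_trans c1' rX) i0).
have := H2 _ c2'; rewrite (ellX_ell theta c1 (lt_le_trans c1' rX) i0) X0.
have sq : (sdir u - e%:C) ^+ 2 = Complex (63 * u ^+ 2) (16 * tau * u ^+ 2).
  have rD : Re (sdir u - e%:C) = 8 * tau * u by rewrite ReB Re_sdir ReC; ring.
  have iD : Im (sdir u - e%:C) = u by rewrite ImB Im_sdir ImC; ring.
  rewrite expr2; apply: complex_ext.
    rewrite (ReM (sdir u - e%:C)) rD iD /=; transitivity (64 * (tau * tau) * u ^+ 2 - u ^+ 2); first by ring.
    by rewrite tau2; ring.
  by rewrite (ImM (sdir u - e%:C)) rD iD /=; ring.
rewrite sq; set E := ell (sdir u) => hh hM.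
have c3 : M * cmod (sdir u - e%:C) ^+ 3 <= tau * g * u ^+ 2.
  have : cmod (sdir u - e%:C) ^+ 3 <= (9 * u) ^+ 3.
    by rewrite lerXn2r // ?nnegrE ?cmod_ge0 // mulr_ge0 // ltW.
  move=> hc; apply: (@le_trans _ _ (M * (9 * u) ^+ 3)); first by rewrite ler_pM2l.
  have -> : M * (9 * u) ^+ 3 = (M * 9 ^+ 3 * u) * u ^+ 2 by ring.
  rewrite ler_wpM2r ?sqr_ge0 //; move: k3; rewrite ler_pdivlMr; last by apply: mulr_gt0 => //; exact: exprn_gt0.
  by rewrite mulrC.
have kR := le_trans (Re_le_cmod _) (le_trans hM c3); have kI := le_trans (Im_le_cmod _) (le_trans hM c3).
rewrite ReB ReB ReC (ReM (g / 2)%:C) ReC ImC mul0r subr0 /= in kR.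
rewrite ImB ImB ImC (ImM (g / 2)%:C) ReC ImC mul0r addr0 subr0 /= in kI.
have u2 : 0 < u ^+ 2 by rewrite exprn_gt0.
have tgu : 0 < tau * g * u ^+ 2 by rewrite mulr_gt0.
split.
  move: kI => /ler_normlP[kI _]; move: kI tgu.
  have -> : g / 2 * (16 * tau * u ^+ 2) = 8 * (tau * g * u ^+ 2) by field.
  by lra.
have hb := le_lt_trans (Re_le_cmod _) hh; rewrite ReB ReC in hb.
have tn : `|tau| = 1 by case: he => -[_ [_ ->]]; rewrite ?normrN normr1.
apply/andP; split.
  have : `|tau * (Re E - lr e) - 63 / 2 * (tau * g * u ^+ 2)| <= tau * g * u ^+ 2.
    apply: le_trans kR; rewrite (_ : tau * (Re E - lr e) - _ = tau * (Re E - lr e - g / 2 * (63 * u ^+ 2))); last by field.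
    by rewrite normrM tn mul1r.
  by move=> /ler_normlP[k _]; move: k tgu; lra.
by apply: le_lt_trans hb; rewrite -[leRHS]mul1r -tn -normrM ler_norm.
Qed.

End Edge.
End Duality.

(** * The two equations at the critical points *)

Section EdgeEquations.
Variable R : realType.
Local Notation C := R[i].
Local Notation leb := (@lebesgue_measure R).
Variables (theta c1 d ea eb : R) (Ip : R -> C).
Hypothesis HD : curve_data theta c1 d ea eb Ip.
Let a := expR (lr theta c1 d ea).
Let b := expR (lr theta c1 d eb).
Local Notation ell := (ell theta c1 d).
Local Notation ell1 := (ell1 theta d).
Local Notation lr := (lr theta c1 d).
Variables (V Vd : R -> R) (mu : probability R R) (l : R).
Hypothesis HE : equilibrium theta a b V Vd mu l.
Let th1 : 1 < theta := cd_theta HD.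
Let d1 : 1 < d := cd_d HD.
Let ab : a < b := cd_ab HD.
Let a0 : 0 < a := cd_a0 _ _ _ _.
Local Notation Wt := (Wt theta c1 d ea eb).
Implicit Types (w z s : C) (x y t : R).
Let mO := oo_measurable a b.
Let oo_open y : `]a, b[%classic y -> a < y < b.
Proof. by rewrite /= in_itv. Qed.

(** Half of the limit of [pt], with [A = 1], as the pole tends to the real critical point [e]. *)
Definition NN e y : R := Im (Ip y - e%:C)^-1.

Lemma NN_intV e : e = ea \/ e = eb -> leb.-integrable `]a, b[ (EFin \o (fun y => NN e y * Vd y)).
Proof.
move=> he; apply: (integrable_mul_cc HD _ (Vd_cont HE)).
have [K K0 HK] := inv_edge HD he.
apply: (@integrable_le R _ _ leb _ mO _ (fun y => K * Wt y)).
- apply: within_measurable.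
  have [] // := @cder_within R theta c1 d ea eb (fun y => (Ip y - e%:C)^-1).
  move=> y yI; have i0 := cd_H HD yI.
  have n1 : Ip y != e%:C by rewrite -subr_eq0 Im_gt0_neq.
  have := qd_path (qd_inv_sub 1 n1) (Ip_der HD yI) => h.
  by eexists; apply: (cder_ext ltr01 _ h) => u _; rewrite div1r.
- by apply: integrableZr => //; exact: (Wt_int HD).
- by move=> y /oo_open yI; apply: le_trans (Im_le_cmod _) _; exact: HK.
Qed.

Lemma conj_far (w s : C) : 0 < Im w -> 0 < Im s -> cmod (w - s) <= cmod (w - cconj s).
Proof.
move=> w0 s0; rewrite -ler_sqr ?nnegrE ?cmod_ge0 // !cmod_sqr !ReB !ImB Re_conj Im_conj opprK lerD2l -subr_ge0.
have -> : (Im w + Im s) ^+ 2 - (Im w - Im s) ^+ 2 = 4 * (Im w * Im s) by ring.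
by rewrite !mulr_ge0 // ltW.
Qed.

Section Edge.
Variables (e e' tau : R).
Hypothesis he : (e = ea /\ e' = eb /\ tau = -1) \/ (e = eb /\ e' = ea /\ tau = 1).
Let heE : e = ea \/ e = eb. Proof. by case: he => -[-> _]; [left|right]. Qed.
Local Notation sdir := (sdir e tau).
Let e_n0 : e != 0.
Proof. by have e1 := cd_ea HD; have e2 := cd_eb HD; case: heE => ->; apply/eqP; lra. Qed.

(** The curve stays in the cone of slope [2] while [sdir] moves off with slope [8]: if [Im (Ip y)]
    is at least [2 * u] the imaginary parts separate the points, otherwise the real parts do. The
    bound is uniform in [u], which gives domination in the limit. *)
Let sep : exists2 r : R, 0 < r & forall u y, 0 < u <= r -> a < y < b ->
  6^-1 * cmod (Ip y - e%:C) <= cmod (Ip y - sdir u).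
Proof.
have [r r0 H] := edge_cone HD he; exists (r / 18); first by rewrite divr_gt0.
move=> u y /andP[u0 ur] yI; have v0 := cd_H HD yI.
set D := Ip y - e%:C.
have ED : Ip y - sdir u = D - (sdir u - e%:C) by rewrite /D; ring.
have [near|far] := ltP (cmod D) r; last first.
  have := cmod_ler_dist D (sdir u - e%:C); rewrite -ED; have := cmod_sdir he (ltW u0).
  by have := cmod_ge0 D; move: far ur r0; lra.
have hc := H _ yI near.
have cD : cmod D <= 3 * Im (Ip y).
  apply: le_trans (cmod_le_RI _) _; rewrite /D ReB ImB ReC ImC subr0 (ger0_norm (ltW v0)); lra.
have [big|small] := leP (2 * u) (Im (Ip y)).
  apply: (@le_trans _ _ `|Im (Ip y - sdir u)|); last exact: Im_le_cmod.
  by rewrite ImB Im_sdir ger0_norm; move: cD big u0; lra.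
apply: (@le_trans _ _ `|Re (Ip y - sdir u)|); last exact: Re_le_cmod.
rewrite ReB Re_sdir; move: hc => /ler_normlP[k1 k2].
case: he => -[_ [_ ->]].
  by apply: le_trans (ler_norm _); move: k1 k2 small cD u0; lra.
by rewrite -normrN; apply: le_trans (ler_norm _); move: k1 k2 small cD u0; lra.
Qed.

(** The duality is applied with [A = 1] and the pole at [sdir (u_ n)]. In the limit the left side
    becomes twice the integral of [NN]; on the right the Stieltjes transform is bounded and
    multiplied by [ell1], which vanishes at [e], so only [1 / e] is left. *)
Lemma edge_eq : \int[leb]_(y in `]a, b[) (NN e y * Vd y) = - (pi / e).
Proof.
have [M [h0 [M0 hp HG]]] := GG_le HD HE.
have /for_epsE/(_ _ hp)[dl dl0 Hdl] := @continuous_expR R (lr e).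
have [u0 u0p Hu0] := sdir_ext HD he dl0.
have [r rp Hr] := sep.
pose u1 := Num.min u0 r; have u1p : 0 < u1 by rewrite lt_min u0p.
pose u_ (n : nat) : R := u1 / n.+1%:R.
have up n : 0 < u_ n <= u1.
  rewrite divr_gt0 ?ltr0n //= ler_pdivrMr ?ltr0n // ler_peMr ?(ltW u1p) // ler1n //.
have uc : u_ n @[n --> \oo] --> (0 : R).
  rewrite -(mulr0 u1); apply: cvgM; [exact: cvg_cst|exact: cvg_harmonic].
have u0n n : 0 < u_ n <= u0 by have /andP[-> h] := up n; rewrite (le_trans h) // ge_min lexx.
have urn n : 0 < u_ n <= r by have /andP[-> h] := up n; rewrite (le_trans h) // ge_min lexx orbT.
pose s_ n := sdir (u_ n).
have si n : 0 < Im (s_ n) by rewrite /s_ Im_sdir; have /andP[] := up n.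
have se n : 0 < Im (ell (s_ n)) by have [] := Hu0 _ (u0n n).
pose z_ n := zf theta c1 d 1 (s_ n).
have zi n : Im (z_ n) != 0 by rewrite gt_eqF //; exact: (ext_Im HD (si n) (se n)).
have cz n : cmod (z_ n) = expR (Re (ell (s_ n))) by rewrite /z_ (cmod_zf theta c1 d 1) mul1r.
have tn : `|tau| = 1 by case: he => -[_ [_ ->]]; rewrite ?normrN normr1.
have cz2 n : `|cmod (z_ n) - expR (lr e)| < h0.
  rewrite cz; apply: Hdl; have [_ /andP[h1 h2]] := Hu0 _ (u0n n).
  by rewrite -[X in X < _]mul1r -tn -normrM gtr0_norm.
have GM n : cmod (GG theta c1 d ea eb mu (z_ n)) <= M.
  apply: HG => //; have [_ /andP[h1 _]] := Hu0 _ (u0n n); rewrite -/(s_ n) in h1.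
  move: (cz n) (cz2 n) h1; generalize (Re (ell (s_ n))) (cmod (z_ n)) => X Z -> /ltr_normlP[].
  case: he => -[-> [_ ->]]; rewrite -/a -/b => k1 k2.
    rewrite mulN1r oppr_gt0 subr_lt0 => h1; apply/orP; right; rewrite ltr_expR h1 andbT.
    by move: k1 k2; lra.
  rewrite mul1r subr_gt0 => h1; apply/orP; left; rewrite ltr_expR h1 /=.
  by move: k1 k2; lra.
have zb n : cmod (z_ n) <= b + h0.
  move: (cz2 n) => /ltr_normlP[_]; have : expR (lr e) <= b by case: heE => -> //; exact: ltW.
  by lra.
have [K K0 HK] := inv_edge HD heE.
have [B B0 HB] := ccont_bounded HD (ccont_real (Vd_cont HE)).
have close n : cmod (s_ n - e%:C) <= 9 * u_ n.
  by apply: (cmod_sdir he); apply: ltW; have /andP[] := up n.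
have cvg9 (F : C -> C) (f : C) : qd F e%:C f -> forall eps : R, 0 < eps ->
    \forall n \near \oo, forall w, cmod (w - e%:C) <= 9 * u_ n -> cmod (F w - F e%:C) < eps.
  move=> qF eps e0; have [del d0 H] := qd_cvg qF e0.
  have d9 : 0 < del / 9 by rewrite divr_gt0.
  have /cvgrPdist_lt/(_ _ d9) := uc; apply: filterS => n; rewrite sub0r normrN => hn w hw.
  apply: H; apply: le_lt_trans hw _; have := ler_norm (u_ n); move: hn; lra.
have [|||||_ L1] := @Rintegral_dominated R _ _ leb `]a, b[%classic mO
  (fun n y => pt Ip (s_ n) 1 y * Vd y) (fun y => 2 * NN e y * Vd y) (fun y => (12 * K * B) * Wt y).
- move=> n; apply: within_measurable; apply: oo_cont => x.
  by apply: cvgM; [exact: (pt_cont HD (si n) (se n))|exact: (Vd_cont HE)].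
- rewrite (_ : (fun y => _) = (fun y => 2 * (NN e y * Vd y))); last by apply/funext => y; rewrite mulrA.
  apply: measurable_funM; first exact: measurable_cst.
  exact: integrable_measurable (NN_intV heE).
- move=> y /oo_open yI; apply: cvgM; last exact: cvg_cst.
  have n1 : e%:C != Ip y by rewrite eq_sym -subr_eq0 Im_gt0_neq // (cd_H HD).
  apply/cvgrPdist_lt => eps e0; have e2 : 0 < eps / 2 by rewrite divr_gt0.
  apply: filterS (cvg9 _ _ (qd_inv_sub (-1) n1) _ e2) => n hn.
  have h1 := hn _ (close n).
  have h2 : cmod (-1 / (cconj (s_ n) - Ip y) - -1 / (e%:C - Ip y)) < eps / 2.
    by apply: hn; rewrite -(cconjC e) -cconjN -cconjD cmod_conj.
  have E1 (w : C) : -1 / (w - Ip y) = (Ip y - w)^-1 by rewrite mulN1r -invrN opprB.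
  rewrite !E1 in h1 h2.
  rewrite distrC.
  have -> : pt Ip (s_ n) 1 y - 2 * NN e y = Im ((Ip y - s_ n)^-1 - (Ip y - e%:C)^-1) +
      Im ((Ip y - cconj (s_ n))^-1 - (Ip y - e%:C)^-1).
    by rewrite /pt /pf cconj1 !div1r !ImD !ImN /NN; ring.
  apply: le_lt_trans (ler_normD _ _) _.
  have := le_lt_trans (Im_le_cmod _) h1; have := le_lt_trans (Im_le_cmod _) h2; lra.
- by apply: integrableZr => //; exact: (Wt_int HD).
- move=> n y /oo_open yI; have v0 := cd_H HD yI.
  have sp := Hr _ _ (urn n) yI; rewrite -/(s_ n) in sp.
  have De : 0 < cmod (Ip y - e%:C) by rewrite cmod_gt0 Im_gt0_neq.
  have sp2 := le_trans sp (conj_far v0 (si n)).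
  have inv6 (w : C) : 6^-1 * cmod (Ip y - e%:C) <= cmod w -> cmod w^-1 <= 6 * (K * Wt y).
    move=> hw; apply: (@le_trans _ _ (6 * cmod (Ip y - e%:C)^-1)); last by rewrite ler_pM2l // HK.
    rewrite !cmodV -[6]invrK -invfM lef_pV2 ?posrE ?mulr_gt0 ?invr_gt0 //.
    by apply: lt_le_trans hw; rewrite mulr_gt0 // invr_gt0.
  have VB : `|Vd y| <= B by have := HB _ (oo_le yI); rewrite cmod_real.
  rewrite normrM; have -> : 12 * K * B * Wt y = (6 * (K * Wt y) + 6 * (K * Wt y)) * B by ring.
  apply: ler_pM => //; apply: le_trans (Im_le_cmod _) _; rewrite /pf cconj1 !div1r.
  by apply: le_trans (cmodD _ _) _; apply: lerD; exact: inv6.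
have E2 : \int[leb]_(y in `]a, b[) (2 * NN e y * Vd y) = 2 * \int[leb]_(y in `]a, b[) (NN e y * Vd y).
  have i := NN_intV heE; rewrite -RintegralZl //; apply: eq_Rintegral => y _; by rewrite mulrA.
rewrite E2 in L1.
suff L2 : (\int[leb]_(y in `]a, b[) (pt Ip (s_ n) 1 y * Vd y))%R @[n --> \oo] --> - (2 * pi / e).
  have E : 2 * \int[leb]_(y in `]a, b[) (NN e y * Vd y) = - (2 * pi / e) by exact: cvg_unique L1 L2.
  by apply: (@mulfI _ 2) => //; rewrite E mulrN mulrA.
have -> : (fun n => \int[leb]_(y in `]a, b[) (pt Ip (s_ n) 1 y * Vd y)) =
   (fun n => - (2 * pi * Re ((s_ n)^-1 + z_ n * ell1 (s_ n) * GG theta c1 d ea eb mu (z_ n)))).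
  apply/funext => n; rewrite (duality HD HE 1 (si n) (se n)).
  by rewrite div1r mul1r [1%:C * _]mul1r.
have ne : e%:C != 0 :> C by rewrite fmorph_eq0.
have [ead e1 e2] : [/\ - d < ea, ea < -1 & 0 < eb].
  by split; [exact: (ea_gtNd d1 (cd_sum HD) (cd_prod HD) (cd_eb HD))|exact: cd_ea HD|exact: cd_eb HD].
have [m2 m3] : e%:C + 1 != 0 :> C /\ e%:C + d%:C != 0 :> C.
  by split; rewrite -?[1]/(1%:C) -rmorphD fmorph_eq0; case: heE => ->; apply/eqP; lra.
have q1 := qdV ne; have q2 := qd_ell1 theta ne m2 m3.
apply/cvgrPdist_lt => eps e0.
have p0 := @pi_gt0 R.
have bh : 0 < (b + h0) * M by rewrite mulr_gt0 // addr_gt0 // (lt_trans a0 ab).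
have ep1 : 0 < eps / (4 * pi) by rewrite divr_gt0 // mulr_gt0.
have ep2 : 0 < eps / (4 * pi) / ((b + h0) * M) by rewrite divr_gt0.
have N1 := cvg9 _ _ q1 _ ep1; have N2 := cvg9 _ _ q2 _ ep2.
apply: filterS2 N1 N2 => n h1 h2.
have {}h1 := h1 _ (close n); have {}h2 := h2 _ (close n).
rewrite (ell1_edge HD heE) subr0 in h2.
have k1 : `|Re (s_ n)^-1 - e^-1| < eps / (4 * pi).
  apply: le_lt_trans h1; apply: le_trans (Re_le_cmod _); by rewrite ReB -fmorphV ReC.
have k2 : `|Re (z_ n * ell1 (s_ n) * GG theta c1 d ea eb mu (z_ n))| <= eps / (4 * pi).
  apply: le_trans (Re_le_cmod _) _; rewrite !cmodM.
  apply: (@le_trans _ _ ((b + h0) * (eps / (4 * pi) / ((b + h0) * M)) * M)).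
    apply: ler_pM; rewrite ?mulr_ge0 ?cmod_ge0 //.
    by apply: ler_pM; rewrite ?cmod_ge0 // ltW.
  have gen (P Q m : R) : 0 < Q -> 0 < m -> Q * (P / (Q * m)) * m <= P.
    by move=> q0 m0; rewrite le_eqVlt; apply/orP; left; apply/eqP; field; rewrite !gt_eqF.
  by apply: gen => //; rewrite addr_gt0 // (lt_trans a0 ab).
rewrite ReD; set X := Re _^-1 in k1 *; set Y := Re (_ * _) in k2 *.
have -> : - (2 * pi / e) - - (2 * pi * (X + Y)) = 2 * pi * ((X - e^-1) + Y) by ring.
rewrite normrM ger0_norm; last by rewrite mulr_ge0 // ltW.
have := ler_normD (X - e^-1) Y => k3.
have k4 : `|X - e^-1 + Y| < 2 * (eps / (4 * pi)) by move: k1 k2 k3; lra.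
have gen (P : R) : 0 < P -> eps = 2 * P * (2 * (eps / (4 * P))) by move=> P0; field; rewrite gt_eqF.
rewrite [ltRHS](gen _ p0).
by rewrite ltr_pM2l // mulr_gt0.
Qed.

End Edge.

Lemma edge_ea : \int[leb]_(y in `]a, b[) (NN ea y * Vd y) = - (pi / ea).
Proof. by apply: (@edge_eq ea eb (-1)); left. Qed.
Lemma edge_eb : \int[leb]_(y in `]a, b[) (NN eb y * Vd y) = - (pi / eb).
Proof. by apply: (@edge_eq eb ea 1); right. Qed.

Lemma edge_combination (p q : R) :
  leb.-integrable `]a, b[ (EFin \o (fun y => (p * NN ea y + q * NN eb y) * Vd y)) /\
  \int[leb]_(y in `]a, b[) ((p * NN ea y + q * NN eb y) * Vd y) = - pi * (p / ea + q / eb).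
Proof.
have i1 := NN_intV (or_introl erefl); have i2 := NN_intV (or_intror erefl).
have E : (fun y => (p * NN ea y + q * NN eb y) * Vd y) = (fun y => p * (NN ea y * Vd y) + q * (NN eb y * Vd y)).
  by apply/funext => y; ring.
rewrite E; split.
  by apply: integrableDr => //; apply: integrableZr.
rewrite RintegralD //; [|exact: integrableZr|exact: integrableZr].
by rewrite !RintegralZl // edge_ea edge_eb; ring.
Qed.

(** The reciprocal of [ell1]: it converts [y * dI / dy] into a rational function of the curve
    variable. *)
Definition rr w : C := w * (w + 1) * (w + d%:C) / ((w - ea%:C) * (w - eb%:C)).

Lemma I1_rr y : a < y < b -> y%:C * I1 theta d Ip y = rr (Ip y).
Proof.
move=> yI; have y0 := oo_gt0 yI; rewrite (I1_factor HD yI) /rr invfM mulrA mulrA -rmorphM mulfV ?mul1r //.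
by rewrite gt_eqF.
Qed.

(* an antisymmetric combination over the curve and its conjugate has a purely
   imaginary integrand *)
Lemma contour_claim (c0 : R) (pole p q : R) (z : C) : c0 = c1 * d ->
  JA theta c0 c1 = a -> JB theta c0 c1 = b ->
  (forall y, a < y < b -> Jt theta c0 c1 (Ip y) = y%:C) ->
  (forall w, 0 < Im w -> rr w / (w + pole%:C) = 1 + p%:C / (w - ea%:C) + q%:C / (w - eb%:C)) ->
  z = Complex 0 (2 * pi * (p / ea + q / eb)) ->
  contour_int theta c0 c1 Ip
    (fun t : C => (Vd (complex.Re (Jt theta c0 c1 t)))%:C * Jt theta c0 c1 t / (t + pole%:C)) z.
Proof.
move=> c0E EA EB HJ Hr ->; rewrite /contour_int EA EB.
pose f (t : C) : C := (Vd (complex.Re (Jt theta c0 c1 t)))%:C * Jt theta c0 c1 t / (t + pole%:C).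
pose h x : C := f (cconj (Ip x)) * cconj (cderive Ip x) - f (Ip x) * cderive Ip x.
have hE y : a < y < b -> h y = Complex 0 (- 2 * ((p * NN ea y + q * NN eb y) * Vd y)).
  move=> yI; have i0 := cd_H HD yI; have y0 := oo_gt0 yI; have [dR dI] := Ip_der HD yI.
  have Ec : cderive Ip y = I1 theta d Ip y.
    apply: complex_ext; rewrite /cderive /= derive1E.
      by have [_ ->] := dR.
    by have [_ ->] := dI.
  have Jc : Jt theta c0 c1 (cconj (Ip y)) = y%:C.
    by rewrite c0E (Jt_conj _ _ _ i0) -c0E HJ // cconjC.
  rewrite /h /f Ec Jc (HJ _ yI) ReC.
  have Q : y%:C * I1 theta d Ip y / (Ip y + pole%:C) =
      1 + p%:C / (Ip y - ea%:C) + q%:C / (Ip y - eb%:C) by rewrite I1_rr // Hr.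
  have E1 : (Vd y)%:C * y%:C / (Ip y + pole%:C) * I1 theta d Ip y =
      (Vd y)%:C * (y%:C * I1 theta d Ip y / (Ip y + pole%:C)) by ring.
  have E2 : (Vd y)%:C * y%:C / (cconj (Ip y) + pole%:C) * cconj (I1 theta d Ip y) =
      cconj ((Vd y)%:C * (y%:C * I1 theta d Ip y / (Ip y + pole%:C))).
    by rewrite !cconjM cconjV cconjD !cconjC; ring.
  rewrite E1 E2 Q; set X := _ * _.
  have IX : Im X = Vd y * (p * NN ea y + q * NN eb y).
    by rewrite /X (ImM (Vd y)%:C) ReC ImC mul0r addr0 !ImD Im1 add0r (ImM p%:C) (ImM q%:C) !ReC !ImC !mul0r !addr0.
  apply: complex_ext; rewrite ?ReB ?ImB ?Re_conj ?Im_conj /= ?IX; ring.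
have [i E] := edge_combination p q.
split.
  transitivity (\int[leb]_(y in `]a, b[) (0 : \bar R))%E; last by rewrite integral0.
  by apply: eq_integral => y /set_mem /oo_open yI; rewrite -/(f _) -/(f _) -/(h y) hE.
transitivity (\int[leb]_(y in `]a, b[) (- 2 * ((p * NN ea y + q * NN eb y) * Vd y))%:E)%E.
  by apply: eq_integral => y /set_mem /oo_open yI; rewrite -/(f _) -/(f _) -/(h y) hE.
have i2 : leb.-integrable `]a, b[ (EFin \o (fun y => - 2 * ((p * NN ea y + q * NN eb y) * Vd y))).
  exact: integrableZr.
transitivity ((\int[leb]_(y in `]a, b[) (- 2 * ((p * NN ea y + q * NN eb y) * Vd y)))%:E).
  by rewrite /Rintegral fineK //; apply: integrable_fin_num; [exact: oo_measurable|exact: i2].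
rewrite RintegralZl // E /=.
by congr (_%:E); ring.
Qed.

End EdgeEquations.

(** * The density and its recovery by the Poisson kernel *)

Section ChangeOfDensity.
Variables (R : realType) (dd : measure_display) (T : measurableType dd).
Variables (nu : {finite_measure set T -> \bar R}) (m : {sigma_finite_measure set T -> \bar R}).

(** On [E] the function [psi] agrees almost everywhere with the Radon-Nikodym derivative, since both
    integrate to [nu] over every measurable subset. *)
Lemma integral_density (E : set T) (f psi : T -> R) : nu `<< m -> measurable E ->
  measurable_fun E psi ->
  (forall A, measurable A -> A `<=` E -> nu A = (\int[m]_(x in A) (psi x)%:E)%E) ->
  nu.-integrable E (EFin \o f) -> \int[nu]_(t in E) f t = \int[m]_(t in E) (f t * psi t).
Proof.
move=> dm mE mpsi den fi; rewrite /Rintegral; congr fine.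
have mf := measurable_int _ fi.
have iRN := Radon_Nikodym_integrable (nu := charge_of_finite_measure nu) dm.
have mRN := measurable_funS measurableT (@subsetT _ E) (measurable_int _ iRN).
rewrite -(Radon_Nikodym_change_of_variables dm mE fi).
apply: ae_eq_integral => //; first exact: emeasurable_funM.
  by apply/measurable_EFinP; apply: measurable_funM => //; apply/measurable_EFinP.
rewrite (_ : (fun x => (f x * psi x)%:E) = (fun x => ((f x)%:E * (psi x)%:E)%E)); last by apply/funext => x.
apply: ae_eqe_mul2l; apply: integral_ae_eq => //.
- exact: (integrableS measurableT mE (@subsetT _ E) iRN).
- exact/measurable_EFinP.
- move=> A AE mA; rewrite -(Radon_Nikodym_integral (nu := charge_of_finite_measure nu) dm mA).
  exact: den.
Qed.

End ChangeOfDensity.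

Section Density.
Variable R : realType.
Local Notation C := R[i].
Local Notation leb := (@lebesgue_measure R).
Variables (a b : R) (mu : probability R R) (psi : R -> R).
Hypothesis a0 : 0 < a.
Hypothesis ab : a < b.
Hypothesis muO : mu (~` `]a, b[%classic) = 0%E.
Hypothesis cpsi : {within `]a, b[, continuous psi}.
Hypothesis den : forall A : set R, measurable A -> A `<=` `]a, b[%classic ->
     mu A = (\int[leb]_(x in A) (psi x)%:E)%E.
Let mO := oo_measurable a b.
Let oo_open (y : R) : `]a, b[%classic y -> a < y < b.
Proof. by rewrite /= in_itv. Qed.

Let mpsi : measurable_fun `]a, b[ (EFin \o psi).
Proof. by apply/measurable_EFinP; exact: within_measurable. Qed.

(* [mu] and the Lebesgue measure live on measurable types with different displays;
   the image of [mu] under the identity moves it to the latter *)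
Let mid : measurable_fun [set: R] (id : R -> measurableTypeR R).
Proof. by move=> _ Y mY; rewrite setTI. Qed.
Let id_mixin := isMeasurableFun.Build _ _ _ _ _ mid.
Let idX : {mfun R >-> measurableTypeR R} := MeasurableFun.Pack (MeasurableFun.Class id_mixin).
Let nu : probability (measurableTypeR R) R := distribution mu idX.

Lemma density_dominated : nu `<< leb.
Proof.
apply/null_content_dominatesP => A mA A0.
change (mu A = 0%E).
have mAO : measurable (A `&` `]a, b[%classic) by exact: measurableI.
have E0 : mu (A `&` `]a, b[%classic) = 0%E.
  apply: etrans (den mAO (@subIsetr _ A _)) _; apply: null_set_integral => //.
  - exact: measurable_funS mpsi.
  - by apply: (subset_measure0 _ _ _ A0) => //; exact: subIsetl.
have : (mu A <= mu ((A `&` `]a, b[%classic) `|` ~` `]a, b[%classic))%E.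
  apply: le_measure; rewrite ?inE //; first by apply: measurableU => //; exact: measurableC.
  by move=> x Ax; have [Ox|nO] := pselect (`]a, b[%classic x); [left|right].
rewrite measureU0 //; last exact: measurableC.
move=> h; apply/eqP; rewrite -measure_le0; apply: le_trans h _.
by rewrite le_eqVlt; apply/orP; left; apply/eqP; exact: E0.
Qed.

Lemma density_change (E : set R) (f : R -> R) : measurable E -> E `<=` `]a, b[ ->
  measurable_fun [set: R] f ->
  mu.-integrable E (EFin \o f) -> \int[mu]_(t in E) f t = \int[leb]_(t in E) (f t * psi t).
Proof.
move=> mE EO mf fi.
have mf' : measurable_fun [set: measurableTypeR R] (EFin \o f : measurableTypeR R -> \bar R).
  exact/measurable_EFinP.
have fi' : nu.-integrable E (EFin \o f) by apply: (integrable_pushforward mid mf' fi).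
have H : \int[nu]_(t in E) f t = \int[mu]_(t in E) f t.
  by congr fine; exact: (integral_pushforward mid mf' fi).
rewrite -H; apply: (integral_density density_dominated mE _ _ fi').
  by apply: measurable_funS (within_measurable cpsi).
by move=> A mA AE; apply: (den (A := A)) => //; exact: subset_trans EO.
Qed.

(** The density is controlled only inside the open interval, so the Poisson limit is taken on a
    segment around [x]. The rest of the mass is at a distance from [x], where the kernel is small,
    and is estimated by the total mass of [mu]. *)
Lemma Poisson_density (x eps : R) : a < x < b -> 0 < eps -> exists2 del : R, 0 < del &
  forall z : C, 0 < Im z -> cmod (z - x%:C) < del ->
   `|\int[mu]_(t in `]a, b[) (t * PK id z t) - pi * (x * psi x)| < eps.
Proof.
move=> /andP[ax xb] e0.
pose u := (a + x) / 2; pose v := (x + b) / 2.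
have [au ux xv vb] : [/\ a < u, u < x, x < v & v < b] by rewrite /u /v; split; lra.
have uv := lt_trans ux xv.
have cc_oo (y : R) : u <= y <= v -> a < y < b by move: au vb; lra.
have ctp : {within `[u, v], continuous (fun t => t * psi t)}.
  have S : `[u, v]%classic `<=` `]a, b[%classic.
    by move=> y /=; rewrite !in_itv /= => /cc_oo.
  move=> y; apply: cvgM; first exact: (continuous_subspaceT (fun t => @cvg_id _ _)).
  exact: (continuous_subspaceW S cpsi).
have e2 : 0 < eps / 2 by rewrite divr_gt0.
have p1 (y : R) : u <= y <= v -> is_derive y 1 id (1 : R) by move=> _; exact: derI.
have p2 : {within `[u, v], continuous (fun=> 1 : R)} by apply: continuous_subspaceT => y; exact: cvg_cst.
have p3 (y : R) : u <= y <= v -> 0 < (1 : R) by move=> _; exact: ltr01.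
have p4 : u <= x <= v by rewrite (ltW ux) (ltW xv).
have p5 : u < x < v \/ x * psi x = 0 by left; rewrite ux xv.
have [del d0 H] := Poisson_limit uv ctp p1 p2 p3 p4 p5 e2.
pose r := Num.min (x - u) (v - x) / 2.
have r0 : 0 < r by rewrite divr_gt0 // lt_min !subr_gt0 ux.
have [r1 r2] : 2 * r <= x - u /\ 2 * r <= v - x.
  by rewrite /r mulrCA mulfV // mulr1; split; rewrite ge_min lexx ?orbT.
have b0 : 0 < b := lt_trans a0 ab.
(* Away from the segment the kernel is at most [Im z / r ^ 2] and [t] is below [b], so [Im z < e3]
   keeps the contribution below [eps / 4]. *)
pose e3 := eps * r ^+ 2 / (4 * b).
have e30 : 0 < e3 by apply: divr_gt0; apply: mulr_gt0 => //; exact: exprn_gt0.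
exists (Num.min del (Num.min r e3)); first by rewrite !lt_min d0 r0.
move=> z z0; rewrite !lt_min => /and3P[zd zr ze].
have Im_z : Im z < e3.
  by apply: le_lt_trans ze; apply: le_trans (Im_le_cmod _); rewrite ImB ImC subr0; exact: ler_norm.
have zn : Im z != 0 by rewrite gt_eqF.
set f := fun t : R => t * PK id z t.
have PKp (t : R) : 0 <= PK id z t by exact: PK_ge0.
have mf : measurable_fun setT f.
  apply: measurable_funM; first exact: measurable_id.
  apply: measurable_funM; first exact: measurable_cst.
  apply: inv_meas; apply: measurable_funD; last exact: measurable_cst.
  by apply: measurable_funX; apply: measurable_funB => //; exact: measurable_cst.
have fb (t : R) : a < t < b -> `|f t| <= b * (Im z)^-1.
  move=> /andP[t1 t2]; have t0 := lt_trans a0 t1.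
  rewrite /f normrM (gtr0_norm t0) (ger0_norm (PKp t)); apply: ler_pM => //; [exact: ltW|exact: ltW|].
  rewrite /PK (gtr0_norm z0) ler_pdivrMr ?PK_den // ler_pdivlMl //.
  by rewrite -expr2 lerDr sqr_ge0.
have fi : mu.-integrable `]a, b[ (EFin \o f).
  by apply: (integrable_bound _ mO mf) => t /oo_open; exact: fb.
pose E : set R := `]u, v[%classic; have mE : measurable E := oo_measurable u v.
have EO : E `<=` `]a, b[%classic by move=> t /=; rewrite !in_itv /= => h; apply: cc_oo; move: h => /andP[/ltW -> /ltW ->].
pose F : set R := `]a, b[%classic `\` E; have mF : measurable F by exact: measurableD.
have OE : `]a, b[%classic = E `|` F 
  by apply/seteqP; split=> t; [move=> h; have [|] := pselect (E t); [left|right]|case=> [/EO|[]]].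
have fiE : mu.-integrable E (EFin \o f) by exact: integrableS fi.
have fiF : mu.-integrable F (EFin \o f) by apply: integrableS fi => //; exact: subDsetl.
rewrite {1}OE Rintegral_setU //; [|by rewrite -OE|by apply/disj_setPS => t [? []]].
rewrite (density_change mE EO mf fiE).
have -> : \int[leb]_(t in E) (f t * psi t) = \int[leb]_(t in `]u, v[) (PK id z t * (t * psi t * 1)).
  by apply: eq_Rintegral => t _; rewrite /f; ring.
have h1 := H z zn zd.
have h2 : `|\int[mu]_(t in F) f t| <= eps / 4.
  have ic : mu.-integrable F (EFin \o cst (eps / 4)).
    apply: (integrable_bound (K := `|eps / 4|) _ mF); first exact: measurable_cst.
    by move=> t _; exact: lexx.
  apply: le_trans (@le_Rintegral_norm R _ _ mu F mF _ _ fiF ic _) _.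
    move=> t [/oo_open /andP[t1 t2] nE]; have t0 := lt_trans a0 t1.
    rewrite /f normrM (gtr0_norm t0) (ger0_norm (PKp t)).
    apply: (@le_trans _ _ (b * (e3 / r ^+ 2))); last first.
      have gen (B q e : R) : 0 < B -> 0 < q -> B * (e * q ^+ 2 / (4 * B) / q ^+ 2) <= e / 4.
        by move=> B0 q0; rewrite le_eqVlt; apply/orP; left; apply/eqP; field; rewrite !gt_eqF.
      exact: gen.
    apply: ler_pM => //; [exact: ltW|exact: ltW|].
    rewrite /PK (gtr0_norm z0); apply: ler_pM; rewrite ?invr_ge0 ?(ltW z0) ?(ltW (PK_den _ _ _)) ?(ltW Im_z) //.
    rewrite lef_pV2 ?posrE ?PK_den ?exprn_gt0 //.
    apply: (@le_trans _ _ ((Re z - t) ^+ 2)); last by rewrite lerDl sqr_ge0.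
    have rz : `|Re z - x| < r by apply: le_lt_trans zr; apply: le_trans (Re_le_cmod _); rewrite ReB ReC.
    rewrite -[leRHS]real_normK ?num_real // ler_sqr ?nnegrE ?normr_ge0 ?(ltW r0) //.
    have tE : t <= u \/ v <= t.
      have [|h] := leP t u; [by left|have [|h'] := leP v t; [by right|]].
      by case: nE; rewrite /E /= in_itv /= h h'.
    move: rz => /ltr_normlP[q1 q2]; case: tE => tE.
      by apply: le_trans (ler_norm _); move: q1 q2 r1 r2 tE; lra.
    by rewrite distrC; apply: le_trans (ler_norm _); move: q1 q2 r1 r2 tE; lra.
  rewrite Rintegral_cst // ler_piMr //; first by rewrite divr_ge0 // ltW.
  rewrite -lee_fin fineK ?probability_le1 //.
  by rewrite fin_num_measure.
rewrite -addrA [X in _ + X]addrC addrA; apply: le_lt_trans (ler_normD _ _) _.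
by move: h1 h2; set X := `|_|; set Y := `|_|; lra.
Qed.

End Density.

(** * Integration by parts against the logarithmic kernel *)

Section LogDerivative.
Variable R : realType.
Local Notation C := R[i].

Lemma ln_cmodE (z : C) : ln (cmod z) = 2^-1 * ln (Re z ^+ 2 + Im z ^+ 2).
Proof.
rewrite -cmod_sqr; have [->|n0] := eqVneq z 0.
  by rewrite cmod0 expr0n /= ln0 // mulr0.
by rewrite lnXn ?cmod_gt0 // mulr2n; field.
Qed.

Lemma ln_cmod_der (g : R -> C) (x : R) (e : C) : cder g x e -> g x != 0 ->
  is_derive x 1 (fun u => ln (cmod (g u))) (Re (e / g x)).
Proof.
move=> [h1 h2] n0.
have q0 : 0 < Re (g x) ^+ 2 + Im (g x) ^+ 2 by rewrite -cmod_sqr exprn_gt0 // cmod_gt0.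
rewrite (_ : (fun u => _) = (fun u => 2^-1 * ln (Re (g u) ^+ 2 + Im (g u) ^+ 2))); last first.
  by apply/funext => u; exact: ln_cmodE.
have := derZ 2^-1 (@derComp R (@ln R) (fun u => Re (g u) ^+ 2 + Im (g u) ^+ 2) x _ _
  (is_derive1_ln q0) (derD (der_sqr h1) (der_sqr h2))).
congr (is_derive _ _ _ _); rewrite ReM ReV ImV.
by field; rewrite gt_eqF.
Qed.

End LogDerivative.

Section PartialFractions.
Variable F : fieldType.

(** Numerator and denominator of [r w / (w - s)] have equal degree and leading coefficient, which
    gives the constant [1]; the other terms are the residues at [s], [p] and [q]. *)
Lemma cubic_quotient_split (w s p q d : F) : w != s -> w != p -> w != q -> s != p -> s != q -> p != q ->
  let r (v : F) := v * (v + 1) * (v + d) / ((v - p) * (v - q)) in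
  r w / (w - s) = r s / (w - s) + 1 -
    (p * (p + 1) * (p + d) / (p - q) * ((w - p)^-1 * (s - p)^-1) +
     q * (q + 1) * (q + d) / (q - p) * ((w - q)^-1 * (s - q)^-1)).
Proof.
move=> n1 n2 n3 n4 n5 n6 r; rewrite /r.
by field; rewrite !subr_eq0 n1 n2 n3 n4 n5 n6 [q == p]eq_sym n6.
Qed.

End PartialFractions.

Section LogKernel.
Variable R : realType.
Local Notation C := R[i].
Local Notation leb := (@lebesgue_measure R).
Variables (theta c1 d ea eb : R) (Ip : R -> C).
Hypothesis HD : curve_data theta c1 d ea eb Ip.
Let a := expR (lr theta c1 d ea).
Let b := expR (lr theta c1 d eb).
Local Notation ell := (ell theta c1 d).
Local Notation ell1 := (ell1 theta d).
Local Notation lr := (lr theta c1 d).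
Local Notation rr := (rr d ea eb).
Local Notation I1 := (I1 theta d Ip).
Local Notation NN := (NN Ip).
Variables (V Vd Vdd : R -> R) (mu : probability R R) (l : R).
Hypothesis HE : equilibrium theta a b V Vd mu l.
Hypothesis Vdder : forall x : R, 0 < x -> is_derive x 1 Vd (Vdd x).
Hypothesis cVdd : {within `[a, b], continuous Vdd}.
Local Notation GG := (GG theta c1 d ea eb mu).
Let th1 : 1 < theta := cd_theta HD.
Let d1 : 1 < d := cd_d HD.
Let ab : a < b := cd_ab HD.
Let a0 : 0 < a := cd_a0 _ _ _ _.
Local Notation Wt := (Wt theta c1 d ea eb).
Let mO := oo_measurable a b.
Let oo_open (y : R) : `]a, b[%classic y -> a < y < b.
Proof. by rewrite /= in_itv. Qed.
Let eab : ea < eb. Proof. by have := cd_ea HD; have := cd_eb HD; lra. Qed.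

(** For [s] on the curve this is the logarithm in the density formula. It is first used with [s]
    outside the curve, where it is smooth. *)
Definition Lam (s : C) (y : R) : R := ln (cmod (Ip y - cconj s)) - ln (cmod (Ip y - s)).

(** The derivative of [y * V' y], the function that is integrated by parts against the kernel. *)
Definition gain (y : R) : R := Vdd y * y + Vd y.

Lemma gain_cont : {within `[a, b], continuous gain}.
Proof.
move=> y; apply: cvgD; last exact: (Vd_cont HE).
by apply: cvgM; [exact: cVdd|exact: (continuous_subspaceT (fun t => @cvg_id _ _))].
Qed.

Lemma cconj_rr (w : C) : cconj (rr w) = rr (cconj w).
Proof. by rewrite /rr !(cconjM, cconjV, cconjD, cconjN, cconjC, cconj1). Qed.

Lemma rr_ell1 (w : C) : 0 < Im w -> rr w * ell1 w = 1.
Proof.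
move=> i0.
have n1 : w != 0 by exact: H_neq0.
have n2 : w + 1 != 0 by rewrite H_neq0 // Im_shift1.
have n3 : w + d%:C != 0 by rewrite H_neq0 // Im_shift.
have m1 := Im_gt0_neq ea i0; have m2 := Im_gt0_neq eb i0.
rewrite (ell1_factor (cd_sum HD) (cd_prod HD)) // /rr.
by field; rewrite n1 n2 n3 m1 m2.
Qed.

Let al e e' : R := e * (e + 1) * (e + d) / (e - e').

Let alE e e' : (al e e')%:C = e%:C * (e%:C + 1) * (e%:C + d%:C) / (e%:C - e'%:C) :> C.
Proof. by rewrite /al !(rmorphM, rmorphD, fmorphV, rmorphN) rmorph1. Qed.

Let split_rr (w s : C) : w != s -> w != ea%:C -> w != eb%:C -> s != ea%:C -> s != eb%:C ->
  rr w / (w - s) = rr s / (w - s) + 1 -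
    ((al ea eb)%:C * ((w - ea%:C)^-1 * (s - ea%:C)^-1) + (al eb ea)%:C * ((w - eb%:C)^-1 * (s - eb%:C)^-1)).
Proof.
move=> n1 n2 n3 n4 n5; rewrite !alE; apply: cubic_quotient_split => //.
by apply/eqP => /(congr1 (@complex.Re R)); rewrite !ReC => e; move: eab; rewrite e ltxx.
Qed.

Let Im_neqR (w : C) (x : R) : Im w != 0 -> w != x%:C.
Proof. by apply: contraNneq => ->; rewrite ImC. Qed.

Section Test.
Variable s : C.
Hypothesis s0 : 0 < Im s.
Hypothesis s_ext : 0 < Im (ell s).
(** With residue [i * rr s] the weight [pt] is exactly the pole part at [s] and [conj s] of minus
    [y] times the derivative of [Lam]. *)
Let A : C := Complex 0 1 * rr s.
Let Ka : C := (s - ea%:C)^-1.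
Let Kb : C := (s - eb%:C)^-1.
Local Notation pt := (pt Ip s A).
Let L1 (y : R) : R := Re (I1 y / (Ip y - cconj s)) - Re (I1 y / (Ip y - s)).

Let sn0 : Im s != 0. Proof. by rewrite gt_eqF. Qed.
Let sc0 : Im (cconj s) != 0. Proof. by rewrite Im_conj oppr_eq0. Qed.

Let neq y : a <= y <= b -> Ip y - s != 0 /\ Ip y - cconj s != 0.
Proof. by move=> yI; have [h1 h2] := Ip_neq_s HD s0 s_ext yI; rewrite !subr_eq0. Qed.

Lemma Lam_der y : a < y < b -> is_derive y 1 (Lam s) (L1 y).
Proof.
move=> yI; have [n1 n2] := neq (oo_le yI).
have k (w : C) : cder (fun u => Ip u - w) y (I1 y).
  have := qd_path (qdD (qd_id (Ip y)) (qd_cst (- w) (Ip y))) (Ip_der HD yI).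
  by rewrite addr0 mul1r.
by apply: derD; [|apply: derN]; apply: ln_cmod_der => //; exact: k.
Qed.

(** The derivative of [Lam] times [y] is a difference of real parts of [rr w / (w - s)] and its
    reflection. Their partial fractions have the poles that form [pt] and poles at the critical
    points, whose coefficients are conjugate and leave multiples of [NN]. *)
Lemma Lam_L1 y : a < y < b ->
  y * L1 y = - pt y - 2 * (al ea eb * Im Ka * NN ea y + al eb ea * Im Kb * NN eb y).
Proof.
move=> yI; have i0 := cd_H HD yI; have [n1 n2] := neq (oo_le yI).
have in0 : Im (Ip y) != 0 by rewrite gt_eqF.
have E (w : C) : y * Re (I1 y / (Ip y - w)) = Re (rr (Ip y) / (Ip y - w)).
  rewrite -(I1_rr HD yI) -[y%:C * _ / _]mulrA (ReM y%:C) ReC ImC mul0r subr0 //.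
have [w1 w2] : Ip y != s /\ Ip y != cconj s by rewrite -subr_eq0 n1 -subr_eq0 n2.
have S1 := split_rr w1 (Im_neqR ea in0) (Im_neqR eb in0) (Im_neqR ea sn0) (Im_neqR eb sn0).
have S2 := split_rr w2 (Im_neqR ea in0) (Im_neqR eb in0) (Im_neqR ea sc0) (Im_neqR eb sc0).
rewrite /L1 mulrBr (E (cconj s)) (E s) S1 S2.
have -> : (cconj s - ea%:C)^-1 = cconj Ka by rewrite /Ka cconjV cconjD cconjN cconjC.
have -> : (cconj s - eb%:C)^-1 = cconj Kb by rewrite /Kb cconjV cconjD cconjN cconjC.
have P : pt y = Re (rr s / (Ip y - s)) - Re (rr (cconj s) / (Ip y - cconj s)).
  have gen (X Y W : C) : Im (Complex 0 1 * X * Y + cconj (Complex 0 1 * X) * W) = Re (X * Y) - Re (cconj X * W).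
    by rewrite cconjM -!mulrA ImD (ImM (Complex 0 1)) (ImM (cconj (Complex 0 1))) /=; ring.
  by rewrite /pt /pf /A gen cconj_rr.
have gen (X Y N M K L : C) (p q : R) :
    Re (Y + 1 - (p%:C * (N * cconj K) + q%:C * (M * cconj L))) -
    Re (X + 1 - (p%:C * (N * K) + q%:C * (M * L))) =
    - (Re X - Re Y) - 2 * (p * Im K * Im N + q * Im L * Im M).
  by rewrite !ReIm; ring.
by rewrite gen P.
Qed.

(** The same partial fraction at [w = 0], where [rr] vanishes. It is what cancels the term [A / s]
    of the duality against the edge equations. *)
Let Im_rr : Im (rr s / s) = al ea eb * Im Ka / ea + al eb ea * Im Kb / eb.
Proof.
have e1 := cd_ea HD; have e2 := cd_eb HD.
have [ea0 eb0] : ea != 0 /\ eb != 0 by split; apply/eqP; lra.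
have rea (e : R) : e != 0 -> 0 != e%:C :> C 
  by move=> e0; apply/eqP => /(congr1 (@complex.Re R)); rewrite ReC => /esym/eqP; apply/negP.
have := split_rr (w := 0) (s := s); rewrite eq_sym (H_neq0 s0) !rea ?Im_neqR // => /(_ isT isT isT isT isT).
have -> : rr 0 = 0 by rewrite /rr !mul0r.
rewrite mul0r !sub0r !invrN mulrN => H.
have {}H : rr s / s = 1 + ((al ea eb)%:C * (ea^-1)%:C * Ka + (al eb ea)%:C * (eb^-1)%:C * Kb).
  rewrite -[LHS]addr0 H /Ka /Kb !fmorphV /=.
  by move: (rr s / s) (ea%:C^-1) (eb%:C^-1) ((s - _)^-1) ((s - _)^-1) => X u v K L; ring.
rewrite H !ImD Im1 -!rmorphM !(ImM _%:C) !ReC !ImC; ring.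
Qed.

Let Lam_cont : {within `[a, b], continuous (Lam s)}.
Proof.
have k (w : C) : (forall y, a <= y <= b -> Ip y - w != 0) ->
    {within `[a, b], continuous (fun y => ln (cmod (Ip y - w)))}.
  move=> nw; rewrite (_ : (fun y => _) = (fun y => 2^-1 * ln (Re (Ip y - w) ^+ 2 + Im (Ip y - w) ^+ 2))); last first.
    by apply/funext => u; exact: ln_cmodE.
  have [c1' c2] := ccontD (Ip_ccont HD) (ccont_cst a b (- w)).
  have cq : {within `[a, b], continuous (fun y => Re (Ip y - w) ^+ 2 + Im (Ip y - w) ^+ 2)}.
    by move=> y; apply: cvgD; rewrite /= ?expr2; apply: cvgM; [exact: c1'|exact: c1'|exact: c2|exact: c2].
  apply: within_eps => y yI eps e0; have yI2 : a <= y <= b by move: yI; rewrite /= in_itv.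
  have q0 : 0 < Re (Ip y - w) ^+ 2 + Im (Ip y - w) ^+ 2 by rewrite -cmod_sqr exprn_gt0 // cmod_gt0 nw.
  have [del1 d10 H1] := for_epsE (continuous_ln q0) e0.
  have [del2 d20 H2] := within_epsE cq yI d10.
  exists del2 => // u uI hu; rewrite -mulrBr normrM ger0_norm ?invr_ge0 //.
  have := H1 _ (H2 _ uI hu); set X := `|_|; have : 0 <= X by exact: normr_ge0.
  by lra.
by move=> y; apply: cvgB; apply: k => u uI; have [] := neq uI.
Qed.

Lemma Lam_edge y : Im (Ip y) = 0 -> Lam s y = 0.
Proof.
move=> i0; rewrite /Lam -(cmod_conj (Ip y - s)) cconjD cconjN.
have -> : cconj (Ip y) = Ip y by apply: complex_ext; rewrite ?Re_conj ?Im_conj ?i0 ?oppr0.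
by rewrite subrr.
Qed.

Let z0 := zf theta c1 d 1 s.

(** The boundary terms of [y * V' * Lam] vanish because [Ip] is real at both ends. The derivative of
    [Lam] is then treated by the duality and the edge equations; the constants cancel by [Im_rr],
    and [rr * ell1 = 1] reduces the coefficient of the Stieltjes transform to [i * z0]. *)
Lemma gain_Lam : leb.-integrable `]a, b[ (EFin \o (fun y => gain y * Lam s y)) /\
  \int[leb]_(y in `]a, b[) (gain y * Lam s y) = 2 * pi * Im (z0 * GG z0).
Proof.
have cH : {within `[a, b], continuous (fun y => gain y * Lam s y)}.
  by move=> y; apply: cvgM; [exact: gain_cont|exact: Lam_cont].
have iH : leb.-integrable `]a, b[ (EFin \o (fun y => gain y * Lam s y)) by exact: integrable_cc_oo.
split=> //.
pose pa := al ea eb * Im Ka; pose pb := al eb ea * Im Kb.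
have [iN EN] := edge_combination HD HE pa pb.
have cpt : {within `[a, b], continuous (fun y => pt y * Vd y)}.
  by move=> y; apply: cvgM; [exact: (pt_cont HD s0 s_ext)|exact: (Vd_cont HE)].
have iP : leb.-integrable `]a, b[ (EFin \o (fun y => pt y * Vd y)) by exact: integrable_cc_oo.
pose G y := (-1) * (pt y * Vd y) + (- 2) * ((pa * NN ea y + pb * NN eb y) * Vd y).
have iG : leb.-integrable `]a, b[ (EFin \o G).
  by apply: integrableDr => //; exact: integrableZr.
have GE y : a < y < b -> G y = y * Vd y * L1 y.
  move=> yI; have -> : y * Vd y * L1 y = Vd y * (y * L1 y) by ring.
  by rewrite Lam_L1 // /G /pa /pb; ring.
have IG : \int[leb]_(y in `]a, b[) G y = - (2 * pi * Im (z0 * GG z0)).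
  rewrite RintegralD //; [|exact: integrableZr|exact: integrableZr].
  rewrite RintegralZl // RintegralZl // EN (duality HD HE A s0 s_ext) -/z0 ReD.
  have -> : A * (z0 * (1%:C * ell1 s)) * GG z0 = Complex 0 1 * (z0 * GG z0).
    rewrite [1%:C * _]mul1r /A.
    have -> : Complex 0 1 * rr s * (z0 * ell1 s) * GG z0 = Complex 0 1 * (rr s * ell1 s) * (z0 * GG z0) by ring.
    by rewrite rr_ell1 // mulr1.
  have -> : A / s = Complex 0 1 * (rr s / s) by rewrite /A mulrA.
  rewrite !(ReM (Complex 0 1)) Im_rr /= -/pa -/pb.
  by move: (Im (z0 * _)) => X; ring.
have IF : \int[leb]_(y in `]a, b[) (gain y * Lam s y + G y) = 0.
  have Vdd' y : a < y < b -> is_derive y 1 (fun u => u * Vd u * Lam s u) (gain y * Lam s y + G y).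
    move=> yI; rewrite GE //.
    have := derM (derM (derI y) (Vdder (oo_gt0 yI))) (Lam_der yI).
    by congr (is_derive _ _ _ _); rewrite /gain; ring.
  rewrite (@FTC_open R a b ab (fun y => gain y * Lam s y + G y) (fun u => u * Vd u * Lam s u)).
  - rewrite !Lam_edge ?mulr0 ?subrr //.
      by have -> := cd_Ia HD; rewrite ImC.
    by have -> := cd_Ib HD; rewrite ImC.
  - have cN e : e = ea \/ e = eb -> {within `]a, b[, continuous (fun y => NN e y)}.
      move=> he; have [] // := @cder_within R theta c1 d ea eb (fun y => (Ip y - e%:C)^-1).
      move=> y yI; have i0 := cd_H HD yI.
      have n1 : Ip y != e%:C by rewrite -subr_eq0 Im_gt0_neq.
      have := qd_path (qd_inv_sub 1 n1) (Ip_der HD yI) => h.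
      by eexists; apply: (cder_ext ltr01 _ h) => u _; rewrite div1r.
    move=> y; apply: cvgD; first exact: (oo_cont cH).
    rewrite /G; apply: cvgD; first by apply: cvgM; [exact: cvg_cst|exact: (oo_cont cpt)].
    apply: cvgM; first exact: cvg_cst.
    apply: cvgM; last exact: (oo_cont (Vd_cont HE)).
    by apply: cvgD; (apply: cvgM; first exact: cvg_cst); apply: cN; [left|right].
  - move=> y; apply: cvgM; last exact: Lam_cont.
    by apply: cvgM; [exact: (continuous_subspaceT (fun t => @cvg_id _ _))|exact: (Vd_cont HE)].
  - exact: integrableDr.
move: IF; rewrite RintegralD // IG.
by move: (\int[leb]_(y in _) _) (2 * pi * _) => X Y; lra.
Qed.

End Test.

End LogKernel.

(** * The density formula *)

Section DensityFormula.
Variable R : realType.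
Local Notation C := R[i].
Local Notation leb := (@lebesgue_measure R).
Variables (theta c1 d ea eb : R) (Ip : R -> C).
Hypothesis HD : curve_data theta c1 d ea eb Ip.
Let a := expR (lr theta c1 d ea).
Let b := expR (lr theta c1 d eb).
Local Notation ell := (ell theta c1 d).
Local Notation ell1 := (ell1 theta d).
Local Notation lr := (lr theta c1 d).
Local Notation I1 := (I1 theta d Ip).
Local Notation Lam := (Lam Ip).
Local Notation zf := (zf theta c1 d 1).
Variables (V Vd Vdd : R -> R) (mu : probability R R) (l : R) (psi : R -> R).
Hypothesis HE : equilibrium theta a b V Vd mu l.
Hypothesis Vdder : forall x : R, 0 < x -> is_derive x 1 Vd (Vdd x).
Hypothesis cVdd : {within `[a, b], continuous Vdd}.
Hypothesis cpsi : {within `]a, b[, continuous psi}.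
Hypothesis den : forall A : set R, measurable A -> A `<=` `]a, b[%classic ->
     mu A = (\int[leb]_(x in A) (psi x)%:E)%E.
Local Notation GG := (GG theta c1 d ea eb mu).
Local Notation gain := (gain Vd Vdd).
Let th1 : 1 < theta := cd_theta HD.
Let d1 : 1 < d := cd_d HD.
Let ab : a < b := cd_ab HD.
Let a0 : 0 < a := cd_a0 _ _ _ _.
Let mO := oo_measurable a b.
Let oo_open (y : R) : `]a, b[%classic y -> a < y < b.
Proof. by rewrite /= in_itv. Qed.
Let dO := dom_oo th1 a0 ab (eq_supp HE) (eq_EL HE).
Let hk1 : ((1 : R) = 1 /\ (1 : R) = 1) \/ ((1 : R) = theta /\ (1 : R) = -1) := or_introl (conj erefl erefl).
Let hkt : (theta = 1 /\ -1 = 1 :> R) \/ (theta = theta /\ (-1 : R) = -1) := or_intror (conj erefl erefl).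

Lemma Im_zGG (z : C) : 0 < Im z -> Im (z * GG z) = \int[mu]_(t in `]a, b[) (t * PK id z t).
Proof.
move=> z0; have zn : Im z != 0 by rewrite gt_eqF.
rewrite /GG -(cIZ mO z (GG_cint theta c1 d ea eb mu zn)) Im_cI; apply: eq_Rintegral => t _.
rewrite ImM ReV ImV ReB ImB ReC ImC sub0r /PK (gtr0_norm z0).
have -> : (t - Re z) ^+ 2 + (- Im z) ^+ 2 = (Re z - t) ^+ 2 + Im z ^+ 2 by ring.
by rewrite opprK; ring.
Qed.

Let ray_inj (x y : R) : a < x < b -> a <= y <= b -> Im (Ip y / Ip x) = 0 -> y = x.
Proof.
move=> xI yI; have i0 := cd_H HD xI; have n0 := H_neq0 i0.
set t := Re (Ip y / Ip x) => I0.
have yE : Ip y = t%:C * Ip x.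
  have -> : t%:C = Ip y / Ip x by apply: complex_ext; rewrite ?ReC ?ImC.
  by rewrite mulfVK.
have yI0 : Im (Ip y) = t * Im (Ip x) by rewrite yE ImM ReC ImC mul0r addr0.
have edge (e : R) : e != 0 -> Ip y <> e%:C.
  move=> en E; have t0 : t = 0.
    by apply/eqP; move/eqP: yI0; rewrite E ImC eq_sym mulf_eq0 (gt_eqF i0) orbF.
  by move: (congr1 (@complex.Re R) E); rewrite ReC yE t0 mul0r => /esym/eqP; apply/negP.
have [e1 e2] := (cd_ea HD, cd_eb HD).
move: yI => /andP[]; rewrite le_eqVlt => /predU1P[ya|ya].
  by move=> _; case: (edge ea); [apply/eqP; lra|rewrite -ya (cd_Ia HD)].
rewrite le_eqVlt => /predU1P[yb|yb].
  by case: (edge eb); [apply/eqP; lra|rewrite yb (cd_Ib HD)].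
have yI : a < y < b by rewrite ya yb.
have t0 : 0 < t by have := cd_H HD yI; rewrite yI0 pmulr_lgt0.
have ellI : Im (ell (t%:C * Ip x)) = 0 by rewrite -yE (cd_ell HD yI) ImC.
case: (ltgtP t 1) => ht.
- have h : 0 < -1 * (t - 1) by move: ht; lra.
  by have [_] := ray_Om HD hkt xI t0 h; rewrite ellI mulr0 ltxx.
- have h : 0 < 1 * (t - 1) by move: ht; lra.
  by have [_] := ray_Om HD hk1 xI t0 h; rewrite ellI mulr0 ltxx.
have E : Ip y = Ip x by rewrite yE ht mul1r.
have := cd_ell HD yI; rewrite E (cd_ell HD xI) => /(congr1 (@complex.Re R)); rewrite !ReC => h.
by apply/esym; apply: (ln_inj _ _ h); rewrite posrE; [exact: (oo_gt0 xI)|exact: (oo_gt0 yI)].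
Qed.

(* Distances to the ray through [Ip x] are bounded below by the transversal
   component [Im (Ip y / Ip x)], which vanishes to first order at [x] only. *)
Lemma ray_sep (x : R) : a < x < b -> exists2 c : R, 0 < c &
  forall y t : R, a < y < b -> c * `|y - x| <= cmod (Ip y - t%:C * Ip x).
Proof.
move=> xI; have i0 := cd_H HD xI; have n0 := H_neq0 i0; have x0 := oo_gt0 xI.
pose h y := Im (Ip y / Ip x).
pose h1 := Im (I1 x / Ip x).
have dh : is_derive x 1 h h1.
  have k : cder (fun=> (Ip x)^-1 : C) x 0 by split; rewrite ?Re0 ?Im0; exact: derC.
  by have [_] := cderM (Ip_der HD xI) k; rewrite mulr0 addr0.
have h1n : h1 != 0.
  apply/eqP; rewrite /h1; set W := I1 x / Ip x => IW.
  have Q0 := ImQ_gt0 th1 d1 i0; have el := ell1_neq0 th1 d1 i0.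
  have xn : x%:C != 0 :> C by rewrite fmorph_eq0 gt_eqF.
  have E1 : W * (x%:C * (Ip x * ell1 (Ip x))) = 1.
    have gen (X B A : C) : X != 0 -> B != 0 -> A != 0 -> (X * A)^-1 / B * (X * (B * A)) = 1.
      by move=> h2 h3 h4; field; rewrite h2 h3 h4.
    exact: gen.
  have k1 := congr1 (@complex.Im R) E1.
  rewrite ImM IW mul0r addr0 (ImM x%:C) ReC ImC mul0r addr0 Im1 in k1.
  have W0 : W = 0.
    apply: complex_ext; rewrite ?IW ?Im0 ?Re0 //; apply/eqP; move/eqP: k1.
    by rewrite !mulf_eq0 (gt_eqF x0) (gt_eqF Q0) !orbF.
  by move: E1; rewrite W0 mul0r => /eqP; rewrite eq_sym oner_eq0.
have hx : h x = 0 by rewrite /h mulfV // Im1.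
have e0 : 0 < `|h1| / 2 by rewrite divr_gt0 // normr_gt0.
have [del d0 Hd] := is_derive1_epsE dh e0.
have near (y : R) : `|y - x| < del -> `|h1| / 2 * `|y - x| <= `|h y|.
  move=> hy; have := Hd _ hy; rewrite addrCA subrr addr0 hx subr0 => k.
  have := ler_normB (h y) (h y - h1 * (y - x)).
  rewrite (_ : h y - (h y - h1 * (y - x)) = h1 * (y - x)); last by ring.
  by rewrite normrM; move: k; lra.
(* The added term is twice the positive part of [del - |y - x|]. So [m] is continuous and positive
   on the whole segment, hence bounded below, and equals [|h y|] at distance at least [del] from
   [x]. *)
pose m y := `|h y| + ((del - `|y - x|) + `|del - `|y - x| |).
have ch : {within `[a, b], continuous h}.
  by have [] := ccontM (Ip_ccont HD) (ccont_cst a b (Ip x)^-1).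
have cm : {within `[a, b], continuous m}.
  have cd' : {within `[a, b], continuous (fun y => del - `|y - x|)}.
    move=> y; apply: cvgB; first exact: cvg_cst.
    apply: cvg_norm; apply: cvgB; last exact: cvg_cst.
    exact: (continuous_subspaceT (fun t => @cvg_id _ _)).
  move=> y; apply: cvgD; first by apply: cvg_norm; exact: ch.
  by apply: cvgD; [exact: cd'|apply: cvg_norm; exact: cd'].
have mn (y : R) : a <= y <= b -> (m y)%:C != 0 :> C.
  move=> yI; rewrite fmorph_eq0 gt_eqF // /m.
  have p2 : 0 <= (del - `|y - x|) + `|del - `|y - x| |.
    by move: (del - _) => X; have := ler_norm (- X); rewrite normrN; lra.
  have [hy|hy] := eqVneq (h y) 0; last by rewrite ltr_pwDl // normr_gt0.
  by rewrite hy normr0 add0r (ray_inj xI yI hy) subrr normr0 subr0 gtr0_norm // addr_gt0.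
have [B B0 HB] := ccont_bounded HD (ccontV mn (ccont_real cm)).
pose c := Num.min (`|h1| / 2) (B * (b - a))^-1.
have c0 : 0 < c by rewrite lt_min e0 invr_gt0 mulr_gt0 // subr_gt0.
have cx0 : 0 < cmod (Ip x) by rewrite cmod_gt0.
exists (cmod (Ip x) * c); first by rewrite mulr_gt0.
move=> y t yI.
have lo : cmod (Ip x) * `|h y| <= cmod (Ip y - t%:C * Ip x).
  have -> : Ip y - t%:C * Ip x = Ip x * (Ip y / Ip x - t%:C) by field.
  rewrite cmodM ler_pM2l //; apply: le_trans (Im_le_cmod _).
  by rewrite ImB ImC subr0.
apply: le_trans lo; rewrite -mulrA ler_pM2l //.
have [hy|hy] := ltP `|y - x| del.
  by apply: le_trans (near y hy); rewrite ler_wpM2r // ge_min lexx.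
have mE : m y = `|h y|.
  by rewrite /m [`|del - _|]ler0_norm ?subrr ?addr0 // subr_le0.
have := HB y (oo_le yI); rewrite cmodV cmod_real mE normr_id => k.
have hy0 : 0 < `|h y|.
  by rewrite -mE lt_neqAle eq_sym -(fmorph_eq0 (real_complex R)) mn ?oo_le //= mE.
have yx : `|y - x| <= b - a.
  by move: yI xI => /andP[y1 y2] /andP[x1 x2]; rewrite ler_norml; apply/andP; split; lra.
apply: (@le_trans _ _ ((B * (b - a))^-1 * (b - a))).
  by apply: ler_pM; rewrite ?(ltW c0) // ge_min lexx orbT.
rewrite invfM -mulrA mulVf ?mulr1 ?subr_eq0 ?gt_eqF //.
by rewrite -[leRHS]invrK lef_pV2 ?posrE ?invr_gt0.
Qed.

(** The poles move inward along the ray to [Ip x]. On the left [ray_sep] dominates the logarithms by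
    one logarithmic singularity at [x]; on the right [Im (z * GG z)] is the integral of [t] against
    the Poisson kernel and tends to [pi * x * psi x]. *)
Lemma density_formula (x : R) : a < x < b ->
  leb.-integrable `]a, b[ (EFin \o (fun y => gain y * Lam (Ip x) y)) /\
  \int[leb]_(y in `]a, b[) (gain y * Lam (Ip x) y) = 2 * pi ^+ 2 * x * psi x.
Proof.
move=> xI; have i0 := cd_H HD xI; have n0 := H_neq0 i0; have x0 := oo_gt0 xI.
pose l_ (n : nat) : R := 1 + n.+1%:R^-1.
have lp n : 0 < (n.+1%:R^-1 : R) <= 1.
  by rewrite invr_gt0 ltr0n /= invf_le1 ?ltr0n // ler1n.
have lc : l_ n @[n --> \oo] --> (1 : R).
  rewrite -[X in _ --> X]addr0; apply: cvgD; first exact: cvg_cst.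
  exact: cvg_harmonic.
pose s_ n : C := (l_ n)%:C * Ip x.
have Om_s n : 0 < Im (s_ n) /\ 0 < Im (ell (s_ n)).
  have /andP[q1 q2] := lp n.
  have h1 : 0 < l_ n by rewrite /l_ addr_gt0.
  have h2 : 0 < 1 * (l_ n - 1) by rewrite mul1r /l_ addrAC subrr add0r.
  by have [h3 h4] := ray_Om HD hk1 xI h1 h2; split=> //; rewrite mul1r in h4.
have si n := (Om_s n).1; have se n := (Om_s n).2.
have [c c0 Hc] := ray_sep xI.
have [BI BI0 HBI] := ccont_bounded HD (Ip_ccont HD).
have [B B0 HB] := ccont_bounded HD (ccont_real (gain_cont HE cVdd)).
pose M := BI + 2 * cmod (Ip x).
pose K := `|ln M| + `|ln c|.
have M0 : 0 < M by rewrite ltr_wpDr // mulr_ge0 // cmod_ge0.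
have mln (w : C) : measurable_fun `]a, b[ (fun y => ln (cmod (Ip y - w))).
  rewrite (_ : (fun y => _) = (fun y => 2^-1 * ln (Re (Ip y - w) ^+ 2 + Im (Ip y - w) ^+ 2))); last first.
    by apply/funext => u; exact: ln_cmodE.
  apply: measurable_funM; first exact: measurable_cst.
  apply: measurableT_comp; first exact: measurable_ln.
  have [q1 q2] := ccontD (Ip_ccont HD) (ccont_cst a b (- w)).
  have m1 := within_measurable (oo_cont q1); have m2 := within_measurable (oo_cont q2).
  by apply: measurable_funD; apply: measurable_funX.
have mg := within_measurable (oo_cont (gain_cont HE cVdd)).
have mL (w : C) : measurable_fun `]a, b[ (fun y => gain y * Lam w y).
  by apply: measurable_funM => //; apply: measurable_funB; exact: mln.
have [|||||i L] := @dominated_punctured R a b x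
  (fun n y => gain y * Lam (s_ n) y) (fun y => gain y * Lam (Ip x) y)
  (fun y => B * (K + `|ln `|y - x| |)).
- by move=> n; exact: mL.
- exact: mL.
- move=> y yI yx; apply: cvgM; first exact: cvg_cst.
  have lim (w : C) : Ip y - w != 0 -> ln (cmod (Ip y - (l_ n)%:C * w)) @[n --> \oo] --> ln (cmod (Ip y - w)).
    move=> nw.
    have k : cder (fun u : R => Ip y - u%:C * w) 1 (- w).
      apply: cder_eps => eps e0; exists 1 => // u _.
      rewrite (_ : _ - _ - _ = 0); last by rewrite rmorphD /= rmorph1; ring.
      by rewrite cmod0 mulr_ge0 // ltW.
    have nw1 : Ip y - 1%:C * w != 0 by rewrite mul1r.
    have := is_derive1_cont (ln_cmod_der k nw1); rewrite /= => ct.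
    have := cvg_comp _ _ lc ct; rewrite [1%:C * w]mul1r; exact.
  have iy := cd_H HD yI.
  apply: cvgB; last first.
    apply: lim; rewrite -cmod_gt0; have := Hc y 1 yI; rewrite mul1r; apply: lt_le_trans.
    by rewrite mulr_gt0 // normr_gt0 subr_eq0; apply/eqP.
  have E n : cconj (s_ n) = (l_ n)%:C * cconj (Ip x) by rewrite /s_ cconjM cconjC.
  rewrite (_ : (fun n => ln (cmod (Ip y - cconj (s_ n)))) =
    (fun n => ln (cmod (Ip y - (l_ n)%:C * cconj (Ip x))))); last by apply/funext => n; rewrite E.
  apply: lim; apply: Im_neq0; rewrite ImB Im_conj opprK gt_eqF // addr_gt0 //.
- apply: integrableZr => //; apply: integrableDr => //; first exact: integrable_cst_oo.
  by apply: integrable_normr => //; exact: integrable_ln_dist.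
- move=> n y yI yx; have iy := cd_H HD yI.
  have gB : `|gain y| <= B by have := HB _ (oo_le yI); rewrite cmod_real.
  rewrite normrM; apply: ler_pM => //.
  have q0 : 0 < `|y - x| by rewrite normr_gt0 subr_eq0; apply/eqP.
  have c1' : c * `|y - x| <= cmod (Ip y - s_ n) by exact: Hc.
  have c2 := conj_far iy (si n).
  have cq : 0 < c * `|y - x| by rewrite mulr_gt0.
  have p1 := lt_le_trans cq c1'; have p2 := lt_le_trans p1 c2.
  have c3 : cmod (Ip y - cconj (s_ n)) <= M.
    apply: le_trans (cmodD _ _) _; rewrite cmodN cmod_conj /M; apply: lerD; first by apply: HBI; exact: oo_le.
    rewrite /s_ cmodM cmod_real; apply: ler_wpM2r; first exact: cmod_ge0.
    have /andP[q1 q2] := lp n; rewrite ger0_norm /l_; last by rewrite addr_ge0 // ltW.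
    by move: q2; set X := _^-1; lra.
  have k1 : ln (cmod (Ip y - s_ n)) <= ln (cmod (Ip y - cconj (s_ n))) by rewrite ler_ln ?posrE.
  have k2 : ln (cmod (Ip y - cconj (s_ n))) <= ln M by rewrite ler_ln ?posrE.
  have k3 : ln c + ln `|y - x| <= ln (cmod (Ip y - s_ n)).
    by rewrite -lnM ?posrE // ler_ln ?posrE.
  rewrite /Lam ger0_norm ?subr_ge0 // /K.
  have := ler_norm (ln M); have := ler_norm (- ln c); have := ler_norm (- ln `|y - x|).
  by rewrite !normrN; move: k1 k2 k3; lra.
split=> //.
have E n : \int[leb]_(y in `]a, b[) (gain y * Lam (s_ n) y) = 2 * pi * Im (zf (s_ n) * GG (zf (s_ n))).
  by have [] := gain_Lam HD HE Vdder cVdd (si n) (se n).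
have L2 : (\int[leb]_(y in `]a, b[) (gain y * Lam (s_ n) y)) @[n --> \oo] --> 2 * pi * (pi * (x * psi x)).
  rewrite (_ : (fun n => _) = (fun n => 2 * pi * Im (zf (s_ n) * GG (zf (s_ n))))); last by apply/funext.
  apply: cvgM; first exact: cvg_cst.
  apply/cvgrPdist_lt => eps e0.
  have [del d0 H] := Poisson_density a0 ab dO.2 cpsi den xI e0.
  have [r r0 Hr] := qd_cvg (qd_zf theta c1 d 1 i0) d0.
  have r1 : 0 < r / cmod (Ip x) by rewrite divr_gt0 // cmod_gt0.
  have /cvgrPdist_lt/(_ _ r1) := lc; apply: filterS => n hn.
  have zi : 0 < Im (zf (s_ n)) := ext_Im HD (si n) (se n).
  rewrite distrC (Im_zGG zi); apply: H => //.
  have zx : zf (Ip x) = x%:C by rewrite (zf_Ip HD 1 xI) /Yp powRr1 // ltW.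
  rewrite -zx; apply: Hr.
  have -> : s_ n - Ip x = (l_ n - 1)%:C * Ip x by rewrite /s_ rmorphB /= rmorph1; ring.
  by rewrite cmodM cmod_real -ltr_pdivlMr ?cmod_gt0 // distrC.
have -> : \int[leb]_(y in `]a, b[) (gain y * Lam (Ip x) y) = 2 * pi * (pi * (x * psi x)).
  exact: cvg_unique L L2.
by ring.
Qed.

End DensityFormula.

(** * Existence of the constants *)

Section Constants.
Variable R : realType.
Variables (theta a b : R).
Hypothesis th1 : 1 < theta.
Hypothesis a0 : 0 < a.
Hypothesis ab : a < b.
Let kap := theta^-1.
Let th0 : 0 < theta. Proof. exact: lt_trans ltr01 th1. Qed.
Let kap0 : 0 < kap. Proof. by rewrite invr_gt0. Qed.
Let kap1 : kap < 1. Proof. by rewrite invf_lt1. Qed.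

(* logarithm of the ratio of the two critical values, as a function of the
   positive critical point [v] *)
Let Lr (v : R) : R := (1 - kap) * (ln v - ln (v + 1 - kap)) + (1 + kap) * (ln (v + 1) - ln (v - kap)).

(** Continuity and the intermediate value theorem: [Lr] is unbounded as [v] decreases to [kap],
    through [- ln (v - kap)], and tends to zero at infinity. *)
Let Lr_surj (T : R) : 0 < T -> exists2 v : R, kap < v & Lr v = T.
Proof.
move=> T0.
pose M := T + (1 - kap) * (ln 2 - ln kap).
have l2 : 0 <= ln 2 - ln kap.
  by rewrite subr_ge0 ler_ln ?posrE //; move: kap1; lra.
have M0 : 0 <= M by rewrite addr_ge0 ?(ltW T0) // mulr_ge0 // subr_ge0 ltW.
(* Here [- ln (v1 - kap) = M], and the second term of [M] compensates the worst value of the first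
   summand, leaving at least [T + kap * M]. *)
pose v1 := kap + expR (- M).
have E0 := expR_gt0 (- M).
have E1 : expR (- M) <= 1 by rewrite -(@expR0 R) ler_expR oppr_le0.
have v1k : kap < v1 by rewrite /v1 ltrDl.
have Lr1 : T <= Lr v1.
  rewrite /Lr /v1; have -> : kap + expR (- M) - kap = expR (- M) by ring.
  have -> : kap + expR (- M) + 1 - kap = expR (- M) + 1 by ring.
  rewrite expRK.
  have h1 : ln kap <= ln (kap + expR (- M)) by rewrite ler_ln ?posrE ?addr_gt0 // lerDl ltW.
  have h2 : ln (expR (- M) + 1) <= ln 2 by rewrite ler_ln ?posrE ?addr_gt0 //; move: E1; lra.
  have h3 : 0 <= ln (kap + expR (- M) + 1).
    by rewrite ln_ge0 // lerDr addr_ge0 // ltW.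
  apply: (@le_trans _ _ ((1 - kap) * (ln kap - ln 2) + (1 + kap) * M)).
    have : 0 <= kap * M by rewrite mulr_ge0 // ltW.
    by rewrite /M => h; lra.
  by apply: lerD; rewrite ler_wpM2l ?subr_ge0 ?addr_ge0 ?(ltW kap1) ?(ltW kap0) //; move: h1 h2 h3; lra.
(* At distance more than [4 / T] from [kap] the second summand is at most
   [(1 + kap) ^ 2 / (v2 - kap) <= T], and the first is nonpositive. *)
pose v2 := v1 + 4 / T.
have q0 : 0 < 4 / T by rewrite divr_gt0.
have v12 : v1 <= v2 by rewrite /v2 lerDl ltW.
have Lr2 : Lr v2 <= T.
  have vk : 0 < v2 - kap by move: v1k q0; rewrite /v2; lra.
  have v0 : 0 < v2 by move: vk kap0; lra.
  have h1 : ln v2 - ln (v2 + 1 - kap) <= 0.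
    by rewrite subr_le0 ler_ln ?posrE //; move: kap1 v0; lra.
  pose q := (1 + kap) / (v2 - kap).
  have h2 : ln (v2 + 1) <= ln (v2 - kap) + q.
    have v3 : 0 < v2 + 1 by rewrite addr_gt0.
    rewrite -[q]expRK -lnM ?posrE ?expR_gt0 // ler_ln ?posrE ?mulr_gt0 ?expR_gt0 //.
    apply: (@le_trans _ _ ((v2 - kap) * (1 + q))); last by rewrite ler_pM2l // expR_ge1Dx.
    by rewrite /q le_eqVlt; apply/orP; left; apply/eqP; field; rewrite gt_eqF.
  have h3 : q <= T / 2.
    rewrite /q ler_pdivrMr //; apply: (@le_trans _ _ (T / 2 * (4 / T))).
      by rewrite (_ : T / 2 * (4 / T) = 2); [move: kap1; lra|field; rewrite gt_eqF].
    by rewrite ler_pM2l ?divr_gt0 // /v2; move: v1k; lra.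
  rewrite /Lr; have h4 : (1 - kap) * (ln v2 - ln (v2 + 1 - kap)) <= 0.
    by rewrite pmulr_rle0 // subr_gt0.
  have h5 : (1 + kap) * (ln (v2 + 1) - ln (v2 - kap)) <= 2 * (T / 2).
    apply: (@le_trans _ _ ((1 + kap) * (T / 2))).
      by rewrite ler_wpM2l ?addr_ge0 ?(ltW kap0) //; move: h2 h3; lra.
    by rewrite ler_wpM2r ?divr_ge0 ?(ltW T0) //; move: kap1; lra.
  by move: h4 h5; lra.
have cL : {within `[v1, v2], continuous Lr}.
  have pos (v : R) : `[v1, v2]%classic v -> kap < v by rewrite /= in_itv /= => /andP[h _]; move: v1k h; lra.
  apply: derivable_within_continuous => v /pos vk.
  have lnd (c : R) : 0 < v + c -> is_derive v 1 (fun u => ln (u + c)) ((v + c)^-1 * (1 + 0)).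
    move=> h; apply: (@derComp R (@ln R) (fun u => u + c) v _ _ (is_derive1_ln h)).
  have l1 : 0 < v + 0 by move: vk kap0; lra.
  have l2' : 0 < v + (1 - kap) by move: vk kap0 kap1; lra.
  have l3 : 0 < v + 1 by move: vk kap0 kap1; lra.
  have l4 : 0 < v + (- kap) by move: vk; lra.
  have := derD (derZ (1 - kap) (derD (lnd _ l1) (derN (lnd _ l2'))))
               (derZ (1 + kap) (derD (lnd _ l3) (derN (lnd _ l4)))).
  rewrite (_ : (fun u => _) = Lr); last first.
    by apply/funext => u; rewrite /Lr addr0 addrA.
  by case.
have [v vI E] : exists2 v, v \in `[v1, v2] & Lr v = T.
  by apply: IVT => //; rewrite ge_min le_max Lr1 Lr2 orbT.
exists v => //; move: vI; rewrite in_itv /= => /andP[h _]; exact: lt_le_trans v1k h.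
Qed.

Let lnsq (x : R) : x != 0 -> 2^-1 * ln (x ^+ 2) = ln `|x|.
Proof.
move=> x0; rewrite -real_normK ?num_real // lnXn ?normr_gt0 //.
by rewrite -[ln `|x| *+ 2]mulr_natl mulKf ?pnatr_eq0.
Qed.

(** The positive critical point [v] is the free parameter: the sum of the roots gives [ea] and their
    product gives [d]. The ratio of the critical values fixes [v], and [c1], which scales both of
    them, then fixes [a]. *)
Lemma constants_exist : exists c1 d ea eb : R, [/\ 0 < c1, 1 < d, ea + eb = - (1 - theta^-1) &
  ea * eb = - (theta^-1 * d)] /\ [/\ ea < -1, 0 < eb,
    s_a theta (c1 * d) c1 = ea & s_b theta (c1 * d) c1 = eb] /\
  expR (lr theta c1 d ea) = a /\ expR (lr theta c1 d eb) = b.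
Proof.
have T0 : 0 < ln b - ln a by rewrite subr_gt0 ltr_ln ?posrE // (lt_trans a0).
have [v vk Ev] := Lr_surj T0.
have thk : theta * kap = 1 by rewrite mulfV // gt_eqF.
have v0 : 0 < v := lt_trans kap0 vk.
pose d := theta * v ^+ 2 + (theta - 1) * v.
pose ea := - (v + 1 - kap).
(* The identity [d - 1 = theta * (v - kap) * (v + 1)] shows that [v > kap] is exactly the condition
   [c0 > c1]. *)
have d1 : 1 < d.
  have -> : d = 1 + theta * (v - kap) * (v + 1).
    rewrite /d; have -> : theta * (v - kap) = theta * v - 1 by rewrite mulrBr thk.
    by ring.
  by rewrite ltrDl !mulr_gt0 ?subr_gt0 ?addr_gt0.
have va : 0 < v - kap by rewrite subr_gt0.
have va1 : 0 < v + 1 - kap by move: va; lra.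
have v1 : 0 < v + 1 by rewrite addr_gt0.
have vd : v + d = theta * (v * (v + 1)) by rewrite /d; ring.
have ead : ea + d = theta * ((v - kap) * (v + 1 - kap)).
  have -> : theta * ((v - kap) * (v + 1 - kap)) = theta * v ^+ 2 + theta * v - theta * kap * (2 * v + 1 - kap) by ring.
  by rewrite thk /ea /d; ring.
have ea1 : ea + 1 = - (v - kap) by rewrite /ea; ring.
have lrE (c x : R) : x + d != 0 -> x + 1 != 0 -> x != 0 ->
    lr theta c d x = ln c + ln `|x + d| + kap * (ln `|x + 1| - ln `|x|).
  by move=> h1 h2 h3; rewrite /lr !lnsq.
have lrb (c : R) : lr theta c d v = ln c + (ln theta + ln v + ln (v + 1)) + kap * (ln (v + 1) - ln v).
  rewrite lrE ?gt_eqF // vd ?mulr_gt0 // !gtr0_norm ?mulr_gt0 //.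
  by rewrite !lnM ?posrE ?mulr_gt0 //; ring.
have lra' (c : R) : lr theta c d ea =
    ln c + (ln theta + ln (v - kap) + ln (v + 1 - kap)) + kap * (ln (v - kap) - ln (v + 1 - kap)).
  have n1 : ea + d != 0 by rewrite ead gt_eqF // !mulr_gt0.
  have n2 : ea + 1 != 0 by rewrite ea1 oppr_eq0 gt_eqF.
  have n3 : ea != 0 by rewrite oppr_eq0 gt_eqF.
  rewrite (lrE _ _ n1 n2 n3) ead ea1 /ea !normrN !gtr0_norm ?mulr_gt0 //.
  by rewrite !lnM ?posrE ?mulr_gt0 //; ring.
pose c1 := expR (ln a - lr theta 1 d ea).
have c10 : 0 < c1 by exact: expR_gt0.
have Ea : lr theta c1 d ea = ln a.
  by rewrite lra' /c1 expRK lra' ln1; ring.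
have Eb : lr theta c1 d v = ln b.
  have -> : ln b = lr theta c1 d ea + Lr v by rewrite Ea Ev; ring.
  by rewrite lrb lra' /Lr; ring.
have sq : Num.sqrt (4 * (c1 * d) * c1 * theta + c1 ^+ 2 * (theta - 1) ^+ 2) = c1 * (2 * theta * v + (theta - 1)).
  have -> : 4 * (c1 * d) * c1 * theta + c1 ^+ 2 * (theta - 1) ^+ 2 = (c1 * (2 * theta * v + (theta - 1))) ^+ 2.
    by rewrite /d; ring.
  rewrite sqrtr_sqr ger0_norm // mulr_ge0 ?(ltW c10) // addr_ge0 ?subr_ge0 ?(ltW th1) //.
  by rewrite !mulr_ge0 // ltW.
exists c1, d, ea, v; split; [split|split; [split|split]] => //.
- by rewrite /ea -/kap; ring.
- rewrite /ea -/kap /d.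
  have -> : kap * (theta * v ^+ 2 + (theta - 1) * v) = (theta * kap) * v ^+ 2 + (theta * kap - kap) * v by ring.
  by rewrite thk; ring.
- by move: va; rewrite /ea; lra.
- rewrite /s_a sq.
  have gen (t c w : R) : 0 < t -> 0 < c ->
      - ((t - 1) / (2 * t)) - (2 * t * c)^-1 * (c * (2 * t * w + (t - 1))) = - (w + 1 - t^-1).
    by move=> t0 cp; field; rewrite !gt_eqF.
  exact: gen.
- rewrite /s_b sq.
  have gen (t c w : R) : 0 < t -> 0 < c ->
      - ((t - 1) / (2 * t)) + (2 * t * c)^-1 * (c * (2 * t * w + (t - 1))) = w.
    by move=> t0 cp; field; rewrite !gt_eqF.
  exact: gen.
- by rewrite Ea lnK.
- by rewrite Eb lnK // posrE (lt_trans a0).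
Qed.

End Constants.

(** * Assembly *)

Section CurveData.
Variable R : realType.
Local Notation C := R[i].

(** The theorem quantifies over every parametrization of the upper curve. From [J (Ip y) = y] the
    equation [ell (Ip y) = ln y] follows because both imaginary parts lie in [(- pi, pi)], where
    [expC] is injective. *)
Lemma upper_curve_data (theta c1 d ea eb : R) (Ip : R -> C) :
  1 < theta -> 0 < c1 -> 1 < d -> ea + eb = - (1 - theta^-1) -> ea * eb = - (theta^-1 * d) ->
  ea < -1 -> 0 < eb -> lr theta c1 d ea < lr theta c1 d eb ->
  s_a theta (c1 * d) c1 = ea -> s_b theta (c1 * d) c1 = eb ->
  upper_curve theta (c1 * d) c1 Ip -> curve_data theta c1 d ea eb Ip.
Proof.
move=> th1 c10 d1 es ep e1 e2 lrl sa sb.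
rewrite /upper_curve (JAE c10 d1 es ep e1 e2 sa) (JBE c10 d1 es ep e1 e2 sb) sa sb.
move=> [h1 h2 h3 h4 [h5 h6 h7]].
split=> //.
- move=> y yI; have y0 : 0 < y by move: yI => /andP[h _]; exact: lt_trans (expR_gt0 _) h.
  have i0 : 0 < Im (Ip y) by apply: h5; rewrite in_itv.
  have := h6 y; rewrite in_itv /=; move: (yI) => /andP[/ltW -> /ltW ->] /(_ isT).
  rewrite (Jt_ell theta d c10 i0) => E.
  have p0 := @pi_gt0 R.
  apply: expC_inj.
  - exact: (Im_ell_pi c1 d th1 i0).
  - by rewrite ImC oppr_lt0 p0.
  - by rewrite E expC_real lnK.
- move=> y yI; have [k1 k2] : derivable (fun u => Re (Ip u)) y 1 /\ derivable (fun u => Im (Ip u)) y 1.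
    by apply: h7; rewrite in_itv.
  exists (Complex ('D_1 (fun u => Re (Ip u)) y) ('D_1 (fun u => Im (Ip u)) y)).
  by split; apply: DeriveDef.
Qed.

End CurveData.

Section PuncturedIntegral.
Variable R : realType.
Local Notation leb := (@lebesgue_measure R).

(** In the density formula the extended logarithm takes the value [-oo] at [y = x], the quotient
    being [0] by the convention for division by zero; one point does not change the integral. *)
Lemma integral_except_point (a b x : R) (F : R -> \bar R) (f : R -> R) : a < x < b ->
  leb.-integrable `]a, b[ (EFin \o f) -> (forall y, a < y < b -> y <> x -> F y = (f y)%:E) ->
  (\int[leb]_(y in `]a, b[) F y = (\int[leb]_(y in `]a, b[) f y)%:E)%E.
Proof.
move=> xI fi FE; have mO := oo_measurable a b.
have mf := measurable_int _ fi.
have mx : measurable ([set x] : set R) by exact: measurable_set1.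
have mD : measurable (`]a, b[%classic `\ x : set R) by exact: measurableD.
have OE : `]a, b[%classic = (`]a, b[%classic `\ x) `|` [set x].
  apply/seteqP; split=> y; last by case=> [[]|->] //=; rewrite in_itv.
  by move=> yO; have [->|/eqP] := eqVneq y x; [right|left].
have mF : measurable_fun `]a, b[ F.
  rewrite OE; apply/measurable_funU => //; split; last exact: measurable_fun_set1.
  apply: (@eq_measurable_fun _ _ _ _ _ (EFin \o f)).
    by move=> y /set_mem [/=]; rewrite in_itv /= => yI yx; rewrite FE.
  by apply: measurable_funS mf => //; exact: subDsetl.
rewrite /Rintegral fineK; last by apply: integrable_fin_num; [exact: mO|exact: fi].
apply: ae_eq_integral => //.
exists [set x]; split=> //; first exact: lebesgue_measure_set1.
by move=> y /= h; apply: contrapT => yx; apply: h => yO; apply: FE.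
Qed.

End PuncturedIntegral.

Section QuadraticSplit.
Variable F : fieldType.

Lemma quadratic_quotient_split (w x y p q : F) : w != p -> w != q -> p != q ->
  (w + x) * (w + y) / ((w - p) * (w - q)) =
  1 + (p + x) * (p + y) / (p - q) / (w - p) + (q + x) * (q + y) / (q - p) / (w - q).
Proof.
move=> n1 n2 n3; field.
by rewrite !subr_eq0 n1 n2 n3 [q == p]eq_sym n3.
Qed.

End QuadraticSplit.

Lemma divr_2pii (R : realType) (S : R) :
  Complex 0 (2 * pi * S) / ((2 * pi)%:C * Complex 0 1) = S%:C :> R[i].
Proof.
have p0 := @pi_gt0 R.
have n0 : (2 * pi)%:C * Complex 0 1 != 0 :> R[i].
  by apply: Im_neq0; rewrite ImM ReC ImC /= mulr1 mul0r addr0 gt_eqF // mulr_gt0.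
have iE (x : R) : Complex 0 x = x%:C * Complex 0 1 :> R[i].
  apply: complex_ext; first by rewrite (ReM x%:C) ReC ImC mulr0 mul0r subr0.
  by rewrite (ImM x%:C) ReC ImC mulr1 mul0r addr0.
rewrite (iE (2 * pi * S)) [2 * pi * S]mulrC rmorphM /= -[_ * Complex 0 1]mulrA.
by rewrite mulfK.
Qed.

Theorem theorem1p6 (R : realType) (theta : R) (V Vd Vdd : R -> R)
  (a b : R) (mu : probability R R) (psi : R -> R) (ell : R) :
  1 < theta ->
  (* V is twice continuously differentiable on [0, +oo), with V' = Vd, V'' = Vdd *)
  (forall x : R, 0 < x -> is_derive x 1 V (Vd x)) ->
  (forall x : R, 0 < x -> is_derive x 1 Vd (Vdd x)) ->
  (fun h : R => h^-1 * (V h - V 0)) x @[x --> (0:R)^'+] --> Vd 0 ->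
  (fun h : R => h^-1 * (Vd h - Vd 0)) x @[x --> (0:R)^'+] --> Vdd 0 ->
  {within `[0, +oo[, continuous Vd} ->
  {within `[0, +oo[, continuous Vdd} ->
  (* V(x) / log x -> +oo *)
  (fun x : R => V x / ln x) x @[x --> +oo] --> +oo ->
  (* mu is supported on the interval [a,b], 0 < a *)
  0 < a -> a < b ->
  msupport mu = `[a, b]%classic ->
  (* mu has a continuous density psi on (a,b) *)
  {within `]a, b[, continuous psi} ->
  (forall A : set R, measurable A -> A `<=` `]a, b[%classic ->
     mu A = (\int[lebesgue_measure]_(x in A) (psi x)%:E)%E) ->
  (* Euler-Lagrange conditions *)
  (forall x : R, msupport mu x -> Upot theta mu V x = ell%:E) ->
  (forall x : R, 0 <= x -> (Upot theta mu V x <= ell%:E)%E) ->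
  exists c0 c1 : R,
    [/\ 0 < c1, c1 < c0,
      a%:C = Jt theta c0 c1 (s_a theta c0 c1)%:C,
      b%:C = Jt theta c0 c1 (s_b theta c0 c1)%:C &
      (exists Ip, upper_curve theta c0 c1 Ip) /\
      forall Ip : R -> R[i], upper_curve theta c0 c1 Ip ->
        let Imn := fun x => cconj (Ip x) in
        [/\ exists z, contour_int theta c0 c1 Ip
              (fun t => (Vd (complex.Re (Jt theta c0 c1 t)))%:C
                        * Jt theta c0 c1 t / t) z
              /\ z / ((2 * pi)%:C * Complex 0 1) = (1 + theta)%:C,
            exists z, contour_int theta c0 c1 Ip
              (fun t => (Vd (complex.Re (Jt theta c0 c1 t)))%:C
                        * Jt theta c0 c1 t / (t + 1)) z
              /\ z / ((2 * pi)%:C * Complex 0 1) = 1%:C &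
            forall x : R, x \in `]a, b[ ->
              ((psi x)%:E =
               ((2 * pi ^+ 2 * x)^-1)%R%:E *
               \int[lebesgue_measure]_(y in `]a, b[)
                  ((Vdd y * y + Vd y)%R%:E *
                   lnE (cmod ((Ip y - Imn x) / (Ip y - Ip x)))%R))%E]].
Proof.
move=> th1 Vder Vdder _ _ cVd cVdd _ a0 ab supp cpsi den EL ELi.
have [c1 [d [ea [eb [[c10 d1 es ep] [[e1 e2 sa sb] [Ea Eb]]]]]]] := constants_exist th1 a0 ab.
subst a b.
have lrl : lr theta c1 d ea < lr theta c1 d eb by rewrite -ltr_expR.
have [_ _ Ja] := edge_rad c10 d1 es ep e1 e2 (or_introl erefl).
have [_ _ Jb] := edge_rad c10 d1 es ep e1 e2 (or_intror erefl).
exists (c1 * d), c1; split => //.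
- by rewrite ltr_pMr.
- by rewrite sa Ja.
- by rewrite sb Jb.
split; first exact: (upper_curve_exists th1 c10 d1 es ep e1 e2 lrl sa sb).
move=> Ip HI Imn.
have HD := upper_curve_data th1 c10 d1 es ep e1 e2 lrl sa sb HI.
have HE : equilibrium theta (expR (lr theta c1 d ea)) (expR (lr theta c1 d eb)) V Vd mu ell.
  by split=> //; move=> x xI; apply: EL; rewrite supp /= in_itv.
have JA' := JAE c10 d1 es ep e1 e2 sa; have JB' := JBE c10 d1 es ep e1 e2 sb.
have HJ (y : R) : expR (lr theta c1 d ea) < y < expR (lr theta c1 d eb) ->
    Jt theta (c1 * d) c1 (Ip y) = y%:C.
  move: HI; rewrite /upper_curve JA' JB' => -[_ _ _ _ [_ H _]] /andP[/ltW y1 /ltW y2].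
  by apply: H; rewrite in_itv /= y1 y2.
(* Both contour conditions reduce to [p / ea + q / eb], where [p] and [q] are the residues of
   [rr w / w], respectively [rr w / (w + 1)], at the critical points. *)
have eab : ea < eb by move: e1 e2; lra.
have nab : ea%:C != eb%:C :> R[i].
  by apply/eqP => /(congr1 (@complex.Re R)); rewrite !ReC => e; move: eab; rewrite e ltxx.
have edge_neq (w : R[i]) (e : R) : 0 < complex.Im w -> w != e%:C.
  by move=> i0; rewrite -subr_eq0 Im_gt0_neq.
have castE (e e' x y : R) : (((e + x) * (e + y) / (e - e'))%:C : R[i]) =
    (e%:C + x%:C) * (e%:C + y%:C) / (e%:C - e'%:C).
  by rewrite !(rmorphM, rmorphD, fmorphV, rmorphN).
have split_at (x y : R) (w : R[i]) : 0 < complex.Im w ->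
    (w + x%:C) * (w + y%:C) / ((w - ea%:C) * (w - eb%:C)) =
    1 + ((ea + x) * (ea + y) / (ea - eb))%:C / (w - ea%:C)
      + ((eb + x) * (eb + y) / (eb - ea))%:C / (w - eb%:C).
  by move=> i0; rewrite !castE; apply: quadratic_quotient_split => //; exact: edge_neq.
have dE : d = - (theta * (ea * eb)) by rewrite ep; field; rewrite gt_eqF // (lt_trans ltr01).
have [n1 [n2 n3]] : ea != 0 /\ eb != 0 /\ ea - eb != 0 by split; [|split]; apply/eqP; lra.
split.
(* The sum is the difference quotient between [ea] and [eb] of [(x + 1) * (x + d) / x = x + 1 + d +
   d / x], that is [1 - d / (ea * eb) = 1 + theta]. *)
- exists (Complex 0 (2 * pi * ((ea + 1) * (ea + d) / (ea - eb) / ea + (eb + 1) * (eb + d) / (eb - ea) / eb))).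
  split; last first.
    rewrite divr_2pii; congr (_%:C); rewrite dE; field.
    by rewrite n1 n2 -opprB oppr_eq0 n3.
  rewrite (_ : (fun t => _) = (fun t : R[i] => (Vd (complex.Re (Jt theta (c1 * d) c1 t)))%:C
      * Jt theta (c1 * d) c1 t / (t + 0%:C))); last by apply/funext => t; rewrite addr0.
  apply: (contour_claim HD HE erefl JA' JB' HJ _ erefl) => w i0.
  rewrite -split_at // /rr addr0.
  have n4 := H_neq0 i0; have n5 := Im_gt0_neq ea i0; have n6 := Im_gt0_neq eb i0.
  by rewrite rmorph1; field; rewrite n4 n5 n6.
(* Here the sum is the difference quotient of [x + d], which is [1]. *)
- exists (Complex 0 (2 * pi * ((ea + 0) * (ea + d) / (ea - eb) / ea + (eb + 0) * (eb + d) / (eb - ea) / eb))).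
  split; last first.
    rewrite divr_2pii; congr (_%:C); field.
    by rewrite n1 n2 -opprB oppr_eq0 n3.
  rewrite (_ : (fun t => _) = (fun t : R[i] => (Vd (complex.Re (Jt theta (c1 * d) c1 t)))%:C
      * Jt theta (c1 * d) c1 t / (t + 1%:C))); last by apply/funext => t.
  apply: (contour_claim HD HE erefl JA' JB' HJ _ erefl) => w i0.
  rewrite -split_at // /rr.
  have n4 : w + 1 != 0 by rewrite H_neq0 // Im_shift1.
  have n5 := Im_gt0_neq ea i0; have n6 := Im_gt0_neq eb i0.
  by rewrite rmorph0 rmorph1 addr0; field; rewrite n4 n5 n6.
move=> x; rewrite in_itv /= => xI.
have cVdd' : {within `[expR (lr theta c1 d ea), expR (lr theta c1 d eb)], continuous Vdd}.
  apply: continuous_subspaceW cVdd => y /=; rewrite !in_itv /= andbT => /andP[h _].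
  by apply: le_trans h; exact: expR_ge0.
have [i E] := density_formula HD HE Vdder cVdd' cpsi den xI.
have x0 : 0 < x by exact: (oo_gt0 xI).
rewrite (integral_except_point xI i) => [|y yI yx]; last first.
  have i0 := cd_H HD yI.
  have n4 : Ip y - Imn x != 0.
    by apply: Im_neq0; rewrite ImB Im_conj opprK gt_eqF // addr_gt0 // (cd_H HD xI).
  have n5 : Ip y - Ip x != 0.
    rewrite subr_eq0; apply/eqP => k; apply: yx.
    have := cd_ell HD yI; rewrite k (cd_ell HD xI) => /(congr1 (@complex.Re R)); rewrite !ReC => h.
    by apply/esym; apply: (ln_inj _ _ h); rewrite posrE //; exact: (oo_gt0 yI).
  have n6 : cmod ((Ip y - Imn x) / (Ip y - Ip x)) != 0.
    by rewrite cmod_eq0 mulf_neq0 // invr_eq0.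
  rewrite /lnE (negbTE n6) -EFinM /gain /Lam cmodM cmodV ln_div ?posrE ?cmod_gt0 //.
rewrite E -EFinM; congr (_%:E).
have p0 := @pi_gt0 R.
by rewrite mulKf // gt_eqF // !mulr_gt0 // exprn_gt0.
Qed.
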